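(* Let $\mathrm{Fred}_{\mathbb C}$ be the space of Fredholm operators and $\mathrm{Fred}^{\mathrm{sa}}_{\mathbb C}$ the space of self-adjoint Fredholm operators on a complex Hilbert space. Under the equivalence of Atiyah–Patodi–Singer $$\mathrm{Fred}^{\mathrm{sa}}_{\mathbb C}\overset{\simeq}{\longrightarrow}\Omega\,\mathrm{Fred}_{\mathbb C},\qquad P\longmapsto P_t=\begin{cases}\cos(t)+i\sin(t)P&(0\le t\le\pi),\\\cos(t)+i\sin(t)&(\pi\le t\le2\pi),\end{cases}$$ the spectral cover $\mathrm{sp}(P)$ is canonically isomorphic to the transgression $S\to\Omega\,\mathrm{Fred}_{\mathbb C}$ of the complex determinant line bundle $\mathrm{Det}\,P_t$. That is, there is a canonical isomorphism of $\mathbb Z$-coverings of $\mathrm{Fred}^{\mathrm{sa}}_{\mathbb C}$ between the spectral cover and the pullback of $S$ along $P\mapsto(t\mapsto P_t)$.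
   Context: $H$ is a separable infinite-dimensional complex Hilbert space; operator spaces carry the norm topology; $\Omega\,\mathrm{Fred}_{\mathbb C}$ is the space of loops $[0,2\pi]\to\mathrm{Fred}_{\mathbb C}$ based at $1$, regarded as a subspace of $\mathrm{Map}(S^1,\mathrm{Fred}_{\mathbb C})$. (That $P\mapsto(P_t)$ is an equivalence is a known result, for which $\mathrm{Fred}^{\mathrm{sa}}_{\mathbb C}$ is understood as the non-contractible component, consisting of operators whose essential spectrum meets both half-lines.) $\mathrm{spec}_{\mathrm{ess}}$ is the spectrum in the Calkin algebra. **Spectral cover.** For a self-adjoint Fredholm $P$, elements of the $\mathbb Z$-torsor $\mathrm{sp}(P)$ are classes $[\mu,n]$ of pairs with $\mu>0$, $n\in\mathbb Z$, $\pm\mu\notin\mathrm{spec}(P)$, $[-\mu,\mu]\cap\mathrm{spec}_{\mathrm{ess}}(P)=\emptyset$, where for $0<\mu<\nu$ one has $(\mu,n)\sim(\nu,m)$ iff $m-n$ equals the number $N_{]\mu,\nu[}(P)$ of eigenvalues of $P$ in $]\mu,\nu[$, counted with multiplicity. The spectral cover $\bigsqcup_P\mathrm{sp}(P)\to\mathrm{Fred}^{\mathrm{sa}}_{\mathbb C}$ is topologized so that for fixed $\mu,n$ the local sections $P\mapsto[\mu,n]$ are continuous (on neighborhoods where $\mu$ remains admissible). **Determinant line bundle.** For $P$ Fredholm, $\mathrm{Det}\,P=\Lambda\mathrm{Ker}P\otimes(\Lambda\mathrm{Ker}P^\dagger)^*$ ($\Lambda$ = top exterior power), topologized as a line bundle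 over $\mathrm{Fred}_{\mathbb C}$ by transport along $\Lambda V_{[0,\mu]}(P^\dagger P)\otimes(\Lambda V_{[0,\mu]}(PP^\dagger))^*\to\mathrm{Det}\,P$, $v\wedge w\otimes\beta\wedge\alpha\mapsto\beta(\Lambda(P)w)\,v\otimes\alpha$, for locally chosen $\mu>0$ with $\mu\notin\mathrm{spec}(P^\dagger P)$, $[0,\mu]\cap\mathrm{spec}_{\mathrm{ess}}(P^\dagger P)=\emptyset$, where $V_I(A)$ is the sum of eigenspaces with eigenvalue in $I$, $v,\alpha$ refer to the eigenvalue $0$ and $w,\beta$ to $(0,\mu]$. **Transgression.** The transgression of a complex line bundle $L\to X$ is the principal $\mathbb Z$-bundle $S\to\mathrm{Map}(S^1,X)$ whose fiber $S_\gamma$ is the set of homotopy classes of nowhere vanishing sections $\tau\colon S^1\to\gamma^*L\setminus\{0\}$, with $n\in\mathbb Z$ acting by $\tau(t)\mapsto e^{2\pi int}\tau(t)$ ($t\in S^1=\mathbb R/\mathbb Z$). For $\mathcal U\subset\mathrm{Map}(S^1,X)$ open, a continuous $\tau\colon S^1\times\mathcal U\to L\setminus\{0\}$ with $\tau(t,\gamma)\in L_{\gamma(t)}$ determines by definition a continuous section $\gamma\mapsto[\tau(\cdot,\gamma)]$ of $S$ over $\mathcal U$. *)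

(* Defs.v *)
From HB Require Import structures.
From mathcomp Require Import all_boot all_order all_algebra.
From mathcomp Require Import all_classical all_reals all_analysis.
From mathcomp Require Import complex zify.

Set Implicit Arguments.
Unset Strict Implicit.
Unset Printing Implicit Defensive.

Import Order.TTheory GRing.Theory Num.Theory numFieldNormedType.Exports.

Local Open Scope classical_set_scope.
Local Open Scope complex_scope.
Local Open Scope ring_scope.

Record submod (K : fieldType) (V : lmodType K) := Submod {
  submod_set :> set V;
  submod0 : submod_set 0;
  submodP : forall (a : K) x y,
    submod_set x -> submod_set y -> submod_set (a *: x + y) }.

Definition subspace_type (K : fieldType) (V : lmodType K) (W : submod V) :
  Type := set_type W.

Section SubspaceType.
Variables (K : fieldType) (V : lmodType K) (W : submod V).

HB.instance Definition _ := SubChoice.on (subspace_type W).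

Lemma submod_submod_closed : submod_closed (mem (W : set V)).
Proof.
split; first by apply/mem_set/submod0.
by move=> a x y /set_mem Wx /set_mem Wy; apply/mem_set/submodP.
Qed.

HB.instance Definition _ :=
  GRing.SubChoice_isSubLmodule.Build K V _ (subspace_type W)
    submod_submod_closed.

End SubspaceType.

Section Span.
Variables (K : fieldType) (V : lmodType K) (A : set V).

Definition lin_span_set : set V := [set x | exists2 s : seq (K * V),
  (forall p, p \in s -> A p.2) & x = \sum_(p <- s) p.1 *: p.2].

Lemma lin_span_set0 : lin_span_set 0.
Proof. by exists [::]; [|rewrite big_nil]. Qed.

Lemma lin_span_setP (a : K) x y :
  lin_span_set x -> lin_span_set y -> lin_span_set (a *: x + y).
Proof.
move=> [s sA ->] [t tA ->]; exists ([seq (a * p.1, p.2) | p <- s] ++ t).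
  move=> p; rewrite mem_cat => /orP[/mapP[q qs ->]|]; [exact: (sA _ qs)|exact: tA].
rewrite big_cat big_map scaler_sumr; congr (_ + _).
by apply: eq_bigr => p _; rewrite scalerA.
Qed.

Definition lin_span : submod V := Submod lin_span_set0 lin_span_setP.

End Span.

Section Dimension.
Variables (K : fieldType) (V : lmodType K).

Definition lin_indep (s : seq V) := forall c : nat -> K,
  \sum_(i < size s) c i *: s`_i = 0 -> forall i, (i < size s)%N -> c i = 0.

Definition is_basis (W : set V) (s : seq V) :=
  lin_indep s /\ W = lin_span [set` s].

Definition finite_dim (W : set V) := exists s, is_basis W s.

(* 0 when W is not a finite-dimensional subspace *)
Definition ldim (W : set V) : nat :=
  xget 0%N [set n | exists2 s, is_basis W s & size s = n].

End Dimension.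

Section ExteriorPower.
Variables (K : fieldType) (V : lmodType K).

(* Alternating n-linear forms, as functions of a list of n vectors; lists     *)
(* avoid the index casts that concatenating families 'I_n -> V would require. *)
Definition alt_form (n : nat) : set (seq V -> K) := [set f |
  [/\ forall s, size s <> n -> f s = 0,
      forall s t (a : K) x y,
        f (s ++ (a *: x + y) :: t) = a * f (s ++ x :: t) + f (s ++ y :: t)
    & forall s t u x, f (s ++ x :: t ++ x :: u) = 0]].

(* x_1 /\ ... /\ x_n, as evaluation on the alternating n-linear forms *)
Definition ext_wedge (n : nat) (s : seq V) : set_type (alt_form n) -> K^o :=
  fun f => set_val f s.

Arguments ext_wedge n s : clear implicits.

(* The exterior power of the subspace W, inside that of V: it is spanned by   *)
(* the x_1 /\ ... /\ x_n with all x_i in W.                                   *)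
Definition ext_power (n : nat) (W : set V) :=
  lin_span [set ext_wedge n s | s in [set s : seq V | forall x, x \in s -> W x]].

Definition top_ext (W : set V) : lmodType K :=
  subspace_type (ext_power (ldim W) W).

(* junk value 0 when the exterior product is not in that of W *)
Definition top_wedge (W : set V) (s : seq V) : top_ext W :=
  insubd 0 (ext_wedge (ldim W) s).

End ExteriorPower.

Section DualTensor.
Variable K : fieldType.

Section Dual.
Variable L : lmodType K.

Definition dual_set : set (L -> K^o) := [set f | linear f].

Lemma dual_set0 : dual_set 0.
Proof. by move=> a x y; rewrite scaler0 addr0. Qed.

Lemma dual_setP (a : K) f g :
  dual_set f -> dual_set g -> dual_set (a *: f + g).
Proof.
move=> fL gL b x y; rewrite !fctE/= fL gL !scalerDr !scalerA (mulrC a b).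
by rewrite addrACA.
Qed.

Definition dual_space : lmodType K := subspace_type (Submod dual_set0 dual_setP).

Definition dual_app (f : dual_space) (x : L) : K := \val f x.

End Dual.

Variables L M : lmodType K.

Definition bilinear_form : set (L -> M -> K^o) :=
  [set B | (forall y, linear (B ^~ y)) /\ (forall x, linear (B x))].

(* x (x) y, as evaluation on the bilinear forms *)
Definition pure_tensor (x : L) (y : M) : set_type bilinear_form -> K^o :=
  fun B => set_val B x y.

Definition tensor_set := lin_span [set pure_tensor p.1 p.2 | p in [set: L * M]].

Definition tensor : lmodType K := subspace_type tensor_set.

Lemma pure_tensor_span x y : pure_tensor x y \in (tensor_set : set _).
Proof.
apply/mem_set; exists [:: (1, pure_tensor x y)]; last first.
  by rewrite big_seq1 scale1r.
by move=> p; rewrite inE => /eqP ->; exists (x, y).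
Qed.

Definition tens (x : L) (y : M) : tensor :=
  Sub (pure_tensor x y) (pure_tensor_span x y).

End DualTensor.

Record topology (T : Type) := Topology {
  opens : set (set T);
  opensT : opens setT;
  opensI : setI_closed opens;
  opens_bigU : forall (I : Type) (f : I -> set T),
    (forall i, opens (f i)) -> opens (\bigcup_i f i) }.

Definition with_topology (T : Type) (tau : topology T) : Type := T.

Section WithTopology.
Variables (T : Type) (tau : topology T).

HB.instance Definition _ := gen_eqMixin (with_topology tau).
HB.instance Definition _ := gen_choiceMixin (with_topology tau).
HB.instance Definition _ := isOpenTopological.Build (with_topology tau)
  (opensT tau) (@opensI _ tau) (@opens_bigU _ tau).

End WithTopology.

(* The finest topology on T for which the g with F U g are continuous on the  *)
(* open set U of X; values of g outside U are irrelevant.                     *)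
Section FinalTopology.
Variables (X : topologicalType) (T : Type) (F : set X -> set (X -> T)).

Definition final_opens : set (set T) := [set W |
  forall U g, open U -> F U g -> open (U `&` g @^-1` W)].

Lemma final_opensT : final_opens setT.
Proof. by move=> U g oU _; rewrite preimage_setT setIT. Qed.

Lemma final_opensI : setI_closed final_opens.
Proof.
move=> A B oA oB U g oU Fg; rewrite preimage_setI setIIr.
exact: (openI (oA _ _ oU Fg) (oB _ _ oU Fg)).
Qed.

Lemma final_opens_bigU (I : Type) (f : I -> set T) :
  (forall i, final_opens (f i)) -> final_opens (\bigcup_i f i).
Proof.
move=> of_ U g oU Fg; rewrite preimage_bigcup setI_bigcupr.
by apply: bigcup_open => i _; exact: (of_ i _ _ oU Fg).
Qed.

Definition final_topology : topology T :=
  Topology final_opensT final_opensI final_opens_bigU.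

End FinalTopology.

Record zcover (X : topologicalType) := ZCover {
  zc_total :> topologicalType;
  zc_proj : zc_total -> X;
  zc_act : int -> zc_total -> zc_total;
  zc_proj_act : forall n x, zc_proj (zc_act n x) = zc_proj x }.

Definition zcover_iso (X : topologicalType) (C D : zcover X) (phi : C -> D) :=
  [/\ exists psi : D -> C,
        [/\ cancel phi psi, cancel psi phi, continuous phi & continuous psi],
      forall x, zc_proj (phi x) = zc_proj x
    & forall n x, phi (zc_act n x) = zc_act n (phi x)].

Section Pullback.
Variables (X Y : topologicalType) (f : Y -> X) (C : zcover X).

Definition pb_total : set (Y * C) := [set p | f p.1 = zc_proj p.2].

Definition pb_proj (p : set_type pb_total) : Y := (set_val p).1.

Lemma pb_act_subproof (n : int) (p : set_type pb_total) :
  ((set_val p).1, zc_act n (set_val p).2) \in pb_total.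
Proof. by apply/mem_set; rewrite /pb_total/= zc_proj_act; exact: (set_valP p). Qed.

Definition pb_act (n : int) (p : set_type pb_total) : set_type pb_total :=
  SigSub (pb_act_subproof n p).

Definition pullback : zcover Y := @ZCover Y (set_type pb_total) pb_proj pb_act
  (fun _ _ => erefl).

Definition pb_point (p : pullback) : C := (set_val (p : set_type pb_total)).2.

End Pullback.

(* The circle is R / Z: maps from it are 1-periodic functions on R. *)
Definition periodic1 (R : realType) (T : Type) (f : R -> T) :=
  forall t, f (t + 1) = f t.

Definition loops (R : realType) (X : topologicalType) :
    set {compact-open, R -> X} :=
  [set g | continuous (g : R -> X) /\ periodic1 g].

Definition loop_space (R : realType) (X : topologicalType) : topologicalType :=
  set_type (@loops R X).

Definition based_loops (R : realType) (X : topologicalType) (x0 : X) :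
    topologicalType :=
  set_type [set g : loop_space R X | set_val g 0 = x0].

Definition expi (R : realType) (t : R) : R[i] := cos t +i* sin t.

(* The data of a line bundle that the transgression depends on: its fibers    *)
(* and the topology of its total space.                                       *)
Record line_bundle_data (R : realType) (X : topologicalType) := LineBundleData {
  fiber :> X -> lmodType R[i];
  total_topology : topology {x : X & fiber x} }.

Section Transgression.
Variables (R : realType) (X : topologicalType) (L : line_bundle_data R X).

Definition total_space : topologicalType := with_topology (total_topology L).

Definition in_total (x : X) (v : L x) : total_space :=
  existT (fun x => fiber L x) x v.

(* the nowhere vanishing continuous sections of the pullback of L along g *)
Definition nv_section (g : loop_space R X) : set (R -> total_space) :=
  [set s : R -> total_space | [/\ continuous s, periodic1 s &
    forall t, exists2 v : L (set_val g t), v <> 0 & s t = in_total v]].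

Definition nv_homotopic (g : loop_space R X) (s s' : R -> total_space) :=
  exists h : R * R -> total_space,
    [/\ {within `[0, 1]%classic `*` setT, continuous h},
        forall a, 0 <= a <= 1 -> nv_section g (fun t => h (a, t)),
        forall t, h (0, t) = s t & forall t, h (1, t) = s' t].

Definition nv_class (g : loop_space R X) (s : R -> total_space) :
    set (R -> total_space) :=
  [set s' | nv_section g s' /\ nv_homotopic g s s'].

Definition transgression_set : set (loop_space R X * set (R -> total_space)) :=
  [set p | exists2 s, nv_section p.1 s & p.2 = nv_class p.1 s].

Definition transgression_type : Type := set_type transgression_set.

Definition transgression_topology : topology transgression_type :=
  @final_topology (loop_space R X) _ (fun U sigma =>
    exists2 s : R * loop_space R X -> total_space,
      {within setT `*` U, continuous s} &
      forall g, U g -> nv_section g (fun t => s (t, g)) /\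
        set_val (sigma g) = (g, nv_class g (fun t => s (t, g)))).

Definition rotate (n : int) (s : R -> total_space) : R -> total_space :=
  fun t => in_total (expi (2 * pi * n%:~R * t) *: projT2 (s t)).

(* insubd because membership of the result uses continuity of the scalar      *)
(* multiplication of L                                                        *)
Definition transgression_act (n : int) (p : transgression_type) :
    transgression_type :=
  insubd p ((set_val p).1, [set s' | nv_section (set_val p).1 s' /\
    exists2 s, (set_val p).2 s & nv_homotopic (set_val p).1 (rotate n s) s']).

Lemma transgression_proj_act n p :
  (set_val (transgression_act n p)).1 = (set_val p).1.
Proof. by rewrite /transgression_act set_valE val_insubd; case: ifP. Qed.

Definition transgression : zcover (loop_space R X) :=
  @ZCover _ (with_topology transgression_topology)
    (fun p => (set_val p).1) transgression_act transgression_proj_act.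

Definition transgression_class (p : transgression) : set (R -> total_space) :=
  (set_val (p : transgression_type)).2.

Definition based_transgression (x0 : X) : zcover (based_loops R x0) :=
  pullback set_val transgression.

End Transgression.

HB.mixin Record isHilbert (R : realType) H & NormedModule R[i] H := {
  inner : H -> H -> R[i];
  inner_linear : forall y, linear (inner ^~ y : H -> R[i]^o);
  inner_conj : forall x y, inner y x = (inner x y)^*;
  inner_norm : forall x, inner x x = `|x| ^+ 2 }.

#[short(type="hilbertType")]
HB.structure Definition Hilbert (R : realType) :=
  {H of CompleteNormedModule R[i] H & isHilbert R H}.

Lemma normC_Re (R : realType) (V : normedModType R[i]) (x : V) : `|x| = (complex.Re `|x|)%:C.
Proof.
have := normr_ge0 x; case: `|x| => a b; rewrite lecE/= => /andP[/eqP -> _].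
by [].
Qed.

Section BoundedOperators.
Variables (R : realType) (H : hilbertType R).

Definition bop_set : set (H -> H) := [set f | linear f /\ continuous f].

Lemma bop_set0 : bop_set 0.
Proof.
split; first by move=> a x y; rewrite scaler0 addr0.
by move=> x; exact: cst_continuous.
Qed.

Lemma bop_setP (a : R[i]) f g : bop_set f -> bop_set g -> bop_set (a *: f + g).
Proof.
move=> [fL fC] [gL gC]; split.
  move=> b x y; rewrite !fctE fL gL !scalerDr !scalerA (mulrC a b).
  by rewrite addrACA.
by move=> x; exact: (cvgD (cvgZl_tmp (fC x)) (gC x)).
Qed.

Definition bop_submod := Submod bop_set0 bop_setP.

Definition bop : Type := subspace_type bop_submod.

HB.instance Definition _ := SubChoice.on bop.
HB.instance Definition _ := GRing.Lmodule.on bop.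

Definition bop_app (P : bop) : H -> H := \val P.

Definition opnorm (P : bop) : R :=
  sup [set complex.Re `|bop_app P x| | x in [set x : H | `|x| <= 1]].

Lemma bop_linear (P : bop) : linear (bop_app P).
Proof. by have /set_mem[] := valP P. Qed.

Lemma bop_continuous (P : bop) : continuous (bop_app P).
Proof. by have /set_mem[] := valP P. Qed.

HB.instance Definition _ (P : bop) :=
  GRing.isLinear.Build R[i] H H _ (bop_app P) (bop_linear P).

End BoundedOperators.

Section OperatorNorm.
Variables (R : realType) (H : hilbertType R).
Implicit Types P Q : bop H.

Lemma opnorm_has_sup P :
  has_sup [set complex.Re `|bop_app P x| | x in [set x : H | `|x| <= 1]].
Proof.
split; first by exists (complex.Re `|bop_app P 0|), 0; rewrite //= normr0.
have /linear_boundedP : bounded_near (bop_app P) (nbhs (0 : H)).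
  exact/continuous_linear_bounded/(@bop_continuous _ _ P 0).
move=> /pinfty_ex_gt0[M M0 PM]; exists (complex.Re M) => _ [x /= x1 <-].
have : `|bop_app P x| <= M.
  by rewrite (le_trans (PM x))// ler_piMr// ltW.
by rewrite lecE => /andP[].
Qed.

Lemma opnorm_ub P x : `|x| <= 1 -> complex.Re `|bop_app P x| <= opnorm P.
Proof.
by move=> x1; apply: (sup_upper_bound (opnorm_has_sup P)); exists x.
Qed.

Lemma opnorm_le P (M : R) :
  (forall x, `|x| <= 1 -> complex.Re `|bop_app P x| <= M) -> opnorm P <= M.
Proof.
move=> PM; apply: ge_sup; first by case: (opnorm_has_sup P).
by move=> _ [x x1 <-]; exact: PM.
Qed.

Lemma ler_opnormD P Q : (opnorm (P + Q))%:C <= (opnorm P)%:C + (opnorm Q)%:C.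
Proof.
rewrite -rmorphD lecR; apply: opnorm_le => x x1.
apply: (@le_trans _ _ (complex.Re (`|bop_app P x| + `|bop_app Q x|))).
  by have := ler_normD (bop_app P x) (bop_app Q x); rewrite lecE => /andP[].
by rewrite raddfD lerD ?opnorm_ub.
Qed.

Lemma opnorm_ge0 P : 0 <= opnorm P.
Proof.
have := @opnorm_ub P 0; rewrite normr0 linear0 normr0 => -> //.
Qed.

Lemma opnormZ_le (a : R[i]) P : (opnorm (a *: P))%:C <= `|a| * (opnorm P)%:C.
Proof.
rewrite [leRHS](_ : _ = (complex.Re `|a| * opnorm P)%:C); last first.
  by rewrite rmorphM/= -(normC_Re (a : R[i]^o)).
rewrite lecR; apply: opnorm_le => x x1.
have -> : bop_app (a *: P) x = a *: bop_app P x by [].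
rewrite normrZ (normC_Re (bop_app P x)) {1}(normC_Re (a : R[i]^o)) -rmorphM/=.
apply: ler_wpM2l; last exact: opnorm_ub.
by have := normr_ge0 a; rewrite lecE => /andP[].
Qed.

Lemma opnormZ (a : R[i]) P : (opnorm (a *: P))%:C = `|a| * (opnorm P)%:C.
Proof.
apply/eqP; rewrite eq_le opnormZ_le/=.
have [->|a0] := eqVneq a 0.
  by rewrite normr0 mul0r scale0r lecR opnorm_ge0.
have a0' : 0 < `|a| by rewrite normr_gt0.
rewrite -ler_pdivlMl// -normfV (le_trans _ (opnormZ_le a^-1 (a *: P)))//.
by rewrite scalerA mulVf// scale1r.
Qed.

Lemma opnorm_eq0 P : (opnorm P)%:C = 0 -> P = 0.
Proof.
move=> /complexI P0; apply/val_inj/funext => x /=.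
have [->|x0] := eqVneq x 0; first exact: (linear0 (bop_app P)).
have nx0 : `|x| != 0 by rewrite normr_eq0.
have : bop_app P (`|x|^-1 *: x) = 0.
  apply/normr0_eq0; rewrite normC_Re; congr (_ %:C); apply/eqP.
  rewrite eq_le; apply/andP; split.
    by rewrite -P0 opnorm_ub// normrZ normfV normr_id mulVf.
  by have := normr_ge0 (bop_app P (`|x|^-1 *: x)); rewrite lecE => /andP[].
rewrite linearZ/= => /eqP; rewrite scaler_eq0 invr_eq0 (negbTE nx0)/=.
by move=> /eqP.
Qed.

HB.instance Definition _ := @Lmodule_isNormed.Build R[i] (bop H)
  (fun P => (opnorm P)%:C) ler_opnormD opnormZ opnorm_eq0.

End OperatorNorm.


Section Operators.
Variables (R : realType) (H : hilbertType R).
Implicit Types (P Q : bop H) (mu nu : R).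

Lemma bop_id_subproof : (idfun : H -> H) \in (bop_submod H : set _).
Proof. by apply/mem_set; split=> // x; exact: cvg_id. Qed.

Definition bop_id : bop H := Sub idfun bop_id_subproof.

Lemma bop_comp_subproof P Q :
  bop_app P \o bop_app Q \in (bop_submod H : set _).
Proof.
apply/mem_set; split; first by move=> a x y /=; rewrite !bop_linear.
move=> x; apply: continuous_comp.
  exact: (@bop_continuous _ _ Q).
exact: (@bop_continuous _ _ P).
Qed.

Definition bop_comp P Q : bop H :=
  Sub (bop_app P \o bop_app Q) (bop_comp_subproof P Q).

Definition is_adjoint P Q :=
  forall x y, inner (bop_app P x) y = inner x (bop_app Q y).

Definition selfadjoint P := is_adjoint P P.

Definition adjoint P : bop H := xget 0 [set Q | is_adjoint P Q].

Definition compact_op P :=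
  precompact (bop_app P @` [set x : H | `|x| <= 1]).

Definition spec P : set R[i] := [set l | ~ exists Q,
  bop_comp Q (P - l *: bop_id) = bop_id /\
  bop_comp (P - l *: bop_id) Q = bop_id].

(* the spectrum in the Calkin algebra *)
Definition spec_ess P : set R[i] := [set l | ~ exists Q,
  compact_op (bop_comp Q (P - l *: bop_id) - bop_id) /\
  compact_op (bop_comp (P - l *: bop_id) Q - bop_id)].

Definition ker_op P : set H := [set x | bop_app P x = 0].

Definition fredholm P := finite_dim (ker_op P) /\
  exists s : seq H, forall y, exists x, lin_span_set [set` s] (y - bop_app P x).

Definition eigenspace_op P (l : R) : set H :=
  [set x | bop_app P x = l%:C *: x].

Definition eigen_mult P (l : R) : nat := ldim (eigenspace_op P l).

(* the sum V_I(P) of the eigenspaces with eigenvalue in I *)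
Definition eigen_sum P (I : set R) : set H :=
  lin_span (\bigcup_(l in I) eigenspace_op P l).

Definition eigen_count P (I : set R) : nat := \sum_(l \in I) eigen_mult P l.

Lemma fredholm_id : fredholm bop_id.
Proof.
split; last by exists [::] => y; exists y; rewrite subrr; exact: lin_span_set0.
exists [::]; split=> //; apply/seteqP; split=> x.
  by move=> x0; have -> : x = 0 := x0; exact: lin_span_set0.
by move=> [s sA ->]; rewrite /ker_op/= big_seq big1// => p /sA.
Qed.

End Operators.

Definition Fred (R : realType) (H : hilbertType R) : topologicalType :=
  set_type [set P : bop H | fredholm P].

Definition Fred_sa (R : realType) (H : hilbertType R) : topologicalType :=
  set_type [set P : bop H | fredholm P /\ selfadjoint P].

Definition Fred_id (R : realType) (H : hilbertType R) : Fred H :=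
  SigSub (mem_set (@fredholm_id R H)).

Section SpectralCover.
Variables (R : realType) (H : hilbertType R).
Implicit Types (P : Fred_sa H) (mu nu : R) (n m k : int).

Definition admissible P mu := [/\ 0 < mu,
  ~ spec (set_val P) mu%:C, ~ spec (set_val P) (- mu%:C) &
  forall l : R, - mu <= l <= mu -> ~ spec_ess (set_val P) l%:C].

(* the class of (mu, n) *)
Definition sp_class P mu n : set (R * int) := [set q |
  admissible P q.1 /\
  [\/ mu < q.1 /\ q.2 - n = eigen_count (set_val P) `]mu, q.1[%classic,
      mu = q.1 /\ q.2 = n
    | q.1 < mu /\ n - q.2 = eigen_count (set_val P) `]q.1, mu[%classic]].

Definition spectral_set : set (Fred_sa H * set (R * int)) := [set p |
  exists mu n, admissible p.1 mu /\ p.2 = sp_class p.1 mu n].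

Definition spectral_type : Type := set_type spectral_set.

Definition spectral_topology : topology spectral_type :=
  @final_topology (Fred_sa H) _ (fun U sigma => exists mu n, forall P, U P ->
    admissible P mu /\ set_val (sigma P) = (P, sp_class P mu n)).

(* The integer k acts by [mu, n] |-> [mu, n - k], as the next lemma shows.    *)
(* This is the orientation for which the spectral cover is equivariantly      *)
(* isomorphic to the transgression of Det: enlarging mu to nu multiplies the  *)
(* section of Det P_t attached to mu by a loop in C^* of winding number       *)
(* N_]mu,nu[(P), and the same step adds N_]mu,nu[(P) to n.                    *)
Definition sp_shift k (c : set (R * int)) : set (R * int) :=
  [set q | c (q.1, q.2 + k)].

Lemma sp_shift_class k P mu n :
  sp_shift k (sp_class P mu n) = sp_class P mu (n - k).
Proof.
apply/seteqP; split=> -[nu m] [/= adm [][h1 h2]]; split=> //=.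
- by apply: Or31; split=> //; lia.
- by apply: Or32; split=> //; lia.
- by apply: Or33; split=> //; lia.
- by apply: Or31; split=> //; lia.
- by apply: Or32; split=> //; lia.
- by apply: Or33; split=> //; lia.
Qed.

Lemma spectral_act_subproof k (p : spectral_type) :
  ((set_val p).1, sp_shift k (set_val p).2) \in spectral_set.
Proof.
apply/mem_set; have [mu [n [adm ->]]] := set_valP p.
by exists mu, (n - k); rewrite sp_shift_class.
Qed.

Definition spectral_act k (p : spectral_type) : spectral_type :=
  SigSub (spectral_act_subproof k p).

Definition spectral_cover : zcover (Fred_sa H) :=
  @ZCover (Fred_sa H) (with_topology spectral_topology)
    (fun p => (set_val p).1) spectral_act (fun _ _ => erefl).

End SpectralCover.

Section Determinant.
Variables (R : realType) (H : hilbertType R).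

Definition det_pair (V W : set H) : lmodType R[i] :=
  tensor (top_ext V) (dual_space (top_ext W)).

Definition Det (P : bop H) : lmodType R[i] :=
  det_pair (ker_op P) (ker_op (adjoint P)).

Definition PdagP (P : bop H) := bop_comp (adjoint P) P.
Definition PPdag (P : bop H) := bop_comp P (adjoint P).

Definition Det_le (mu : R) (P : bop H) : lmodType R[i] :=
  det_pair (eigen_sum (PdagP P) `[0, mu]%classic)
           (eigen_sum (PPdag P) `[0, mu]%classic).

(* the list x_1, ..., x_n consists of n = dim V vectors of V *)
Definition top_list (V : set H) (x : seq H) :=
  (forall y, y \in x -> V y) /\ size x = ldim V.

(* Phi (v /\ w (x) beta /\ alpha) = beta (Lambda(P) w) . v (x) alpha.         *)
(* The product beta /\ alpha of functionals is evaluated by nested            *)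
(* contraction, (beta /\ alpha)(v' /\ w') = alpha(v') beta(w').  With the     *)
(* opposite order the signs of the transition functions between different mu  *)
(* would jump where dim Ker P does.                                           *)
Definition is_transport (mu : R) (P : bop H) (Phi : Det_le mu P -> Det P) :=
  linear Phi /\
  forall (v w : seq H)
    (alpha : dual_space (top_ext (ker_op (adjoint P))))
    (beta : dual_space (top_ext (eigen_sum (PPdag P) `]0, mu]%classic)))
    (gamma : dual_space (top_ext (eigen_sum (PPdag P) `[0, mu]%classic))),
  top_list (ker_op P) v -> top_list (eigen_sum (PdagP P) `]0, mu]%classic) w ->
  (forall v' w', top_list (ker_op (adjoint P)) v' ->
     top_list (eigen_sum (PPdag P) `]0, mu]%classic) w' ->
     dual_app gamma (top_wedge _ (v' ++ w')) =
     dual_app alpha (top_wedge _ v') * dual_app beta (top_wedge _ w')) ->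
  Phi (tens (top_wedge _ (v ++ w)) gamma) =
  dual_app beta (top_wedge _ [seq bop_app P x | x <- w]) *:
    tens (top_wedge _ v) alpha.

Definition transport (mu : R) (P : bop H) : Det_le mu P -> Det P :=
  xget (fun=> 0) [set Phi | is_transport Phi].

Definition continuous_frame (U : set (Fred H)) (V : Fred H -> set H)
    (e : seq (Fred H -> H)) :=
  (forall s, s \in e -> {within U, continuous s}) /\
  forall P, U P -> is_basis (V P) [seq s P | s <- e].

Arguments transport : clear implicits.

(* The local trivializations U x C -> Det induced by continuous frames e, f   *)
(* of the bundles V_[0,mu](P^dag P) and V_[0,mu](P P^dag) over U.             *)
Definition det_topology : topology {P : Fred H & Det (set_val P)} :=
  @final_topology (Fred H * R[i]^o)%type _ (fun W g =>
    exists (U : set (Fred H)) (mu : R) (e f : seq (Fred H -> H)),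
    [/\ open U /\ W = U `*` setT,
        0 < mu /\ forall P, U P ->
          ~ spec (PdagP (set_val P)) mu%:C /\
          forall l : R, 0 <= l <= mu -> ~ spec_ess (PdagP (set_val P)) l%:C,
        continuous_frame U
          (fun P => eigen_sum (PdagP (set_val P)) `[0, mu]%classic) e,
        continuous_frame U
          (fun P => eigen_sum (PPdag (set_val P)) `[0, mu]%classic) f &
        forall P c, U P -> exists2 gamma,
          dual_app gamma (top_wedge _ [seq s P | s <- f]) = 1 &
          g (P, c) = existT (fun P : Fred H => Det (set_val P)) P
            (c *: transport mu (set_val P)
              (tens (top_wedge _ [seq s P | s <- e]) gamma))]).

Definition det_bundle : line_bundle_data R (Fred H) :=
  @LineBundleData R (Fred H) (fun P => Det (set_val P)) det_topology.

End Determinant.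

Section APS.
Variables (R : realType) (H : hilbertType R).

(* P_t, for t in [0, 2 pi] *)
Definition aps_path (P : bop H) (t : R) : bop H :=
  if t <= pi then (cos t)%:C *: bop_id H + (0 +i* sin t) *: P
  else (cos t +i* sin t) *: bop_id H.

(* The parameter of the loops in the target runs through R / Z. *)
Definition is_aps_map (f : Fred_sa H -> based_loops R (Fred_id H)) :=
  forall P t, 0 <= t <= 2 * pi ->
    set_val (set_val (set_val (f P)) (t / (2 * pi))) = aps_path (set_val P) t.

(* the canonical isomorphism C = Det P for invertible P *)
Definition is_det_one (P : bop H) (x : Det P) := exists2 alpha,
  dual_app alpha (top_wedge (ker_op (adjoint P)) [::]) = 1 &
  x = tens (top_wedge (ker_op P) [::]) alpha.

(* the determinant of P_t on the sum V of the eigenspaces of P in [-mu, mu]   *)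
(* for t <= pi, followed by e^{it dim V}, which leads back from (-1)^{dim V}  *)
(* to 1                                                                       *)
Definition det_path (P : bop H) (mu t : R) : R[i] :=
  if t <= pi then
    \big[*%R/1]_(l \in `[- mu, mu]%classic)
      (cos t +i* (sin t * l)) ^+ eigen_mult P l
  else expi ((eigen_count P `[- mu, mu]%classic)%:R * t).

(* The sections of Det P_t that represent the image of [mu, n]: P_t is        *)
(* invertible for t <> pi / 2, where Det P_t = C, and the value at pi / 2 is  *)
(* determined by continuity.                                                  *)
Definition canonical_section (P : Fred_sa H) (mu : R) (n : int)
    (g : loop_space R (Fred H)) : set (R -> total_space (det_bundle H)) :=
  [set s | nv_section g s /\
    forall t, 0 <= t <= 2 * pi -> t <> pi / 2 ->
    exists2 x : Det (set_val (set_val g (t / (2 * pi)))), is_det_one x &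
      s (t / (2 * pi)) = in_total (L := det_bundle H)
        (expi (- n%:~R * t) * det_path (set_val P) mu t *: x)].

Definition is_canonical (f : Fred_sa H -> based_loops R (Fred_id H))
    (phi : spectral_cover H ->
      pullback f (based_transgression (det_bundle H) (Fred_id H))) :=
  forall (P : Fred_sa H) (mu : R) (n : int) (p : spectral_type H),
    admissible P mu -> set_val p = (P, sp_class P mu n) ->
    exists2 s, canonical_section P mu n (set_val (f P)) s &
      transgression_class (pb_point (pb_point (phi p))) s.

End APS.

(* Main.v *)
Require Import Defs.
From mathcomp Require Import all_boot all_order all_algebra.
From mathcomp Require Import all_classical all_reals all_analysis.
From mathcomp Require Import complex zify ring lra.

(* Write u = max(sin t, 0). For self-adjoint P the operator P_t is invertible  *)
(* unless sin t = 1, so that Det P_t = C, and the section attached to [mu, n]  *)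
(* is e^{-int} times the determinant of P_t on V = V_[-mu,mu](P). Since        *)
(* P_t^dag P_t = P_t P_t^dag = (1 - u^2) + u^2 P^2, the space V is also        *)
(* V_[0,mu^2](P_t^dag P_t) for t near pi/2. In the trivialisation of Det given *)
(* by continuous frames e and f of these spaces the section has coordinate     *)
(* e^{-int} times the determinant of the base change between e and f, so it    *)
(* extends without zeros over t = pi/2, continuously in (t, P).                *)
(*                                                                             *)
(* Enlarging mu to nu multiplies the section by the loops of eigenvalues of    *)
(* P_t on the eigenvectors of P with mu < |l| < nu. These loops have winding   *)
(* number 1 for l > 0 and 0 for l < 0, so two such sections, for (mu, n) and   *)
(* (nu, m), are homotopic exactly when (mu, n) ~ (nu, m). Any nowhere          *)
(* vanishing section differs from a given one by a loop in C^*, which is       *)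
(* classified by its winding number; hence the map of Z-torsors is bijective.  *)
(* It is a homeomorphism because a section along one loop extends to the       *)
(* nearby loops, and two families of sections that are jointly continuous and  *)
(* homotopic at one point are homotopic at all nearby points.                  *)

Set Implicit Arguments.
Unset Strict Implicit.
Unset Printing Implicit Defensive.

Import Order.TTheory GRing.Theory Num.Theory numFieldNormedType.Exports.

Local Open Scope classical_set_scope.
Local Open Scope ring_scope.
Local Open Scope complex_scope.

(** * Hilbert spaces and bounded operators *)

(** A representative (mu, n) determines the finite-dimensional space V = V_[-mu,mu](P), which every
    P_t preserves, and the function e^{-int} det(P_t on V). This number may vanish at t = pi/2, but
    the corresponding element of Det P_t does not. Near that time Det is trivialised by frames e and
    f of V itself, and [frame_one] identifies det(P_t on V) times the canonical generator with the
    base change coef(f, e) times the frame; the latter expression never vanishes and makes sense at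
    pi/2 too. The result is a [spectral_section], jointly continuous in t and P
    ([local_spectral_section]).

    Two nowhere vanishing sections over a loop differ by a loop of nonzero complex numbers, and they
    are homotopic iff its winding number is zero, that is, iff it has a periodic continuous
    logarithm ([Null], [nv_homotopicP]). The ratio of the sections for (mu, n) and (nu, m) is
    e^{-i(m-n)t} times the loops [aps_eig l] with l in [-nu, nu] outside [-mu, mu]
    ([spectral_section_ratio]). Such a loop winds once if l > 0 and not at all if l < 0, so the
    sections are homotopic iff (mu, n) ~ (nu, m) ([sp_class_homotopic]). Hence [corresponds] is a
    well-defined injective relation between the two covers. It is surjective because a loop of
    nonzero numbers is homotopic to some e^{2 pi i k t} ([Null_winding]), and rotating a section by
    k replaces n by n - k.

    Both covers carry final topologies. Continuity of the map is tested on the local sections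
    [mu, n], but the transgression is topologised by families over open sets of all loops;
    [local_transgression] therefore extends the sections from the loops P_t to neighbouring loops.
    Continuity of the inverse holds because the classes of such a family form an open set
    ([local_section_open]). Both use that homotopy of two continuous families persists nearby
    ([near_homotopic]).

    The analytic input is a finite description of the low spectrum, obtained by minimising quadratic
    forms ([gap_exists]), its stability and the continuity of the spectral projections
    ([spectral_gap_perturb], [spectral_gap_proj_perturb]), the existence of an admissible mu for
    each P ([fredholm_adm]), and transition functions of Det that stay continuous where the kernel
    jumps ([transitionE]). *)

Section RealNorm.
Variables (R : realType) (V : normedModType R[i]).
Implicit Types x y : V.

Definition nrm x : R := complex.Re `|x|.

Lemma nrmE x : `|x| = (nrm x)%:C.
Proof. exact: normC_Re. Qed.

Lemma nrm_ge0 x : 0 <= nrm x.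
Proof. by have := normr_ge0 x; rewrite nrmE lecR. Qed.

Lemma nrm0 : nrm (0 : V) = 0.
Proof. by rewrite /nrm normr0. Qed.

Lemma nrm_eq0 x : (nrm x == 0) = (x == 0).
Proof.
by rewrite -[RHS]normr_eq0 nrmE -(inj_eq (@complexI R)).
Qed.

Lemma nrm_gt0 x : (0 < nrm x) = (x != 0).
Proof. by rewrite lt_def nrm_ge0 andbT nrm_eq0. Qed.

Lemma nrmN x : nrm (- x) = nrm x.
Proof. by rewrite /nrm normrN. Qed.

Lemma nrmB x y : nrm (x - y) = nrm (y - x).
Proof. by rewrite -nrmN opprB. Qed.

Lemma ler_nrmD x y : nrm (x + y) <= nrm x + nrm y.
Proof. by have := ler_normD x y; rewrite !nrmE -rmorphD lecR. Qed.

Lemma ler_nrmB x y : nrm (x - y) <= nrm x + nrm y.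
Proof. by rewrite -(nrmN y) ler_nrmD. Qed.

Lemma lerB_nrm x y : nrm x - nrm y <= nrm (x - y).
Proof. by rewrite lerBlDr -{1}(subrK y x) ler_nrmD. Qed.

Lemma cvg_nrmP T (F : set_system T) {FF : Filter F} (f : T -> V) l :
  f @ F --> l <-> forall e : R, 0 < e -> \forall t \near F, nrm (f t - l) < e.
Proof.
split=> [/cvgrPdist_lt fl e e0|fl].
  have e0' : 0 < e%:C by rewrite ltcR.
  have := fl _ e0'; apply: filterS => t.
  by rewrite nrmE ltcR nrmB.
apply/cvgrPdist_lt => e e0.
have eE : e = (complex.Re e)%:C.
  by move: e0; rewrite ltcE; case: e => a b /= /andP[/eqP -> _].
have /fl : 0 < complex.Re e by rewrite -ltcR -eE.
by apply: filterS => t; rewrite eE nrmE ltcR nrmB.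
Qed.

Lemma near_nrm (z : V) (e : R) : 0 < e -> \forall w \near nbhs z, nrm (w - z) < e.
Proof.
move=> e0; have [h _] := @cvg_nrmP V (nbhs z) (nbhs_filter z) id z.
exact: (h (@cvg_id _ (nbhs z)) e e0).
Qed.

End RealNorm.

Section ComplexNumbers.
Variable R : realType.
Local Notation C := (R[i]^o).
Implicit Types z : R[i].

Definition cabs z : R := nrm (z : C).

Lemma cabsE z : `|z| = (cabs z)%:C.
Proof. exact: (@nrmE R C). Qed.

Lemma nrmZ (V : normedModType R[i]) z (x : V) : nrm (z *: x) = cabs z * nrm x.
Proof. by apply: (@complexI R); rewrite rmorphM /= -!nrmE normrZ. Qed.

Lemma cabsM z1 z2 : cabs (z1 * z2) = cabs z1 * cabs z2.
Proof. exact: (@nrmZ C). Qed.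

Lemma cabs_real (a : R) : cabs a%:C = `|a|.
Proof.
by apply: (@complexI R); rewrite -cabsE normc_def /= expr0n addr0 sqrtr_sqr.
Qed.

Lemma cabs_sqr z : cabs z ^+ 2 = complex.Re z ^+ 2 + complex.Im z ^+ 2.
Proof. by apply: (@complexI R); rewrite rmorphXn /= -cabsE -add_Re2_Im2. Qed.

Lemma ler_Re_cabs z : `|complex.Re z| <= cabs z.
Proof.
rewrite -(@ler_pXn2r _ 2)// ?nnegrE ?nrm_ge0// cabs_sqr real_normK ?num_real//.
by rewrite lerDl sqr_ge0.
Qed.

Lemma ler_Im_cabs z : `|complex.Im z| <= cabs z.
Proof.
rewrite -(@ler_pXn2r _ 2)// ?nnegrE ?nrm_ge0// cabs_sqr real_normK ?num_real//.
by rewrite lerDr sqr_ge0.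
Qed.

Lemma cabs_le_ReIm z : cabs z <= `|complex.Re z| + `|complex.Im z|.
Proof.
rewrite -(@ler_pXn2r _ 2)// ?nnegrE ?nrm_ge0 ?addr_ge0// cabs_sqr sqrrD.
have : 0 <= `|complex.Re z| * `|complex.Im z| by rewrite mulr_ge0.
by rewrite !real_normK ?num_real// mulr2n => ?; lra.
Qed.

Lemma ReD z1 z2 : complex.Re (z1 + z2) = complex.Re z1 + complex.Re z2.
Proof. by case: z1 z2 => [a b] []. Qed.
Lemma ImD z1 z2 : complex.Im (z1 + z2) = complex.Im z1 + complex.Im z2.
Proof. by case: z1 z2 => [a b] []. Qed.
Lemma ReN z : complex.Re (- z) = - complex.Re z.
Proof. by case: z. Qed.
Lemma ReB z1 z2 : complex.Re (z1 - z2) = complex.Re z1 - complex.Re z2.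
Proof. by case: z1 z2 => [a b] []. Qed.
Lemma Re_conj z : complex.Re z^* = complex.Re z.
Proof. by case: z. Qed.
Lemma ReZ (a : R) z : complex.Re (a%:C * z) = a * complex.Re z.
Proof. by case: z => c d /=; rewrite mul0r subr0. Qed.

Lemma ImB z1 z2 : complex.Im (z1 - z2) = complex.Im z1 - complex.Im z2.
Proof. by case: z1 z2 => [a b] []. Qed.

Lemma cvg_Re T (F : set_system T) {FF : Filter F} (f : T -> C) (l : R[i]) :
  f @ F --> (l : C) -> (fun t => complex.Re (f t)) @ F --> complex.Re l.
Proof.
move=> /cvg_nrmP fl; apply/cvgrPdist_lt => e e0.
apply: filterS (fl e e0) => t; apply: le_lt_trans; rewrite distrC.
have -> : complex.Re (f t) - complex.Re l = complex.Re (f t - l).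
  exact/esym/ReB.
exact: ler_Re_cabs.
Qed.

Lemma cvg_Im T (F : set_system T) {FF : Filter F} (f : T -> C) (l : R[i]) :
  f @ F --> (l : C) -> (fun t => complex.Im (f t)) @ F --> complex.Im l.
Proof.
move=> /cvg_nrmP fl; apply/cvgrPdist_lt => e e0.
apply: filterS (fl e e0) => t; apply: le_lt_trans; rewrite distrC.
have -> : complex.Im (f t) - complex.Im l = complex.Im (f t - l).
  exact/esym/ImB.
exact: ler_Im_cabs.
Qed.

Lemma cvg_complex T (F : set_system T) {FF : Filter F} (f g : T -> R) (a b : R) :
  f @ F --> a -> g @ F --> b -> (fun t => f t +i* g t : C) @ F --> (a +i* b : C).
Proof.
move=> fa gb; apply/cvg_nrmP => e e0.
have e2 : 0 < e / 2 by rewrite divr_gt0.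
move/cvgrPdist_lt: fa => /(_ _ e2) fa; move/cvgrPdist_lt: gb => /(_ _ e2) gb.
near=> t.
have h : nrm ((f t +i* g t : C) - (a +i* b : C)) <= `|f t - a| + `|g t - b|.
  by have := cabs_le_ReIm ((f t +i* g t) - (a +i* b)); rewrite ReB ImB.
apply: (le_lt_trans h).
rewrite (splitr e) ltrD// distrC; [near: t; exact: fa | near: t; exact: gb].
Unshelve. all: by end_near. Qed.

Lemma cvg_real_complex T (F : set_system T) {FF : Filter F} (f : T -> R) (a : R) :
  f @ F --> a -> (fun t => (f t)%:C : C) @ F --> (a%:C : C).
Proof. by move=> fa; apply: cvg_complex => //; exact: cvg_cst. Qed.

Lemma mulcE z1 z2 : z1 * z2 = (complex.Re z1 * complex.Re z2 - complex.Im z1 * complex.Im z2)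
   +i* (complex.Re z1 * complex.Im z2 + complex.Im z1 * complex.Re z2).
Proof. by case: z1 z2 => [a b] [c d]. Qed.

Lemma conjR (a : R) : (a%:C)^* = a%:C.
Proof. by rewrite /conjc /= oppr0. Qed.

Lemma complex_ReIm z : z = complex.Re z +i* complex.Im z.
Proof. by case: z. Qed.

Lemma cvg_scale (V : normedModType R[i]) T (F : set_system T) {FF : Filter F}
    (a : T -> C) (f : T -> V) (b : R[i]) x :
  a @ F --> (b : C) -> f @ F --> x -> (fun t => a t *: f t) @ F --> b *: x.
Proof. exact: cvgZ. Qed.

End ComplexNumbers.

Section InnerProduct.
Variables (R : realType) (H : hilbertType R).
Local Notation C := (R[i]^o).
Implicit Types (x y z : H) (a : R[i]).

Lemma innerPl a x y z : inner (a *: x + y) z = a * inner x z + inner y z.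
Proof. exact: (@inner_linear _ _ z). Qed.

Lemma innerDl x y z : inner (x + y) z = inner x z + inner y z.
Proof. by rewrite -[x]scale1r innerPl mul1r !scale1r. Qed.

Lemma inner0l z : inner 0 z = 0.
Proof. by apply: (addrI (inner 0 z)); rewrite -innerDl !addr0. Qed.

Lemma innerZl a x z : inner (a *: x) z = a * inner x z.
Proof. by rewrite -[_ *: _]addr0 innerPl inner0l addr0. Qed.

Lemma innerNl x z : inner (- x) z = - inner x z.
Proof. by rewrite -scaleN1r innerZl mulN1r. Qed.

Lemma innerBl x y z : inner (x - y) z = inner x z - inner y z.
Proof. by rewrite innerDl innerNl. Qed.

Lemma innerDr x y z : inner z (x + y) = inner z x + inner z y.
Proof. by rewrite ![inner z _]inner_conj innerDl rmorphD. Qed.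

Lemma inner0r z : inner z 0 = 0.
Proof. by rewrite inner_conj inner0l rmorph0. Qed.

Lemma innerZr a x z : inner z (a *: x) = a^* * inner z x.
Proof. by rewrite ![inner z _]inner_conj innerZl rmorphM. Qed.

Lemma innerZrR (t : R) x z : inner z (t%:C *: x) = t%:C * inner z x.
Proof. by rewrite innerZr; congr (_ * _); exact: conjR. Qed.

Lemma innerNr x z : inner z (- x) = - inner z x.
Proof. by rewrite ![inner z _]inner_conj innerNl rmorphN. Qed.

Lemma innerBr x y z : inner z (x - y) = inner z x - inner z y.
Proof. by rewrite innerDr innerNr. Qed.

Lemma inner_suml I (s : seq I) (P : pred I) (F : I -> H) z :
  inner (\sum_(i <- s | P i) F i) z = \sum_(i <- s | P i) inner (F i) z.
Proof. by apply: (big_morph (inner^~ z)); [move=> *; exact: innerDl|exact: inner0l]. Qed.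

Lemma inner_sumr I (s : seq I) (P : pred I) (F : I -> H) z :
  inner z (\sum_(i <- s | P i) F i) = \sum_(i <- s | P i) inner z (F i).
Proof. by apply: (big_morph (inner z)); [move=> *; exact: innerDr|exact: inner0r]. Qed.

Lemma innerxx x : inner x x = (nrm x ^+ 2)%:C.
Proof. by rewrite inner_norm nrmE rmorphXn. Qed.

Lemma inner_eq0 x : inner x x = 0 -> x = 0.
Proof.
rewrite innerxx => /(@complexI R)/eqP; rewrite expf_eq0 /= nrm_eq0.
by move/eqP.
Qed.

Definition rin x y : R := complex.Re (inner x y).

Lemma rinC x y : rin x y = rin y x.
Proof. by rewrite /rin inner_conj Re_conj. Qed.

Lemma rinxx x : rin x x = nrm x ^+ 2.
Proof. by rewrite /rin innerxx. Qed.

Lemma rinDl x y z : rin (x + y) z = rin x z + rin y z.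
Proof. by rewrite /rin innerDl ReD. Qed.
Lemma rinDr x y z : rin z (x + y) = rin z x + rin z y.
Proof. by rewrite /rin innerDr ReD. Qed.
Lemma rinNl x z : rin (- x) z = - rin x z.
Proof. by rewrite /rin innerNl ReN. Qed.
Lemma rinNr x z : rin z (- x) = - rin z x.
Proof. by rewrite /rin innerNr ReN. Qed.
Lemma rinZl (t : R) x z : rin (t%:C *: x) z = t * rin x z.
Proof. by rewrite /rin innerZl ReZ. Qed.
Lemma rinZr (t : R) x z : rin z (t%:C *: x) = t * rin z x.
Proof. by rewrite rinC rinZl rinC. Qed.

Lemma nrmD_sqr x y : nrm (x + y) ^+ 2 = nrm x ^+ 2 + 2 * rin x y + nrm y ^+ 2.
Proof. by rewrite -!rinxx !(rinDl, rinDr) (rinC y x); ring. Qed.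

Lemma nrmB_sqr x y : nrm (x - y) ^+ 2 = nrm x ^+ 2 - 2 * rin x y + nrm y ^+ 2.
Proof. by rewrite nrmD_sqr rinNr nrmN; ring. Qed.

Lemma cauchy_schwarz x y : cabs (inner x y) <= nrm x * nrm y.
Proof.
have [->|y0] := eqVneq y 0.
  by rewrite inner0r nrm0 mulr0 /cabs nrm0.
have ny0 : 0 < nrm y by rewrite nrm_gt0.
set a := inner x y.
have : 0 <= nrm ((nrm y ^+ 2)%:C *: x - a *: y) ^+ 2 by exact: sqr_ge0.
rewrite nrmB_sqr !nrmZ rinZl /rin innerZr -/a cabs_real.
have -> : complex.Re (a^* * a) = cabs a ^+ 2.
  by rewrite mulrC -sqr_normc cabsE -rmorphXn.
rewrite ger0_norm ?sqr_ge0// => h.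
have : cabs a ^+ 2 <= (nrm x * nrm y) ^+ 2.
  have h2 : 0 <= nrm y ^+ 2 * ((nrm x * nrm y) ^+ 2 - cabs a ^+ 2) by nra.
  by move: h2; rewrite pmulr_rge0 ?exprn_gt0// subr_ge0.
by rewrite ler_pXn2r// nnegrE ?nrm_ge0// mulr_ge0 ?nrm_ge0.
Qed.

Lemma rin_le x y : `|rin x y| <= nrm x * nrm y.
Proof. exact: le_trans (ler_Re_cabs _) (cauchy_schwarz _ _). Qed.

Lemma cvg_inner T (F : set_system T) {FF : Filter F} (f g : T -> H) x y :
  f @ F --> x -> g @ F --> y ->
  (fun t => inner (f t) (g t) : C) @ F --> (inner x y : C).
Proof.
move=> /cvg_nrmP fx /cvg_nrmP gy; apply/cvg_nrmP => e e0.
pose M := nrm x + nrm y + 1.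
have M0 : 0 < M by rewrite ltr_wpDl ?addr_ge0 ?nrm_ge0.
pose d := Num.min 1 (e / (2 * M)).
have d0 : 0 < d by rewrite lt_min ltr01/= divr_gt0// mulr_gt0.
have dM : d * (2 * M) <= e.
  by rewrite -ler_pdivlMr ?mulr_gt0// ge_min lexx orbT.
have d1 : d <= 1 by rewrite ge_min lexx.
near=> t.
have h1 : nrm (f t - x) < d by near: t; exact: fx.
have h2 : nrm (g t - y) < d by near: t; exact: gy.
have -> : inner (f t) (g t) - inner x y =
   inner (f t - x) (g t - y) + inner (f t - x) y + inner x (g t - y).
  by rewrite !innerBl !innerBr; ring.
apply: (le_lt_trans (ler_nrmD _ _)).
apply: (@le_lt_trans _ _ (d * d + d * nrm y + nrm x * d)).
  apply: lerD; last first.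
    by apply: (le_trans (cauchy_schwarz _ _)); rewrite ler_wpM2l ?nrm_ge0 ?ltW.
  apply: (le_trans (ler_nrmD _ _)); apply: lerD.
    by apply: (le_trans (cauchy_schwarz _ _)); rewrite ler_pM ?nrm_ge0 ?ltW.
  by apply: (le_trans (cauchy_schwarz _ _)); rewrite ler_wpM2r ?nrm_ge0 ?ltW.
have := nrm_ge0 x; have := nrm_ge0 y; rewrite /M in dM *; nra.
Unshelve. all: by end_near. Qed.

Lemma inner_ext x y : (forall z, inner z x = inner z y) -> x = y.
Proof.
move=> h; apply/eqP; rewrite -subr_eq0; apply/eqP/inner_eq0.
by rewrite innerBr h subrr.
Qed.

End InnerProduct.

Section BoundedOperators.
Variables (R : realType) (H : hilbertType R).
Local Notation C := (R[i]^o).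
Implicit Types (P Q B : bop H) (x y z : H).

Lemma bopDE P Q x : bop_app (P + Q) x = bop_app P x + bop_app Q x.
Proof. by []. Qed.
Lemma bopZE (a : R[i]) P x : bop_app (a *: P) x = a *: bop_app P x.
Proof. by []. Qed.

Lemma bopBE P Q x : bop_app (P - Q) x = bop_app P x - bop_app Q x.
Proof. by []. Qed.
Lemma bop_compE P Q x : bop_app (bop_comp P Q) x = bop_app P (bop_app Q x).
Proof. by []. Qed.
Lemma bop_idE x : bop_app (bop_id H) x = x.
Proof. by []. Qed.

Lemma bop_ext P Q : (forall x, bop_app P x = bop_app Q x) -> P = Q.
Proof. by move=> h; apply/val_inj/funext. Qed.

Lemma nrm_bop_app P x : nrm (bop_app P x) <= nrm P * nrm x.
Proof.
have [->|x0] := eqVneq x 0; first by rewrite linear0 !nrm0 mulr0.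
have nx0 : 0 < nrm x by rewrite nrm_gt0.
have : complex.Re `|bop_app P ((nrm x)^-1%:C *: x)| <= opnorm P.
  apply: opnorm_ub; rewrite nrmE lecR nrmZ cabs_real ger0_norm ?invr_ge0 ?nrm_ge0//.
  by rewrite mulVf// gt_eqF.
rewrite linearZ /= -/(nrm _) nrmZ cabs_real ger0_norm ?invr_ge0 ?nrm_ge0//.
by rewrite ler_pdivrMl// mulrC.
Qed.

Lemma nrm_bop_le P (M : R) : 0 <= M ->
  (forall x, nrm (bop_app P x) <= M * nrm x) -> nrm P <= M.
Proof.
move=> M0 h; apply: opnorm_le => x x1; apply: (le_trans (h x)).
by rewrite ler_piMr//; move: x1; rewrite nrmE lecR.
Qed.

Lemma bop_exists (f : H -> H) (M : R) : linear f ->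
  (forall x, nrm (f x) <= M * nrm x) -> exists Q : bop H, bop_app Q = f.
Proof.
move=> fl fM.
have fP : f \in (bop_submod H : set _).
  apply/mem_set; split=> // x; apply/cvg_nrmP => e e0.
  have M1 : 0 < `|M| + 1 by rewrite ltr_wpDl.
  have := (@cvg_nrmP R H _ (nbhs x) (nbhs_filter x) id x).1 cvg_id (e / (`|M| + 1)) (divr_gt0 e0 M1).
  apply: filterS => y; rewrite ltr_pdivlMr// => ye.
  have -> : f y - f x = f (y - x) by rewrite -scaleN1r addrC -fl scaleN1r addrC.
  apply: le_lt_trans ye; apply: (le_trans (fM _)); rewrite mulrC.
  by rewrite ler_wpM2l ?nrm_ge0// (le_trans (ler_norm _))// lerDl.
by exists (Sub f fP).
Qed.

Lemma cvg_bop_app T (F : set_system T) {FF : Filter F} (p : T -> bop H)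
    (f : T -> H) P x : p @ F --> P -> f @ F --> x ->
  (fun t => bop_app (p t) (f t)) @ F --> bop_app P x.
Proof.
move=> /cvg_nrmP pP /cvg_nrmP fx; apply/cvg_nrmP => e e0.
pose M := nrm P + nrm x + 1.
have M0 : 0 < M by rewrite ltr_wpDl ?addr_ge0 ?nrm_ge0.
pose d := Num.min 1 (e / (2 * M)).
have d0 : 0 < d by rewrite lt_min ltr01/= divr_gt0// mulr_gt0.
have dM : d * (2 * M) <= e by rewrite -ler_pdivlMr ?mulr_gt0// ge_min lexx orbT.
have d1 : d <= 1 by rewrite ge_min lexx.
near=> t.
have h1 : nrm (p t - P) < d by near: t; exact: pP.
have h2 : nrm (f t - x) < d by near: t; exact: fx.
have -> : bop_app (p t) (f t) - bop_app P x =
   bop_app (p t - P) (f t - x) + bop_app (p t - P) x + bop_app P (f t - x).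
  by rewrite linearB /= subrK bopBE linearB /= addrA subrK.
apply: (le_lt_trans (ler_nrmD _ _)).
apply: (@le_lt_trans _ _ (d * d + d * nrm x + nrm P * d)).
  apply: lerD; last first.
    by apply: (le_trans (nrm_bop_app _ _)); rewrite ler_wpM2l ?nrm_ge0 ?ltW.
  apply: (le_trans (ler_nrmD _ _)); apply: lerD.
    by apply: (le_trans (nrm_bop_app _ _)); rewrite ler_pM ?nrm_ge0 ?ltW.
  by apply: (le_trans (nrm_bop_app _ _)); rewrite ler_wpM2r ?nrm_ge0 ?ltW.
have := nrm_ge0 x; have := nrm_ge0 P; rewrite /M in dM *; nra.
Unshelve. all: by end_near. Qed.

Lemma nrm_comp P Q : nrm (bop_comp P Q) <= nrm P * nrm Q.
Proof.
apply: nrm_bop_le => [|x]; first by rewrite mulr_ge0 ?nrm_ge0.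
rewrite bop_compE (le_trans (nrm_bop_app _ _))// -mulrA.
by rewrite ler_wpM2l ?nrm_ge0// nrm_bop_app.
Qed.

Lemma bop_compBl P Q B : bop_comp (P - Q) B = bop_comp P B - bop_comp Q B.
Proof. exact: bop_ext. Qed.

Lemma bop_compBr P Q B : bop_comp B (P - Q) = bop_comp B P - bop_comp B Q.
Proof. by apply: bop_ext => x; rewrite !(bop_compE, bopBE) linearB. Qed.

Lemma bop_compZl (a : R[i]) P B : bop_comp (a *: P) B = a *: bop_comp P B.
Proof. exact: bop_ext. Qed.
Lemma bop_compZr (a : R[i]) P B : bop_comp B (a *: P) = a *: bop_comp B P.
Proof. by apply: bop_ext => x; rewrite !(bop_compE, bopZE) linearZ. Qed.
Lemma bop_compA P Q B : bop_comp P (bop_comp Q B) = bop_comp (bop_comp P Q) B.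
Proof. exact: bop_ext. Qed.
Lemma bop_comp1l P : bop_comp (bop_id H) P = P.
Proof. exact: bop_ext. Qed.
Lemma bop_comp1r P : bop_comp P (bop_id H) = P.
Proof. exact: bop_ext. Qed.

Lemma cvg_bop_comp T (F : set_system T) {FF : Filter F} (p q : T -> bop H) P Q :
  p @ F --> P -> q @ F --> Q ->
  (fun t => bop_comp (p t) (q t)) @ F --> bop_comp P Q.
Proof.
move=> /cvg_nrmP pP /cvg_nrmP fx; apply/cvg_nrmP => e e0.
pose M := nrm P + nrm Q + 1.
have M0 : 0 < M by rewrite ltr_wpDl ?addr_ge0 ?nrm_ge0.
pose d := Num.min 1 (e / (2 * M)).
have d0 : 0 < d by rewrite lt_min ltr01/= divr_gt0// mulr_gt0.
have dM : d * (2 * M) <= e by rewrite -ler_pdivlMr ?mulr_gt0// ge_min lexx orbT.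
have d1 : d <= 1 by rewrite ge_min lexx.
near=> t.
have h1 : nrm (p t - P) < d by near: t; exact: pP.
have h2 : nrm (q t - Q) < d by near: t; exact: fx.
have -> : bop_comp (p t) (q t) - bop_comp P Q = bop_comp (p t - P) (q t - Q) +
    bop_comp (p t - P) Q + bop_comp P (q t - Q).
  by rewrite bop_compBr subrK bop_compBl bop_compBr addrA subrK.
apply: (le_lt_trans (ler_nrmD _ _)).
apply: (@le_lt_trans _ _ (d * d + d * nrm Q + nrm P * d)).
  apply: lerD; last first.
    by apply: (le_trans (nrm_comp _ _)); rewrite ler_wpM2l ?nrm_ge0 ?ltW.
  apply: (le_trans (ler_nrmD _ _)); apply: lerD.
    by apply: (le_trans (nrm_comp _ _)); rewrite ler_pM ?nrm_ge0 ?ltW.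
  by apply: (le_trans (nrm_comp _ _)); rewrite ler_wpM2r ?nrm_ge0 ?ltW.
have := nrm_ge0 Q; have := nrm_ge0 P; rewrite /M in dM *; nra.
Unshelve. all: by end_near. Qed.

Lemma hilbert_complete (u : nat -> H) :
  (forall e : R, 0 < e -> exists N, forall n m, (N <= n)%N -> (N <= m)%N ->
    nrm (u n - u m) < e) -> exists l : H, u @ \oo --> l.
Proof.
move=> uC; have : cauchy (u @ \oo).
  apply/cauchy_ballP => e e0.
  have eE : e = (complex.Re e)%:C.
    by move: e0; rewrite ltcE; case: e => a b /= /andP[/eqP -> _].
  have /uC[N uN] : 0 < complex.Re e by rewrite -ltcR -eE.
  exists (u @` [set n | (N <= n)%N], u @` [set n | (N <= n)%N]).
    by split; exists N => // n Nn; exists n.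
  move=> [_ _] /= [[n Nn <-] [m Nm <-]]; rewrite -ball_normE /= nrmE eE ltcR.
  exact: uN.
by move=> /cauchy_cvg/cvg_ex[l ul]; exists l.
Qed.

(** Direct method: J(x) = <Bx, x> - 2 Re phi(x) is bounded below, and its minimiser l satisfies the
    Euler equation phi = <., B l>. For B = 1 this is the Riesz representation theorem, from which
    adjoints are built; for general B it solves B x = y. *)
Lemma coercive_represent B (c M : R) (phi : H -> C) : selfadjoint B -> 0 < c ->
  (forall x, c * nrm x ^+ 2 <= rin (bop_app B x) x) ->
  linear phi -> (forall x, cabs (phi x) <= M * nrm x) ->
  exists y, forall h, phi h = inner h (bop_app B y).
Proof.
move=> saB c0 Bc lphi phiM.
pose q x := rin (bop_app B x) x.
pose J x := q x - 2 * complex.Re (phi x).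
have phiD x y : phi (x + y) = phi x + phi y.
  by have := lphi 1 x y; rewrite !scale1r.
have phiZ (a : R[i]) x : phi (a *: x) = a * phi x.
  have phi0 : phi 0 = 0 by apply: (addrI (phi 0)); rewrite -phiD !addr0.
  by have := lphi a x 0; rewrite phi0 !addr0.
have rinB x y : rin (bop_app B x) y = rin x (bop_app B y) by rewrite /rin saB.
have JD x y (t : R) : J (x + t%:C *: y) =
    J x + 2 * t * (rin (bop_app B x) y - complex.Re (phi y)) + t ^+ 2 * q y.
  rewrite /J /q linearD linearZ /= phiD phiZ !(rinDl, rinDr, rinZl, rinZr) ReD ReZ.
  by rewrite (rinB y x) (rinC y); ring.
have Jlb x : - (M ^+ 2 / c) <= J x.
  have h1 := Bc x; have h2 := le_trans (ler_norm _) (ler_Re_cabs (phi x)).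
  have h3 := phiM x; rewrite /J.
  have h4 : 0 <= (c * nrm x - M) ^+ 2 / c by rewrite divr_ge0 ?sqr_ge0 ?ltW.
  have h5 : (c * nrm x - M) ^+ 2 / c = c * nrm x ^+ 2 - 2 * (M * nrm x) + M ^+ 2 / c.
    by field; rewrite gt_eqF.
  rewrite -/(q x) in h1; lra.
have Jinf : has_inf (range J).
  split; first by exists (J 0), 0.
  by exists (- (M ^+ 2 / c)) => _ [x _ <-].
set d := inf (range J).
have Jd x : d <= J x by apply: (ge_inf Jinf.2); exists x.
have /choice[u uP] : forall n : nat, exists x, J x < d + n.+1%:R^-1.
  move=> n; have n0 : 0 < n.+1%:R^-1 :> R by rewrite invr_gt0.
  by have [_ [x _ <-] ?] := inf_adherent n0 Jinf; exists x.
(* Parallelogram law: the midpoint of x and y has J >= d as well, so a minimising sequence is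
   Cauchy. *)
have par x y : c * nrm (x - y) ^+ 2 <= 2 * (J x + J y - 2 * d).
  have -> : x = y + 1%:C *: (x - y) by rewrite scale1r addrC subrK.
  have := Jd (y + (2^-1)%:C *: (x - y)); have := Bc (x - y).
  rewrite !JD -/(q _); set s := rin _ _ - _; rewrite scale1r [y + _]addrC addrK.
  lra.
have [l ul] : exists l : H, u @ \oo --> l.
  apply: hilbert_complete => e e0.
  have ce : 0 < c * e ^+ 2 / 4 by rewrite divr_gt0// mulr_gt0// exprn_gt0.
  have [N _ HN] := near_infty_natSinv_lt (PosNum ce).
  exists N => n m /HN /= hn /HN /= hm.
  rewrite -(@ltr_pXn2r _ 2)// ?nnegrE ?nrm_ge0 ?ltW//.
  rewrite -(ltr_pM2l c0).
  have h1 := par (u n) (u m); have h2 := uP n; have h3 := uP m.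
  apply: (le_lt_trans h1); move: hn hm; set E := c * e ^+ 2 => hn hm.
  move: h2 h3 hn hm; set a := n.+1%:R^-1; set b := m.+1%:R^-1.
  set Jn := J _; set Jm := J _; lra.
have Jl : J l <= d.
  suff h (e : R) : 0 < e -> J l <= d + e by apply/ler_addgt0Pr.
  move=> e0.
  have Jul : (fun n => J (u n)) @ \oo --> J l.
    apply: cvgB.
      by apply: cvg_Re; apply: cvg_inner => //; apply: cvg_bop_app => //; exact: cvg_cst.
    apply: cvgM; first exact: cvg_cst.
    apply: cvg_Re; apply/cvg_nrmP => e' e'0.
    have M1 : 0 < `|M| + 1 by rewrite ltr_wpDl.
    have := (@cvg_nrmP R H _ \oo eventually_filter u l).1 ul (e' / (`|M| + 1)) (divr_gt0 e'0 M1).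
    apply: filterS => n; rewrite ltr_pdivlMr// => ye.
    have -> : phi (u n) - phi l = phi (u n - l).
      by rewrite phiD -(scaleN1r l) phiZ mulN1r.
    apply: le_lt_trans ye; apply: (le_trans (phiM _)); rewrite mulrC.
    by rewrite ler_wpM2l ?nrm_ge0// (le_trans (ler_norm _))// lerDl.
  have e2 : 0 < e / 2 by rewrite divr_gt0.
  move/cvgrPdist_lt: Jul => /(_ _ e2) Jul.
  have [N _ HN] := near_infty_natSinv_lt (PosNum e2).
  have [n [n1 n2]] : exists n, `|J l - J (u n)| < e / 2 /\ n.+1%:R^-1 < e / 2.
    have [N' _ HN'] := Jul.
    exists (maxn N N'); split; first by apply: HN' => /=; rewrite leq_maxr.
    by apply: HN => /=; rewrite leq_maxl.
  have := uP n; move: n1 n2; rewrite ltr_norml => /andP[_ +].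
  by move: (n.+1%:R^-1) => a; lra.
exists l => h.
have Re0 k : complex.Re (phi k) = rin k (bop_app B l).
  rewrite -rinB rinC; set r := rin _ _.
  apply/eqP; rewrite eq_sym -subr_eq0; apply/eqP; set s := r - _.
  have key t : 0 <= 2 * t * s + t ^+ 2 * q k.
    have := Jd (l + t%:C *: k); rewrite JD rinB -/r -/s; lra.
  have qk : 0 <= q k by rewrite (le_trans _ (Bc k))// mulr_ge0 ?sqr_ge0 ?ltW.
  (* This t makes the quadratic in [key] negative unless s = 0; the added 1 allows for q k = 0. *)
  have := key (- s / (q k + 1)); have q1 : 0 < q k + 1 by rewrite ltr_wpDl.
  have -> : 2 * (- s / (q k + 1)) * s + (- s / (q k + 1)) ^+ 2 * q k =
     - (s ^+ 2 * (q k + 2) / (q k + 1) ^+ 2) by field; rewrite gt_eqF.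
  rewrite oppr_ge0 => h1; apply/eqP; rewrite -sqrf_eq0 eq_le sqr_ge0 andbT.
  move: h1; rewrite pmulr_lle0 ?invr_gt0 ?exprn_gt0// pmulr_lle0//.
  by rewrite ltr_wpDl.
have Im0 : complex.Im (phi h) = complex.Im (inner h (bop_app B l)).
  (* The real part at -i h is the imaginary part at h. *)
  have := Re0 ((0 -i* 1) *: h); rewrite phiZ /rin innerZl.
  by case: (phi h) (inner _ _) => [a b] [a' b'] /=; lra.
by rewrite [LHS]complex_ReIm [RHS]complex_ReIm Re0 Im0.
Qed.

Lemma is_adjoint_ex P : exists Q, is_adjoint P Q.
Proof.
have /choice[f fP] y : exists z, forall x, inner (bop_app P x) y = inner x z.
  have idsa : selfadjoint (bop_id H) by [].
  have lphi : linear (fun x => inner (bop_app P x) y : C).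
    by move=> a u v; rewrite linearP innerPl.
  have [|x|z zP] := @coercive_represent (bop_id H) 1 (nrm P * nrm y) _ idsa ltr01 _ lphi.
  - by move=> x; rewrite mul1r bop_idE rinxx.
  - rewrite (le_trans (cauchy_schwarz _ _))// mulrAC ler_wpM2r ?nrm_ge0//.
    exact: nrm_bop_app.
  - by exists z => x; rewrite zP.
have fl : linear f.
  move=> a u v; apply: inner_ext => z.
  by rewrite -fP !innerDr !innerZr !fP.
have [|Q QE] := @bop_exists f (nrm P) fl.
  move=> x; have [->|fx0] := eqVneq (f x) 0.
    by rewrite nrm0 mulr_ge0 ?nrm_ge0.
  have : nrm (f x) * nrm (f x) <= nrm P * nrm x * nrm (f x).
    rewrite -expr2 -rinxx /rin -fP; apply: (le_trans (ler_norm _)).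
    apply: (le_trans (rin_le _ _)); rewrite mulrAC ler_wpM2r ?nrm_ge0//.
    exact: nrm_bop_app.
  by rewrite ler_pM2r// nrm_gt0.
by exists Q => x y; rewrite QE.
Qed.

Lemma adjointP P : is_adjoint P (adjoint P).
Proof. by rewrite /adjoint; case: xgetP => [Q _ //|h]; have [Q /h] := is_adjoint_ex P. Qed.

Lemma adjoint_uniq P Q : is_adjoint P Q -> adjoint P = Q.
Proof.
move=> h; apply: bop_ext => y; apply: inner_ext => x.
by rewrite -(adjointP P) h.
Qed.

Lemma adjointPr P x y : inner (bop_app (adjoint P) x) y = inner x (bop_app P y).
Proof. by rewrite inner_conj -adjointP [RHS]inner_conj. Qed.

Lemma adjointK P : adjoint (adjoint P) = P.
Proof. by apply: adjoint_uniq => x y; rewrite adjointPr. Qed.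

Lemma adjointB P Q : adjoint (P - Q) = adjoint P - adjoint Q.
Proof.
by apply: adjoint_uniq => x y; rewrite !bopBE innerBl innerBr !adjointP.
Qed.

Lemma nrm_adjoint_le P : nrm (adjoint P) <= nrm P.
Proof.
apply: nrm_bop_le => [|x]; first exact: nrm_ge0.
have [->|fx0] := eqVneq (bop_app (adjoint P) x) 0.
  by rewrite nrm0 mulr_ge0 ?nrm_ge0.
have : nrm (bop_app (adjoint P) x) * nrm (bop_app (adjoint P) x) <=
    nrm P * nrm x * nrm (bop_app (adjoint P) x).
  rewrite -expr2 -rinxx /rin -adjointP; apply: (le_trans (ler_norm _)).
  apply: (le_trans (rin_le _ _)); rewrite mulrAC ler_wpM2r ?nrm_ge0//.
  exact: nrm_bop_app.
by rewrite ler_pM2r// nrm_gt0.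
Qed.

Lemma cvg_adjoint T (F : set_system T) {FF : Filter F} (p : T -> bop H) P :
  p @ F --> P -> (fun t => adjoint (p t)) @ F --> adjoint P.
Proof.
move=> /cvg_nrmP pP; apply/cvg_nrmP => e e0; apply: filterS (pP e e0) => t.
by apply: le_lt_trans; rewrite -adjointB nrm_adjoint_le.
Qed.

Definition invertible P := exists Q,
  bop_comp Q P = bop_id H /\ bop_comp P Q = bop_id H.

(** Coercivity bounds B from below, which gives injectivity and a bounded inverse; surjectivity is
    [coercive_represent] for the functional <., y>. *)
Lemma coercive_invertible B (c : R) : selfadjoint B -> 0 < c ->
  (forall x, c * nrm x ^+ 2 <= rin (bop_app B x) x) -> invertible B.
Proof.
move=> saB c0 Bc.
have Blb x : c * nrm x <= nrm (bop_app B x).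
  have [->|x0] := eqVneq x 0; first by rewrite linear0 !nrm0 mulr0.
  have : c * nrm x * nrm x <= nrm (bop_app B x) * nrm x.
    rewrite -mulrA -expr2; apply: (le_trans (Bc x)).
    exact: le_trans (ler_norm _) (rin_le _ _).
  by rewrite ler_pM2r ?nrm_gt0.
have Binj x : bop_app B x = 0 -> x = 0.
  move=> Bx; apply/eqP; rewrite -nrm_eq0 eq_le nrm_ge0 andbT.
  by have := Blb x; rewrite Bx nrm0 pmulr_rle0.
have /choice[f fP] y : exists x, bop_app B x = y.
  have lphi : linear (fun x => inner x y : C) by move=> a u v; rewrite innerPl.
  have [|x xP] := coercive_represent saB c0 Bc lphi (M := nrm y).
    by move=> x; rewrite mulrC cauchy_schwarz.
  by exists x; apply: inner_ext => z; rewrite -xP.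
have fl : linear f.
  move=> a u v; apply/eqP; rewrite -subr_eq0; apply/eqP/Binj.
  by rewrite linearB /= fP linearP /= !fP subrr.
have [|Q QE] := @bop_exists f c^-1 fl.
  by move=> x; rewrite ler_pdivlMl// -{2}(fP x).
exists Q; split; apply: bop_ext => x; rewrite bop_compE bop_idE QE //.
by apply/eqP; rewrite -subr_eq0; apply/eqP/Binj; rewrite linearB /= fP subrr.
Qed.

Lemma selfadjoint_comp B : selfadjoint B -> selfadjoint (bop_comp B B).
Proof. by move=> saB x y; rewrite !bop_compE !saB. Qed.

Lemma rin_comp_adjoint P x :
  rin (bop_app (bop_comp (adjoint P) P) x) x = nrm (bop_app P x) ^+ 2.
Proof. by rewrite /rin bop_compE adjointPr -/(rin _ _) rinxx. Qed.

Lemma selfadjoint_PdagP P : selfadjoint (PdagP P).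
Proof. by move=> x y; rewrite !bop_compE adjointPr adjointP. Qed.

Lemma selfadjoint_PPdag P : selfadjoint (PPdag P).
Proof. by move=> x y; rewrite !bop_compE adjointP adjointPr. Qed.

Lemma invertible_comp P Q : invertible P -> invertible Q -> invertible (bop_comp P Q).
Proof.
move=> [P' [P1 P2]] [Q' [Q1 Q2]]; exists (bop_comp Q' P'); split.
  by rewrite -bop_compA (bop_compA P') P1 bop_comp1l.
by rewrite -bop_compA (bop_compA Q) Q2 bop_comp1l.
Qed.

Lemma invertible_lr P Q1 Q2 : bop_comp Q1 P = bop_id H -> bop_comp P Q2 = bop_id H ->
  invertible P.
Proof.
move=> h1 h2; exists Q2; split=> //.
suff <- : Q1 = Q2 by [].
by rewrite -(bop_comp1r Q1) -h2 bop_compA h1 bop_comp1l.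
Qed.

(** P^dag P and P P^dag are coercive, hence invertible; their inverses provide a left and a right
    inverse of P. *)
Lemma bounded_below_invertible P (c : R) : 0 < c ->
  (forall x, c * nrm x <= nrm (bop_app P x)) ->
  (forall x, c * nrm x <= nrm (bop_app (adjoint P) x)) -> invertible P.
Proof.
move=> c0 h1 h2.
have hh Q : (forall x, c * nrm x <= nrm (bop_app Q x)) ->
    forall x, c ^+ 2 * nrm x ^+ 2 <= rin (bop_app (bop_comp (adjoint Q) Q) x) x.
  by move=> h x; rewrite rin_comp_adjoint -exprMn ler_pXn2r// nnegrE ?mulr_ge0 ?nrm_ge0// ltW.
have [Q1 [q1 _]] := coercive_invertible (selfadjoint_PdagP P) (exprn_gt0 2 c0) (hh _ h1).
have := coercive_invertible (selfadjoint_PdagP (adjoint P)) (exprn_gt0 2 c0) (hh _ h2).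
rewrite /PdagP adjointK => -[Q2 [_ q2]].
apply: (@invertible_lr _ (bop_comp Q1 (adjoint P)) (bop_comp (adjoint P) Q2)).
  by rewrite -bop_compA.
by rewrite bop_compA.
Qed.

Lemma selfadjoint_adjoint P : selfadjoint P -> adjoint P = P.
Proof. exact: adjoint_uniq. Qed.

Lemma sa_bounded_below_invertible P (c : R) : selfadjoint P -> 0 < c ->
  (forall x, c * nrm x <= nrm (bop_app P x)) -> invertible P.
Proof.
by move=> saP c0 h; apply: (bounded_below_invertible c0 h); rewrite selfadjoint_adjoint.
Qed.

Lemma invertible_bounded_below P : invertible P ->
  exists2 c : R, 0 < c & forall x, c * nrm x <= nrm (bop_app P x).
Proof.
move=> [Q [QP _]]; have Q1 : 0 < nrm Q + 1 by rewrite ltr_wpDl ?nrm_ge0.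
exists (nrm Q + 1)^-1 => [|x]; first by rewrite invr_gt0.
rewrite ler_pdivrMl//; have -> : nrm x = nrm (bop_app Q (bop_app P x)).
  by rewrite -bop_compE QP.
apply: (le_trans (nrm_bop_app _ _)); rewrite ler_wpM2r ?nrm_ge0// lerDl ler01.
by [].
Qed.

(* Gliding hump: from any point a step of length 3^-(n+1) makes the n-th        *)
(* functional large; the limit is at distance at most half of the last step.   *)
Lemma uniform_boundedness (z : nat -> H) :
  (forall y, exists M : R, forall k, cabs (inner y (z k)) <= M) ->
  exists M : R, forall k, nrm (z k) <= M.
Proof.
move=> ptw; apply: contrapT => unb.
pose r n : R := (3 ^+ n)^-1.
have r0 n : 0 < r n by rewrite invr_gt0 exprn_gt0.
have rS n : r n = 3 * r n.+1 by rewrite /r exprS; field; rewrite expf_neq0.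
have /choice[k kP] n : exists k, n%:R / r n <= nrm (z k).
  apply: contrapT => h; apply: unb; exists (n%:R / r n) => k.
  by rewrite leNgt; apply/negP => hk; apply: h; exists k; exact: ltW.
have step x n : exists x', nrm (x' - x) <= r n.+1 /\
    r n.+1 * nrm (z (k n.+1)) <= cabs (inner x' (z (k n.+1))).
  set w := z _; have [w0|w0] := eqVneq w 0.
    by exists x; rewrite subrr nrm0 w0 inner0r nrm0 mulr0 nrm_ge0 ltW.
  have nw : 0 < nrm w by rewrite nrm_gt0.
  pose v := (r n.+1 / nrm w)%:C *: w.
  have nv : nrm v = r n.+1.
    by rewrite nrmZ cabs_real ger0_norm ?divr_ge0 ?nrm_ge0 ?ltW// divfK ?gt_eqF.
  have cv : cabs (inner v w) = r n.+1 * nrm w.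
    rewrite innerZl cabsM innerxx !cabs_real !ger0_norm ?sqr_ge0 ?divr_ge0 ?nrm_ge0 ?ltW//.
    by field; rewrite gt_eqF.
  have [h|h] := leP (r n.+1 * nrm w) (cabs (inner (x + v) w)).
    by exists (x + v); split=> //; rewrite [x + v]addrC addrK nv.
  exists (x - v); split; first by rewrite [x - v]addrC addrK nrmN nv.
  (* The two values differ by 2 <v, w>, so at least one of them has modulus at least |<v, w>|. *)
  have : cabs (inner (x + v) w - inner (x - v) w) <=
    cabs (inner (x + v) w) + cabs (inner (x - v) w) by exact: ler_nrmB.
  have -> : inner (x + v) w - inner (x - v) w = 2%:C * inner v w.
    by rewrite innerDl innerBl (_ : 2%:C = 2) ?rmorph_nat//; ring.
  rewrite cabsM cv cabs_real ger0_norm//; lra.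
have /choice[g gP] : forall p : H * nat, exists x', nrm (x' - p.1) <= r p.2.+1 /\
    r p.2.+1 * nrm (z (k p.2.+1)) <= cabs (inner x' (z (k p.2.+1))).
  by move=> p; exact: step.
pose x := fix x n : H := if n is m.+1 then g (x m, m) else 0.
have xd n m : nrm (x (n + m)%N - x n) <= (r n - r (n + m)%N) / 2.
  elim: m => [|m IH]; first by rewrite addn0 !subrr nrm0 mul0r.
  rewrite addnS.
  have -> : x (n + m).+1 - x n = (x (n + m).+1 - x (n + m)%N) + (x (n + m)%N - x n).
    by rewrite addrA subrK.
  apply: (le_trans (ler_nrmD _ _)).
  have := (gP (x (n + m)%N, (n + m)%N)).1; rewrite /= -/(x _) => h.
  have := rS (n + m)%N; lra.
have rbound n : r n <= n.+1%:R^-1.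
  rewrite lef_pV2 ?posrE ?exprn_gt0 ?ltr0n//.
  elim: n => [|n IH]; first by rewrite expr0.
  rewrite exprS -natr1; have : (1:R) <= n.+1%:R by rewrite ler1n.
  by move: IH; set a := n.+1%:R; set b := 3 ^+ n => *; lra.
have [l xl] : exists l : H, x @ \oo --> l.
  apply: hilbert_complete => e e0.
  have [N _ HN] := near_infty_natSinv_lt (PosNum e0).
  exists N => n m Nn Nm.
  have hd p : (N <= p)%N -> nrm (x p - x N) <= r N / 2.
    move=> Np; have := xd N (p - N)%N; rewrite subnKC// => h; apply: (le_trans h).
    by have := r0 p; lra.
  have -> : x n - x m = (x n - x N) - (x m - x N) by rewrite opprB addrA subrK.
  apply: (le_lt_trans (ler_nrmB _ _)).
  have := hd _ Nn; have := hd _ Nm.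
  by have /= := le_lt_trans (rbound N) (HN N (leqnn N)); lra.
have xl2 n : nrm (l - x n) <= r n / 2.
  suff h (e : R) : 0 < e -> nrm (l - x n) <= r n / 2 + e by apply/ler_addgt0Pr.
  move=> e0.
  have [N _ HN] := (@cvg_nrmP R H _ \oo eventually_filter x l).1 xl e e0.
  have -> : l - x n = (x (n + N)%N - x n) - (x (n + N)%N - l).
    by rewrite opprB [RHS]addrC addrA subrK.
  apply: (le_trans (ler_nrmB _ _)).
  have := xd n N; have := HN (n + N)%N (leq_addl _ _); have := r0 (n + N)%N => /=; lra.
have [M MP] := ptw l.
have := MP (k (Num.truncn (2 * M)).+2).
set n := (Num.truncn _).+1; set w := z _ => Mw.
have h1 := (gP (x n, n)).2; rewrite /= -/(x n.+1) -/w in h1.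
have h2 : cabs (inner (l - x n.+1) w) <= r n.+1 / 2 * nrm w.
  by apply: (le_trans (cauchy_schwarz _ _)); rewrite ler_wpM2r ?nrm_ge0.
have h3 : cabs (inner (x n.+1) w) <= cabs (inner l w) + cabs (inner (l - x n.+1) w).
  have -> : inner (x n.+1) w = inner l w - inner (l - x n.+1) w.
    by rewrite innerBl opprB addrC subrK.
  exact: ler_nrmB.
have h4 := kP n.+1; rewrite ler_pdivrMr// -/w in h4.
have h5 : 2 * M < n.+1%:R.
  by apply: (lt_trans (truncnS_gt _)); rewrite ltr_nat.
lra.
Qed.

End BoundedOperators.

(** * Exterior powers and determinant lines *)

Section LinearSpan.
Variables (K : fieldType) (V : lmodType K).
Implicit Types (W : submod V) (A : set V) (s t : seq V).

Lemma submodZ W (a : K) x : submod_set W x -> submod_set W (a *: x).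
Proof. by move=> Wx; rewrite -[_ *: _]addr0; apply: submodP => //; exact: submod0. Qed.

Lemma submodD W x y : submod_set W x -> submod_set W y -> submod_set W (x + y).
Proof. by move=> Wx Wy; rewrite -[x]scale1r; exact: submodP. Qed.

Lemma submod_sum W I (r : seq I) (P : pred I) (F : I -> V) :
  (forall i, P i -> submod_set W (F i)) -> submod_set W (\sum_(i <- r | P i) F i).
Proof.
move=> WF; elim/big_ind: _ => //; first exact: submod0.
by move=> x y; exact: submodD.
Qed.

Lemma lin_span_mem A x : A x -> lin_span_set A x.
Proof.
move=> Ax; exists [:: (1, x)]; last by rewrite big_seq1 scale1r.
by move=> p; rewrite inE => /eqP ->.
Qed.

Lemma lin_span_sub A W : A `<=` W -> lin_span A `<=` W.
Proof.
move=> AW x [r rA ->]; rewrite big_seq; apply: submod_sum => p pr.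
by apply: submodZ; apply/AW/rA.
Qed.

Lemma lin_spanS A B : A `<=` B -> lin_span A `<=` lin_span B.
Proof. by move=> AB; apply: lin_span_sub => x /AB; exact: lin_span_mem. Qed.

Lemma lin_spanP s x : lin_span_set [set` s] x <->
  exists c : nat -> K, x = \sum_(i < size s) c i *: s`_i.
Proof.
split=> [[r rA ->]|[c ->]]; last first.
  apply: (@submod_sum (lin_span [set` s])) => i _; apply: submodZ.
  by apply: lin_span_mem => /=; rewrite mem_nth.
elim: r rA => [|[a y] r IH] rA.
  by exists (fun=> 0); rewrite big_nil big1// => i _; rewrite scale0r.
rewrite big_cons /=.
have [p pr|c ->] := IH; first by apply: rA; rewrite inE pr orbT.
have ys : y \in s by apply: (rA (a, y)); rewrite inE eqxx.
have ks : (index y s < size s)%N by rewrite index_mem.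
exists (fun i => a * (i == index y s)%:R + c i).
under [RHS]eq_bigr do rewrite scalerDl.
rewrite [RHS]big_split /= [X in _ = X + _](bigD1 (Ordinal ks)) //= eqxx mulr1 nth_index//.
rewrite [X in _ + X + _]big1 ?addr0// => i.
by rewrite -val_eqE /= => /negbTE ->; rewrite mulr0 scale0r.
Qed.

Lemma lin_indep_uniq s : lin_indep s -> uniq s.
Proof.
move=> si; apply/(uniqP 0) => i j; rewrite !inE => ii ij eij.
apply/eqP; apply: contraT => nij.
have : (1 : K) = 0; last by move=> /eqP; rewrite oner_eq0.
have := si (fun k => (k == i)%:R - (k == j)%:R) _ i ii.
rewrite eqxx (negbTE nij) subr0; apply.
under eq_bigr do rewrite scalerBl.
rewrite sumrB (bigD1 (Ordinal ii)) //= eqxx scale1r big1 => [|k]; last first.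
  by rewrite -val_eqE /= => /negbTE ->; rewrite scale0r.
rewrite addr0 (bigD1 (Ordinal ij)) //= eqxx scale1r big1 => [|k].
  by rewrite addr0 eij subrr.
by rewrite -val_eqE /= => /negbTE ->; rewrite scale0r.
Qed.

(** With more vectors than generators the coefficient matrix has a nonzero left kernel vector, which
    is a linear relation among the vectors of t. *)
Lemma lin_indep_size s t : lin_indep t ->
  (forall x, x \in t -> lin_span_set [set` s] x) -> (size t <= size s)%N.
Proof.
move=> ti ts; rewrite leqNgt; apply/negP => st.
have /choice[c cE] (i : 'I_(size t)) :
    exists c : nat -> K, t`_i = \sum_(j < size s) c j *: s`_j.
  by apply/lin_spanP/ts; rewrite mem_nth.
pose M : 'M[K]_(size t, size s) := \matrix_(i, j) c i j.
have : \rank (kermx M) != 0%N.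
  by rewrite mxrank_ker -lt0n subn_gt0 (leq_ltn_trans (rank_leq_col M)).
rewrite mxrank_eq0 => /rowV0Pn[v /sub_kermxP vM v0].
case/negP: v0; apply/eqP/rowP => i; rewrite mxE.
pose d (k : nat) : K := if insub k is Some i then v 0 i else 0.
have dE (k : 'I_(size t)) : d k = v 0 k by rewrite /d valK.
have := ti d _ i (ltn_ord i); rewrite dE; apply.
under eq_bigr => k _ do rewrite dE cE scaler_sumr.
rewrite exchange_big /= big1 // => j _.
under eq_bigr do rewrite scalerA.
have e : \sum_k v 0 k * c k j = 0.
  have /rowP/(_ j) := vM; rewrite !mxE => e; rewrite -[RHS]e.
  by apply: eq_bigr => k _; rewrite mxE.
by rewrite -scaler_suml e scale0r.
Qed.

Lemma is_basis_size (W : set V) s t : is_basis W s -> is_basis W t -> size s = size t.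
Proof.
move=> [si Ws] [ti Wt]; apply/eqP; rewrite eqn_leq; apply/andP; split.
  apply: lin_indep_size si _ => x xs.
  by have : W x by [rewrite Ws; exact: lin_span_mem]; rewrite Wt.
apply: lin_indep_size ti _ => x xs.
by have : W x by [rewrite Wt; exact: lin_span_mem]; rewrite Ws.
Qed.

Lemma ldim_basis (W : set V) s : is_basis W s -> ldim W = size s.
Proof.
move=> Ws; rewrite /ldim; case: xgetP => [n _ [t Wt <-]|/(_ (size s))].
  exact: is_basis_size Wt Ws.
by case; exists s.
Qed.

Lemma lin_indep_nil : lin_indep ([::] : seq V).
Proof. by move=> c _ i. Qed.

Lemma is_basis_nil (W : set V) : W 0 -> (forall x, W x -> x = 0) -> is_basis W [::].
Proof.
move=> W0 W0E; split; first exact: lin_indep_nil.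
apply/seteqP; split=> x; first by move=> /W0E ->; exact: submod0.
by move=> /lin_spanP[c ->]; rewrite big_ord0.
Qed.

Lemma lin_indep_rcons s y : lin_indep s -> ~ lin_span_set [set` s] y ->
  lin_indep (rcons s y).
Proof.
move=> si ys c; rewrite size_rcons big_ord_recr /= nth_rcons ltnn eqxx => h.
have cy : c (size s) = 0.
  apply/eqP; apply: contra_notT ys => cy.
  have -> : y = - (c (size s))^-1 *: \sum_(i < size s) c i *: (rcons s y)`_i.
    have /eqP := h; rewrite addr_eq0 => /eqP ->.
    by rewrite scalerN scaleNr opprK scalerA mulVf// scale1r.
  apply: (@submodZ (lin_span [set` s])); apply: submod_sum => i _; apply: submodZ.
  by apply: lin_span_mem => /=; rewrite nth_rcons ltn_ord mem_nth.
move: h; rewrite cy scale0r addr0 => h i; rewrite ltnS leq_eqVlt => /orP[/eqP -> //|].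
apply: (si c); rewrite -[RHS]h; apply: eq_bigr => j _.
by rewrite nth_rcons ltn_ord.
Qed.

(** The ambient space may be infinite-dimensional; the bound N on independent lists in W is what
    stops the adjunction of further vectors. *)
Lemma basis_extend W (N : nat) s :
  (forall t, lin_indep t -> (forall x, x \in t -> submod_set W x) -> (size t <= N)%N) ->
  lin_indep s -> (forall x, x \in s -> submod_set W x) -> exists u, is_basis W (s ++ u).
Proof.
move=> WN; have [n] := ubnP (N - size s); elim: n s => // n IH s nN si sW.
have [h|/existsNP[y /not_implyP[Wy ys]]] := pselect (forall y, submod_set W y -> lin_span_set [set` s] y).
  exists [::]; rewrite cats0; split => //.
  by apply/seteqP; split => // x; apply: lin_span_sub.
have si' := lin_indep_rcons si ys.
have sW' x : x \in rcons s y -> submod_set W x by rewrite mem_rcons inE => /orP[/eqP -> //|/sW].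
have := WN _ si' sW'; rewrite size_rcons => h.
have [|u Wu] := IH (rcons s y) _ si' sW'.
  by rewrite size_rcons; move: nN h; lia.
by exists (y :: u); rewrite -cat_rcons.
Qed.

Lemma is_basis_sub (W : set V) s t : is_basis W s -> lin_indep t ->
  (forall x, x \in t -> W x) -> size t = size s -> is_basis W t.
Proof.
move=> [si Ws] ti tW st.
have [||u Wu] := @basis_extend (lin_span [set` s]) (size s) t _ ti.
- by move=> r ri rW; exact: lin_indep_size ri rW.
- by move=> x /tW; rewrite Ws.
have := is_basis_size Wu (conj si erefl); rewrite size_cat st.
case: u Wu => [|? ?] /=; last by lia.
by rewrite cats0 Ws.
Qed.

Lemma basis_mem (W : set V) s x : is_basis W s -> x \in s -> W x.
Proof. by move=> [_ ->] xs; exact: lin_span_mem. Qed.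

End LinearSpan.

Section Alternating.
Variables (K : fieldType) (V : lmodType K) (n : nat) (f : seq V -> K).
Hypothesis fA : alt_form n f.

Let f_size s : size s <> n -> f s = 0. Proof. by case: fA => + _ _; apply. Qed.
Let f_lin s t a x y :
  f (s ++ (a *: x + y) :: t) = a * f (s ++ x :: t) + f (s ++ y :: t).
Proof. by case: fA. Qed.
Let f_alt s t u x : f (s ++ x :: t ++ x :: u) = 0. Proof. by case: fA. Qed.

Lemma altD s t x y : f (s ++ (x + y) :: t) = f (s ++ x :: t) + f (s ++ y :: t).
Proof. by rewrite -{1}[x]scale1r f_lin mul1r. Qed.

Lemma alt0 s t : f (s ++ 0 :: t) = 0.
Proof. by apply: (addrI (f (s ++ 0 :: t))); rewrite -altD !addr0. Qed.

Lemma altZ s t a x : f (s ++ (a *: x) :: t) = a * f (s ++ x :: t).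
Proof. by rewrite -[a *: x]addr0 f_lin alt0 addr0. Qed.

Lemma alt_sum s t I (r : seq I) (F : I -> V) :
  f (s ++ (\sum_(i <- r) F i) :: t) = \sum_(i <- r) f (s ++ F i :: t).
Proof.
by elim: r => [|i r IH]; rewrite !(big_nil, big_cons) ?alt0// altD IH.
Qed.

Lemma alt_swap s t x y : f (s ++ x :: y :: t) = - f (s ++ y :: x :: t).
Proof.
have e z : f (s ++ z :: (x + y) :: t) = f (s ++ [:: z, x & t]) + f (s ++ [:: z, y & t]).
  by rewrite -(cat_rcons z) altD !cat_rcons.
have := f_alt s [::] t (x + y); rewrite /= altD !e.
have -> : f (s ++ [:: x, x & t]) = 0 by exact: (f_alt s [::]).
have -> : f (s ++ [:: y, y & t]) = 0 by exact: (f_alt s [::]).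
by rewrite add0r addr0 => /eqP; rewrite addr_eq0 => /eqP.
Qed.

Lemma alt_move_eq0 s t u x : f (s ++ x :: t ++ u) = 0 -> f (s ++ t ++ x :: u) = 0.
Proof.
elim: t s => [//|y t IH] s /= h.
rewrite -cat_rcons; apply: IH; rewrite cat_rcons.
by apply/eqP; rewrite -oppr_eq0 -alt_swap h.
Qed.

(** Only vanishing is transported along the permutation, so its sign never has to be computed. *)
Lemma alt_perm_eq0 r s t : perm_eq s t -> f (r ++ s) = 0 -> f (r ++ t) = 0.
Proof.
elim: s r t => [|x s IH] r t.
  by rewrite perm_sym => /perm_nilP ->.
move=> pst h; have xt : x \in t by rewrite -(perm_mem pst) inE eqxx.
case/splitPr: xt pst => t1 t2 pst.
apply: alt_move_eq0; rewrite -cat_rcons; apply: IH; last by rewrite cat_rcons.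
rewrite -(perm_cons x) (perm_trans pst)//.
by rewrite -[x :: t2]cat1s perm_catCA.
Qed.

Lemma not_uniqP (T : eqType) (s : seq T) : ~~ uniq s ->
  exists x s1 s2 s3, s = s1 ++ x :: s2 ++ x :: s3.
Proof.
elim: s => // x s IH /=; rewrite negb_and negbK => /orP[|/IH].
  by case/splitPr => s2 s3; exists x, [::], s2, s3.
by move=> [y [s1 [s2 [s3 ->]]]]; exists y, (x :: s1), s2, s3.
Qed.

(** Multilinear expansion replaces the entries one at a time, from the right, by members of s0: in
    the induction s1 is the part not yet expanded and s2 the part already replaced. A list of
    members of s0 of full length either repeats an entry or is a permutation of s0. This is the
    one-dimensionality of the top exterior power. *)
Lemma alt_span_eq0 s0 s : uniq s0 -> f s0 = 0 ->
  (forall x, x \in s -> lin_span_set [set` s0] x) -> size s = size s0 -> f s = 0.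
Proof.
move=> us0 fs0.
suff h s1 s2 : (forall x, x \in s1 -> lin_span_set [set` s0] x) ->
    {subset s2 <= s0} -> size (s1 ++ s2) = size s0 -> f (s1 ++ s2) = 0.
  by move=> ss sz; have := h s [::]; rewrite cats0; exact.
elim/last_ind: s1 s2 => [s2 _ s20 sz|s1 x IH s2 s1x s20 sz].
  rewrite /= in sz *; have [u2|/not_uniqP[y [t1 [t2 [t3 ->]]]]] := boolP (uniq s2).
    apply: (@alt_perm_eq0 [::] s0) => //; apply: uniq_perm => //.
    by apply/fsym; have [] := uniq_min_size u2 s20; rewrite ?sz.
  exact: f_alt.
rewrite cat_rcons.
have /lin_spanP[c ->] : lin_span_set [set` s0] x by apply: s1x; rewrite mem_rcons inE eqxx.
rewrite alt_sum big1 // => i _; rewrite altZ IH ?mulr0//.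
- by move=> y ys; apply: s1x; rewrite mem_rcons inE ys orbT.
- by move=> y; rewrite inE => /orP[/eqP ->|/s20//]; rewrite mem_nth.
- by move: sz; rewrite !size_cat size_rcons /= addSnnS.
Qed.

End Alternating.

Section AltForms.
Variables (K : fieldType) (V : lmodType K).

Lemma alt_form_lin n a (f g : seq V -> K) : alt_form n f -> alt_form n g ->
  alt_form n (fun s => f s + a * g s).
Proof.
move=> [f1 f2 f3] [g1 g2 g3]; split=> [s sn|s t b x y|s t u x].
- by rewrite f1// g1// mulr0 addr0.
- by rewrite f2 g2; ring.
- by rewrite f3 g3 mulr0 addr0.
Qed.

Lemma alt_form_catl n (t : seq V) (f : seq V -> K) : alt_form (n + size t) f ->
  alt_form n (fun s => f (s ++ t)).
Proof.
move=> [f1 f2 f3]; split=> [s sn|s u b x y|s u v x].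
- by apply: f1; rewrite size_cat => /addIn.
- by rewrite -!catA !cat_cons f2.
- by rewrite -!catA !cat_cons -!catA !cat_cons f3.
Qed.

Lemma alt_form_catr n (t : seq V) (f : seq V -> K) : alt_form (size t + n) f ->
  alt_form n (fun s => f (t ++ s)).
Proof.
move=> [f1 f2 f3]; split=> [s sn|s u b x y|s u v x].
- by apply: f1; rewrite size_cat => /addnI.
- by rewrite !catA f2.
- by rewrite !catA f3.
Qed.

Lemma ext_wedge_alt (n : nat) (f : set_type (alt_form n)) (s : seq V) :
  ext_wedge s f = set_val f s.
Proof. by []. Qed.

End AltForms.

Section Gram.
Variables (R : realType) (H : hilbertType R).
Implicit Types s t u : seq H.

(** The Gram determinant. The default 0 for unequal lengths makes it an alternating form in s of
    degree [size t] in the sense of [alt_form]. *)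
Definition gram s t : R[i] :=
  if size s == size t then
    \det (\matrix_(i < size t, j < size t) inner s`_i t`_j) else 0.

Lemma nth_cat_cons (s t : seq H) (x : H) (i : nat) :
  (s ++ x :: t)`_i = if i == size s then x else
    if (i < size s)%N then s`_i else t`_(i - (size s).+1).
Proof.
rewrite nth_cat; case: ltngtP => [//|h|->]; last by rewrite subnn.
by rewrite -[(i - size s)%N]prednK ?subn_gt0//= subnS.
Qed.

Lemma gram_alt t : alt_form (size t) (gram^~ t).
Proof.
split=> [s /eqP/negbTE h|s u b x y|s u v x].
- by rewrite /gram h.
- rewrite /gram !size_cat /=; case: ifPn => [/eqP sz|_]; last by rewrite mulr0 addr0.
  have hi : (size s < size t)%N by rewrite -sz addnS ltnS leq_addr.
  rewrite -[\det (\matrix_(i, j) inner (s ++ y :: u)`_i t`_j)]mul1r.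
  apply: (@determinant_multilinear _ _ _ _ _ (Ordinal hi)).
  + by apply/rowP => j; rewrite !mxE !nth_cat_cons /= eqxx innerPl mul1r.
  + apply/matrixP => i j; rewrite !mxE !nth_cat_cons /=.
    by have := neq_lift (Ordinal hi) i; rewrite -val_eqE eq_sym => /negbTE ->.
  + apply/matrixP => i j; rewrite !mxE !nth_cat_cons /=.
    by have := neq_lift (Ordinal hi) i; rewrite -val_eqE eq_sym => /negbTE ->.
- rewrite /gram; case: ifPn => // /eqP; rewrite !size_cat /= size_cat /= => sz.
  have h1 : (size s < size t)%N by rewrite -sz addnS ltnS leq_addr.
  have h2 : (size s + (size u).+1 < size t)%N by rewrite -sz ltn_add2l ltnS addnS ltnS leq_addr.
  apply: (@determinant_alternate _ _ _ (Ordinal h1) (Ordinal h2)).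
    by apply/eqP => /(congr1 val) /= /eqP; rewrite -{1}[size s]addn0 eqn_add2l.
  move=> j; rewrite !mxE /= nth_cat_cons eqxx; congr (inner _ _).
  by rewrite -cat_cons catA nth_cat_cons size_cat /= addnS eqxx.
Qed.

(** A left kernel vector of the Gram matrix gives a combination y of t orthogonal to all of t, hence
    to itself. *)
Lemma gram_neq0 t : lin_indep t -> gram t t != 0.
Proof.
move=> ti; rewrite /gram eqxx; apply/det0P => -[v v0 vM].
case/negP: v0; apply/eqP/rowP => i; rewrite mxE.
pose d (k : nat) : R[i] := if insub k is Some i then v 0 i else 0.
have dE (k : 'I_(size t)) : d k = v 0 k by rewrite /d valK.
rewrite -dE; apply: (ti d) (ltn_ord i).
set y := \sum_(_ < _) _; apply: inner_eq0; rewrite {2}/y inner_sumr big1 // => j _.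
rewrite innerZr /y inner_suml.
have /rowP/(_ j) := vM; rewrite !mxE => e.
rewrite (eq_bigr (fun k => v 0 k * (\matrix_(i < size t, j < size t) inner t`_i t`_j) k j)).
  by rewrite e mulr0.
by move=> k _; rewrite mxE innerZl dE.
Qed.

Lemma gram_lin_indep t : gram t t != 0 -> lin_indep t.
Proof.
rewrite /gram eqxx => /det0P h c hc i ii; apply/eqP; apply: contra_notT h => ci.
exists (\row_(k < size t) c k); first by apply/eqP => /rowP/(_ (Ordinal ii)); rewrite !mxE => /eqP; rewrite (negbTE ci).
apply/rowP => j; rewrite !mxE; under eq_bigr do rewrite !mxE -innerZl.
by rewrite -inner_suml hc inner0l.
Qed.

(** The determinant of the base change: if s lies in the span of the independent list t and has the
    same length, the wedge of s is [coef s t] times the wedge of t. The quotient of Gram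
    determinants extends this to all s in H as an alternating form, and is visibly continuous in
    both lists. *)
Definition coef s t := gram s t / gram t t.

Lemma coef_alt t : alt_form (size t) (coef^~ t).
Proof.
split=> [s|s u b x y|s u v x]; rewrite /coef; have [h1 h2 h3] := gram_alt t.
- by move=> /h1 ->; rewrite mul0r.
- by rewrite h2 mulrDl mulrA.
- by rewrite h3 mul0r.
Qed.

Lemma coefxx s : lin_indep s -> coef s s = 1.
Proof. by move=> /gram_neq0 h; rewrite /coef divff. Qed.

(** The form f - f(s0) coef(-, s0) is alternating and vanishes on s0, so [alt_span_eq0] applies. *)
Lemma alt_coef n (f : seq H -> R[i]) s0 s : alt_form n f -> n = size s0 ->
  lin_indep s0 -> (forall x, x \in s -> lin_span_set [set` s0] x) ->
  size s = n -> f s = coef s s0 * f s0.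
Proof.
move=> fA nE; move: fA; rewrite nE => fA s0i ss sz.
have gA := alt_form_lin (- f s0) fA (coef_alt s0).
move: fA gA => _ gA; have := alt_span_eq0 gA (lin_indep_uniq s0i) _ ss sz.
rewrite coefxx// mulr1 subrr => /(_ erefl)/eqP.
by rewrite mulNr subr_eq0 mulrC => /eqP.
Qed.

Lemma coef_trans s t u : size s = size t -> size t = size u -> lin_indep t ->
  (forall x, x \in s -> lin_span_set [set` t] x) ->
  coef s u = coef s t * coef t u.
Proof. by move=> st tu ti ss; apply: alt_coef (coef_alt u) _ ti ss _ => //; rewrite st. Qed.

End Gram.

Lemma val_linear_app (K : fieldType) (I : Type) (W : submod (I -> K^o)) (a : K)
    (x y : subspace_type W) i : \val (a *: x + y) i = a * \val x i + \val y i.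
Proof. by rewrite linearP. Qed.

Section TopExt.
Variables (R : realType) (H : hilbertType R).
Local Notation wedge n s := (@ext_wedge R[i] H n s).
Implicit Types (W : set H) (s t u : seq H).

Lemma lin_scale (L M : lmodType R[i]) (f : L -> M) : linear f ->
  forall a x, f (a *: x) = a *: f x.
Proof.
move=> fl a x; have f0 : f 0 = 0.
  have := fl 1 0 0; rewrite scaler0 addr0 scale1r => h.
  by apply: (addrI (f 0)); rewrite -h addr0.
by have := fl a x 0; rewrite f0 !addr0.
Qed.

Lemma top_wedgeE (B : set H) t : (forall x, x \in t -> lin_span_set B x) ->
  set_val (top_wedge (lin_span B) t) = wedge (ldim (lin_span B)) t.
Proof.
move=> tW; rewrite /top_wedge set_valE val_insubd.
have -> // : wedge (ldim (lin_span B)) t \in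
  (ext_power (ldim (lin_span B)) (lin_span B) : set _).
by apply/mem_set; apply: lin_span_mem; exists t.
Qed.

Lemma top_wedge_val W s t : is_basis W s -> (forall x, x \in t -> W x) ->
  set_val (top_wedge W t) = wedge (ldim W) t.
Proof. by move=> [_ ->] tW; exact: top_wedgeE. Qed.

Lemma coef_alt_ldim W s : is_basis W s -> (fun t => coef t s) \in (alt_form (ldim W) : set (seq H -> R[i])).
Proof. by move=> Ws; apply/mem_set; rewrite (ldim_basis Ws); exact: coef_alt. Qed.

Lemma ext_wedge_coef W s t : is_basis W s -> (forall x, x \in t -> W x) ->
  size t = size s -> wedge (ldim W) t = coef t s *: wedge (ldim W) s :> (_ -> R[i]^o).
Proof.
move=> Ws tW st; apply/funext => f; rewrite fctE /= !ext_wedge_alt.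
have [si WE] := Ws; apply: (@alt_coef _ _ (ldim W)) => //.
- exact: set_valP.
- exact: ldim_basis.
- by move=> x /tW; rewrite {1}WE.
- by rewrite (ldim_basis Ws).
Qed.

Lemma top_wedge_coef W s t : is_basis W s -> (forall x, x \in t -> W x) ->
  size t = size s -> top_wedge W t = coef t s *: top_wedge W s.
Proof.
move=> Ws tW st; apply: val_inj.
have sW x : x \in s -> W x by exact: basis_mem Ws.
rewrite linearZ /= -!set_valE (top_wedge_val Ws tW) (top_wedge_val Ws sW).
exact: ext_wedge_coef.
Qed.

(* Elements of the exterior power are functionals on alternating forms; the    *)
(* value at the form coef(-, s) is the coordinate with respect to the wedge of s. *)
Definition top_coord W s (Ws : is_basis W s) (x : top_ext W) : R[i] :=
  set_val x (SigSub (coef_alt_ldim Ws)).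

Lemma top_coord_linear W s (Ws : is_basis W s) : linear (top_coord Ws : _ -> R[i]^o).
Proof.
move=> a x y; exact: (val_linear_app a x y (SigSub (coef_alt_ldim Ws))).
Qed.

Lemma top_coord_wedge W s t (Ws : is_basis W s) : (forall x, x \in t -> W x) ->
  top_coord Ws (top_wedge W t) = coef t s.
Proof. by move=> tW; rewrite /top_coord (top_wedge_val Ws tW). Qed.

Lemma top_coordP W s (Ws : is_basis W s) (x : top_ext W) :
  x = top_coord Ws x *: top_wedge W s.
Proof.
have [k xk] : exists k, x = k *: top_wedge W s.
  have sW y : y \in s -> W y by exact: basis_mem Ws.
  case/set_mem: (valP x) => r rP xE.
  suff [k kE] : exists k, \sum_(p <- r) p.1 *: p.2 = k *: wedge (ldim W) s.
    by exists k; apply: val_inj; rewrite linearZ /= -set_valE (top_wedge_val Ws sW) -kE.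
  elim: r rP {xE} => [|p r IH] rP; first by exists 0; rewrite big_nil scale0r.
  have [q qr|k kE] := IH; first by apply: rP; rewrite inE qr orbT.
  have [t tW tE] : [set wedge (ldim W) s | s in [set s : seq H | forall x, x \in s -> W x]] p.2.
    by apply: rP; rewrite inE eqxx.
  rewrite big_cons kE -tE; have [st|st] := eqVneq (size t) (size s).
    by rewrite (ext_wedge_coef Ws tW st) scalerA -scalerDl; eexists.
  (* A wedge of the wrong number of vectors is zero, since alternating forms vanish on lists of
     other lengths. *)
  exists k; rewrite [X in p.1 *: X](_ : _ = 0) ?scaler0 ?add0r//.
  apply/funext => f; rewrite ext_wedge_alt; case: (set_valP f) => h _ _.
  by apply: h; rewrite (ldim_basis Ws); exact/eqP.
rewrite {1}xk; congr (_ *: _); rewrite xk.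
have := top_coord_linear Ws k (top_wedge W s) 0.
have h0 : top_coord Ws 0 = 0 by [].
have sW y : y \in s -> W y by exact: basis_mem Ws.
rewrite addr0 h0 addr0 => ->; rewrite (top_coord_wedge Ws sW).
by rewrite coefxx ?[RHS]mulr1//; case: (Ws).
Qed.

Lemma dual_ex W s (Ws : is_basis W s) (k : R[i]) :
  exists g : dual_space (top_ext W), dual_app g = (fun x => k * top_coord Ws x).
Proof.
have h : (fun x => k * top_coord Ws x : R[i]^o) \in (dual_set (L := top_ext W)).
  apply/mem_set => a x y; rewrite top_coord_linear mulrDr.
  by congr (_ + _); exact: mulrCA.
by exists (SigSub h).
Qed.

Lemma dual_app_linear (L : lmodType R[i]) (g : dual_space L) :
  linear (dual_app g : L -> R[i]^o).
Proof. exact: (set_mem (valP g)). Qed.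

Lemma dual_appZ (L : lmodType R[i]) (g : dual_space L) a x :
  dual_app g (a *: x) = a * dual_app g x.
Proof.
exact: (lin_scale (dual_app_linear g)).
Qed.

Lemma dual_ext W s (g h : dual_space (top_ext W)) : is_basis W s ->
  dual_app g (top_wedge W s) = dual_app h (top_wedge W s) -> g = h.
Proof.
move=> Ws gh; apply/val_inj/funext => x; rewrite (top_coordP Ws x).
by have := dual_appZ g; have := dual_appZ h; rewrite /dual_app => -> ->; congr (_ * _).
Qed.

Lemma dual_appZl (L : lmodType R[i]) (g : dual_space L) a x :
  dual_app (a *: g) x = a * dual_app g x.
Proof. by rewrite /dual_app linearZ. Qed.

Lemma tensZl (L M : lmodType R[i]) a (x : L) (y : M) : tens (a *: x) y = a *: tens x y.
Proof.
apply/val_inj/funext => B; have [Bl Br] := set_valP B.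
exact: (lin_scale (Bl y) a x).
Qed.

Lemma tensZr (L M : lmodType R[i]) a (x : L) (y : M) : tens x (a *: y) = a *: tens x y.
Proof.
apply/val_inj/funext => B; have [Bl Br] := set_valP B.
exact: (lin_scale (Br x) a y).
Qed.

Lemma pure_tensorZ (L M : lmodType R[i]) a b (x : L) (y : M) :
  pure_tensor (a *: x) (b *: y) = (a * b) *: pure_tensor x y.
Proof.
apply/funext => B; have [Bl Br] := set_valP B.
have h1 : pure_tensor (a *: x) (b *: y) B = a *: pure_tensor x (b *: y) B.
  exact: (lin_scale (Bl (b *: y)) a x).
have h2 : pure_tensor x (b *: y) B = b *: pure_tensor x y B.
  exact: (lin_scale (Br x) b y).
by rewrite h1 h2 scalerA.
Qed.

Lemma tensor_gen (L M : lmodType R[i]) (x0 : L) (y0 : M) :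
  (forall x, exists a, x = a *: x0) -> (forall y, exists b, y = b *: y0) ->
  forall T : tensor L M, exists k, T = k *: tens x0 y0.
Proof.
move=> hx hy T; have [r rP xE] := set_mem (valP T).
suff [k kE] : exists k, \sum_(p <- r) p.1 *: p.2 = k *: pure_tensor x0 y0.
  by exists k; apply: val_inj; exact: etrans xE kE.
elim: r rP {xE} => [|p r IH] rP; first by exists 0; rewrite big_nil scale0r.
have [q qr|k kE] := IH; first by apply: rP; rewrite inE qr orbT.
have [[y h] _ /= tE] := rP p (mem_head _ _).
have [a ya] := hx y; have [b hb] := hy h.
exists (p.1 * (a * b) + k).
by rewrite big_cons kE -tE ya hb pure_tensorZ scalerDl scalerA.
Qed.

Section DetPair.
Variables (V W : set H) (v w : seq H).
Hypotheses (Vv : is_basis V v) (Ww : is_basis W w).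

(** Tensors are functionals on bilinear forms, so evaluation at this one form is a linear coordinate
    on the line [det_pair V W]. *)
Definition pair_form (x : top_ext V) (g : dual_space (top_ext W)) : R[i]^o :=
  top_coord Vv x * dual_app g (top_wedge W w).

Lemma pair_form_bilinear : pair_form \in bilinear_form (L := top_ext V) (M := dual_space (top_ext W)).
Proof.
apply/mem_set; split=> [g a x y|x a g h]; rewrite /pair_form.
  by rewrite top_coord_linear mulrDl; congr (_ + _); exact/esym/mulrA.
by rewrite /dual_app linearP /= mulrDr; congr (_ + _); exact: mulrCA.
Qed.

Definition pair_coord (x : det_pair V W) : R[i] := set_val x (SigSub pair_form_bilinear).

Lemma pair_coord_linear : linear (pair_coord : _ -> R[i]^o).
Proof.
move=> a x y; exact: (val_linear_app a x y (SigSub pair_form_bilinear)).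
Qed.

Lemma pair_coordZ a x : pair_coord (a *: x) = a * pair_coord x.
Proof. exact: (lin_scale pair_coord_linear). Qed.

Lemma pair_coord_tens t g : (forall x, x \in t -> V x) ->
  pair_coord (tens (top_wedge V t) g) = coef t v * dual_app g (top_wedge W w).
Proof. by move=> tV; rewrite -(top_coord_wedge Vv). Qed.

Lemma pair_coordP g : dual_app g (top_wedge W w) = 1 ->
  forall x : det_pair V W, x = pair_coord x *: tens (top_wedge V v) g.
Proof.
move=> g1 x.
have [k xk] : exists k, x = k *: tens (top_wedge V v) g.
  apply: tensor_gen => [y|h]; first by eexists; exact: (top_coordP Vv).
  by exists (dual_app h (top_wedge W w)); apply: (dual_ext Ww); rewrite dual_appZl g1 mulr1.
have vV y : y \in v -> V y by exact: basis_mem Vv.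
rewrite {1}xk; congr (_ *: _); rewrite xk pair_coordZ (pair_coord_tens _ vV).
by rewrite g1 coefxx ?mulr1//; case: (Vv).
Qed.

End DetPair.
End TopExt.

(** * Spectral theory of self-adjoint operators *)

Section Orthonormal.
Variables (R : realType) (H : hilbertType R).
Local Notation C := (R[i]^o).
Implicit Types (s t u : seq H) (x y z : H).

Definition orthonormal s := forall i j, (i < size s)%N -> (j < size s)%N ->
  inner s`_i s`_j = (i == j)%:R.

Definition perp s x := forall y, y \in s -> inner x y = 0.

Definition proj s x := \sum_(i < size s) inner x s`_i *: s`_i.

Lemma orthonormal_nrm s x : orthonormal s -> x \in s -> nrm x = 1.
Proof.
move=> os /(nthP 0)[i ii <-]; have := os i i ii ii.
rewrite eqxx innerxx => /(@complexI R _ 1)/eqP.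
by rewrite sqrp_eq1 ?nrm_ge0// => /eqP.
Qed.

Lemma orthonormal_lin_indep s : orthonormal s -> lin_indep s.
Proof.
move=> os c hc i ii; have : inner (\sum_(k < size s) c k *: s`_k) s`_i = 0.
  by rewrite hc inner0l.
rewrite inner_suml (bigD1 (Ordinal ii)) //= innerZl os// eqxx mulr1 big1 ?addr0// => j.
by rewrite -val_eqE /= => /negbTE ji; rewrite innerZl os// ji mulr0.
Qed.

Lemma proj_linear s : linear (proj s).
Proof.
move=> a x y; rewrite /proj scaler_sumr -big_split; apply: eq_bigr => i _.
by rewrite innerPl scalerDl scalerA.
Qed.

Lemma proj_span s x : lin_span_set [set` s] (proj s x).
Proof. by apply/lin_spanP; exists (fun i => inner x s`_i). Qed.

Lemma inner_proj s x i : orthonormal s -> (i < size s)%N -> inner (proj s x) s`_i = inner x s`_i.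
Proof.
move=> os ii; rewrite /proj inner_suml (bigD1 (Ordinal ii)) //= innerZl os// eqxx mulr1.
rewrite big1 ?addr0// => j.
by rewrite -val_eqE /= => /negbTE ji; rewrite innerZl os// ji mulr0.
Qed.

Lemma perp_proj s x : orthonormal s -> perp s (x - proj s x).
Proof.
move=> os y /(nthP 0)[i ii <-]; by rewrite innerBl inner_proj// subrr.
Qed.

Lemma perp_span s x y : perp s x -> lin_span_set [set` s] y -> inner x y = 0.
Proof.
move=> xs /lin_spanP[c ->]; rewrite inner_sumr big1// => i _.
by rewrite innerZr xs ?mulr0// mem_nth.
Qed.

Lemma perpP s (a : R[i]) x y : perp s x -> perp s y -> perp s (a *: x + y).
Proof. by move=> xs ys z zs; rewrite innerPl xs// ys// mulr0 addr0. Qed.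

Lemma perpB s x y : perp s x -> perp s y -> perp s (x - y).
Proof. by move=> xs ys; rewrite addrC -scaleN1r; exact: perpP. Qed.

Lemma perpZ s a x : perp s x -> perp s (a *: x).
Proof. by move=> xs y ys; rewrite innerZl xs// mulr0. Qed.

Lemma pythagoras x y : inner x y = 0 -> nrm (x + y) ^+ 2 = nrm x ^+ 2 + nrm y ^+ 2.
Proof. by move=> xy; rewrite nrmD_sqr /rin xy /= mulr0 addr0. Qed.

Lemma nrm_proj s x : orthonormal s -> nrm x ^+ 2 = nrm (proj s x) ^+ 2 + nrm (x - proj s x) ^+ 2.
Proof.
move=> os; rewrite -pythagoras; first by rewrite addrC subrK.
by rewrite inner_conj (perp_span (perp_proj x os) (proj_span s x)) rmorph0.
Qed.

Lemma nrm_sum_orthonormal s (c : nat -> R[i]) : orthonormal s ->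
  nrm (\sum_(i < size s) c i *: s`_i) ^+ 2 = \sum_(i < size s) cabs (c i) ^+ 2.
Proof.
move=> os; apply: (@complexI R); rewrite -innerxx inner_suml rmorph_sum; apply: eq_bigr => i _.
rewrite innerZl inner_sumr (bigD1 i) //= innerZr os// eqxx mulr1 big1 ?addr0 => [|j].
  by rewrite -sqr_normc cabsE -rmorphXn.
by rewrite -val_eqE /= eq_sym => /negbTE ji; rewrite innerZr os// ji mulr0.
Qed.

Lemma span_proj s x : orthonormal s -> lin_span_set [set` s] x -> proj s x = x.
Proof.
move=> os xs; apply/eqP; rewrite eq_sym -subr_eq0; apply/eqP/inner_eq0.
have px := @perp_proj s x os.
rewrite innerBr (perp_span px xs) (perp_span px (proj_span s x)) subrr.
by [].
Qed.

Lemma orthonormal_rcons s x : orthonormal s -> perp s x -> nrm x = 1 -> orthonormal (rcons s x).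
Proof.
move=> os xs x1 i j; rewrite !size_rcons !ltnS !nth_rcons => hi hj.
case: (ltnP i (size s)) => ii; case: (ltnP j (size s)) => jj.
- exact: os.
- have -> : j = size s by apply/eqP; rewrite eqn_leq hj jj.
  by rewrite eqxx inner_conj xs ?mem_nth// rmorph0 (ltn_eqF ii).
- have -> : i = size s by apply/eqP; rewrite eqn_leq hi ii.
  by rewrite eqxx xs ?mem_nth// (gtn_eqF jj).
- have -> : j = size s by apply/eqP; rewrite eqn_leq hj jj.
  have -> : i = size s by apply/eqP; rewrite eqn_leq hi ii.
  by rewrite eqxx innerxx x1 expr1n.
Qed.

(** Vectors of s that depend on the earlier ones are dropped, so s need not be independent. *)
Lemma gram_schmidt s : exists2 o, orthonormal o & forall x, perp o x -> perp s x.
Proof.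
elim: s => [|x s [b bo bs]]; first by exists [::] => // x _ y.
pose y := x - proj b x; have py := @perp_proj b x bo.
have [y0|y0] := eqVneq y 0.
  exists b => // z zo w; rewrite inE => /orP[/eqP ->|]; last exact: bs.
  apply: (perp_span zo); have -> : x = proj b x by apply/eqP; rewrite -subr_eq0 -/y y0.
  exact: proj_span.
have ny : 0 < nrm y by rewrite nrm_gt0.
pose y' := (nrm y)^-1%:C *: y.
exists (rcons b y').
  apply: orthonormal_rcons => //; first exact: perpZ.
  by rewrite nrmZ cabs_real ger0_norm ?invr_ge0 ?ltW// mulVf ?gt_eqF.
move=> z zo.
have zo' : perp b z by move=> w wb; apply: zo; rewrite mem_rcons inE wb orbT.
move=> w; rewrite inE => /orP[/eqP ->|]; last exact: bs.
have -> : x = (nrm y)%:C *: y' + proj b x.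
  by rewrite scalerA -rmorphM divff ?gt_eqF// scale1r subrK.
rewrite innerDr innerZr (zo y') ?mulr0 ?add0r; last by rewrite mem_rcons inE eqxx.
exact: perp_span zo' (proj_span _ _).
Qed.

(** The kernel of the projection to span t, restricted to span s, consists of the vectors of span s
    orthogonal to t. Used in both directions, this compares dimensions of nearby spectral
    subspaces. *)
Lemma proj_lin_indep s t : orthonormal s ->
  (forall x, lin_span_set [set` s] x -> perp t x -> x = 0) -> orthonormal t ->
  lin_indep [seq proj t y | y <- s].
Proof.
move=> os st ot c; rewrite size_map => hc i ii.
apply: (orthonormal_lin_indep os) ii; apply: st; first by apply/lin_spanP; exists c.
have e : proj t (\sum_(k < size s) c k *: s`_k) = 0.
  rewrite -[RHS]hc.
  have pD x y : proj t (x + y) = proj t x + proj t y.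
    by have := proj_linear t 1 x y; rewrite !scale1r.
  have p0 : proj t 0 = 0 by apply: (addrI (proj t 0)); rewrite -pD !addr0.
  rewrite (big_morph _ pD p0); apply: eq_bigr => k _.
  rewrite (nth_map 0)// -[_ *: s`_k]addr0 proj_linear p0 addr0.
  by [].
by have := @perp_proj t (\sum_(k < size s) c k *: s`_k) ot; rewrite e subr0.
Qed.

Lemma finrank_exists (r : seq (H * H)) : exists Q : bop H,
  forall x, bop_app Q x = \sum_(p <- r) inner x p.1 *: p.2.
Proof.
elim: r => [|p r [Q QE]]; first by exists 0 => x; rewrite big_nil.
have fl : linear (fun x => inner x p.1 *: p.2).
  by move=> a x y; rewrite innerPl scalerDl scalerA.
have [|P PE] := @bop_exists R H _ (nrm p.1 * nrm p.2) fl.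
  move=> x; rewrite nrmZ mulrAC ler_wpM2r ?nrm_ge0// mulrC.
  exact: cauchy_schwarz.
by exists (P + Q) => x; rewrite bopDE PE QE big_cons.
Qed.

Lemma projb_exists s : exists Q : bop H, forall x, bop_app Q x = proj s x.
Proof.
have [Q QE] := finrank_exists [seq (y, y) | y <- s].
exists Q => x; rewrite QE big_map /proj (big_nth 0) big_mkord.
exact: eq_bigr.
Qed.

Lemma compact_disc (c : R) : exists2 D : set C, compact D & forall z : R[i], cabs z <= c -> D z.
Proof.
pose f (p : R * R) : C := p.1 +i* p.2.
exists (f @` (`[- c, c]%classic `*` `[- c, c]%classic)).
  apply: continuous_compact; last by apply: compact_setX; exact: segment_compact.
  apply: continuous_subspaceT => p; apply: cvg_complex; [exact: cvg_fst|exact: cvg_snd].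
move=> z zc; exists (complex.Re z, complex.Im z); last by case: z {zc}.
split => /=; rewrite in_itv /= -ler_norml.
  exact: le_trans (ler_Re_cabs _) zc.
exact: le_trans (ler_Im_cabs _) zc.
Qed.

Lemma compact_opI (Q : bop H) (K : set H) : compact K ->
  (forall x, nrm x <= 1 -> K (bop_app Q x)) -> compact_op Q.
Proof.
move=> cK QK; apply: (@precompact_subset _ _ K).
  by move=> _ [x /= x1 <-]; apply: QK; move: x1; rewrite nrmE lecR.
by exists K => //; split=> //; apply: compact_closed => //; exact: norm_hausdorff.
Qed.

Lemma compact_opE (Q : bop H) : compact_op Q ->
  exists2 K : set H, compact K & forall x, nrm x <= 1 -> K (bop_app Q x).
Proof.
move=> [K QK [cK _]]; exists K => // x x1; apply: QK; exists x => //=.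
by rewrite nrmE lecR.
Qed.

Lemma compact_add (K L : set H) : compact K -> compact L ->
  compact [set x.1 + x.2 | x in K `*` L].
Proof.
move=> cK cL; apply: continuous_compact; last exact: compact_setX.
by apply: continuous_subspaceT => p; apply: cvgD; [exact: cvg_fst|exact: cvg_snd].
Qed.

Lemma compact_op_finrank (Q : bop H) (r : seq (H * H)) :
  (forall x, bop_app Q x = \sum_(p <- r) inner x p.1 *: p.2) -> compact_op Q.
Proof.
suff [K cK rK] : exists2 K : set H, compact K & forall x, nrm x <= 1 ->
    K (\sum_(p <- r) inner x p.1 *: p.2).
  by move=> QE; apply: (compact_opI cK) => x x1; rewrite QE; exact: rK.
elim: r => [|p r [K cK rK]].
  by exists [set 0]; [exact: compact_set1|move=> x _; rewrite big_nil].
have [D cD DE] := compact_disc (nrm p.1).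
exists [set x.1 + x.2 | x in ((fun z : C => z *: p.2) @` D) `*` K].
  apply: compact_add => //; apply: continuous_compact => //.
  apply: continuous_subspaceT => z.
  apply: (@cvg_scale R H _ (nbhs z) (nbhs_filter z) id (fun=> p.2) z p.2).
    exact: (@cvg_id _ (nbhs z)).
  exact: cvg_cst.
move=> x x1; rewrite big_cons; exists (inner x p.1 *: p.2, \sum_(q <- r) inner x q.1 *: q.2) => //.
split=> /=; last exact: rK.
exists (inner x p.1) => //; apply: DE; apply: (le_trans (cauchy_schwarz _ _)).
by rewrite ler_piMl ?nrm_ge0.
Qed.

Lemma compact_opD (P Q : bop H) : compact_op P -> compact_op Q -> compact_op (P + Q).
Proof.
move=> /compact_opE[K cK PK] /compact_opE[L cL QL].
apply: (compact_opI (compact_add cK cL)) => x x1.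
by exists (bop_app P x, bop_app Q x) => //; split; [exact: PK|exact: QL].
Qed.

Lemma compact_op_compl (P Q : bop H) : compact_op Q -> compact_op (bop_comp P Q).
Proof.
move=> /compact_opE[K cK QK].
apply: (@compact_opI _ (bop_app P @` K)); last by move=> x x1; exists (bop_app Q x) => //; exact: QK.
by apply: continuous_compact => //; apply: continuous_subspaceT; exact: bop_continuous.
Qed.

Lemma compact_op_compr (P Q : bop H) : compact_op Q -> compact_op (bop_comp Q P).
Proof.
move=> /compact_opE[K cK QK].
have P1 : 0 < nrm P + 1 by rewrite ltr_wpDl ?nrm_ge0.
have nP : cabs (nrm P + 1)^-1%:C = (nrm P + 1)^-1.
  by rewrite cabs_real ger0_norm// invr_ge0 ltW.
apply: (@compact_opI _ ((fun x => (nrm P + 1)%:C *: x) @` K)).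
  apply: continuous_compact => //; apply: continuous_subspaceT => x.
  by apply: cvgZl_tmp; exact: cvg_id.
move=> x x1; exists (bop_app Q ((nrm P + 1)^-1%:C *: bop_app P x)).
  apply: QK; rewrite nrmZ nP ler_pdivrMl// mulr1 (le_trans (nrm_bop_app _ _))//.
  have := nrm_ge0 P; have := nrm_ge0 x; nra.
rewrite linearZ /= scalerA -rmorphM divff ?scale1r ?gt_eqF//.
Qed.

Lemma compact_op_cluster (K : bop H) (x : nat -> H) : compact_op K ->
  (forall n, nrm (x n) <= 1) ->
  exists z, forall e : R, 0 < e -> forall N, exists2 n, (N <= n)%N & nrm (bop_app K (x n) - z) < e.
Proof.
move=> /compact_opE[L cL KL] x1.
have [z [_ zc]] : L `&` cluster ((fun n => bop_app K (x n)) @ \oo) !=set0.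
  by apply: cL; exists 0%N => // n _ /=; apply: KL.
exists z => e e0 N.
have nz : \forall w \near nbhs z, nrm (w - z) < e.
  exact: near_nrm.
have [||w [/= [n Nn <-] wz]] := zc ((fun n => bop_app K (x n)) @` [set n | (N <= n)%N])
    [set w | nrm (w - z) < e].
- by exists N => // n Nn; exists n.
- exact: nz.
- by exists n.
Qed.

End Orthonormal.

Section Spectral.
Variables (R : realType) (H : hilbertType R).
Local Notation C := (R[i]^o).
Implicit Types (s t u : seq H) (x y z : H) (A B P Q : bop H) (l m : R).
Local Notation "1b" := (bop_id H).

Lemma specE P l : ~ spec P l%:C <-> invertible (P - l%:C *: 1b).
Proof.
split; first by move=> /contrapT.
by move=> h; apply.
Qed.

Lemma spec_essE P l : ~ spec_ess P l%:C <->
  exists Q, compact_op (bop_comp Q (P - l%:C *: 1b) - 1b) /\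
            compact_op (bop_comp (P - l%:C *: 1b) Q - 1b).
Proof.
split; first by move=> /contrapT.
by move=> h; apply.
Qed.

Lemma bop_shift P l x : bop_app (P - l%:C *: 1b) x = bop_app P x - l%:C *: x.
Proof. by []. Qed.

Lemma selfadjoint_shift A l : selfadjoint A -> selfadjoint (A - l%:C *: 1b).
Proof.
by move=> saA x y; rewrite !bop_shift innerBl innerBr innerZl innerZrR saA.
Qed.

(** The factorisation P^2 - l^2 = (P - l)(P + l) relates the spectra of P at l and -l to that of the
    nonnegative operator P^2 at l^2, where minimisation of the quadratic form applies. *)
Lemma shift_factor P l : bop_comp P P - (l ^+ 2)%:C *: 1b =
  bop_comp (P - l%:C *: 1b) (P - (- l)%:C *: 1b).
Proof.
apply: bop_ext => x; rewrite bop_compE !bop_shift bop_compE rmorphN /= scaleNr opprK.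
have -> : bop_app P (bop_app P x + l%:C *: x) = bop_app P (bop_app P x) + l%:C *: bop_app P x.
  by rewrite linearD linearZ.
by rewrite scalerDr scalerA opprD addrA addrK -rmorphM -expr2.
Qed.

Lemma shift_factor' P l : bop_comp P P - (l ^+ 2)%:C *: 1b =
  bop_comp (P - (- l)%:C *: 1b) (P - l%:C *: 1b).
Proof. by have := shift_factor P (- l); rewrite sqrrN opprK. Qed.

Lemma spec_sqr P l : ~ spec P l%:C -> ~ spec P (- l)%:C ->
  ~ spec (bop_comp P P) (l ^+ 2)%:C.
Proof.
move=> /specE h1 /specE h2; apply/specE; rewrite shift_factor.
exact: invertible_comp.
Qed.

Lemma spec_sqrt P l : ~ spec (bop_comp P P) (l ^+ 2)%:C -> ~ spec P l%:C.
Proof.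
move=> /specE[Q [Q1 Q2]]; apply/specE.
apply: (@invertible_lr _ _ _ (bop_comp Q (P - (- l)%:C *: 1b)) (bop_comp (P - (- l)%:C *: 1b) Q)).
  by rewrite -bop_compA -shift_factor'.
by rewrite bop_compA -shift_factor.
Qed.

Lemma spec_ess_sqr P l : ~ spec_ess P l%:C -> ~ spec_ess P (- l)%:C ->
  ~ spec_ess (bop_comp P P) (l ^+ 2)%:C.
Proof.
move=> /spec_essE[Q [q1 q2]] /spec_essE[S [s1 s2]]; apply/spec_essE.
rewrite shift_factor; set U := P - _ in q1 q2 *; set W := P - _ in s1 s2 *.
exists (bop_comp S Q); split.
  have -> : bop_comp (bop_comp S Q) (bop_comp U W) - 1b =
     bop_comp S (bop_comp (bop_comp Q U - 1b) W) + (bop_comp S W - 1b).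
    by rewrite bop_compBl bop_compBr bop_comp1l !bop_compA addrA subrK.
  by apply: compact_opD => //; apply/compact_op_compl/compact_op_compr.
have -> : bop_comp (bop_comp U W) (bop_comp S Q) - 1b =
   bop_comp U (bop_comp (bop_comp W S - 1b) Q) + (bop_comp U Q - 1b).
  by rewrite bop_compBl bop_compBr bop_comp1l !bop_compA addrA subrK.
by apply: compact_opD => //; apply/compact_op_compl/compact_op_compr.
Qed.

Lemma compact_opN (K : bop H) : compact_op K -> compact_op (- K).
Proof.
move=> cK; have -> : - K = bop_comp (- 1b) K by exact: bop_ext.
exact: compact_op_compl.
Qed.

(** A left parametrix is also a right one as soon as some right parametrix T exists: US - 1 = U(SU -
    1)T - US(UT - 1) + (UT - 1). *)
Lemma compact_op_lr U S T : compact_op (bop_comp S U - 1b) ->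
  compact_op (bop_comp U T - 1b) -> compact_op (bop_comp U S - 1b).
Proof.
move=> h1 h2.
have e (a b c d : bop H) : c - d = a - b - (a - c) + (b - d).
  by rewrite opprB [a - b + (c - a)]addrC subrKA subrKA.
have -> : bop_comp U S - 1b = bop_comp U (bop_comp (bop_comp S U - 1b) T)
    - bop_comp U (bop_comp S (bop_comp U T - 1b)) + (bop_comp U T - 1b).
  rewrite (bop_compBl (bop_comp S U)) (bop_compBr (bop_comp _ T)) (bop_compBr (bop_comp U T)).
  rewrite (bop_compBr (bop_comp S _)) bop_comp1l bop_comp1r.
  rewrite -(bop_compA S U T); exact: e.
apply: compact_opD => //; apply: compact_opD.
  by apply/compact_op_compl/compact_op_compr.
by apply/compact_opN/compact_op_compl/compact_op_compl.
Qed.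

Lemma spec_ess_sqrt P l : ~ spec_ess (bop_comp P P) (l ^+ 2)%:C -> ~ spec_ess P l%:C.
Proof.
move=> /spec_essE[Q [q1 q2]]; apply/spec_essE.
have [S [T [s1 s2]]] : exists S S', compact_op (bop_comp S (P - l%:C *: 1b) - 1b) /\
    compact_op (bop_comp (P - l%:C *: 1b) S' - 1b).
  exists (bop_comp Q (P - (- l)%:C *: 1b)), (bop_comp (P - (- l)%:C *: 1b) Q).
  by rewrite -bop_compA -shift_factor' bop_compA -shift_factor.
by exists S; split; [exact: s1|exact: compact_op_lr s1 s2].
Qed.

Lemma rin_shift A l x : rin (bop_app (A - l%:C *: 1b) x) x =
  rin (bop_app A x) x - l * nrm x ^+ 2.
Proof. by rewrite bop_shift rinDl rinNl rinZl rinxx. Qed.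

(** Adding a large multiple M of the projection T to span o makes A - l coercive. The inverse of A -
    l + M T inverts A - l up to a finite-rank, hence compact, operator. *)
Lemma ess_free A (o : seq H) m l : selfadjoint A -> orthonormal o -> l < m ->
  (forall x, perp o x -> m * nrm x ^+ 2 <= rin (bop_app A x) x) ->
  ~ spec_ess A l%:C.
Proof.
move=> saA oo lm Am; apply/spec_essE.
have [T TE] := projb_exists o.
have saT : selfadjoint T.
  move=> x y; rewrite !TE /proj inner_suml inner_sumr; apply: eq_bigr => i _.
  by rewrite innerZl innerZr -inner_conj mulrC.
pose a := nrm A; pose d := m - l.
have d0 : 0 < d by rewrite subr_gt0.
(* The terms a and |l| compensate A - l on span o, and 2 a^2 / d absorbs the cross term by
   completing the square ([h4]), at the cost of half of d on the complement. *)
pose M := a + `|l| + d / 2 + 2 * a ^+ 2 / d.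
pose B := (A - l%:C *: 1b) + M%:C *: T.
have BE x : bop_app B x = bop_app (A - l%:C *: 1b) x + M%:C *: bop_app T x by [].
have saB : selfadjoint B.
  move=> x y; rewrite !BE innerDl innerDr (selfadjoint_shift l saA).
  by rewrite innerZl innerZrR saT.
have Bc x : d / 2 * nrm x ^+ 2 <= rin (bop_app B x) x.
  pose f := proj o x; pose y := x - f.
  have xE : x = f + y by rewrite /y addrC subrK.
  have yo : perp o y by exact: perp_proj.
  have fy : rin f y = 0 by rewrite rinC /rin (perp_span yo (proj_span o x)).
  have Tx : rin (bop_app T x) x = nrm f ^+ 2.
    by rewrite TE {2}xE rinDr -/f fy addr0 rinxx.
  have nx : nrm x ^+ 2 = nrm f ^+ 2 + nrm y ^+ 2 by rewrite (nrm_proj x oo).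
  have Ax : rin (bop_app A x) x = rin (bop_app A f) f + 2 * rin (bop_app A f) y + rin (bop_app A y) y.
    have e : rin (bop_app A y) f = rin (bop_app A f) y by rewrite rinC /rin -saA.
    have gen (v w : H) : rin (bop_app A (v + w)) (v + w) =
        rin (bop_app A v) v + rin (bop_app A v) w + (rin (bop_app A w) v + rin (bop_app A w) w).
      by rewrite linearD rinDl !rinDr.
    by rewrite xE gen e; ring.
  rewrite BE rinDl rin_shift rinZl Tx Ax nx.
  have h1 := Am y yo.
  have h2 : - (a * nrm f ^+ 2) <= rin (bop_app A f) f.
    rewrite lerNl (le_trans (ler_norm _))// normrN (le_trans (rin_le _ _))//.
    by rewrite expr2 mulrA ler_wpM2r ?nrm_ge0// nrm_bop_app.
  have h3 : - (a * nrm f * nrm y) <= rin (bop_app A f) y.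
    rewrite lerNl (le_trans (ler_norm _))// normrN (le_trans (rin_le _ _))//.
    by rewrite ler_wpM2r ?nrm_ge0// nrm_bop_app.
  have h4 : 0 <= d / 2 * (nrm y - 2 * a / d * nrm f) ^+ 2.
    by rewrite mulr_ge0 ?sqr_ge0// divr_ge0// ltW.
  have h5 : d / 2 * (nrm y - 2 * a / d * nrm f) ^+ 2 =
     d / 2 * nrm y ^+ 2 - 2 * (a * nrm f * nrm y) + 2 * a ^+ 2 / d * nrm f ^+ 2.
    by field; rewrite gt_eqF.
  have h6 : 0 <= (`|l| - l) * nrm f ^+ 2.
    by rewrite mulr_ge0 ?sqr_ge0// subr_ge0 ler_norm.
  rewrite h5 in h4; rewrite /M.
  move: h1 h2 h3 h4 h6; rewrite /d.
  move: (rin (bop_app A f) f) (rin (bop_app A f) y) (rin (bop_app A y) y).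
  move: (2 * a ^+ 2 / (m - l)) => k.
  move: (a * nrm f * nrm y) => k2 r1 r2 r3.
  move: (nrm f ^+ 2) (nrm y ^+ 2) => ff yy; lra.
have d2 : 0 < d / 2 by rewrite divr_gt0.
have [Q [q1 q2]] := coercive_invertible saB d2 Bc.
have cT : compact_op T.
  apply: (@compact_op_finrank _ _ _ [seq (y, y) | y <- o]) => x.
  rewrite TE big_map /proj (big_nth 0) big_mkord.
  exact: eq_bigr.
exists Q; have -> : A - l%:C *: 1b = B - M%:C *: T by rewrite /B addrK.
rewrite bop_compBr bop_compBl q1 q2 -!addrA ![- _ - 1b]addrC !addrA subrr !add0r.
rewrite bop_compZr bop_compZl.
have cN (K : bop H) : compact_op K -> compact_op (- (M%:C *: K)).
  move=> cK; have -> : - (M%:C *: K) = bop_comp (- (M%:C *: 1b)) K by exact: bop_ext.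
  exact: compact_op_compl.
by split; apply: cN; [exact: compact_op_compl|exact: compact_op_compr].
Qed.

Lemma small_eq0 (a c : R) : 0 <= a -> (forall e, 0 < e -> a <= c * e) -> a = 0.
Proof.
move=> a0 h; apply/eqP; rewrite eq_le a0 andbT leNgt; apply/negP => a1.
have c1 : 0 < `|c| + 1 by rewrite ltr_wpDl.
have := h (a / (2 * (`|c| + 1))); rewrite divr_gt0 ?mulr_gt0// => /(_ isT).
rewrite mulrCA => h2.
have : c / (2 * (`|c| + 1)) <= 2^-1.
  by rewrite ler_pdivrMr ?mulr_gt0// mulrA mulVf// mul1r (le_trans (ler_norm c))// lerDl.
move: h2; move: (c / (2 * (`|c| + 1))) => k h2 k2; nra.
Qed.

Definition eigenlist B s := forall y, y \in s -> exists l, bop_app B y = l%:C *: y.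

Lemma eigenlist_perp B s x : selfadjoint B -> eigenlist B s -> perp s x -> perp s (bop_app B x).
Proof.
move=> saB es xs y ys; have [l yl] := es y ys.
by rewrite saB yl innerZr xs// mulr0.
Qed.

(* the infimum of the quadratic form on the complement of s is an eigenvalue if it is at most lam *)
Lemma eig_step A s (lam : R) : selfadjoint A ->
  (forall x, 0 <= rin (bop_app A x) x) -> 0 <= lam ->
  (forall l, 0 <= l <= lam -> ~ spec_ess A l%:C) -> eigenlist A s ->
  (exists2 m : R, lam < m & forall x, perp s x -> m * nrm x ^+ 2 <= rin (bop_app A x) x) \/
  (exists y, [/\ nrm y = 1, perp s y & exists2 l : R, 0 <= l <= lam & bop_app A y = l%:C *: y]).
Proof.
move=> saA A0 lam0 ess es.
pose E := [set r : R | exists x, [/\ nrm x = 1, perp s x & r = rin (bop_app A x) x]].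
have [E0|/set0P[r0 Er0]] := eqVneq E set0.
  left; exists (lam + 1); first by rewrite ltrDl.
  move=> x xs; have [->|x0] := eqVneq x 0; first by rewrite linear0 nrm0 rinxx nrm0 expr0n mulr0.
  have nx : 0 < nrm x by rewrite nrm_gt0.
  have : E (rin (bop_app A ((nrm x)^-1%:C *: x)) ((nrm x)^-1%:C *: x)).
    exists ((nrm x)^-1%:C *: x); split=> //; last exact: perpZ.
    by rewrite nrmZ cabs_real ger0_norm ?invr_ge0 ?ltW// mulVf// gt_eqF.
  by rewrite E0.
have Einf : has_inf E.
  by split; [exists r0|exists 0 => _ [x [_ _ ->]]].
set m := inf E.
have m0 : 0 <= m by apply: lb_le_inf; [exists r0|move=> _ [x [_ _ ->]]].
have Am x : perp s x -> m * nrm x ^+ 2 <= rin (bop_app A x) x.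
  move=> xs; have [->|x0] := eqVneq x 0; first by rewrite linear0 nrm0 rinxx nrm0 expr0n mulr0.
  have nx : 0 < nrm x by rewrite nrm_gt0.
  have : m <= rin (bop_app A ((nrm x)^-1%:C *: x)) ((nrm x)^-1%:C *: x).
    apply: (ge_inf Einf.2); exists ((nrm x)^-1%:C *: x); split=> //; last exact: perpZ.
    by rewrite nrmZ cabs_real ger0_norm ?invr_ge0 ?ltW// mulVf// gt_eqF.
  rewrite linearZ /= rinZl rinZr mulrA -expr2 exprVn mulrC ler_pdivlMr ?exprn_gt0//.
have [mlam|lamm] := ltP lam m; [by left; exists m|right].
have /choice[u uP] : forall n : nat, exists x, [/\ nrm x = 1, perp s x &
    rin (bop_app A x) x < m + n.+1%:R^-1].
  move=> n; have n0 : 0 < n.+1%:R^-1 :> R by rewrite invr_gt0.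
  by have [_ [x [x1 xs ->]] ?] := inf_adherent n0 Einf; exists x.
have /spec_essE[Q [cK _]] : ~ spec_ess A m%:C by apply: ess; rewrite m0 lamm.
have [D DE] : exists D, D = A - m%:C *: 1b by eexists.
rewrite -DE in cK.
have saD : selfadjoint D by rewrite DE; exact: selfadjoint_shift.
have Ds x : perp s x -> perp s (bop_app D x).
  by move=> xs; rewrite DE bop_shift; apply: perpB; [exact: eigenlist_perp|exact: perpZ].
have D0 x : perp s x -> 0 <= rin (bop_app D x) x.
  by move=> xs; rewrite DE rin_shift subr_ge0 Am.
pose N := nrm D + 1; have N0 : 0 < N by rewrite ltr_wpDl ?nrm_ge0.
(* The form of D is nonnegative on the complement of s. Testing it at u - N^-1 D u, where N exceeds
   the norm of D, turns smallness of the form at u into smallness of D u. *)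
have Du n : nrm (bop_app D (u n)) ^+ 2 <= N * n.+1%:R^-1.
  have [un1 us un] := uP n; set x := u n in un1 us un *; set y := bop_app D x.
  have ys : perp s y by exact: Ds.
  have := D0 (x - N^-1%:C *: y) (perpB us (perpZ _ ys)).
  rewrite linearB linearZ /= !(rinDl, rinDr, rinNl, rinNr, rinZl, rinZr) -/y.
  have -> : rin (bop_app D y) x = nrm y ^+ 2 by rewrite rinC /rin -saD -/(rin _ _) rinxx.
  have hD : rin (bop_app D y) y <= N * nrm y ^+ 2.
    apply: (le_trans (ler_norm _)); apply: (le_trans (rin_le _ _)).
    rewrite expr2 mulrA ler_wpM2r ?nrm_ge0// (le_trans (nrm_bop_app _ _))//.
    by rewrite ler_wpM2r ?nrm_ge0// lerDl.
  have hx : rin y x <= n.+1%:R^-1.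
    rewrite /y DE rin_shift un1 expr1n mulr1; move: un; move: (n.+1%:R^-1) => k; lra.
  rewrite rinxx => h.
  have h2 : N^-1 * (N^-1 * rin (bop_app D y) y) <= N^-1 * nrm y ^+ 2.
    by rewrite ler_pM2l ?invr_gt0// ler_pdivrMl.
  rewrite -ler_pdivrMl//; move: h h2 hx; move: (n.+1%:R^-1) (N^-1 * nrm y ^+ 2) => k k1.
  move: (N^-1 * (N^-1 * _)) => k2; lra.
have nu1 n : nrm (u n) <= 1 by have [-> _ _] := uP n.
have [z zc] := compact_op_cluster cK nu1.
(* With the compact operator K = QD - 1 one has u = QDu - Ku. As D u tends to 0 and K u clusters at
   z, the minimising sequence comes close to -z, which is the eigenvector sought. *)
have key (e : R) : 0 < e -> exists n, nrm (u n - (- z)) <= (nrm Q + 1) * e /\ nrm (bop_app D (u n)) <= e.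
  move=> e0; have eN : 0 < e ^+ 2 / N by rewrite divr_gt0// exprn_gt0.
  have [n0 _ n0P] := near_infty_natSinv_lt (PosNum eN).
  have [n n0n un] := zc e e0 n0; exists n.
  have Due : nrm (bop_app D (u n)) <= e.
    have : nrm (bop_app D (u n)) ^+ 2 <= e ^+ 2.
      by apply: (le_trans (Du n)); rewrite -ler_pdivlMl// mulrC; apply/ltW/n0P.
    by rewrite ler_pXn2r// ?nnegrE ?nrm_ge0// ltW.
  split=> //; have -> : u n - - z = bop_app Q (bop_app D (u n)) -
      (bop_app (bop_comp Q D - 1b) (u n) - z).
    by rewrite bopBE bop_compE bop_idE !opprD !opprK !addrA subrr add0r.
  apply: (le_trans (ler_nrmB _ _)); rewrite mulrDl mul1r; apply: lerD; last exact: ltW.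
  by apply: (le_trans (nrm_bop_app _ _)); rewrite ler_wpM2l ?nrm_ge0.
exists (- z); split.
- apply/eqP; rewrite -subr_eq0; apply/eqP/normr0_eq0.
  apply: (@small_eq0 _ (nrm Q + 1)) => // e e0; have [n [h _]] := key e e0.
  apply: le_trans h; have [<- _ _] := uP n; rewrite ler_norml.
  have := lerB_nrm (u n) (- z); have := lerB_nrm (- z) (u n).
  rewrite (nrmB (- z)); lra.
- move=> y ys; have : nrm (inner (- z) y : C) = 0; last by move=> /eqP; rewrite nrm_eq0 => /eqP.
  apply: (@small_eq0 _ ((nrm Q + 1) * nrm y)) => [|e e0]; first exact: nrm_ge0.
  have [n [h _]] := key e e0; have [_ us _] := uP n.
  have -> : inner (- z) y = inner (- z - u n) y by rewrite innerBl us// subr0.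
  apply: (le_trans (cauchy_schwarz _ _)); rewrite mulrAC ler_wpM2r ?nrm_ge0//.
  by rewrite nrmB.
- exists m; first by rewrite m0 lamm.
  apply/eqP; rewrite -subr_eq0 -bop_shift -DE -nrm_eq0; apply/eqP.
  apply: (@small_eq0 _ (nrm D * (nrm Q + 1) + 1)) => [|e e0]; first exact: nrm_ge0.
  have [n [h1 h2]] := key e e0.
  have -> : bop_app D (- z) = bop_app D (- z - u n) + bop_app D (u n).
    by rewrite -linearD subrK.
  apply: (le_trans (ler_nrmD _ _)); rewrite mulrDl mul1r lerD//.
  apply: (le_trans (nrm_bop_app _ _)); rewrite -mulrA ler_wpM2l ?nrm_ge0//.
  by rewrite nrmB.
Qed.

(** Good vectors are adjoined greedily until the stopping condition [LB] holds. A process that never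
    stops would produce an infinite orthonormal sequence of good vectors. *)
Lemma eigen_process (good : set H) (LB : set (seq H)) :
  (forall s, orthonormal s -> (forall y, y \in s -> good y) ->
    LB s \/ exists y, [/\ good y, nrm y = 1 & perp s y]) ->
  (forall x : nat -> H, (forall n, good (x n)) ->
    (forall i j, inner (x i) (x j) = (i == j)%:R) -> False) ->
  exists s, [/\ orthonormal s, forall y, y \in s -> good y & LB s].
Proof.
move=> step noinf; apply: contrapT => nos.
have /choice[g gP] s : exists y, orthonormal s -> (forall y, y \in s -> good y) ->
    [/\ good y, nrm y = 1 & perp s y].
  have [[os gs]|h] := pselect (orthonormal s /\ (forall y, y \in s -> good y)).
    have [LBs|[y yP]] := step s os gs; last by exists y.
    by exfalso; apply: nos; exists s.
  by exists 0 => os gs; exfalso; apply: h.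
pose S := fix S n : seq H := if n is m.+1 then rcons (S m) (g (S m)) else [::].
have SP n : orthonormal (S n) /\ (forall y, y \in S n -> good y).
  elim: n => [|n [os gs]] //=; have [gg g1 gp] := gP _ os gs.
  split; first exact: orthonormal_rcons.
  by move=> y; rewrite mem_rcons inE => /orP[/eqP ->|/gs].
pose x n := g (S n).
have xS i j : (i < j)%N -> x i \in S j.
  elim: j => // j IH; rewrite ltnS leq_eqVlt => /orP[/eqP ->|/IH h] /=.
    by rewrite mem_rcons inE eqxx.
  by rewrite mem_rcons inE h orbT.
have xP n : [/\ good (x n), nrm (x n) = 1 & perp (S n) (x n)].
  by have [os gs] := SP n; exact: gP.
apply: (noinf x) => [n|i j]; first by case: (xP n).
have [ij|ji|->] := ltngtP i j.
- by rewrite inner_conj; have [_ _ ->] := xP j; rewrite ?rmorph0//; exact: xS.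
- by have [_ _ ->] := xP i => //; exact: xS.
- by rewrite innerxx; have [_ -> _] := xP j; rewrite expr1n.
Qed.

(** The eigenvalues accumulate at some l0, so D = A - l0 nearly kills infinitely many of the x n.
    With K = QD - 1 compact, x = QDx - Kx then brings two of them within distance 1, whereas
    orthonormal vectors have distance sqrt 2. *)
Lemma eig_noinf A (lam : R) (x : nat -> H) : 0 <= lam ->
  (forall l, 0 <= l <= lam -> ~ spec_ess A l%:C) ->
  (forall n, exists2 l : R, 0 <= l <= lam & bop_app A (x n) = l%:C *: x n) ->
  (forall i j, inner (x i) (x j) = (i == j)%:R) -> False.
Proof.
move=> lam0 ess ex xo.
have /choice[l lP] n : exists l, 0 <= l <= lam /\ bop_app A (x n) = l%:C *: x n.
  by have [l ? ?] := ex n; exists l.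
have x1 n : nrm (x n) = 1.
  have := xo n n; rewrite eqxx innerxx => /(@complexI R _ 1)/eqP.
  by rewrite sqrp_eq1 ?nrm_ge0// => /eqP.
have [l0 [/= l0I lc]] : `[0, lam]%classic `&` cluster (l @ \oo) !=set0.
  by apply: (@segment_compact R 0 lam); exists 0%N => // n _ /=; rewrite in_itv /=; case: (lP n).
rewrite in_itv /= in l0I.
have /choice[k kP] j : exists n, (j <= n)%N /\ `|l n - l0| < j.+1%:R^-1.
  have j0 : 0 < j.+1%:R^-1 :> R by rewrite invr_gt0.
  have [||_ [/= [n jn <-] nl]] := lc (l @` [set n | (j <= n)%N]) [set w : R | `|w - l0| < j.+1%:R^-1].
  - by exists j => // n jn; exists n.
  - have [h _] := @cvgrPdist_lt R R R (nbhs l0) (nbhs_filter l0) id l0.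
    have := h (@cvg_id _ (nbhs l0)) _ j0.
    by apply: filterS => w; rewrite distrC.
  - by exists n.
have /spec_essE[Q [cK _]] : ~ spec_ess A l0%:C by exact: ess.
set D := A - _ in cK.
have Dx n : nrm (bop_app D (x n)) = `|l n - l0|.
  rewrite bop_shift (lP n).2 -scalerBl -rmorphB /= nrmZ x1 mulr1.
  exact: cabs_real.
have nu1 n : nrm (x (k n)) <= 1 by rewrite x1.
have [z zc] := compact_op_cluster cK nu1.
have e4 : 0 < 4^-1 / (nrm Q + 1) :> R by rewrite divr_gt0// ltr_wpDl ?nrm_ge0.
have [n0 _ n0P] := near_infty_natSinv_lt (PosNum e4).
have close j : (n0 <= j)%N -> nrm (bop_app (bop_comp Q D - 1b) (x (k j)) - z) < 4^-1 ->
    nrm (x (k j) + z) < 2^-1.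
  move=> n0j h; have -> : x (k j) + z = bop_app Q (bop_app D (x (k j))) -
      (bop_app (bop_comp Q D - 1b) (x (k j)) - z).
    by rewrite bopBE bop_compE bop_idE !opprD !opprK !addrA subrr add0r.
  apply: (le_lt_trans (ler_nrmB _ _)).
  have h2 : nrm (bop_app Q (bop_app D (x (k j)))) <= 4^-1.
    apply: (le_trans (nrm_bop_app _ _)); rewrite Dx.
    have h3 : `|l (k j) - l0| <= 4^-1 / (nrm Q + 1).
      exact/ltW/(lt_trans (kP j).2)/n0P.
    have Q1 : 0 < nrm Q + 1 by rewrite ltr_wpDl ?nrm_ge0.
    rewrite ler_pdivlMr// in h3.
    have := normr_ge0 (l (k j) - l0); have := nrm_ge0 Q; nra.
  lra.
have e4' : 0 < 4^-1 :> R by rewrite invr_gt0.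
have [j1 n0j1 /(close _ n0j1) h1] := zc _ e4' n0.
have [j2 j2P h2'] := zc _ e4' (maxn n0 (k j1).+1).
have h2 : nrm (x (k j2) + z) < 2^-1 by apply: close h2'; rewrite (leq_trans _ j2P)// leq_maxl.
have kk : k j1 != k j2.
  have : (k j1 < j2)%N by rewrite (leq_trans _ j2P)// leq_maxr.
  by move=> /leq_trans/(_ (kP j2).1) /ltn_eqF ->.
have := nrmB_sqr (x (k j1)) (x (k j2)); rewrite !x1 /rin xo (negbTE kk) /=.
have : nrm (x (k j1) - x (k j2)) < 1.
  have -> : x (k j1) - x (k j2) = (x (k j1) + z) - (x (k j2) + z) by rewrite opprD addrACA subrr addr0.
  by apply: (le_lt_trans (ler_nrmB _ _)); lra.
have := nrm_ge0 (x (k j1) - x (k j2)); nra.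
Qed.

(** A finite substitute for the spectral projection of A to ]-oo, lam]: the eigenvectors s carry the
    low spectrum, and the quadratic form lies above m > lam on their orthogonal complement. *)
Definition gap A (lam : R) s m := [/\ orthonormal s,
  forall y, y \in s -> exists2 l : R, 0 <= l <= lam & bop_app A y = l%:C *: y,
  lam < m &
  forall x, perp s x -> m * nrm x ^+ 2 <= rin (bop_app A x) x].

Lemma gap_exists A (lam : R) : selfadjoint A ->
  (forall x, 0 <= rin (bop_app A x) x) -> 0 <= lam ->
  (forall l, 0 <= l <= lam -> ~ spec_ess A l%:C) -> exists s m, gap A lam s m.
Proof.
move=> saA A0 lam0 ess.
have [||s [os gs [m mP sm]]] := @eigen_process
  [set y | exists2 l : R, 0 <= l <= lam & bop_app A y = l%:C *: y]
  [set s | exists2 m : R, lam < m & forall x, perp s x -> m * nrm x ^+ 2 <= rin (bop_app A x) x].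
- move=> s os gs.
  have [|h|[y [y1 ys yg]]] := @eig_step A s lam saA A0 lam0 ess; first by move=> y /gs[l _ ?]; exists l.
    by left.
  by right; exists y; split.
- by move=> x xP xo; exact: (eig_noinf lam0 ess xP xo).
- by exists s, m.
Qed.

(* the eigenvectors of A = P^2 split into eigenvectors of P *)
Lemma gap_sqrt_exists P (mu : R) : selfadjoint P -> 0 < mu ->
  (forall l, - mu <= l <= mu -> ~ spec_ess P l%:C) ->
  exists s m, [/\ orthonormal s,
    forall y, y \in s -> exists2 l : R, - mu <= l <= mu & bop_app P y = l%:C *: y,
    mu ^+ 2 < m & forall x, perp s x -> m * nrm x ^+ 2 <= nrm (bop_app P x) ^+ 2].
Proof.
move=> saP mu0 ess; pose A := bop_comp P P.
have saA : selfadjoint A by exact: selfadjoint_comp.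
have rA x : rin (bop_app A x) x = nrm (bop_app P x) ^+ 2.
  by rewrite /rin bop_compE saP -/(rin _ _) rinxx.
have A0 x : 0 <= rin (bop_app A x) x by rewrite rA sqr_ge0.
have lam0 : 0 <= mu ^+ 2 by rewrite sqr_ge0.
have essA l : 0 <= l <= mu ^+ 2 -> ~ spec_ess A l%:C.
  move=> /andP[l0 lmu]; rewrite -(sqr_sqrtr l0).
  have sl : Num.sqrt l <= mu by rewrite -(ger0_norm (ltW mu0)) -sqrtr_sqr ler_sqrt.
  have sl0 := sqrtr_ge0 l.
  by apply: spec_ess_sqr; apply: ess; lra.
have [||s [os gs [m mP sm]]] := @eigen_process
  [set y | exists2 l : R, - mu <= l <= mu & bop_app P y = l%:C *: y]
  [set s | exists2 m : R, mu ^+ 2 < m & forall x, perp s x -> m * nrm x ^+ 2 <= rin (bop_app A x) x].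
- move=> s os gs; have esP : eigenlist P s by move=> y /gs[l _ ?]; exists l.
  have [|h|[y [y1 ys [l /andP[l0 lmu] yl]]]] := @eig_step A s (mu ^+ 2) saA A0 lam0 essA.
  + by move=> y /esP[l yl]; exists (l * l); rewrite bop_compE yl linearZ /= yl scalerA rmorphM.
  + by left.
  right; pose nu := Num.sqrt l; have nu0 : 0 <= nu := sqrtr_ge0 l.
  have numu : nu <= mu by rewrite -(ger0_norm (ltW mu0)) -sqrtr_sqr ler_sqrt.
  (* As P^2 y = nu^2 y, the vector z is an eigenvector of P for nu unless it is zero, and then y is
     one for -nu. *)
  pose z := bop_app P y + nu%:C *: y.
  have Pz : bop_app P z = nu%:C *: z.
    rewrite linearD linearZ /= -bop_compE yl scalerDr scalerA -rmorphM -expr2 sqr_sqrtr//.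
    by rewrite addrC.
  have [z0|z0] := eqVneq z 0.
    exists y; split=> //; exists (- nu); first by lra.
    by apply/eqP; rewrite rmorphN /= scaleNr -subr_eq0 opprK -/z z0.
  have nz : 0 < nrm z by rewrite nrm_gt0.
  have zs : perp s z by rewrite /z addrC; apply: perpP => //; exact: eigenlist_perp.
  exists ((nrm z)^-1%:C *: z); split.
  + by exists nu; [lra|rewrite linearZ /= Pz !scalerA mulrC].
  + by rewrite nrmZ cabs_real ger0_norm ?invr_ge0 ?ltW// mulVf// gt_eqF.
  + exact: perpZ.
- move=> x xP xo; apply: (eig_noinf lam0 essA _ xo) => n; have [l /andP[l1 l2] xl] := xP n; exists (l ^+ 2).
    by rewrite sqr_ge0 /=; nra.
  by rewrite bop_compE xl linearZ /= xl scalerA -rmorphM -expr2.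
- by exists s, m; split => // x /sm; rewrite rA.
Qed.

Definition rayleigh B x : R := rin (bop_app B x) x.

Lemma rayleighE B s y : orthonormal s -> eigenlist B s -> y \in s -> bop_app B y = (rayleigh B y)%:C *: y.
Proof.
move=> os es ys; have [l yl] := es y ys; rewrite /rayleigh yl rinZl rinxx (orthonormal_nrm os ys).
by rewrite expr1n mulr1.
Qed.

Lemma proj_eigenlist B s x : selfadjoint B -> orthonormal s -> eigenlist B s ->
  bop_app B (proj s x) = proj s (bop_app B x).
Proof.
move=> saB os es; rewrite /proj linear_sum; apply: eq_bigr => i _.
have si : s`_i \in s by rewrite mem_nth.
rewrite linearZ /= (rayleighE os es si) scalerA saB (rayleighE os es si) innerZrR.
by rewrite mulrC.
Qed.

Lemma orthonormal_filter (p : pred H) s : orthonormal s -> orthonormal [seq x <- s | p x].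
Proof.
move=> os; have us := lin_indep_uniq (orthonormal_lin_indep os).
move=> i j ii jj; set x := _`_i; set y := _`_j.
have xs : x \in s by have := mem_nth 0 ii; rewrite mem_filter => /andP[].
have ys : y \in s by have := mem_nth 0 jj; rewrite mem_filter => /andP[].
have := os (index x s) (index y s); rewrite !index_mem !nth_index// => -> //.
congr (_%:R); have [/eqP e|ne] := boolP (i == j).
  by rewrite /x /y e eqxx.
case: eqP => // e; exfalso; move/negP: ne; apply.
have xy : x = y by rewrite -(nth_index 0 xs) e nth_index.
by apply/eqP/(uniqP 0 (filter_uniq p us)).
Qed.

(** The part of an eigenvector orthogonal to s is again an eigenvector for the same l, hence zero by
    the last hypothesis. The other components pair nontrivially only with members of s having the
    eigenvalue l. *)
Lemma eigen_sum_basis B s (I : set R) : selfadjoint B -> orthonormal s -> eigenlist B s ->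
  (forall x l, perp s x -> I l -> bop_app B x = l%:C *: x -> x = 0) ->
  is_basis (eigen_sum B I) [seq y <- s | rayleigh B y \in I].
Proof.
move=> saB os es h; split; first exact/orthonormal_lin_indep/orthonormal_filter.
apply/seteqP; split; apply: lin_span_sub => x.
  move=> [l Il xl]; pose y := x - proj s x.
  have ys : perp s y by exact: perp_proj.
  have yl : bop_app B y = l%:C *: y.
    rewrite linearB /= proj_eigenlist// xl scalerBr; congr (_ - _).
    have := proj_linear s l%:C x 0; rewrite !addr0 => ->.
    have -> : proj s 0 = 0; last by rewrite addr0.
    by rewrite /proj big1// => i _; rewrite inner0l scale0r.
  have y0 : y = 0 by exact: h yl.
  have -> : x = proj s x by apply/eqP; rewrite -subr_eq0 -/y y0.
  apply: submod_sum => i _.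
  have si : s`_i \in s by rewrite mem_nth.
  have [c0|c0] := eqVneq (inner x s`_i) 0; first by rewrite c0 scale0r; exact: submod0.
  apply/submodZ/lin_span_mem => /=; rewrite mem_filter si andbT; apply/mem_set.
  suff -> : rayleigh B s`_i = l by [].
  have : inner (bop_app B x) s`_i = inner x (bop_app B s`_i) by exact: saB.
  rewrite xl innerZl (rayleighE os es si) innerZrR => /(mulIf c0).
  by move=> /(@complexI R).
rewrite /= mem_filter => /andP[/set_mem Ix xs]; apply: lin_span_mem.
by exists (rayleigh B x) => //; exact: rayleighE es xs.
Qed.

Lemma eigen_mult_count B s (l : R) : selfadjoint B -> orthonormal s -> eigenlist B s ->
  (forall x, perp s x -> bop_app B x = l%:C *: x -> x = 0) ->
  eigen_mult B l = count (fun y => rayleigh B y == l) s.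
Proof.
move=> saB os es h; rewrite /eigen_mult.
have -> : eigenspace_op B l = eigen_sum B [set l].
  apply/seteqP; split=> x; first by move=> xl; apply: lin_span_mem; exists l.
  move=> [r rP ->]; rewrite /eigenspace_op /= linear_sum scaler_sumr /= !big_seq.
  apply: eq_bigr => p pr; rewrite linearZ /=.
  by have [_ -> ->] := rP p pr; rewrite !scalerA mulrC.
have := @eigen_sum_basis B s [set l] saB os es.
rewrite (ldim_basis (s := [seq y <- s | rayleigh B y \in [set l]])) => [_|]; last first.
  by apply: eigen_sum_basis => // x k xs ->; exact: h.
rewrite size_filter; apply: eq_count => y.
by apply/idP/idP => [/set_mem ->//|/eqP e]; apply/mem_set.
Qed.

End Spectral.

(** * Stability of spectral gaps and admissible cut-offs *)

Section Perturbation.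
Variables (R : realType) (H : hilbertType R).
Local Notation C := (R[i]^o).
Implicit Types (s t u : seq H) (x y z : H) (A B P Q : bop H) (l m a : R).
Local Notation "1b" := (bop_id H).

(** The strict form of [gap], with room a < lam < m on both sides. The sizes lam - a and m - lam
    measure how large a perturbation is harmless. *)
Definition spectral_gap A (lam : R) s a m := [/\ orthonormal s,
  forall y, y \in s -> exists2 l : R, 0 <= l <= a & bop_app A y = l%:C *: y,
  a < lam, lam < m &
  forall x, perp s x -> m * nrm x ^+ 2 <= rin (bop_app A x) x].

Lemma spectral_gap_eigenlist A lam s a m : spectral_gap A lam s a m -> eigenlist A s.
Proof. by move=> [_ h _ _ _] y /h[l _ ?]; exists l. Qed.

Lemma gap_strict A lam s m : selfadjoint A -> gap A lam s m ->
  (forall y, bop_app A y = lam%:C *: y -> y = 0) -> exists a, spectral_gap A lam s a m.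
Proof.
move=> saA [os es lm LB] h.
suff [a al sa] : exists2 a, a < lam & forall y, y \in s ->
    exists2 l : R, 0 <= l <= a & bop_app A y = l%:C *: y by exists a.
have h' y : y \in s -> exists2 l : R, 0 <= l < lam & bop_app A y = l%:C *: y.
  move=> ys; have [l /andP[l0 llam] yl] := es y ys; exists l => //.
  rewrite l0 lt_neqAle llam andbT /=; apply: contraPneq (orthonormal_nrm os ys) => ll.
  by rewrite (h y) ?nrm0 -?ll// => /eqP; rewrite eq_sym oner_eq0.
elim: s h' {os es LB} => [|x s IH] h'; first by exists (lam - 1) => //; rewrite ltrBlDr ltrDl.
have [y ys|a al sa] := IH; first by apply: h'; rewrite inE ys orbT.
have [k /andP[k0 kl] xk] := h' x (mem_head _ _).
exists (Num.max a k); first by rewrite gt_max al kl.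
move=> y; rewrite inE => /orP[/eqP ->|/sa[l /andP[l0 la] yl]].
  by exists k => //; rewrite k0 le_max lexx orbT.
by exists l => //; rewrite l0 le_max la.
Qed.

Lemma span_ub B s a f : orthonormal s ->
  (forall y, y \in s -> exists2 l : R, l <= a & bop_app B y = l%:C *: y) ->
  lin_span_set [set` s] f -> rin (bop_app B f) f <= a * nrm f ^+ 2.
Proof.
move=> os es fs; rewrite -{1 3}(span_proj os fs) /proj (nrm_sum_orthonormal (fun i => inner f s`_i) os) linear_sum.
rewrite /rin inner_suml (big_morph (@complex.Re R) (@ReD R) (erefl : complex.Re 0 = 0)).
rewrite mulr_sumr; apply: ler_sum => i _.
have [|l la il] := es s`_i; first by rewrite mem_nth.
rewrite linearZ /= il !innerZl (inner_conj f).
have -> : inner f s`_i * (l%:C * conjc (inner f s`_i)) = l%:C * (inner f s`_i * conjc (inner f s`_i)).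
  by rewrite mulrCA.
by rewrite -sqr_normc cabsE -rmorphXn ReZ /= ler_wpM2r// sqr_ge0.
Qed.

(** A - lam is negative on span s and positive on its complement. Pairing (A - lam) x with x
    reflected in the complement makes both contributions positive, and the reflection preserves the
    norm. *)
Lemma spectral_gap_bounded_below A lam s a m x : selfadjoint A -> spectral_gap A lam s a m ->
  Num.min (lam - a) (m - lam) * nrm x <= nrm (bop_app (A - lam%:C *: 1b) x).
Proof.
move=> saA [os es al lm LB]; set c := Num.min _ _; set D := A - _.
have saD : selfadjoint D by exact: selfadjoint_shift.
have esA : eigenlist A s by move=> y /es[l _ ?]; exists l.
pose f := proj s x; pose y := x - f.
have xE : x = f + y by rewrite addrC subrK.
have ys : perp s y by exact: perp_proj.
have fs : lin_span_set [set` s] f by exact: proj_span.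
have Dys : perp s (bop_app D y).
  by rewrite /D bop_shift; apply: perpB; [exact: eigenlist_perp|exact: perpZ].
have c1 : rin (bop_app D y) f = 0 by rewrite /rin (perp_span Dys fs).
have c2 : rin (bop_app D f) y = 0 by rewrite /rin saD inner_conj -/(rin _ _) (perp_span Dys fs) rmorph0.
have key : c * nrm x ^+ 2 <= rin (bop_app D x) (y - f).
  have gen (v w : H) : rin (bop_app D (v + w)) (w - v) =
    rin (bop_app D v) w - rin (bop_app D v) v + (rin (bop_app D w) w - rin (bop_app D w) v).
    by rewrite linearD rinDl !rinDr !rinNr.
  rewrite {2}xE gen c1 c2 subr0 sub0r /D !rin_shift.
  have h1 := LB y ys.
  have h2 : rin (bop_app A f) f <= a * nrm f ^+ 2.
    by apply: (span_ub os _ fs) => z /es[l /andP[_ la] ?]; exists l.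
  rewrite (nrm_proj x os) -/f -/y.
  have h3 : c <= lam - a by rewrite ge_min lexx.
  have h4 : c <= m - lam by rewrite ge_min lexx orbT.
  have h5 := sqr_ge0 (nrm f); have h6 := sqr_ge0 (nrm y).
  move: h1 h2 h5 h6; move: (nrm f ^+ 2) (nrm y ^+ 2) => ff yy; nra.
have nyf : nrm (y - f) = nrm x.
  apply/eqP; rewrite -(@eqrXn2 _ 2)// ?nrm_ge0//; apply/eqP.
  rewrite nrmB_sqr (nrm_proj x os) -/f -/y rinC.
  have -> : rin f y = 0 by rewrite rinC /rin (perp_span ys fs).
  by rewrite mulr0 subr0 addrC.
have [->|x0] := eqVneq x 0; first by rewrite linear0 !nrm0 mulr0.
have nx : 0 < nrm x by rewrite nrm_gt0.
rewrite -(ler_pM2r nx) -mulrA -expr2 (le_trans key)// (le_trans (ler_norm _))//.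
by rewrite (le_trans (rin_le _ _))// nyf.
Qed.

Lemma spectral_gap_not_spec A lam s a m : selfadjoint A -> spectral_gap A lam s a m -> ~ spec A lam%:C.
Proof.
move=> saA sg; apply/specE.
apply: (@sa_bounded_below_invertible _ _ _ (Num.min (lam - a) (m - lam))).
- exact: selfadjoint_shift.
- by case: sg => _ _ ? ? _; rewrite lt_min !subr_gt0; apply/andP.
- by move=> x; exact: spectral_gap_bounded_below sg.
Qed.

Lemma spectral_gap_ess A lam s a m l : selfadjoint A -> spectral_gap A lam s a m -> l <= lam -> ~ spec_ess A l%:C.
Proof.
by move=> saA [os _ _ lm LB] llam; apply: (ess_free saA os _ LB); exact: le_lt_trans lm.
Qed.

Lemma rin_perturb A B x : rin (bop_app B x) x - nrm (A - B) * nrm x ^+ 2 <= rin (bop_app A x) x.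
Proof.
have -> : rin (bop_app A x) x = rin (bop_app B x) x + rin (bop_app (A - B) x) x.
  by rewrite -rinDl -bopDE addrC subrK.
rewrite lerD2l lerNl (le_trans (ler_norm _))// normrN (le_trans (rin_le _ _))//.
by rewrite expr2 mulrA ler_wpM2r ?nrm_ge0// nrm_bop_app.
Qed.

(** A nonzero vector of one low space orthogonal to the other would have forms for A and A0 on
    opposite sides of the gap, farther apart than the norm of A - A0 permits. *)
Lemma spectral_gap_size A A0 lam s0 a0 m0 s a m : spectral_gap A0 lam s0 a0 m0 -> spectral_gap A lam s a m ->
  nrm (A - A0) < Num.min (lam - a0) (m0 - lam) ->
  (forall x, lin_span_set [set` s] x -> perp s0 x -> x = 0) /\
  (forall x, lin_span_set [set` s0] x -> perp s x -> x = 0).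
Proof.
move=> [os0 es0 al0 lm0 LB0] [os es al lm LB]; rewrite lt_min => /andP[d1 d2]; split=> x xs xp.
- have h1 := LB0 x xp.
  have h2 : rin (bop_app A x) x <= lam * nrm x ^+ 2.
    by apply: (span_ub os _ xs) => z /es[l /andP[_ la] ?]; exists l => //; rewrite (le_trans la)// ltW.
  have h3 := rin_perturb A A0 x; apply/eqP; rewrite -nrm_eq0 -sqrf_eq0 eq_le sqr_ge0 andbT.
  have := sqr_ge0 (nrm x); move: h1 h2 h3; move: (nrm x ^+ 2) => xx; nra.
- have h1 := LB x xp.
  have h2 : rin (bop_app A0 x) x <= a0 * nrm x ^+ 2.
    by apply: (span_ub os0 _ xs) => z /es0[l /andP[_ la] ?]; exists l.
  have h3 := rin_perturb A0 A x; rewrite nrmB in h3.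
  apply/eqP; rewrite -nrm_eq0 -sqrf_eq0 eq_le sqr_ge0 andbT.
  have := sqr_ge0 (nrm x); move: h1 h2 h3; move: (nrm x ^+ 2) => xx; nra.
Qed.

(** The lower bound on the complement of s0 persists for A, which yields a gap of A; mutual
    injectivity of the projections gives equal dimensions. The basis in the conclusion, the
    projections of the fixed vectors s0, is what [frame_family] uses as a local frame. *)
Lemma spectral_gap_perturb A0 lam s0 a0 m0 : selfadjoint A0 -> 0 < lam -> spectral_gap A0 lam s0 a0 m0 ->
  exists2 d : R, 0 < d & forall A, selfadjoint A -> (forall x, 0 <= rin (bop_app A x) x) ->
    nrm (A - A0) < d -> exists s a m, [/\ spectral_gap A lam s a m, size s = size s0 &
      is_basis (eigen_sum A `[0, lam]%classic) [seq proj s y | y <- s0]].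
Proof.
move=> saA0 lam0 sg; have [os0 es0 al0 lm0 LB0] := sg.
pose d := Num.min (lam - a0) (m0 - lam).
exists d; first by rewrite lt_min !subr_gt0 al0.
move=> A saA A0' Ad; have [d1 d2] : nrm (A - A0) < lam - a0 /\ nrm (A - A0) < m0 - lam.
  by apply/andP; rewrite -lt_min.
have LB x : perp s0 x -> (m0 - nrm (A - A0)) * nrm x ^+ 2 <= rin (bop_app A x) x.
  move=> xp; have := rin_perturb A A0 x; have := LB0 x xp; lra.
have lm1 : lam < m0 - nrm (A - A0) by rewrite ltrBrDr addrC -ltrBrDr.
have [|s [m gs]] := @gap_exists _ _ A lam saA A0' (ltW lam0).
  by move=> l /andP[_ ll]; apply: (ess_free saA os0 _ LB); exact: le_lt_trans lm1.
(* lam is no eigenvalue of A, because A0 - lam is bounded below by d, which exceeds the norm of A -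
   A0. *)
have [|a sgA] := gap_strict saA gs.
  move=> y yl; have := spectral_gap_bounded_below y saA0 sg.
  rewrite bop_shift -yl -bopBE => h.
  have h2 := le_trans h (nrm_bop_app _ _).
  apply/eqP; rewrite -nrm_eq0; apply/negPn/negP => y0.
  have ny : 0 < nrm y by rewrite lt_def nrm_ge0 andbT.
  by move: h2; rewrite ler_pM2r// nrmB leNgt => /negP; apply.
have [j1 j2] := spectral_gap_size sg sgA Ad.
have [os es al lm LBs] := sgA.
have li1 := proj_lin_indep os j1 os0; have li2 := proj_lin_indep os0 j2 os.
have sz : size s = size s0.
  apply/eqP; rewrite eqn_leq; apply/andP; split.
    rewrite -(size_map (proj s0) s); apply: lin_indep_size li1 _ => x /mapP[y _ ->].
    exact: proj_span.
  rewrite -(size_map (proj s) s0); apply: lin_indep_size li2 _ => x /mapP[y _ ->].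
  exact: proj_span.
exists s, a, m; split=> //.
have esA : eigenlist A s by exact: spectral_gap_eigenlist sgA.
have := @eigen_sum_basis _ _ A s `[0, lam]%classic saA os esA.
have -> : [seq y <- s | rayleigh A y \in `[0, lam]%classic] = s.
  apply/all_filterP/allP => y ys; apply/mem_set; rewrite /= in_itv /=.
  have [l /andP[l0 la] yl] := es y ys.
  have -> : rayleigh A y = l by rewrite /rayleigh yl rinZl rinxx (orthonormal_nrm os ys) expr1n mulr1.
  by rewrite l0 (le_trans la)// ltW.
move=> h; have bs : is_basis (eigen_sum A `[0, lam]%classic) s.
  apply: h => x l xp; rewrite /= in_itv /= => /andP[_ ll] xl.
  have := LBs x xp; rewrite xl rinZl rinxx => h.
  apply/eqP; rewrite -nrm_eq0 -sqrf_eq0 eq_le sqr_ge0 andbT.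
  have := sqr_ge0 (nrm x); move: h; move: (nrm x ^+ 2) => xx; nra.
apply: (is_basis_sub bs li2); last by rewrite size_map sz.
by move=> x /mapP[y _ ->]; rewrite (bs.2); exact: proj_span.
Qed.

(* Davis-Kahan *)
Lemma eigenvector_perturb A B t m x l : selfadjoint B -> orthonormal t -> eigenlist B t ->
  (forall z, perp t z -> m * nrm z ^+ 2 <= rin (bop_app B z) z) ->
  bop_app A x = l%:C *: x -> nrm x = 1 -> l < m ->
  nrm (x - proj t x) <= nrm (A - B) / (m - l).
Proof.
move=> saB ot et LB xl x1 lm; set y := x - _.
have yt : perp t y by exact: perp_proj.
rewrite ler_pdivlMr ?subr_gt0//.
have [y0|y0] := eqVneq y 0; first by rewrite y0 nrm0 mul0r nrm_ge0.
have ny : 0 < nrm y by rewrite nrm_gt0.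
rewrite -(ler_pM2r ny) -mulrAC -expr2.
have h1 : (m - l) * nrm y ^+ 2 <= rin (bop_app (B - l%:C *: 1b) y) y.
  by rewrite rin_shift mulrBl lerD2r LB.
have h2 : rin (bop_app (B - l%:C *: 1b) y) y = rin (bop_app (B - l%:C *: 1b) x) y.
  have e : bop_app (B - l%:C *: 1b) y =
     bop_app (B - l%:C *: 1b) x - bop_app (B - l%:C *: 1b) (proj t x) by exact: linearB.
  rewrite e rinDl rinNl [rin (bop_app _ (proj t x)) y]rinC.
  have -> : rin y (bop_app (B - l%:C *: 1b) (proj t x)) = 0.
    rewrite /rin -(selfadjoint_shift l saB) (perp_span _ (proj_span t x))//.
    by rewrite bop_shift; apply: perpB; [exact: eigenlist_perp|exact: perpZ].
  by rewrite subr0.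
have h3 : bop_app (B - l%:C *: 1b) x = bop_app (B - A) x by rewrite bop_shift -xl.
rewrite mulrC (le_trans h1)// h2 h3 (le_trans (ler_norm _))// (le_trans (rin_le _ _))//.
rewrite ler_wpM2r ?nrm_ge0// (le_trans (nrm_bop_app _ _))// x1 mulr1 nrmB.
by [].
Qed.

Lemma ler_nrm_sum I (r : seq I) (F : I -> H) : nrm (\sum_(i <- r) F i) <= \sum_(i <- r) nrm (F i).
Proof.
elim: r => [|i r IH]; rewrite !(big_nil, big_cons) ?nrm0//.
by rewrite (le_trans (ler_nrmD _ _))// lerD2l.
Qed.

(** The Lipschitz constant involves only the gap of B, so the estimate gives continuity at B
    although nothing is known about a and m for nearby A. The part p of u in span t is treated by
    applying [eigenvector_perturb] to the eigenvectors t of B, the rest q by applying it to the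
    eigenvectors s of A. *)
Lemma spectral_gap_proj_perturb A B lam s a m t b n (u : H) : selfadjoint A -> selfadjoint B ->
  spectral_gap A lam s a m -> spectral_gap B lam t b n -> size s = size t ->
  nrm (proj s u - proj t u) <=
    (size t)%:R * ((lam - b)^-1 + (n - lam)^-1) * nrm (A - B) * nrm u.
Proof.
move=> saA saB sgA sgB st; have [os es al lm LB] := sgA; have [ot et bl ln LBt] := sgB.
pose p := proj t u; pose q := u - p.
have lb : 0 < lam - b by rewrite subr_gt0.
have nl : 0 < n - lam by rewrite subr_gt0.
have nA : 0 <= nrm (A - B) by exact: nrm_ge0.
have np : nrm p <= nrm u.
  rewrite -(@ler_pXn2r _ 2)// ?nnegrE ?nrm_ge0// (nrm_proj u ot) lerDl; exact: sqr_ge0.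
have nq : nrm q <= nrm u.
  rewrite -(@ler_pXn2r _ 2)// ?nnegrE ?nrm_ge0// (nrm_proj u ot) lerDr; exact: sqr_ge0.
have pD v x y : proj v (x + y) = proj v x + proj v y.
  by have := proj_linear v 1 x y; rewrite !scale1r.
have p0 (v : seq H) : proj v 0 = 0 by rewrite /proj big1// => i _; rewrite inner0l scale0r.
have pZ v (c : R[i]) x : proj v (c *: x) = c *: proj v x.
  by have := proj_linear v c x 0; rewrite p0 !addr0.
have uE : u = p + q by rewrite addrC subrK.
have -> : proj s u - proj t u = (proj s p - p) + proj s q.
  by rewrite {1}uE pD -/p addrAC.
have h1 : nrm (proj s p - p) <= (size t)%:R * (nrm u * (nrm (A - B) / (lam - b))).
  have -> : proj s p - p = \sum_(i < size t) inner u t`_i *: (proj s t`_i - t`_i).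
    under [RHS]eq_bigr do rewrite scalerBr -pZ.
    by rewrite sumrB -(big_morph _ (pD s) (p0 s)).
  apply: (le_trans (ler_nrm_sum _ _)).
  apply: (@le_trans _ _ (\sum_(i < size t) nrm u * (nrm (A - B) / (lam - b)))); last first.
    by rewrite sumr_const card_ord mulr_natl.
  apply: ler_sum => i _; have ti : t`_i \in t by rewrite mem_nth.
  have nti := orthonormal_nrm ot ti; have [l /andP[_ lb'] il] := et _ ti.
  rewrite nrmZ nrmB ler_pM ?nrm_ge0//.
    by rewrite (le_trans (cauchy_schwarz _ _))// nti mulr1.
  have llam : l < m by rewrite (le_lt_trans lb')// (lt_trans bl).
  apply: (le_trans (eigenvector_perturb saA os (spectral_gap_eigenlist sgA) LB il nti llam)).
  rewrite (nrmB B) ler_wpM2l// lef_pV2 ?posrE ?subr_gt0//; lra.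
have h2 : nrm (proj s q) <= (size t)%:R * (nrm u * (nrm (A - B) / (n - lam))).
  apply: (le_trans (ler_nrm_sum _ _)).
  apply: (@le_trans _ _ (\sum_(i < size s) nrm u * (nrm (A - B) / (n - lam)))); last first.
    by rewrite sumr_const card_ord mulr_natl st.
  apply: ler_sum => i _; have si : s`_i \in s by rewrite mem_nth.
  have nsi := orthonormal_nrm os si; have [l /andP[_ la'] il] := es _ si.
  rewrite nrmZ nsi mulr1.
  have qt : perp t q by exact: perp_proj.
  have -> : inner q s`_i = inner q (s`_i - proj t s`_i).
    by rewrite innerBr (perp_span qt (proj_span t _)) subr0.
  apply: (le_trans (cauchy_schwarz _ _)); apply: ler_pM => //; rewrite ?nrm_ge0//.
  have ln' : l < n by rewrite (le_lt_trans la')// (lt_trans al).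
  apply: (le_trans (eigenvector_perturb saB ot (spectral_gap_eigenlist sgB) LBt il nsi ln')).
  rewrite ler_wpM2l// lef_pV2 ?posrE ?subr_gt0//; lra.
apply: (le_trans (ler_nrmD _ _)); apply: (le_trans (lerD h1 h2)).
rewrite le_eqVlt; apply/orP; left; apply/eqP.
by move: ((lam - b)^-1) ((n - lam)^-1) => x y; ring.
Qed.

Lemma sa_sqr_ge0 P x : selfadjoint P -> rin (bop_app (bop_comp P P) x) x = nrm (bop_app P x) ^+ 2.
Proof. by move=> saP; rewrite /rin bop_compE saP -/(rin _ _) rinxx. Qed.

Definition adm P (mu : R) := [/\ 0 < mu, ~ spec P mu%:C, ~ spec P (- mu%:C) &
  forall l : R, - mu <= l <= mu -> ~ spec_ess P l%:C].

(** Together with [spectral_gap_adm] this turns admissibility of mu into a spectral gap of P^2 at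
    mu^2, to which the perturbation results apply. *)
Lemma adm_spectral_gap P mu : selfadjoint P -> adm P mu -> exists s a m,
  eigenlist P s /\ spectral_gap (bop_comp P P) (mu ^+ 2) s a m.
Proof.
move=> saP [mu0 sp1 sp2 ess].
have [s [m [os es mum LB]]] := gap_sqrt_exists saP mu0 ess.
have saA := selfadjoint_comp saP.
have esP : eigenlist P s by move=> y /es[l _ ?]; exists l.
have ga : gap (bop_comp P P) (mu ^+ 2) s m.
  split=> // [y /es[l /andP[l1 l2] yl]|x /LB]; last by rewrite sa_sqr_ge0.
  exists (l ^+ 2); first by rewrite sqr_ge0 /=; nra.
  by rewrite bop_compE yl linearZ /= yl scalerA -rmorphM -expr2.
have sp3 : ~ spec (bop_comp P P) (mu ^+ 2)%:C.
  by apply: spec_sqr => //; rewrite rmorphN.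
have [|a sg] := gap_strict saA ga; last by exists s, a, m.
move=> y yl; have /specE[Q [Q1 _]] := sp3.
by rewrite -[y](bop_idE y) -Q1 bop_compE bop_shift yl subrr linear0.
Qed.

Lemma spectral_gap_adm P mu s a m : selfadjoint P -> 0 < mu ->
  spectral_gap (bop_comp P P) (mu ^+ 2) s a m -> adm P mu.
Proof.
move=> saP mu0 sg; have saA := selfadjoint_comp saP.
have sp := spectral_gap_not_spec saA sg.
split=> //; first exact: spec_sqrt.
  by rewrite -rmorphN; apply: spec_sqrt; rewrite sqrrN.
move=> l /andP[l1 l2]; apply: spec_ess_sqrt; apply: (spectral_gap_ess saA sg); nra.
Qed.

(** Without a lower bound there would be arbitrarily long z orthogonal to v with |Pz| <= 1. Since
    every y equals some P w modulo span s, and z is orthogonal to s, <y, z> = <w, Pz> stays bounded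
    for each y, which contradicts uniform boundedness. *)
Lemma fredholm_bounded_below P : selfadjoint P -> fredholm P ->
  exists o (c : R), [/\ orthonormal o, 0 < c & forall x, perp o x -> c * nrm x <= nrm (bop_app P x)].
Proof.
move=> saP [_ [s sP]]; have [v vo os] := gram_schmidt s.
exists v; apply: contrapT => h.
have /choice[z zP] (k : nat) : exists z, [/\ perp v z, nrm (bop_app P z) <= 1 & nrm z = k.+1%:R].
  apply: contrapT => hk; apply: h; exists k.+1%:R^-1; split=> // x xo.
  rewrite leNgt; apply/negP => hx; apply: hk.
  have [x0|x0] := eqVneq x 0; first by move: hx; rewrite x0 linear0 !nrm0 mulr0 ltxx.
  have nx : 0 < nrm x by rewrite nrm_gt0.
  have k1 : 0 < k.+1%:R :> R by rewrite ltr0n.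
  have nk : cabs (k.+1%:R / nrm x)%:C = k.+1%:R / nrm x.
    by rewrite cabs_real ger0_norm// divr_ge0// ltW.
  exists ((k.+1%:R / nrm x)%:C *: x); split; first exact: perpZ.
    rewrite linearZ /= nrmZ nk -ler_pdivlMl ?divr_gt0// mulr1 invf_div.
    by rewrite mulrC ltW.
  by rewrite nrmZ nk divfK// gt_eqF.
have [|M MP] := @uniform_boundedness _ _ z.
  move=> y; have [w wy] := sP y; exists (nrm w) => k; have [zo Pz _] := zP k.
  have -> : inner y (z k) = inner w (bop_app P (z k)).
    rewrite -saP; apply/eqP; rewrite -subr_eq0 -innerBl; apply/eqP.
    by rewrite inner_conj (perp_span (os _ zo) wy) rmorph0.
  by rewrite (le_trans (cauchy_schwarz _ _))// ler_piMr ?nrm_ge0.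
have [n nM] : exists n : nat, M < n.+1%:R by exists (Num.truncn M); exact: truncnS_gt.
by have := MP n; have [_ _ ->] := zP n; rewrite leNgt nM.
Qed.

Lemma gap_below_list (L : seq R) (c : R) : 0 < c ->
  exists2 b, 0 < b <= c & forall x : R, x \in L -> 0 < x -> b <= x.
Proof.
move=> c0; elim: L => [|x L [b /andP[b0 bc] bL]]; first by exists c => //; rewrite c0 lexx.
have [x0|x0] := ltP 0 x; last first.
  exists b; first by rewrite b0.
  by move=> y; rewrite inE => /orP[/eqP ->|/bL//]; rewrite ltNge x0.
exists (Num.min b x); first by rewrite lt_min b0 x0 ge_min bc.
move=> y; rewrite inE => /orP[/eqP -> _|/bL h /h yb]; first by rewrite ge_min lexx orbT.
by rewrite ge_min yb.
Qed.

(** Below c^2 the operator P^2 has no essential spectrum, hence only finitely many eigenvalues up to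
    c^2 / 2; the square root of any lam strictly below the positive ones will do. *)
Lemma fredholm_adm P : selfadjoint P -> fredholm P -> exists mu, adm P mu.
Proof.
move=> saP fP; have [v [c [oo c0 LB]]] := fredholm_bounded_below saP fP.
have saA := selfadjoint_comp saP; set A := bop_comp P P in saA.
have A0 x : 0 <= rin (bop_app A x) x by rewrite sa_sqr_ge0// sqr_ge0.
have LBA x : perp v x -> c ^+ 2 * nrm x ^+ 2 <= rin (bop_app A x) x.
  move=> xo; rewrite sa_sqr_ge0// -exprMn ler_pXn2r// ?nnegrE ?nrm_ge0 ?LB//.
  by rewrite mulr_ge0 ?nrm_ge0// ltW.
have c2 : 0 < c ^+ 2 / 2 by rewrite divr_gt0// exprn_gt0.
have cc : c ^+ 2 / 2 < c ^+ 2 by move: c2; lra.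
have [|s [m ga]] := @gap_exists _ _ A (c ^+ 2 / 2) saA A0 (ltW c2).
  by move=> l /andP[_ ll]; apply: (ess_free saA oo _ LBA); exact: le_lt_trans cc.
have [b /andP[b0 bc] bL] := gap_below_list [seq rayleigh A y | y <- s] c2.
(* b is a positive lower bound for the positive listed eigenvalues of P^2, so b / 2 is not an
   eigenvalue. *)
pose lam := b / 2; have lam0 : 0 < lam by rewrite divr_gt0.
have [|t [n gt]] := @gap_exists _ _ A lam saA A0 (ltW lam0).
  move=> l /andP[_ ll]; apply: (ess_free saA oo _ LBA); rewrite (le_lt_trans _ cc)//.
  by rewrite (le_trans ll)// (le_trans _ bc)// /lam; move: b0; lra.
have [|a sg] := gap_strict saA gt.
  move=> y yl; have [os es lm LBs] := ga.
  have esA : eigenlist A s by move=> z /es[l _ ?]; exists l.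
  have ls : rayleigh A y = lam * nrm y ^+ 2 by rewrite /rayleigh yl rinZl rinxx.
  have lc : lam < c ^+ 2 / 2 by rewrite /lam; move: b0 bc; lra.
  have ip i : (i < size s)%N -> inner y s`_i = 0.
    move=> ii; have si : s`_i \in s by rewrite mem_nth.
    apply/eqP; apply: contraT => c0'; have : inner (bop_app A y) s`_i = inner y (bop_app A s`_i) by exact: saA.
    rewrite yl innerZl (rayleighE os esA si) innerZrR => /(mulIf c0')/(@complexI R) e.
    have := bL (rayleigh A s`_i) (map_f _ si); rewrite -e => /(_ lam0).
    by rewrite /lam; move: b0; lra.
  have yp : perp s y by move=> z /(nthP 0)[i ii <-]; exact: ip.
  have := LBs y yp; rewrite yl rinZl rinxx => h.
  apply/eqP; rewrite -nrm_eq0 -sqrf_eq0 eq_le sqr_ge0 andbT.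
  have := sqr_ge0 (nrm y); move: h lc lm; move: (nrm y ^+ 2) (c ^+ 2 / 2) => xx dd; nra.
exists (Num.sqrt lam); apply: (@spectral_gap_adm _ _ t a n saP); first by rewrite sqrtr_gt0.
by rewrite sqr_sqrtr// ltW.
Qed.

End Perturbation.

(** * The transport maps between determinant lines *)

Section MoreLinear.
Variables (K : fieldType) (V : lmodType K).
Implicit Types (s t u : seq V).

Lemma lin_indep_cat s t : lin_indep s -> lin_indep t ->
  (forall x, lin_span_set [set` s] x -> lin_span_set [set` t] x -> x = 0) ->
  lin_indep (s ++ t).
Proof.
move=> si ti st c; rewrite size_cat big_split_ord /= => h.
set x := \sum_(i < size s) _ in h; set y := \sum_(i < size t) _ in h.
have xE : x = \sum_(i < size s) c i *: s`_i.
  by apply: eq_bigr => i _; rewrite nth_cat ltn_ord.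
have yE : y = \sum_(i < size t) c (size s + i)%N *: t`_i.
  by apply: eq_bigr => i _; rewrite nth_cat ltnNge leq_addr /= addKn.
have x0 : x = 0.
  apply: st; first by apply/lin_spanP; exists c.
  have -> : x = (-1) *: y by rewrite scaleN1r; apply/eqP; rewrite -addr_eq0 h.
  apply: (@submodZ _ _ (lin_span [set` t])); apply/lin_spanP.
  by exists (fun i => c (size s + i)%N).
have y0 : y = 0 by rewrite -h x0 add0r.
move=> i ii; have [is_|si_] := ltnP i (size s).
  by apply: (si c) is_; rewrite -xE.
rewrite -(subnKC si_); apply: (ti (fun k => c (size s + k)%N)); first by rewrite -yE.
by rewrite -(ltn_add2l (size s)) subnKC.
Qed.

Lemma lin_span_cat s t x : lin_span_set [set` s ++ t] x <->
  exists y z, [/\ lin_span_set [set` s] y, lin_span_set [set` t] z & x = y + z].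
Proof.
split=> [/lin_spanP[c ->]|[y [z [ys zt ->]]]].
  rewrite size_cat big_split_ord /=.
  exists (\sum_(i < size s) c i *: (s ++ t)`_i), (\sum_(i < size t) c (size s + i)%N *: (s ++ t)`_(size s + i)).
  split=> //; apply/lin_spanP.
    by exists c; apply: eq_bigr => i _; rewrite nth_cat ltn_ord.
  exists (fun i => c (size s + i)%N); apply: eq_bigr => i _.
  by rewrite nth_cat ltnNge leq_addr /= addKn.
apply: (@submodD _ _ (lin_span [set` s ++ t])).
  by move: ys; apply: lin_spanS => w /=; rewrite mem_cat => ->.
by move: zt; apply: lin_spanS => w /=; rewrite mem_cat => ->; rewrite orbT.
Qed.

(** Changing an entry by an element of span z adds forms in which an entry of z is repeated. *)
Lemma alt_mod n (f : seq V -> K) (z s t : seq V) : alt_form n f -> size s = size t ->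
  (forall i, lin_span_set [set` z] (s`_i - t`_i)) -> f (z ++ s) = f (z ++ t).
Proof.
move=> fA st h.
suff gen r : f (z ++ r ++ s) = f (z ++ r ++ t) by exact: (gen [::]).
elim: s t st h r => [|x s IH] [|y t] //= [st] h r.
have -> : f (z ++ r ++ x :: s) = f (z ++ r ++ y :: s).
  have -> : x = y + (x - y) by rewrite addrC subrK.
  rewrite !catA (altD fA).
  suff -> : f ((z ++ r) ++ (x - y) :: s) = 0 by rewrite addr0 -catA.
  have /lin_spanP[c ->] := h 0%N; rewrite (alt_sum fA) big1 // => i _.
  rewrite (altZ fA).
  have zE : z = take i z ++ z`_i :: drop i.+1 z by rewrite -drop_nth ?cat_take_drop.
  case: fA => _ _ alt; have := alt (take i z) (drop i.+1 z ++ r) s z`_i.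
  by rewrite -cat_cons catA -cat_cons catA -zE => ->; rewrite mulr0.
rewrite -2!cat_rcons; apply: IH => // i; exact: (h i.+1).
Qed.

Lemma alt_form_map n (U : lmodType K) (q : U -> V) (f : seq V -> K) : linear q ->
  alt_form n f -> alt_form n (fun s : seq U => f [seq q x | x <- s]).
Proof.
move=> ql [f1 f2 f3]; split=> [s sn|s t a x y|s t u x].
- by apply: f1; rewrite size_map.
- by rewrite !map_cat /= ql f2.
- by rewrite !map_cat /= map_cat /= f3.
Qed.

End MoreLinear.

Section Coefficients.
Variables (R : realType) (H : hilbertType R).
Implicit Types (s t u v w y : seq H).

Lemma coef_catl v w (x y : seq H) : lin_indep v -> size x = size v -> size y = size w ->
  (forall z, z \in x -> lin_span_set [set` v] z) ->
  coef (x ++ y) (v ++ w) = coef x v * coef (v ++ y) (v ++ w).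
Proof.
move=> vi xv yw xs.
apply: (@alt_coef _ _ (size v) (fun x => coef (x ++ y) (v ++ w)) v x) => //.
by apply: (@alt_form_catl _ _ (size v) y (fun s => coef s (v ++ w))); rewrite yw -size_cat; exact: coef_alt.
Qed.

Lemma coef_cat v w (x y : seq H) : lin_indep (v ++ w) -> lin_indep v -> lin_indep w ->
  size x = size v -> size y = size w ->
  (forall z, z \in x -> lin_span_set [set` v] z) ->
  (forall z, z \in y -> lin_span_set [set` w] z) ->
  coef (x ++ y) (v ++ w) = coef x v * coef y w.
Proof.
move=> vwi vi wi xv yw xs ys; rewrite coef_catl//; congr (_ * _).
rewrite (@alt_coef _ _ (size w) (fun y => coef (v ++ y) (v ++ w)) w y)//.
  by rewrite coefxx// mulr1.
by apply: (@alt_form_catr _ _ (size w) v (fun s => coef s (v ++ w))); rewrite -size_cat; exact: coef_alt.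
Qed.

Lemma coef_map (q : H -> H) w y : linear q -> lin_indep w ->
  lin_indep [seq q x | x <- w] -> size y = size w ->
  (forall z, z \in y -> lin_span_set [set` w] z) ->
  coef [seq q x | x <- y] [seq q x | x <- w] = coef y w.
Proof.
move=> ql wi qwi yw ys.
rewrite (@alt_coef _ _ (size w) (fun y => coef [seq q x | x <- y] [seq q x | x <- w]) w y)//.
  by rewrite coefxx// mulr1.
apply: (@alt_form_map _ _ (size w) _ q (fun s => coef s [seq q x | x <- w])) => //.
by rewrite -(size_map q); exact: coef_alt.
Qed.

Lemma coef_inv s t : size s = size t -> lin_indep s -> lin_indep t ->
  (forall z, z \in s -> lin_span_set [set` t] z) ->
  coef s t * coef t s = 1.
Proof. by move=> st si ti ss; rewrite -coef_trans// coefxx. Qed.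

End Coefficients.

Section EigenSums.
Variables (R : realType) (H : hilbertType R).
Implicit Types (s t u v w : seq H) (x y : H) (B P Q : bop H) (I J : set R).

Lemma eigen_sum_orth B I J x y : selfadjoint B -> (forall l, I l -> J l -> False) ->
  eigen_sum B I x -> eigen_sum B J y -> inner x y = 0.
Proof.
move=> saB IJ xI yJ.
have h1 (z w : H) : (\bigcup_(l in I) eigenspace_op B l) z -> (\bigcup_(l in J) eigenspace_op B l) w ->
    inner z w = 0.
  move=> [l Il zl] [k Jk wk]; have : inner (bop_app B z) w = inner z (bop_app B w) by exact: saB.
  have -> : bop_app B z = l%:C *: z by []. have -> : bop_app B w = k%:C *: w by [].
  rewrite innerZl innerZrR => e; apply/eqP; apply: contraT => zw.
  by move/(mulIf zw)/(@complexI R): e => lk; exfalso; apply: (IJ l) => //; rewrite lk.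
have [r rP ->] := xI; have [q qP ->] := yJ.
rewrite inner_suml big_seq big1 // => p pr; rewrite innerZl inner_sumr big_seq big1 ?mulr0// => p' pq.
by rewrite innerZr h1 ?mulr0//; [exact: rP|exact: qP].
Qed.

Lemma split_basis B I J v w : selfadjoint B -> (forall l, I l -> J l -> False) ->
  is_basis (eigen_sum B I) v -> is_basis (eigen_sum B J) w ->
  is_basis (eigen_sum B (I `|` J)) (v ++ w).
Proof.
move=> saB IJ [vi vE] [wi wE]; split.
  apply: lin_indep_cat => // x xv xw; apply: inner_eq0.
  apply: (eigen_sum_orth saB IJ); first by rewrite vE.
  by rewrite wE.
apply/seteqP; split.
  apply: lin_span_sub => x [l [Il|Jl] xl]; apply/lin_span_cat.
    exists x, 0; split; [|exact: lin_span_set0|by rewrite addr0].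
    by have : eigen_sum B I x by [apply: lin_span_mem; exists l]; rewrite vE.
  exists 0, x; split; [exact: lin_span_set0| |by rewrite add0r].
  by have : eigen_sum B J x by [apply: lin_span_mem; exists l]; rewrite wE.
move=> x /lin_span_cat[y [z [yv zw ->]]]; apply: submodD.
  have : eigen_sum B I y by rewrite vE.
  by apply: lin_spanS => u [l Il ul]; exists l => //; left.
have : eigen_sum B J z by rewrite wE.
by apply: lin_spanS => u [l Il ul]; exists l => //; right.
Qed.

Lemma ker_PdagP Q : ker_op Q = eigen_sum (PdagP Q) [set 0].
Proof.
apply/seteqP; split=> x.
  move=> Qx; apply: lin_span_mem; exists 0 => //.
  have Qx' : bop_app Q x = 0 by [].
  by rewrite /eigenspace_op /= bop_compE Qx' linear0 scale0r.
move=> [r rP ->]; rewrite /ker_op /= linear_sum big_seq big1 // => p pr; rewrite linearZ /=.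
have [l -> h] := rP p pr.
have h' : bop_app (PdagP Q) p.2 = 0 by rewrite (h : _ = _) scale0r.
have : nrm (bop_app Q p.2) ^+ 2 = 0 by rewrite -rin_comp_adjoint [bop_app _ _]h' /rin inner0l.
by move=> /eqP; rewrite sqrf_eq0 nrm_eq0 => /eqP ->; rewrite scaler0.
Qed.

Lemma PdagP_adjoint Q : PdagP (adjoint Q) = PPdag Q.
Proof. by rewrite /PdagP adjointK. Qed.

Lemma ker_adjoint Q : ker_op (adjoint Q) = eigen_sum (PPdag Q) [set 0].
Proof. by rewrite ker_PdagP PdagP_adjoint. Qed.

(** Q and Q^dag intertwine Q^dag Q and Q Q^dag, and l^-1 Q^dag inverts Q on the eigenspaces for l !=
    0. *)
Lemma image_basis Q I w : ~ I 0 -> is_basis (eigen_sum (PdagP Q) I) w ->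
  is_basis (eigen_sum (PPdag Q) I) [seq bop_app Q x | x <- w].
Proof.
move=> I0 [wi wE]; have map_sum (c : nat -> R[i]) :
    \sum_(i < size w) c i *: [seq bop_app Q x | x <- w]`_i = bop_app Q (\sum_(i < size w) c i *: w`_i).
  by rewrite linear_sum; apply: eq_bigr => i _; rewrite (nth_map 0)// linearZ.
split.
  move=> c; rewrite size_map map_sum => h i ii; apply: (wi c) ii.
  set x := \sum_(_ < _) _ in h *.
  have xw : eigen_sum (PdagP Q) I x by rewrite wE; apply/lin_spanP; exists c.
  apply: inner_eq0; apply: (@eigen_sum_orth (PdagP Q) [set 0] I) xw => //.
  - exact: selfadjoint_PdagP.
  - by move=> l -> /I0.
  - by rewrite -ker_PdagP.
apply/seteqP; split.
  apply: lin_span_sub => y [l Il yl].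
  have yl' : bop_app (PPdag Q) y = l%:C *: y by [].
  have l0 : l != 0 by apply: contra_notN I0 => /eqP <-.
  have xE : eigen_sum (PdagP Q) I (bop_app (adjoint Q) y).
    apply: lin_span_mem; exists l => //; rewrite /eigenspace_op /= !bop_compE.
    have e : bop_app Q (bop_app (adjoint Q) y) = l%:C *: y := yl'.
    by rewrite e linearZ.
  move: xE; rewrite wE => /lin_spanP[c cE]; apply/lin_spanP.
  exists (fun i => l^-1%:C * c i); rewrite size_map.
  under eq_bigr do rewrite -scalerA; rewrite -scaler_sumr map_sum -cE.
  have e : bop_app Q (bop_app (adjoint Q) y) = l%:C *: y := yl'.
  by rewrite e scalerA -rmorphM mulVf// scale1r.
move=> y /lin_spanP[c ->]; rewrite size_map map_sum.
have : eigen_sum (PdagP Q) I (\sum_(i < size w) c i *: w`_i).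
  by rewrite wE; apply/lin_spanP; exists c.
move=> [r rP ->]; rewrite linear_sum big_seq; apply: submod_sum => p pr.
rewrite linearZ; apply/submodZ/lin_span_mem; have [l Il pl] := rP p pr; exists l => //.
have e : bop_app (adjoint Q) (bop_app Q p.2) = l%:C *: p.2 := pl.
by rewrite /eigenspace_op /= !bop_compE e linearZ.
Qed.

Lemma spectral_gap_basis B lam s a m I : selfadjoint B -> spectral_gap B lam s a m -> I `<=` [set l | l <= lam] ->
  is_basis (eigen_sum B I) [seq y <- s | rayleigh B y \in I].
Proof.
move=> saB sg Il; have [os es al lm LB] := sg.
apply: eigen_sum_basis => //; first exact: spectral_gap_eigenlist sg.
move=> x l xs /Il /= ll xl; have := LB x xs; rewrite xl rinZl rinxx => h.
apply/eqP; rewrite -nrm_eq0 -sqrf_eq0 eq_le sqr_ge0 andbT.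
have := sqr_ge0 (nrm x); move: h; move: (nrm x ^+ 2) => xx; nra.
Qed.

Lemma eigen_sum_sub_basis B I J f : is_basis (eigen_sum B J) f -> I `<=` J ->
  exists v, is_basis (eigen_sum B I) v.
Proof.
move=> [fi fE] IJ.
have [|||v vP] := @basis_extend _ _ (lin_span (\bigcup_(l in I) eigenspace_op B l)) (size f) [::].
- move=> t ti tI; apply: lin_indep_size ti _ => x /tI xI.
  suff : eigen_sum B J x by rewrite fE.
  by move: xI; apply: lin_spanS => y [l Il yl]; exists l => //; exact: IJ.
- exact: lin_indep_nil.
- by [].
- by exists v.
Qed.

End EigenSums.

Section Transport.
Variables (R : realType) (H : hilbertType R) (lam : R) (Q : bop H).
Hypothesis lam0 : 0 < lam.
Local Notation A := (PdagP Q).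
Local Notation A' := (PPdag Q).
Local Notation V := (eigen_sum A `[0, lam]%classic).
Local Notation V' := (eigen_sum A' `[0, lam]%classic).
Local Notation Wp := (eigen_sum A `]0, lam]%classic).
Local Notation Wp' := (eigen_sum A' `]0, lam]%classic).

Variables (v w v' : seq H).
Hypotheses (bv : is_basis (ker_op Q) v) (bw : is_basis Wp w) (bv' : is_basis (ker_op (adjoint Q)) v').

Lemma itv_split : `[0, lam]%classic = [set 0] `|` `]0, lam]%classic.
Proof. by rewrite setU1itv// bnd_simp ltW. Qed.

Lemma itv_disj (l : R) : [set 0] l -> `]0, lam]%classic l -> False.
Proof. by move=> ->; rewrite /= in_itv /= ltxx. Qed.

Lemma basisV : is_basis V (v ++ w).
Proof.
rewrite itv_split; apply: split_basis => //; [exact: selfadjoint_PdagP|exact: itv_disj|].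
by rewrite -ker_PdagP.
Qed.

Lemma basisW' : is_basis Wp' [seq bop_app Q x | x <- w].
Proof. by apply: image_basis => //; rewrite /= in_itv /= ltxx. Qed.

Lemma basisV' : is_basis V' (v' ++ [seq bop_app Q x | x <- w]).
Proof.
rewrite itv_split; apply: split_basis; [exact: selfadjoint_PPdag|exact: itv_disj| |exact: basisW'].
by rewrite -ker_adjoint.
Qed.

Let Qw := [seq bop_app Q x | x <- w].

Variable alpha0 : dual_space (top_ext (ker_op (adjoint Q))).
Hypothesis alpha01 : dual_app alpha0 (top_wedge _ v') = 1.

(** A witness for [is_transport], which ensures that the choice in [transport] does not return its
    default value. *)
Definition the_transport (T : Det_le lam Q) : Det Q :=
  @pair_coord R H _ V' _ (v' ++ Qw) basisV T *: tens (top_wedge (ker_op Q) v) alpha0.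

Lemma the_transport_is : is_transport the_transport.
Proof.
split=> [a x y|x y alpha beta gamma [xK xs] [yW ys] h].
  rewrite /the_transport [pair_coord _ _ _](pair_coord_linear (v' ++ Qw) basisV a x y).
  by rewrite scalerDl scalerA.
have bWp' := basisW'; have bV := basisV; have bV' := basisV'.
have sx : size x = size v by rewrite xs (ldim_basis bv).
have sy : size y = size w by rewrite ys (ldim_basis bw).
have xv z : z \in x -> lin_span_set [set` v] z by move=> /xK; rewrite {1}bv.2.
have yw z : z \in y -> lin_span_set [set` w] z by move=> /yW; rewrite {1}bw.2.
rewrite /the_transport pair_coord_tens; last first.
  move=> z; rewrite bV.2 mem_cat => /orP[zx|zy]; apply/lin_span_cat.
    by exists z, 0; split; [exact: xv|exact: lin_span_set0|rewrite addr0].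
  by exists 0, z; split; [exact: lin_span_set0|exact: yw|rewrite add0r].
have -> : dual_app gamma (top_wedge V' (v' ++ Qw)) =
    dual_app alpha (top_wedge _ v') * dual_app beta (top_wedge _ Qw).
  apply: h; split.
  - by move=> z; exact: basis_mem.
  - by rewrite (ldim_basis bv').
  - by move=> z; exact: basis_mem bWp'.
  - by rewrite (ldim_basis bWp').
rewrite coef_cat//; [|by case: bV|by case: bv|by have [] := bw].
have -> : top_wedge (ker_op Q) x = coef x v *: top_wedge (ker_op Q) v.
  exact: top_wedge_coef.
have -> : top_wedge Wp' [seq bop_app Q x | x <- y] = coef y w *: top_wedge Wp' Qw.
  rewrite -(@coef_map _ _ (bop_app Q) w y)//; [|exact: bop_linear|by case: bw|by have [] := bWp'].
  apply: top_wedge_coef => //; last by rewrite !size_map.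
  move=> _ /mapP[z zy ->]; have /lin_spanP[c ->] := yw z zy.
  rewrite bWp'.2 linear_sum; apply: (@submod_sum _ _ (lin_span [set` Qw])) => i _.
  by rewrite linearZ; apply/submodZ/lin_span_mem/map_f; rewrite mem_nth.
rewrite dual_appZ tensZl scalerA.
have -> : alpha = dual_app alpha (top_wedge _ v') *: alpha0.
  by apply: (dual_ext bv'); rewrite dual_appZl alpha01 mulr1.
rewrite tensZr scalerA dual_appZl alpha01 mulr1; congr (_ *: _); ring.
Qed.

(** The defining formula, applied to v, w and a gamma that factors over v' and Qw, fixes the value
    on a generator. The coefficients are the base changes between e and v ++ w and between v' ++ Qw
    and f. *)
Lemma transportE e f gamma : is_basis V e -> is_basis V' f ->
  dual_app gamma (top_wedge V' f) = 1 ->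
  @transport R H lam Q (tens (top_wedge V e) gamma) =
  (coef e (v ++ w) * coef (v' ++ Qw) f) *: tens (top_wedge (ker_op Q) v) alpha0.
Proof.
move=> be bf gf.
have trP : is_transport (@transport R H lam Q).
  rewrite /transport; case: xgetP => [Phi _ //|/(_ the_transport)].
  by case; exact: the_transport_is.
have bWp' := basisW'; have bV := basisV; have bV' := basisV'.
have [trl trE] := trP.
have sev : size e = size (v ++ w) by exact: is_basis_size be bV.
have sfv : size (v' ++ Qw) = size f by exact: is_basis_size bV' bf.
have -> : top_wedge V e = coef e (v ++ w) *: top_wedge V (v ++ w).
  by apply: top_wedge_coef => // z; exact: basis_mem be.
rewrite tensZl (lin_scale trl) -scalerA; congr (_ *: _).
have [beta betaE] := dual_ex bWp' 1.
have [alpha alphaE] := dual_ex bv' (coef (v' ++ Qw) f).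
rewrite (trE v w alpha beta gamma); first last.
- move=> x y [xK xs] [yW ys]; rewrite alphaE betaE !top_coord_wedge// mul1r.
  have sx : size x = size v' by rewrite xs (ldim_basis bv').
  have sy : size y = size Qw by rewrite ys (ldim_basis bWp').
  have xv z : z \in x -> lin_span_set [set` v'] z by move=> /xK; rewrite {1}bv'.2.
  have yw z : z \in y -> lin_span_set [set` Qw] z by move=> /yW; rewrite {1}bWp'.2.
  have xyV z : z \in x ++ y -> V' z.
    rewrite bV'.2 mem_cat => /orP[zx|zy]; apply/lin_span_cat.
      by exists z, 0; split; [exact: xv|exact: lin_span_set0|rewrite addr0].
    by exists 0, z; split; [exact: lin_span_set0|exact: yw|rewrite add0r].
  have -> : top_wedge V' (x ++ y) = (coef (x ++ y) (v' ++ Qw) * coef (v' ++ Qw) f) *: top_wedge V' f.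
    rewrite (@top_wedge_coef _ _ _ f (x ++ y))//; last by rewrite size_cat sx sy -size_cat.
    congr (_ *: _); apply: coef_trans; rewrite ?size_cat ?sx ?sy//; first by rewrite -size_cat.
      by have [] := bV'.
    by move=> z zxy; have := xyV z zxy; rewrite {1}bV'.2.
  rewrite dual_appZ gf mulr1 coef_cat//; [|by case: bV'|by case: bv'|by have [] := bWp'].
  by rewrite mulrC mulrA.
- by split; [move=> z; exact: basis_mem bw|rewrite (ldim_basis bw)].
- by split; [move=> z; exact: basis_mem bv|rewrite (ldim_basis bv)].
rewrite betaE mul1r top_coord_wedge; last by move=> z; exact: basis_mem bWp'.
rewrite coefxx ?scale1r; last by have [] := bWp'.
have -> : alpha = coef (v' ++ Qw) f *: alpha0; last by rewrite tensZr.
apply: (dual_ext bv'); rewrite dual_appZl alpha01 alphaE top_coord_wedge; last first.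
  by move=> z; exact: basis_mem bv'.
by rewrite coefxx//; case: bv'.
Qed.

End Transport.

Section Transition.
Variables (R : realType) (H : hilbertType R).
Implicit Types (Q : bop H) (e f u v w : seq H).
Local Notation V Q lam := (eigen_sum (PdagP Q) `[0, lam]%classic).
Local Notation V' Q lam := (eigen_sum (PPdag Q) `[0, lam]%classic).

Lemma det_frames Q (lam : R) e f : 0 < lam ->
  is_basis (V Q lam) e -> is_basis (V' Q lam) f ->
  exists v w v', [/\ is_basis (ker_op Q) v,
    is_basis (eigen_sum (PdagP Q) `]0, lam]%classic) w & is_basis (ker_op (adjoint Q)) v'].
Proof.
move=> lam0 be bf.
have sub0 : [set 0] `<=` `[0, lam]%classic by move=> l ->; rewrite /= in_itv /= lexx ltW.
have [v bv] := eigen_sum_sub_basis be sub0; rewrite -ker_PdagP in bv.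
have [v' bv'] := eigen_sum_sub_basis bf sub0; rewrite -ker_adjoint in bv'.
have [|w bw] := @eigen_sum_sub_basis _ _ _ `]0, lam]%classic _ _ be; last by exists v, w, v'.
by apply: subset_itv; rewrite bnd_simp.
Qed.

Lemma det_gen Q v v' (g : dual_space (top_ext (ker_op (adjoint Q)))) :
  is_basis (ker_op Q) v -> is_basis (ker_op (adjoint Q)) v' ->
  dual_app g (top_wedge _ v') = 1 ->
  (forall x : Det Q, exists k, x = k *: tens (top_wedge (ker_op Q) v) g) /\
  tens (top_wedge (ker_op Q) v) g != 0.
Proof.
move=> bv bv' g1; split.
  by move=> x; eexists; exact: (@pair_coordP _ _ _ _ _ _ bv bv' _ g1).
apply/eqP => h; have := @pair_coord_tens _ _ _ (ker_op (adjoint Q)) _ v' bv v g (fun x => basis_mem bv).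
rewrite h g1 coefxx; last by have [] := bv.
by rewrite mulr1 => /esym/eqP; rewrite oner_eq0.
Qed.

Lemma basis_coef_neq0 (W : set H) e f : is_basis W e -> is_basis W f -> coef e f != 0.
Proof.
move=> be bf; have [ei eE] := be; have [fi fE] := bf.
have : coef e f * coef f e = 1.
  by apply: coef_inv => //; [exact: is_basis_size be bf|move=> z /(basis_mem be); rewrite fE].
by apply: contra_eqN => /eqP ->; rewrite mul0r eq_sym oner_eq0.
Qed.

Lemma transport_gen Q (lam : R) e f (g : dual_space (top_ext (V' Q lam))) : 0 < lam ->
  is_basis (V Q lam) e -> is_basis (V' Q lam) f -> dual_app g (top_wedge _ f) = 1 ->
  (forall x : Det Q, exists k, x = k *: @transport R H lam Q (tens (top_wedge _ e) g)) /\
  @transport R H lam Q (tens (top_wedge _ e) g) != 0.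
Proof.
move=> lam0 be bf g1; have [v [w [v' [bv bw bv']]]] := det_frames lam0 be bf.
have [a aE] := dual_ex bv' 1.
have a1 : dual_app a (top_wedge _ v') = 1.
  rewrite aE top_coord_wedge; last by move=> z; exact: basis_mem bv'.
  by rewrite coefxx ?mulr1//; have [] := bv'.
have [gen nz] := det_gen bv bv' a1.
rewrite (transportE lam0 bv bw bv' a1 be bf g1).
have c1 : coef e (v ++ w) * coef (v' ++ [seq bop_app Q x | x <- w]) f != 0.
  by rewrite mulf_neq0 ?(basis_coef_neq0 be (basisV lam0 bv bw)) ?(basis_coef_neq0 (basisV' lam0 bw bv') bf).
split; last by rewrite scaler_eq0 (negbTE c1).
move=> x; have [k ->] := gen x; exists (k / (coef e (v ++ w) * coef (v' ++ [seq bop_app Q x | x <- w]) f)).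
by rewrite scalerA divfK.
Qed.

(** For invertible Q both kernels vanish, and the transport becomes the determinant of Q with
    respect to the frames e and f. Here the determinant of P_t enters. *)
Lemma transport_inv Q (lam : R) e f (g : dual_space (top_ext (V' Q lam)))
    (a : dual_space (top_ext (ker_op (adjoint Q)))) : 0 < lam ->
  (forall x, bop_app Q x = 0 -> x = 0) -> (forall x, bop_app (adjoint Q) x = 0 -> x = 0) ->
  is_basis (V Q lam) e -> is_basis (V' Q lam) f -> dual_app g (top_wedge _ f) = 1 ->
  dual_app a (top_wedge _ [::]) = 1 ->
  @transport R H lam Q (tens (top_wedge _ e) g) =
  coef [seq bop_app Q x | x <- e] f *: tens (top_wedge (ker_op Q) [::]) a.
Proof.
move=> lam0 Q0 Q0' be bf g1 a1.
have [_ [w [_ [_ bw _]]]] := det_frames lam0 be bf.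
have bv : is_basis (ker_op Q) [::].
  by apply: is_basis_nil => //; rewrite /ker_op /= linear0.
have bv' : is_basis (ker_op (adjoint Q)) [::].
  by apply: is_basis_nil => //; rewrite /ker_op /= linear0.
rewrite (transportE lam0 bv bw bv' a1 be bf g1) !cat0s.
suff -> : coef e w * coef [seq bop_app Q x | x <- w] f = coef [seq bop_app Q x | x <- e] f by [].
have bV := basisV lam0 bv bw; have bV' := basisV' lam0 bw bv'.
have [wi wE] := bV; have [wi' wE'] := bV'.
have sz : size e = size w by exact: is_basis_size be bV.
have ew z : z \in e -> lin_span_set [set` w] z by move=> /(basis_mem be); rewrite wE.
rewrite -(@coef_map _ _ (bop_app Q) w e)//; last exact: bop_linear.
rewrite -coef_trans//; first by rewrite !size_map.
  by rewrite -(is_basis_size bV' bf).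
move=> _ /mapP[z ze ->]; have /lin_spanP[c ->] := ew z ze.
rewrite linear_sum; apply: (@submod_sum _ _ (lin_span [set` [seq bop_app Q x | x <- w]])) => i _.
by rewrite linearZ; apply/submodZ/lin_span_mem/map_f; rewrite mem_nth.
Qed.

(** The transition between two levels involves only the frames, vectors u completing e1, and their
    images under Q; bases of the kernels cancel. The formula is thus continuous in Q even where the
    dimension of Ker Q jumps. *)
Lemma transitionE Q (lam1 lam2 : R) e1 f1 e2 f2 u
    (g1 : dual_space (top_ext (V' Q lam1))) (g2 : dual_space (top_ext (V' Q lam2))) :
  0 < lam1 -> lam1 <= lam2 ->
  is_basis (V Q lam1) e1 -> is_basis (V' Q lam1) f1 -> dual_app g1 (top_wedge _ f1) = 1 ->
  is_basis (V Q lam2) e2 -> is_basis (V' Q lam2) f2 -> dual_app g2 (top_wedge _ f2) = 1 ->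
  lin_indep (e1 ++ u) -> size (e1 ++ u) = size e2 -> (forall z, z \in u -> V Q lam2 z) ->
  @transport R H lam2 Q (tens (top_wedge _ e2) g2) =
  (coef e2 (e1 ++ u) * coef (f1 ++ [seq bop_app Q x | x <- u]) f2) *:
    @transport R H lam1 Q (tens (top_wedge _ e1) g1).
Proof.
move=> lam10 lam12 be1 bf1 g11 be2 bf2 g21 eui eus uV.
have lam20 : 0 < lam2 by rewrite (lt_le_trans lam10).
have [v [w1 [v' [bv bw1 bv']]]] := det_frames lam10 be1 bf1.
have [|w2 bw2] := @eigen_sum_sub_basis _ _ _ `]lam1, lam2]%classic _ _ be2.
  by apply: subset_itv; rewrite bnd_simp// ltW.
have bw12 : is_basis (eigen_sum (PdagP Q) `]0, lam2]%classic) (w1 ++ w2).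
  have -> : `]0, lam2]%classic = `]0, lam1]%classic `|` `]lam1, lam2]%classic.
    by rewrite -itv_bndbnd_setU// bnd_simp// ltW.
  apply: split_basis => //; first exact: selfadjoint_PdagP.
  by move=> l; rewrite /= !in_itv /= => /andP[_ h1] /andP[h2 _]; lra.
have [a aE] := dual_ex bv' 1.
have a1 : dual_app a (top_wedge _ v') = 1.
  rewrite aE top_coord_wedge; last by move=> z; exact: basis_mem bv'.
  by rewrite coefxx ?mulr1//; have [] := bv'.
rewrite (transportE lam10 bv bw1 bv' a1 be1 bf1 g11) (transportE lam20 bv bw12 bv' a1 be2 bf2 g21).
rewrite scalerA; congr (_ *: _); rewrite map_cat !catA.
have bV1 := basisV lam10 bv bw1; have bV1' := basisV' lam10 bw1 bv'.
have bV2 := basisV lam20 bv bw12; have bV2' := basisV' lam20 bw12 bv'.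
rewrite map_cat !catA in bV2 bV2'.
set z := v ++ w1 in bV1 bV2 *; set z' := v' ++ _ in bV1' bV2' *.
set Qw2 := [seq bop_app Q x | x <- w2] in bV2' *; set Qu := [seq bop_app Q x | x <- u].
have Qz x : lin_span_set [set` z] x -> lin_span_set [set` z'] (bop_app Q x).
  move=> /lin_span_cat[x1 [x2 [x1v x2w ->]]].
  have Qx1 : bop_app Q x1 = 0 by have : ker_op Q x1 by rewrite bv.2.
  rewrite linearD /= Qx1 add0r; have /lin_spanP[c ->] := x2w.
  rewrite linear_sum; apply: (@submod_sum _ _ (lin_span [set` z'])) => i _.
  rewrite linearZ; apply/submodZ/lin_span_mem => /=.
  by rewrite mem_cat map_f ?orbT// mem_nth.
have sz1 : size e1 = size z by exact: is_basis_size be1 bV1.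
have sz1' : size f1 = size z' by exact: is_basis_size bf1 bV1'.
have sz2 : size e2 = size (z ++ w2) by exact: is_basis_size be2 bV2.
have sz2' : size f2 = size (z' ++ Qw2) by exact: is_basis_size bf2 bV2'.
have su : size u = size w2.
  by apply: (@addnI (size z)); rewrite -{1}sz1 -(size_cat e1) -(size_cat z) eus.
(* q x is the component of x along w2. Since Q maps span z to span z' and w2 to Qw2, the
   determinants of u modulo z and of Qu modulo z' are the same number ([k1], [k2]). *)
have /choice[q qP] x : exists y, V Q lam2 x -> lin_span_set [set` w2] y /\ lin_span_set [set` z] (x - y).
  have [xV|] := pselect (V Q lam2 x); last by exists 0.
  move: xV; rewrite bV2.2 => /lin_span_cat[y1 [y2 [y1z y2w ->]]].
  by exists y2 => _; rewrite addrK.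
have [zi zE] := bV1; have [zi' zE'] := bV1'; have [zwi zwE] := bV2; have [zwi' zwE'] := bV2'.
have w2i : lin_indep w2 by have [] := bw2.
have Qw2i : lin_indep Qw2.
  have [] := @image_basis _ _ Q `]lam1, lam2]%classic w2 _ bw2 => //.
  by rewrite /= in_itv /= => /andP[h _]; move: lam10 h; lra.
have k1 : coef (z ++ u) (z ++ w2) = coef [seq q x | x <- u] w2.
  rewrite (@alt_mod _ _ (size (z ++ w2)) (fun s => coef s (z ++ w2)) z u [seq q x | x <- u]); first last.
  - move=> i; have [iu|ui] := ltnP i (size u).
      by rewrite (nth_map 0)//; apply: (qP _ _).2; apply: uV; rewrite mem_nth.
    by rewrite !nth_default ?size_map// subrr; exact: lin_span_set0.
  - by rewrite size_map.
  - exact: coef_alt.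
  rewrite coef_cat// ?size_map//; first by rewrite coefxx// mul1r.
    by move=> x; exact: lin_span_mem.
  by move=> _ /mapP[x xu ->]; apply: (qP _ _).1; exact: uV.
have k2 : coef (z' ++ Qu) (z' ++ Qw2) = coef [seq q x | x <- u] w2.
  rewrite (@alt_mod _ _ (size (z' ++ Qw2)) (fun s => coef s (z' ++ Qw2)) z' Qu
     [seq bop_app Q x | x <- [seq q x | x <- u]]); first last.
  - move=> i; have [iu|ui] := ltnP i (size u).
      rewrite !(nth_map 0) ?size_map// -linearB; apply: Qz.
      by apply: (qP _ _).2; apply: uV; rewrite mem_nth.
    by rewrite !nth_default ?size_map// subrr; exact: lin_span_set0.
  - by rewrite !size_map.
  - exact: coef_alt.
  have qw x : x \in [seq q x | x <- u] -> lin_span_set [set` w2] x.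
    by move=> /mapP[y yu ->]; apply: (qP _ _).1; exact: uV.
  rewrite coef_cat// ?size_map//; first last.
  - move=> _ /mapP[x /qw/lin_spanP[c ->] ->]; rewrite linear_sum.
    apply: (@submod_sum _ _ (lin_span [set` Qw2])) => i _.
    by rewrite linearZ; apply/submodZ/lin_span_mem/map_f; rewrite mem_nth.
  - by move=> x; exact: lin_span_mem.
  rewrite coefxx// mul1r coef_map//; first exact: bop_linear.
  by rewrite size_map.
rewrite (@coef_trans _ _ e2 (e1 ++ u) (z ++ w2))//; first last.
- move=> x xe; suff : V Q lam2 x.
    have beu : is_basis (V Q lam2) (e1 ++ u).
      apply: (is_basis_sub be2 eui) => // y; rewrite mem_cat => /orP[ye|/uV//].
      have : V Q lam1 y by exact: basis_mem ye.
      apply: lin_spanS => t [l ll lt]; exists l => //; move: ll.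
      by rewrite /= !in_itv /= => /andP[-> h]; exact: le_trans lam12.
    by rewrite beu.2.
  exact: basis_mem xe.
- by rewrite eus.
have zz x : x \in e1 -> lin_span_set [set` z] x by move=> /(basis_mem be1); rewrite zE.
have zz' x : x \in f1 -> lin_span_set [set` z'] x by move=> /(basis_mem bf1); rewrite zE'.
rewrite (@coef_catl _ _ z w2 e1 u)// k1.
rewrite (@coef_trans _ _ (f1 ++ Qu) (z' ++ Qw2) f2)//; first last.
- move=> x; rewrite mem_cat => /orP[/zz' h|/mapP[y yu ->]].
    by apply/lin_span_cat; exists x, 0; split => //; [exact: lin_span_set0|rewrite addr0].
  have := uV y yu; rewrite zwE => /lin_span_cat[y1 [y2 [y1z y2w ->]]].
  apply/lin_span_cat; exists (bop_app Q y1), (bop_app Q y2); split; [exact: Qz| |exact: linearD].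
  have /lin_spanP[c ->] := y2w; rewrite linear_sum.
  apply: (@submod_sum _ _ (lin_span [set` Qw2])) => i _.
  by rewrite linearZ; apply/submodZ/lin_span_mem/map_f; rewrite mem_nth.
- by rewrite (size_cat f1) (size_cat z') sz1' /Qu /Qw2 !size_map su.
rewrite (@coef_catl _ _ z' Qw2 f1 Qu)// ?size_map// k2.
(* The target side is dual to the source side, so its base change appears inverted and has to be
   cancelled. *)
have cc : coef f1 z' * coef z' f1 = 1 by apply: coef_inv => //; have [] := bf1.
rewrite -[LHS]mulr1 -cc; ring.
Qed.

End Transition.

(** * The topology of the determinant bundle *)

Section ListConvergence.
Variables (R : realType) (H : hilbertType R).
Local Notation C := (R[i]^o).

Section Filter.
Context (T : Type) (F : set_system T) {FF : Filter F}.

Lemma cvg_mulC (f g : T -> C) (a b : R[i]) : f @ F --> (a : C) -> g @ F --> (b : C) ->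
  (fun t => f t * g t : C) @ F --> (a * b : C).
Proof. by move=> fa gb; exact: (cvg_scale fa gb). Qed.

Lemma cvg_invC (f : T -> C) (a : R[i]) : a != 0 -> f @ F --> (a : C) ->
  (fun t => (f t)^-1 : C) @ F --> (a^-1 : C).
Proof. move=> a0 fa. exact: (@cvgV R[i] T F FF f a a0 fa). Qed.

Lemma cvg_bigsum (V : normedModType R[i]) I (r : seq I) (f : I -> T -> V) (a : I -> V) :
  (forall i, f i @ F --> a i) ->
  (fun t => \sum_(i <- r) f i t) @ F --> \sum_(i <- r) a i.
Proof.
move=> fa; elim: r => [|i r IH].
  rewrite big_nil; under eq_fun do rewrite big_nil; exact: cvg_cst.
by rewrite big_cons; under eq_fun do rewrite big_cons; exact: cvgD.
Qed.

Lemma cvg_bigprod I (r : seq I) (f : I -> T -> C) (a : I -> R[i]) :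
  (forall i, f i @ F --> (a i : C)) ->
  (fun t => \prod_(i <- r) f i t : C) @ F --> (\prod_(i <- r) a i : C).
Proof.
move=> fa; elim: r => [|i r IH].
  rewrite big_nil; under eq_fun do rewrite big_nil; exact: cvg_cst.
by rewrite big_cons; under eq_fun do rewrite big_cons; exact: (cvg_mulC (fa i) IH).
Qed.

Lemma cvg_det n (A : T -> 'M[R[i]]_n) (B : 'M[R[i]]_n) :
  (forall i j, (fun t => A t i j : C) @ F --> (B i j : C)) ->
  (fun t => \det (A t) : C) @ F --> (\det B : C).
Proof.
move=> AB; rewrite /determinant; apply: (@cvg_bigsum C) => s.
by apply: cvg_mulC; [exact: cvg_cst|apply: cvg_bigprod => i; exact: AB].
Qed.

Definition cvgl (s : T -> seq H) (s0 : seq H) := (forall t, size (s t) = size s0) /\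
  forall i, (fun t => (s t)`_i) @ F --> s0`_i.

Lemma cvg_gram s t s0 t0 : cvgl s s0 -> cvgl t t0 ->
  (fun x => gram (s x) (t x) : C) @ F --> (gram s0 t0 : C).
Proof.
move=> [ss sc] [ts tc]; have [st|st] := eqVneq (size s0) (size t0); last first.
  rewrite /gram (negbTE st); under eq_fun do rewrite ss ts (negbTE st); exact: cvg_cst.
have gE n (a b : seq H) : size a = n -> size b = n ->
    gram a b = \det (\matrix_(i < n, j < n) inner a`_i b`_j).
  by move=> an bn; rewrite /gram an bn eqxx.
rewrite (gE (size t0))//.
under eq_fun => x do rewrite (gE (size t0) (s x) (t x) (etrans (ss x) st) (ts x)).
apply: cvg_det => i j; rewrite mxE; under eq_fun do rewrite mxE.
exact: cvg_inner.
Qed.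

Lemma cvg_coef s t s0 t0 : lin_indep t0 -> cvgl s s0 -> cvgl t t0 ->
  (fun x => coef (s x) (t x) : C) @ F --> (coef s0 t0 : C).
Proof.
move=> ti ss tt; apply: cvg_mulC; first exact: cvg_gram.
by apply: cvg_invC; [exact: gram_neq0|exact: cvg_gram].
Qed.

Lemma near_lin_indep t t0 : lin_indep t0 -> cvgl t t0 -> \forall x \near F, lin_indep (t x).
Proof.
move=> ti tt; have h := cvg_gram tt tt; have g0 := gram_neq0 ti.
have /cvg_nrmP/(_ (nrm (gram t0 t0 : C))) := h; rewrite nrm_gt0 => /(_ g0).
apply: filterS => x; move=> lt; apply: gram_lin_indep; apply: contraTN lt => /eqP ->.
by rewrite sub0r nrmN ltxx.
Qed.

Lemma cvgl_cat s t s0 t0 : cvgl s s0 -> cvgl t t0 -> cvgl (fun x => s x ++ t x) (s0 ++ t0).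
Proof.
move=> [ss sc] [ts tc]; split=> [x|i]; first by rewrite !size_cat ss ts.
rewrite nth_cat; under eq_fun do rewrite nth_cat ss.
by case: ifP => _; [exact: sc|exact: tc].
Qed.

Lemma cvgl_map (I : eqType) (r : seq I) (f : I -> T -> H) (a : I -> H) :
  (forall i, i \in r -> f i @ F --> a i) ->
  cvgl (fun x => [seq f i x | i <- r]) [seq a i | i <- r].
Proof.
move=> fa; split=> [x|k]; first by rewrite !size_map.
elim: r fa k => [|i r IH] fa k.
  by under eq_fun do rewrite nth_nil; rewrite nth_nil; exact: cvg_cst.
case: k => [|k] /=; first by apply: fa; rewrite mem_head.
by apply: IH => j jr; apply: fa; rewrite in_cons jr orbT.
Qed.

Lemma cvgl_bop (p : T -> bop H) (P : bop H) s s0 : p @ F --> P -> cvgl s s0 ->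
  cvgl (fun x => [seq bop_app (p x) y | y <- s x]) [seq bop_app P y | y <- s0].
Proof.
move=> pP [ss sc]; split=> [x|i]; first by rewrite !size_map.
have [is0|si] := ltnP i (size s0).
  rewrite (nth_map 0)//; under eq_fun do rewrite (nth_map 0) ?ss//.
  exact: cvg_bop_app.
rewrite nth_default ?size_map//; under eq_fun do rewrite nth_default ?size_map ?ss//.
exact: cvg_cst.
Qed.

End Filter.
End ListConvergence.

Lemma open_setX (X Y : topologicalType) (A : set X) (B : set Y) : open A -> open B -> open (A `*` B).
Proof.
move=> oA oB; rewrite openE => -[x y] [/= Ax By]; exists (A, B) => //=.
by split; exact: open_nbhs_nbhs.
Qed.

Lemma with_topology_openE (T : Type) (tau : topology T) (W : set (with_topology tau)) :
  open W = opens tau W.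
Proof. by []. Qed.

Section DetFrames.
Variables (R : realType) (H : hilbertType R).
Local Notation C := (R[i]^o).
Implicit Types (P Q : Fred H) (U : set (Fred H)) (lam : R) (e f : seq (Fred H -> H)).
Implicit Types (tau : forall P : Fred H, Det (set_val P)).
Local Notation V P lam := (eigen_sum (PdagP (set_val P)) `[0, lam]%classic).
Local Notation V' P lam := (eigen_sum (PPdag (set_val P)) `[0, lam]%classic).

Definition det_frame U lam e f tau := [/\ open U,
  0 < lam /\ (forall P, U P -> ~ spec (PdagP (set_val P)) lam%:C /\
    forall l : R, 0 <= l <= lam -> ~ spec_ess (PdagP (set_val P)) l%:C),
  continuous_frame U (fun P => V P lam) e, continuous_frame U (fun P => V' P lam) f &
  forall P, U P -> exists2 gamma, dual_app gamma (top_wedge _ [seq s P | s <- f]) = 1 &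
    tau P = @transport R H lam (set_val P) (tens (top_wedge _ [seq s P | s <- e]) gamma)].

Lemma cvg_frame U (W : Fred H -> set H) e P : open U -> continuous_frame U W e -> U P ->
  cvgl (nbhs P) (fun Q => [seq s Q | s <- e]) [seq s P | s <- e].
Proof.
move=> oU [ec _] UP; apply: (@cvgl_map _ _ _ (nbhs P) (nbhs_filter P) (Fred H -> H) e (fun s => s) (fun s => s P)).
move=> s se; have := ec s se; rewrite (continuous_open_subspace _ oU) => /(_ P).
by apply; rewrite inE.
Qed.

Lemma det_frame_gen U lam e f tau P : det_frame U lam e f tau -> U P ->
  (forall x : Det (set_val P), exists k, x = k *: tau P) /\ tau P != 0.
Proof.
move=> [oU [l0 _] [_ be] [_ bf] tE] UP; have [g g1 ->] := tE _ UP.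
by apply: (@transport_gen _ _ (set_val P) lam [seq s P | s <- e] _ g l0 _ _ g1); [exact: be|exact: bf].
Qed.

Lemma near_nz (T : Type) (F : set_system T) {FF : Filter F} (f : T -> C) (a : R[i]) :
  a != 0 -> f @ F --> (a : C) -> \forall t \near F, f t != 0.
Proof.
move=> a0 /cvg_nrmP/(_ (nrm (a : C))); rewrite nrm_gt0 => /(_ a0).
apply: filterS => x; move=> lt; apply: contraTneq lt => ->.
by rewrite sub0r nrmN ltxx.
Qed.

(** The basis e1 of the smaller space is completed at P by vectors w; writing these in the frame e2
    with constant coefficients extends them continuously to nearby Q as u Q. Independence of e1 ++ u
    is an open condition, and [transitionE] then exhibits the transition function as a product of
    continuous coefficients. *)
Lemma transition_le U1 U2 l1 l2 e1 e2 f1 f2 tau1 tau2 P :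
  det_frame U1 l1 e1 f1 tau1 -> det_frame U2 l2 e2 f2 tau2 -> U1 P -> U2 P -> l1 <= l2 ->
  exists2 r : Fred H -> C, r @ P --> r P & \forall Q \near P, tau2 Q = r Q *: tau1 Q.
Proof.
move=> F1 F2 U1P U2P l12; have [oU1 [l10 _] c1 d1 t1] := F1; have [oU2 [l20 _] c2 d2 t2] := F2.
have [_ be1] := c1; have [_ bf1] := d1; have [_ be2] := c2; have [_ bf2] := d2.
pose E1 Q := [seq s Q | s <- e1]; pose E2 Q := [seq s Q | s <- e2].
pose G1 Q := [seq s Q | s <- f1]; pose G2 Q := [seq s Q | s <- f2].
have V12 Q x : V Q l1 x -> V Q l2 x.
  apply: lin_spanS => t [l ll lt]; exists l => //; move: ll.
  by rewrite /= !in_itv /= => /andP[-> h]; exact: le_trans l12.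
have [b2i b2E] := be2 P U2P; have [b1i b1E] := be1 P U1P.
have [|||w [wi wE]] := @basis_extend _ _ (lin_span (\bigcup_(l in `[0, l2]%classic) eigenspace_op (PdagP (set_val P)) l)) (size (E2 P)) (E1 P).
- move=> t ti tI; apply: lin_indep_size ti _ => x /tI xI.
  suff : V P l2 x by rewrite b2E.
  by [].
- exact: b1i.
- by move=> x x1; apply: V12; exact: basis_mem (be1 P U1P) x1.
have bw : is_basis (V P l2) (E1 P ++ w) by split.
have /choice[c cE] : forall x, exists c : nat -> R[i], x \in w -> x = \sum_(k < size e2) c k *: (E2 P)`_k.
  move=> x; have [xw|] := boolP (x \in w); last by exists (fun=> 0).
  have : lin_span_set [set` E2 P] x.
    rewrite -[lin_span_set _]b2E; apply: basis_mem bw _; by rewrite mem_cat xw orbT.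
  by move=> /lin_spanP[k ->]; exists k => _; rewrite size_map.
pose u Q := [seq \sum_(k < size e2) c x k *: (E2 Q)`_k | x <- w].
have uP : u P = w.
  rewrite /u -[RHS]map_id; apply/eq_in_map => x xw /=.
  by rewrite -cE.
have E1c := cvg_frame oU1 c1 U1P; have E2c := cvg_frame oU2 c2 U2P.
have G1c := cvg_frame oU1 d1 U1P; have G2c := cvg_frame oU2 d2 U2P.
have uc : cvgl (nbhs P) u (u P).
  apply: cvgl_map => x xw; apply: cvg_bigsum => k; apply: cvg_scale; first exact: cvg_cst.
  by case: E2c => _; apply.
have Qc : set_val @ P --> (set_val P : bop H) by exact: initial_continuous.
have EuI : \forall Q \near P, lin_indep (E1 Q ++ u Q).
  by apply: (@near_lin_indep _ _ _ _ (nbhs_filter P) (fun Q => E1 Q ++ u Q) (E1 P ++ u P)); [rewrite uP|exact: cvgl_cat].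
exists (fun Q => coef (E2 Q) (E1 Q ++ u Q) * coef (G1 Q ++ [seq bop_app (set_val Q) x | x <- u Q]) (G2 Q)).
  have EuI0 : lin_indep (E1 P ++ u P) by rewrite uP.
  have h1 := @cvg_coef _ _ _ _ (nbhs_filter P) E2 (fun Q => E1 Q ++ u Q) (E2 P) (E1 P ++ u P) EuI0 E2c (cvgl_cat E1c uc).
  have bfi : lin_indep (G2 P) by case: (bf2 P U2P).
  have h2 : (fun Q => coef (G1 Q ++ [seq bop_app (set_val Q) x | x <- u Q]) (G2 Q) : C) @ P -->
      (coef (G1 P ++ [seq bop_app (set_val P) x | x <- u P]) (G2 P) : C).
    by apply: (@cvg_coef _ _ _ _ (nbhs_filter P)) => //; apply: cvgl_cat => //; exact: (cvgl_bop Qc uc).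
  exact: (cvg_mulC h1 h2).
have U12 : \forall Q \near P, U1 Q /\ U2 Q.
  by apply: filterI; exact: open_nbhs_nbhs.
near=> Q; have [U1Q U2Q] : U1 Q /\ U2 Q by near: Q.
have [g1 g11 ->] := t1 Q U1Q; have [g2 g21 ->] := t2 Q U2Q.
apply: (transitionE l10 l12 (be1 Q U1Q) (bf1 Q U1Q) g11 (be2 Q U2Q) (bf2 Q U2Q) g21).
- by near: Q.
- rewrite -uP in bw; rewrite /E2 size_cat !size_map -(size_map (fun s => s P) e1) -(size_map (fun s => s P) e2).
  by rewrite -(is_basis_size bw (be2 P U2P)) size_cat !size_map.
- move=> _ /mapP[x xw ->]; apply: submod_sum => k _; apply: submodZ.
  by apply: (basis_mem (be2 Q U2Q)); rewrite mem_nth// size_map.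
Unshelve. all: by end_near.
Qed.

Lemma transition U1 U2 l1 l2 e1 e2 f1 f2 tau1 tau2 P :
  det_frame U1 l1 e1 f1 tau1 -> det_frame U2 l2 e2 f2 tau2 -> U1 P -> U2 P ->
  exists2 r : Fred H -> C, r @ P --> r P & \forall Q \near P, tau2 Q = r Q *: tau1 Q.
Proof.
move=> F1 F2 U1P U2P; have [l12|/ltW l21] := leP l1 l2; first exact: (transition_le F1 F2).
have [r rc rE] := transition_le F2 F1 U2P U1P l21.
have rP : r P != 0.
  have := nbhs_singleton rE; have [_] := det_frame_gen F1 U1P.
  by move=> t0 h; apply: contraNneq t0 => rP; rewrite h rP scale0r.
exists (fun Q => (r Q)^-1); first exact: (cvg_invC rP rc).
have rN := @near_nz _ _ (nbhs_filter P) r _ rP rc; near=> Q.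
have -> : tau1 Q = r Q *: tau2 Q by near: Q.
by rewrite scalerA mulVf ?scale1r//; near: Q.
Unshelve. all: by end_near.
Qed.

Definition det_atlas U tau := exists lam e f, det_frame U lam e f tau.

Lemma det_frame_open U lam e f tau (W : set (total_space (det_bundle H))) : det_frame U lam e f tau -> open W ->
  open [set p : Fred H * C | U p.1 /\ W (in_total (L := det_bundle H) (p.2 *: tau p.1))].
Proof.
move=> [oU l0 ce cf tE] oW.
have := oW (U `*` setT) (fun p => in_total (L := det_bundle H) (p.2 *: tau p.1)).
have -> : (U `*` setT) `&` (fun p : Fred H * C => in_total (L := det_bundle H) (p.2 *: tau p.1)) @^-1` W =
    [set p : Fred H * C | U p.1 /\ W (in_total (L := det_bundle H) (p.2 *: tau p.1))].
  by apply/seteqP; split=> p /= => [[[]]|[]].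
apply; first exact: (open_setX oU (@openT C)).
exists U, lam, e, f; split; [by split|exact: l0|exact: ce|exact: cf|].
move=> P c UP; have [g g1 tP] := tE P UP.
by exists g; [exact: g1|rewrite -tP].
Qed.

(** The final topology refers to all maps g that induce a trivialisation. On U such a g coincides
    with the chart of a single frame tau, because gamma is determined by its value on f, so the
    charts of [det_atlas] suffice. *)
Lemma open_det_total (W : set (total_space (det_bundle H))) :
  (forall U tau, det_atlas U tau ->
    open [set p : Fred H * C | U p.1 /\ W (in_total (L := det_bundle H) (p.2 *: tau p.1))]) -> open W.
Proof.
move=> h; rewrite /total_space with_topology_openE; move=> U0 g oU0 [U [mu [e [f [[oU U0E] l0 ce cf gE]]]]]; subst U0.
pose ga P : dual_space (top_ext (V' P mu)) :=
  xget 0 [set ga | dual_app ga (top_wedge (V' P mu) [seq s P | s <- f]) = 1].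
have gaE P : U P -> dual_app (ga P) (top_wedge (V' P mu) [seq s P | s <- f]) = 1.
  by move=> UP; have [g0 g1 _] := gE P 1 UP; rewrite /ga; case: xgetP => [x _ //|/(_ g0)]; case.
pose tau P := @transport R H mu (set_val P) (tens (top_wedge _ [seq s P | s <- e]) (ga P)).
have gE' P c : U P -> g (P, c) = in_total (L := det_bundle H) (c *: tau P).
  move=> UP; have [ga' g1' ->] := gE P c UP; rewrite /tau.
  suff -> : ga' = ga P by [].
  by apply: (dual_ext (proj2 cf P UP)); rewrite g1' gaE.
have := h U tau; set B := [set p : Fred H * C | _].
have -> : (U `*` setT) `&` g @^-1` W = B.
  apply/seteqP; split=> -[P c].
    by move=> [[/= UP _]]; rewrite /preimage /= gE'.
  by move=> [/= UP WP]; split=> //; rewrite /preimage /= gE'.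
apply; exists mu, e, f; split=> // P UP; exists (ga P) => //; exact: gaE.
Qed.

End DetFrames.

Lemma scale_inj (K : fieldType) (L : lmodType K) (v : L) (a b : K) : v != 0 -> a *: v = b *: v -> a = b.
Proof. by move=> v0 /eqP; rewrite -subr_eq0 -scalerBl scaler_eq0 (negbTE v0) orbF subr_eq0 => /eqP. Qed.

Lemma nbhs_openP (Y : topologicalType) (y : Y) (W : set Y) : nbhs y W ->
  exists B, [/\ open B, B y & B `<=` W].
Proof. by rewrite nbhsE => -[B [oB By] BW]; exists B. Qed.

Lemma cvg_near_eq (T : Type) (F : set_system T) {FF : Filter F} (Y : topologicalType)
    (f g : T -> Y) (l : Y) : f @ F --> l -> (\forall t \near F, f t = g t) -> g @ F --> l.
Proof.
move=> fl fg W /fl Wf; have : \forall t \near F, W (f t) /\ f t = g t by exact: filterI.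
by apply: filterS => t [/= Wt h]; rewrite /preimage /= -h.
Qed.

(** * Line bundles described by an atlas of frames *)

Section Bundle.
Variables (R : realType) (X : topologicalType) (L : line_bundle_data R X).
Local Notation C := (R[i]^o).
Local Notation Tot := (total_space L).
Implicit Types (x y : X) (U : set X) (tau : forall x, fiber L x).

Definition tot x (v : fiber L x) : Tot := in_total v.

(** All that the study of the transgression uses about L: nonvanishing local frames with continuous
    transition functions, which determine the topology of the total space. The charts need not cover
    X; [framed] asks for frames only along the loop in question. *)
Definition is_atlas (atlas : set X -> (forall x, fiber L x) -> Prop) := [/\
  forall U tau, atlas U tau -> open U,
  forall U tau x, atlas U tau -> U x ->
    (forall v : fiber L x, exists k, v = k *: tau x) /\ tau x != 0,
  forall U1 U2 tau1 tau2 x, atlas U1 tau1 -> atlas U2 tau2 -> U1 x -> U2 x ->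
    exists2 r : X -> C, r @ x --> r x & \forall y \near x, tau2 y = r y *: tau1 y,
  forall U tau (W : set Tot), atlas U tau -> open W ->
    open [set p : X * C | U p.1 /\ W (tot (p.2 *: tau p.1))] &
  forall W : set Tot, (forall U tau, atlas U tau ->
    open [set p : X * C | U p.1 /\ W (tot (p.2 *: tau p.1))]) -> open W].

Variable atlas : set X -> (forall x, fiber L x) -> Prop.
Hypothesis atlasP : is_atlas atlas.

Definition tbase (p : Tot) : X := projT1 p.
Definition tvec (p : Tot) : fiber L (tbase p) := projT2 p.
Definition tcoord tau (p : Tot) : R[i] := xget 0 [set k | tvec p = k *: tau (tbase p)].

Definition frame_at tau x := exists2 U, atlas U tau & U x.

Lemma frame_at_gen tau x : frame_at tau x ->
  (forall v : fiber L x, exists k, v = k *: tau x) /\ tau x != 0.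
Proof. by case: atlasP => _ g _ _ _ [U a Ux]; exact: g a Ux. Qed.

Lemma frame_at_near tau x : frame_at tau x -> \forall y \near x, frame_at tau y.
Proof.
case: atlasP => op _ _ _ _ [U a Ux].
have : nbhs x U by apply: open_nbhs_nbhs; split=> //; exact: op a.
by apply: filterS => y Uy; exists U.
Qed.

Lemma tcoordE tau x (k : R[i]) : frame_at tau x -> tcoord tau (tot (k *: tau x)) = k.
Proof.
move=> /frame_at_gen[_ t0]; rewrite /tcoord; case: xgetP => [k' _ h|/(_ k)]; last by case.
exact/esym/(scale_inj t0).
Qed.

Lemma totP tau (p : Tot) : frame_at tau (tbase p) -> p = tot (tcoord tau p *: tau (tbase p)).
Proof.
case: p => x v fx; have [gen _] := frame_at_gen fx; have [k kE] := gen v.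
have vE : existT (fun x => fiber L x) x v = tot (k *: tau x) by rewrite /tot /in_total -kE.
have -> : tcoord tau (existT (fun x => fiber L x) x v) = k by rewrite vE tcoordE.
exact: vE.
Qed.

Lemma cvg_tbase (p : Tot) : tbase @ p --> tbase p.
Proof.
case: atlasP => op _ _ _ opW W; rewrite nbhsE => -[B [oO Op] OW].
have : nbhs p [set q | B (tbase q)].
  apply: open_nbhs_nbhs; split => //; apply: opW => U tau a.
  have -> : [set p : X * C | U p.1 /\ B (tbase (tot (p.2 *: tau p.1)))] = (U `&` B) `*` setT.
    by apply/seteqP; split=> [[? ?] [? ?]|[? ?] [[? ?] _]].
  by apply: open_setX; [apply: openI => //; exact: op a|exact: openT].
by apply: filterS => q; exact: OW.
Qed.

(** Openness has to be checked in every other chart, where the set is the preimage of O under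
    multiplication by the transition function. *)
Lemma chart_open U tau (O : set (X * C)) : atlas U tau -> open O ->
  open [set p : Tot | U (tbase p) /\ O (tbase p, tcoord tau p)].
Proof.
move=> a oO; case: atlasP => op _ tr _ opW; apply: opW => U' tau' a'.
rewrite openE => -[x c] [/= U'x [/= Ux Ox]].
have [r rc rE] := tr _ _ _ _ _ a a' Ux U'x.
have cE (y : X) (k : R[i]) : U y -> tau' y = r y *: tau y -> tcoord tau (tot (k *: tau' y)) = k * r y.
  by move=> Uy ->; rewrite scalerA tcoordE//; exists U.
have hx : tau' x = r x *: tau x by exact: nbhs_singleton rE.
have OP : nbhs (x, c * r x : C) O by apply: open_nbhs_nbhs; split => //; rewrite -cE.
have lim : (fun q : X * C => (q.1, q.2 * r q.1 : C)) @ (x, c : C) --> (x, c * r x : C).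
  have l1 : (fun q : X * C => q.1) @ (x, c : C) --> x by exact: cvg_fst.
  have l2 : (fun q : X * C => q.2) @ (x, c : C) --> (c : C) by exact: cvg_snd.
  have l3 : (fun q : X * C => r q.1 : C) @ (x, c : C) --> (r x : C) by exact: cvg_comp l1 rc.
  exact: (cvg_pair l1 (cvg_mulC l2 l3)).
have h : \forall y \near x, [/\ U' y, U y & tau' y = r y *: tau y].
  have n1 : nbhs x U by apply: open_nbhs_nbhs; split=> //; exact: op a.
  have n2 : nbhs x U' by apply: open_nbhs_nbhs; split=> //; exact: op a'.
  by apply: filterS (filterI (filterI n1 n2) rE) => y [[]].
have h' : \forall q \near ((x, c) : X * C), [/\ U' q.1, U q.1 & tau' q.1 = r q.1 *: tau q.1].
  exact: (@cvg_fst _ _ (nbhs x) (nbhs (c : C)) _ _ h).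
have hO : \forall q \near ((x, c) : X * C), O (q.1, q.2 * r q.1) by exact: lim.
apply: filterS (filterI h' hO) => q [[U'q Uq qE] Oq].
by split=> //; split=> //; rewrite /= cE.
Qed.

Lemma cvg_tcoord tau (p : Tot) : frame_at tau (tbase p) -> (tcoord tau : Tot -> C) @ p --> (tcoord tau p : C).
Proof.
move=> [U a Up] W /nbhs_openP[B [oO Op OW]].
have : nbhs p [set q | U (tbase q) /\ (setT `*` B) (tbase q, tcoord tau q : C)].
  apply: open_nbhs_nbhs; split; last by split.
  by apply: chart_open a _; apply: open_setX => //; exact: openT.
by apply: filterS => q [_ [_ Oq]]; exact: OW.
Qed.

Lemma cvg_tot tau (T : Type) (F : set_system T) {FF : Filter F} (s : T -> Tot) (p : Tot) :
  frame_at tau (tbase p) -> (fun t => tbase (s t)) @ F --> tbase p ->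
  (fun t => tcoord tau (s t) : C) @ F --> (tcoord tau p : C) -> s @ F --> p.
Proof.
move=> fp bc cc W; rewrite nbhsE => -[W' [oW' W'p] /filterS]; apply.
have [U a Up] := fp; case: atlasP => _ _ _ fo _.
have := fo _ _ _ a oW'; rewrite openE => /(_ (tbase p, tcoord tau p : C)) h.
have /h {}h : U (tbase p) /\ W' (tot (tcoord tau p *: tau (tbase p))) by rewrite -totP.
have : \forall t \near F, U (tbase (s t)) /\ W' (tot (tcoord tau (s t) *: tau (tbase (s t)))).
  exact: (cvg_pair bc cc h).
apply: filterS => t [Ut Wt].
by rewrite /preimage /= (@totP tau (s t))//; exists U.
Qed.

Lemma cvg_tot_scale tau (T : Type) (F : set_system T) {FF : Filter F} (b : T -> X) (k : T -> C)
    (x : X) (c : R[i]) : frame_at tau x -> b @ F --> x -> k @ F --> (c : C) ->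
  (fun t => tot (k t *: tau (b t))) @ F --> tot (c *: tau x).
Proof.
move=> fx bx kc; have h : \forall t \near F, frame_at tau (b t) by apply: bx; exact: frame_at_near.
have kc' : (fun t => tcoord tau (tot (k t *: tau (b t))) : C) @ F --> (tcoord tau (tot (c *: tau x)) : C).
  rewrite (tcoordE _ fx); apply: cvg_near_eq kc _.
  by apply: filterS h => t ft; rewrite (tcoordE _ ft).
exact: (@cvg_tot tau T F FF (fun t => tot (k t *: tau (b t))) (tot (c *: tau x)) fx bx kc').
Qed.

Lemma cvg_frame_transition tau1 tau2 x : frame_at tau1 x -> frame_at tau2 x ->
  (fun y => tcoord tau1 (tot (tau2 y)) : C) @ x --> (tcoord tau1 (tot (tau2 x)) : C).
Proof.
move=> f1 f2; have : (fun y => tot (1 *: tau2 y)) @ x --> tot (1 *: tau2 x).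
  by apply: (@cvg_tot_scale tau2 X (nbhs x) _ id (fun=> 1 : C) x 1 f2); [exact: cvg_id|exact: cvg_cst].
under eq_fun do rewrite scale1r.
rewrite scale1r => h; have c : (tcoord tau1 : Tot -> C) @ tot (tau2 x) --> (tcoord tau1 (tot (tau2 x)) : C) by exact: cvg_tcoord.
exact: (cvg_comp _ _ h c).
Qed.

(* The ratio of two elements of the same line, 0 if they are not. *)
Definition tratio (p q : Tot) : R[i] := xget 0 [set k | exists e : tbase q = tbase p,
   tvec p = k *: eq_rect _ (fun x => fiber L x : Type) (tvec q) _ e].

Lemma tratioE x (v w : fiber L x) k : w != 0 -> v = k *: w -> tratio (tot v) (tot w) = k.
Proof.
move=> w0 ->; rewrite /tratio; case: xgetP => [k' _ [e]|/(_ k)]; last by case; exists erefl.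
have -> : e = erefl by exact: Prop_irrelevance.
by move=> /= /(scale_inj w0) ->.
Qed.

Lemma tratio_coord tau (p q : Tot) : frame_at tau (tbase p) -> tbase q = tbase p ->
  tcoord tau q != 0 -> tratio p q = tcoord tau p / tcoord tau q.
Proof.
move=> fp bE q0; have fq : frame_at tau (tbase q) by rewrite bE.
have [_ t0] := frame_at_gen fp.
rewrite (totP fp) (totP fq) !tcoordE// bE; apply: tratioE; first by rewrite scaler_eq0 negb_or q0.
by rewrite scalerA divfK.
Qed.

Lemma tcoord_neq0 tau (q : Tot) : frame_at tau (tbase q) -> tvec q != 0 -> tcoord tau q != 0.
Proof.
move=> fq; have [gen t0] := frame_at_gen fq; apply: contraNneq => h.
have qE := totP fq; rewrite h scale0r in qE.
by rewrite [q]qE /tvec /tot /in_total.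
Qed.

Lemma cvg_tratio (T : Type) (F : set_system T) {FF : Filter F} (s s' : T -> Tot) (p p' : Tot) :
  (exists tau, frame_at tau (tbase p)) -> tbase p' = tbase p -> tvec p' != 0 ->
  s @ F --> p -> s' @ F --> p' -> (\forall t \near F, tbase (s' t) = tbase (s t)) ->
  (fun t => tratio (s t) (s' t) : C) @ F --> (tratio p p' : C).
Proof.
move=> [tau fp] pE p'0 sp sp' sE.
have fp' : frame_at tau (tbase p') by rewrite pE.
have c1 : (fun t => tcoord tau (s t) : C) @ F --> (tcoord tau p : C) by exact: cvg_comp sp (cvg_tcoord fp).
have c2 : (fun t => tcoord tau (s' t) : C) @ F --> (tcoord tau p' : C) by exact: cvg_comp sp' (cvg_tcoord fp').
have q0 := tcoord_neq0 fp' p'0.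
rewrite (tratio_coord fp pE q0).
have c12 : (fun t => tcoord tau (s t) / tcoord tau (s' t) : C) @ F --> (tcoord tau p / tcoord tau p' : C).
  by apply: cvg_mulC; [exact: c1|exact: cvg_invC].
have nf : \forall t \near F, frame_at tau (tbase (s t)).
  by apply: (cvg_comp _ _ sp (@cvg_tbase p)); exact: frame_at_near.
apply: cvg_near_eq c12 _.
have nz := @near_nz _ _ _ FF _ _ q0 c2.
have : \forall t \near F, (frame_at tau (tbase (s t)) /\ tbase (s' t) = tbase (s t)) /\ tcoord tau (s' t) != 0.
  by apply: filterI => //; exact: filterI.
by apply: filterS => t [[ft bt] ct]; rewrite (tratio_coord ft bt ct).
Qed.

End Bundle.

(** * Winding numbers *)

Section Expi.
Variable R : realType.
Local Notation C := (R[i]^o).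
Implicit Types (a b : R) (z : R[i]).

Lemma expiD a b : expi (a + b) = expi a * expi b.
Proof. by rewrite mulcE /expi /= cosD sinD [sin a * cos b + _]addrC. Qed.

Lemma expi0 : expi (0 : R) = 1.
Proof. by rewrite /expi cos0 sin0. Qed.

Lemma expiNr a : expi (- a) * expi a = 1.
Proof. by rewrite -expiD addNr expi0. Qed.

Lemma expi_neq0 a : expi a != 0.
Proof. by apply/eqP => h; have := expiNr a; rewrite h mulr0 => /eqP; rewrite eq_sym oner_eq0. Qed.

Lemma expiN a : expi (- a) = (expi a)^-1.
Proof. by apply: (mulIf (expi_neq0 a)); rewrite expiNr mulVf// expi_neq0. Qed.

Lemma cabs_expi a : cabs (expi a) = 1.
Proof.
apply/eqP; rewrite -(eqrXn2 (n := 2))// ?nrm_ge0// cabs_sqr /expi /= cos2Dsin2 expr1n//.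
Qed.

Lemma cvg_expi (T : Type) (F : set_system T) {FF : Filter F} (f : T -> R) a :
  f @ F --> a -> (fun t => expi (f t) : C) @ F --> (expi a : C).
Proof.
move=> fa; apply: cvg_complex; first exact: cvg_comp fa (@continuous_cos R a).
exact: cvg_comp fa (@continuous_sin R a).
Qed.

Lemma expi_2pi_nat (n : nat) : expi (2 * pi * n%:R : R) = 1.
Proof.
elim: n => [|n IH]; first by rewrite mulr0 expi0.
rewrite -(natr1 n) mulrDr expiD IH mul1r mulr1 /expi.
by rewrite (_ : 2 * pi = pi *+ 2) ?cos2pi ?sin2pi// mulr_natl.
Qed.

Lemma expi_2pi_int (n : int) : expi (2 * pi * n%:~R : R) = 1.
Proof.
case: n => n; first exact: expi_2pi_nat.
by rewrite NegzE rmorphN mulrN expiN expi_2pi_nat invr1.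
Qed.

(** After reduction to y in [0, 2 pi[ the half-angle formula gives sin(y/2) = 0, while sin is
    positive on ]0, pi[. *)
Lemma expi_eq1 (t : R) : expi t = 1 -> exists n : int, t = 2 * pi * n%:~R.
Proof.
move=> t1; have p0 : 0 < 2 * pi :> R by rewrite mulr_gt0// pi_gt0.
exists (Num.floor (t / (2 * pi))); set n := Num.floor _.
have /andP[n1 n2] := floor_itv (t / (2 * pi)); rewrite -/n in n1 n2.
pose y := t - 2 * pi * n%:~R.
have yc : cos y = 1.
  have : expi y = 1 by rewrite /y expiD t1 mul1r expiN expi_2pi_int invr1.
  by move=> /(congr1 (@complex.Re R)).
have y0 : 0 <= y by rewrite /y subr_ge0 mulrC -ler_pdivlMr.
have y2 : y < 2 * pi.
  by move: n2; rewrite ltr_pdivrMr// intrD mulrDl mul1r mulrC => n2; rewrite /y ltrBlDl.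
suff : y = 0 by move=> /eqP; rewrite subr_eq0 => /eqP.
apply: contrapT => /eqP yn.
have : 0 < sin (y / 2).
  apply: sin_gt0_pi; have yp : 0 < y by rewrite lt_neqAle eq_sym yn.
  by apply/andP; split; lra.
have := cos2Dsin2 (y / 2); have := cos_mulr2n (y / 2).
rewrite (_ : y / 2 *+ 2 = y); last by rewrite -mulr_natr divfK// pnatr_eq0.
rewrite yc => h1 h2 h3; have : sin (y / 2) ^+ 2 = 0 by move: h1; rewrite !mulr2n; lra.
by move=> /eqP; rewrite sqrf_eq0 => /eqP h; rewrite h ltxx in h3.
Qed.

Lemma polar_Re_gt0 z : 0 < complex.Re z ->
  z = (complex.Re z * Num.sqrt (1 + (complex.Im z / complex.Re z) ^+ 2))%:C *
      expi (atan (complex.Im z / complex.Re z)).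
Proof.
move=> z0; set q := _ / _.
have s0 : Num.sqrt (1 + q ^+ 2) != 0 by rewrite gt_eqF// sqrtr_gt0 ltr_wpDr ?sqr_ge0.
have cE : cos (atan q) = (Num.sqrt (1 + q ^+ 2))^-1 by exact: cos_atan.
have sE : sin (atan q) = q * (Num.sqrt (1 + q ^+ 2))^-1.
  by rewrite -cE -{2}(atanK q) /tan divfK// cE invr_neq0.
rewrite mulcE /expi /= cE sE mul0r subr0 mul0r addr0 mulrCA.
rewrite mulfK// [X in _ +i* X](_ : _ = complex.Im z); first exact: complex_ReIm.
rewrite /q divfK//; exact: lt0r_neq0.
Qed.

End Expi.

Section Winding.
Variable R : realType.
Local Notation C := (R[i]^o).

(* Null c: the winding number of c vanishes. Invariance under kap, whose     *)
(* values lie in [0, 1], stands for being defined on a quotient or a subset:  *)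
(* kap is the fractional part for loops and the retraction for paths.         *)
Section Null.
Variable kap : R -> R.
Hypothesis kap01 : forall t, 0 <= kap t <= 1.

Definition Null (c : R -> R[i]) := exists rho phi : R -> R,
  [/\ continuous rho, continuous phi, forall t, 0 < rho t,
      forall t, rho (kap t) = rho t /\ phi (kap t) = phi t &
      forall t, c t = (rho t)%:C * expi (phi t)].

Definition kloop (c : R -> R[i]) := continuous (c : R -> C) /\ forall t, c (kap t) = c t.

Lemma NullM c1 c2 : Null c1 -> Null c2 -> Null (fun t => c1 t * c2 t).
Proof.
move=> [r1 [p1 [r1c p1c r10 k1 E1]]] [r2 [p2 [r2c p2c r20 k2 E2]]].
exists (fun t => r1 t * r2 t), (fun t => p1 t + p2 t); split.
- by move=> t; apply: cvgM; [exact: r1c|exact: r2c].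
- by move=> t; apply: cvgD; [exact: p1c|exact: p2c].
- by move=> t; rewrite mulr_gt0.
- by move=> t; have [-> ->] := k1 t; have [-> ->] := k2 t.
- by move=> t; rewrite E1 E2 expiD rmorphM /= !mulrA; congr (_ * _); rewrite mulrAC.
Qed.

Lemma NullV c : Null c -> Null (fun t => (c t)^-1).
Proof.
move=> [r [p [rc pc r0 k E]]]; exists (fun t => (r t)^-1), (fun t => - p t); split.
- by move=> t; apply: cvgV; [exact: lt0r_neq0|exact: rc].
- by move=> t; apply: cvgN; exact: pc.
- by move=> t; rewrite invr_gt0.
- by move=> t; have [-> ->] := k t.
- by move=> t; rewrite E invfM expiN fmorphV.
Qed.

Lemma Null_eq c1 c2 : c1 =1 c2 -> Null c1 -> Null c2.
Proof. by move=> /funext ->. Qed.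

Lemma Null_cst_expi a : Null (fun=> expi a).
Proof.
exists (fun=> 1), (fun=> a); split=> //; try by move=> t; exact: cvg_cst.
by move=> t; rewrite mul1r.
Qed.

Lemma Null_cst_pos (a : R) : 0 < a -> Null (fun=> a%:C).
Proof.
move=> a0; exists (fun=> a), (fun=> 0); split=> //; try by move=> t; exact: cvg_cst.
by move=> t; rewrite expi0 mulr1.
Qed.

Lemma Null1 : Null (fun=> 1).
Proof. exact: (Null_cst_pos ltr01). Qed.

Lemma Null_half_plane c : kloop c -> (forall t, 0 < complex.Re (c t)) -> Null c.
Proof.
move=> [cc ck] c0.
have qc t : (fun s => complex.Im (c s) / complex.Re (c s)) @ t --> complex.Im (c t) / complex.Re (c t).
  apply: cvgM; first by apply: cvg_Im; exact: cc.
  by apply: cvgV; [exact: lt0r_neq0|apply: cvg_Re; exact: cc].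
exists (fun t => complex.Re (c t) * Num.sqrt (1 + (complex.Im (c t) / complex.Re (c t)) ^+ 2)),
  (fun t => atan (complex.Im (c t) / complex.Re (c t))); split.
- move=> t; apply: cvgM; first by apply: cvg_Re; exact: cc.
  have q2 : (fun s => 1 + (complex.Im (c s) / complex.Re (c s)) ^+ 2) @ t -->
      1 + (complex.Im (c t) / complex.Re (c t)) ^+ 2.
    apply: cvgD; first exact: cvg_cst.
    by rewrite expr2; under eq_fun do rewrite expr2; apply: cvgM; exact: qc.
  exact: (cvg_comp _ _ q2 (@sqrt_continuous R _)).
- by move=> t; exact: (cvg_comp _ _ (qc t) (@continuous_atan R _)).
- by move=> t; rewrite mulr_gt0// sqrtr_gt0 ltr_wpDr ?sqr_ge0.
- by move=> t; rewrite ck.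
- by move=> t; exact: polar_Re_gt0.
Qed.

(** By compactness of [0, 1], loops that converge jointly to 1 eventually stay in the right
    half-plane, where the principal logarithm exists. *)
Lemma near_Null (X : Type) (F : set_system X) {FF : Filter F} (q : X -> R -> R[i]) :
  (\forall x \near F, kloop (q x)) ->
  (forall t : R, 0 <= t <= 1 -> (fun p => q p.1 p.2 : C) @ filter_prod F (nbhs t) --> (1 : C)) ->
  \forall x \near F, Null (q x).
Proof.
move=> qk q1.
have /compact_near_coveringP nc : compact `[0 : R, 1]%classic by exact: segment_compact.
have /= h := nc X F (fun x t => 0 < complex.Re (q x t)) FF _.
have : \forall x \near F, `[0, 1]%classic `<=` (fun t => 0 < complex.Re (q x t)).
  apply: h => t; rewrite /= in_itv /= => t01.
  have /cvg_nrmP/(_ 1 ltr01) [[A B] /= [FA tB] AB] := q1 t t01.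
  exists (B, A) => //= -[t' x] [/= Bt Ax]; have := AB (x, t') (conj Ax Bt) => /=.
  have := ler_Re_cabs (q x t' - 1); rewrite /cabs ReB /= => h1 h2.
  have := le_lt_trans h1 h2; rewrite ltr_norml => /andP[+ _]; lra.
move=> h'; have : \forall x \near F, kloop (q x) /\ `[0, 1]%classic `<=` (fun t => 0 < complex.Re (q x t)).
  exact: filterI.
apply: filterS => x [kx px]; apply: Null_half_plane => // t.
by case: kx => _ <-; apply: px; rewrite /= in_itv /=.
Qed.

Lemma Null_neq0 c t : Null c -> c t != 0.
Proof.
move=> [r [p [_ _ r0 _ ->]]]; rewrite mulf_neq0 ?expi_neq0//.
by rewrite eq_complex /= gt_eqF.
Qed.

(** The quotient of two neighbouring loops of the family is close to 1, hence null; as null loops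
    form a group, nullity is locally constant in a, and [0, 1] is connected. *)
Lemma Null_homotopy (q : R -> R -> R[i]) :
  (forall a : R, 0 <= a <= 1 -> kloop (q a) /\ forall t, q a t != 0) ->
  (forall a t : R, 0 <= a <= 1 ->
    (fun p => q p.1 p.2 : C) @ filter_prod (within `[0, 1]%classic (nbhs a)) (nbhs t) --> (q a t : C)) ->
  Null (q 0) -> Null (q 1).
Proof.
move=> qk qc q0.
have loc (a0 : R) : 0 <= a0 <= 1 -> \forall a \near a0, 0 <= a <= 1 -> Null (fun t => q a t / q a0 t).
  move=> a01; have [[q0c q0k] q0n] := qk a0 a01.
  have h : \forall a \near within `[0, 1]%classic (nbhs a0), Null (fun t => q a t / q a0 t).
    apply: near_Null.
      near=> a; have a1 : 0 <= a <= 1.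
        have : `[0, 1]%classic a by near: a; exact: withinT.
        by rewrite /= in_itv.
      have [[ac ak] _] := qk a a1.
      split; last by move=> t; rewrite ak q0k.
      by move=> t; apply: cvg_mulC; [exact: ac|apply: cvg_invC => //; exact: q0c].
    move=> t t01; rewrite -(divff (q0n t)); apply: cvg_mulC; first exact: qc.
    apply: cvg_invC => //.
    have l : (fun p : R * R => p.2) @ filter_prod (within `[0, 1]%classic (nbhs a0)) (nbhs t) --> t by exact: cvg_snd.
    exact: cvg_comp l (q0c t).
  move: h; rewrite near_withinE; apply: filterS => a ha a1; apply: ha; by rewrite /= in_itv.
have conn : connected `[0 : R, 1]%classic by exact: segment_connected.
(* Taking b to be True or False treats nullity and its negation alike; both persist nearby, so [B]
   is open and closed in [0, 1]. *)
pose N b := [set a : R | 0 <= a <= 1 -> (Null (q a) <-> b)].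
have locN (b : Prop) (a0 : R) : 0 <= a0 <= 1 -> N b a0 -> \forall a \near a0, N b a.
  move=> a01 Na; have [_ q0n] := qk a0 a01; apply: filterS (loc a0 a01) => a ha a1.
  have {ha}r := ha a1; rewrite -(Na a01); have [_ qn] := qk a a1; split=> h.
    by apply: Null_eq (NullM h (NullV r)) => t; rewrite invf_div mulrCA mulfV ?mulr1.
  by apply: Null_eq (NullM r h) => t; rewrite divfK.
pose B := `[0 : R, 1]%classic `&` (N True)°.
have BE : B = `[0, 1]%classic.
  apply: conn.
  - exists 0; split; first by rewrite /= in_itv /= lexx ler01.
    by apply: locN => [|_]; rewrite ?lexx ?ler01//.
  - by exists (N True)° => //; exact: open_interior.
  - exists (~` (N False)°); first exact/open_closedC/open_interior.
    apply/seteqP; split=> a [aI]; have a01 : 0 <= a <= 1 by move: aI; rewrite /= in_itv.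
      move=> /nbhs_singleton h1; split => // /nbhs_singleton h2.
      by have [+ _] := h2 a01; apply; apply/(h1 a01).
    move=> h; split => //; apply: (locN True a) => // _; split => // _.
    by apply: contrapT => nN; apply: h; apply: (locN False a) => // _; split.
have : B 1 by rewrite BE /= in_itv /= lexx ler01.
by move=> [_ /nbhs_singleton h]; apply/h => //; rewrite lexx ler01.
Unshelve. all: by end_near.
Qed.

End Null.

Lemma near_itv (a b t : R) : a < t < b -> \forall s \near t, a < s < b.
Proof.
move=> tab; have : t \in `]a, b[ by rewrite in_itv.
by move=> /near_in_itvoo; apply: filterS => s; rewrite in_itv.
Qed.

Definition fracp (t : R) : R := t - (Num.floor t)%:~R.

Lemma fracp01 t : 0 <= fracp t <= 1.
Proof.
have /andP[h1 h2] := floor_itv t; rewrite /fracp subr_ge0 h1 /= lerBlDr addrC ltW//.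
by rewrite intrD in h2.
Qed.

Lemma periodic_int (T : Type) (f : R -> T) (n : int) t : periodic1 f -> f (t + n%:~R) = f t.
Proof.
move=> pf; have pn (k : nat) s : f (s + k%:R) = f s.
  by elim: k s => [|k IH] s; rewrite ?addr0// -natr1 addrA pf IH.
case: n => n; first exact: pn.
by rewrite NegzE rmorphN -{2}(subrK (n.+1%:R) t) pn.
Qed.

Lemma periodic_fracp (T : Type) (f : R -> T) t : periodic1 f -> f (fracp t) = f t.
Proof. by move=> pf; rewrite /fracp -rmorphN periodic_int. Qed.

Lemma fracpD1 t : fracp (t + 1) = fracp t.
Proof.
rewrite /fracp; have -> : Num.floor (t + 1) = Num.floor t + 1; last by rewrite intrD; ring.
apply: floor_def; have := floor_itv t; rewrite !intrD => /andP[h1 h2]; apply/andP; split; lra.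
Qed.

(** Only integers need care: there the two branches f(s - m) and f(s - m + 1) both tend to f 0 = f
    1. *)
Lemma continuous_fracp (f : R -> R) : continuous f -> f 0 = f 1 -> continuous (f \o fracp).
Proof.
move=> fc f01 t; set m := Num.floor t.
have /andP[m1 m2] := floor_itv t; rewrite -/m intrD in m1 m2.
have c1 : (fun s => f (s - m%:~R)) @ t --> f (t - m%:~R).
  have l : (fun s : R => s - m%:~R) @ t --> t - m%:~R by apply: cvgB; [exact: cvg_id|exact: cvg_cst].
  exact: cvg_comp l (fc _).
have [tm|tm] := eqVneq t m%:~R; last first.
  apply: (cvg_near_eq c1).
  have : \forall s \near t, m%:~R < s < m%:~R + 1.
    by apply: near_itv; rewrite m2 andbT lt_neqAle eq_sym tm.
  apply: filterS => s /andP[s1 s2].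
  by rewrite /= /fracp (@floor_def _ _ m)// intrD ltW.
have c2 : (fun s => f (s - m%:~R + 1)) @ t --> f 1.
  have l : (fun s : R => s - m%:~R + 1) @ t --> (1 : R).
    have e : t - m%:~R + 1 = 1 by rewrite tm subrr add0r.
    rewrite -[X in _ --> X]e.
    by apply: cvgD; [apply: cvgB; [exact: cvg_id|exact: cvg_cst]|exact: cvg_cst].
  exact: cvg_comp l (fc _).
have e1 : f (t - m%:~R) = f 1 by rewrite tm subrr f01.
have e2 : (f \o fracp) t = f 1 by rewrite /= /fracp -/m e1.
rewrite e1 in c1; rewrite /continuous_at e2 => W nW.
have n1 : \forall s \near t, W (f (s - m%:~R)) by exact: c1.
have n2 : \forall s \near t, W (f (s - m%:~R + 1)) by exact: c2.
have n3 : \forall s \near t, m%:~R - 1 < s < m%:~R + 1.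
  by apply: near_itv; rewrite tm; apply/andP; split; lra.
have : \forall s \near t, [/\ W (f (s - m%:~R)), W (f (s - m%:~R + 1)) & m%:~R - 1 < s < m%:~R + 1].
  by apply: filterS (filterI (filterI n1 n2) n3) => s [[]].
apply: filterS => s [w1 w2 /andP[s1 s2]]; rewrite /preimage /= /fracp.
have [ms|sm] := leP m%:~R s; first by rewrite (@floor_def _ _ m)// ms intrD.
rewrite (@floor_def _ _ (m - 1)); last by rewrite subrK sm andbT rmorphB /= ltW.
by rewrite rmorphB opprB addrCA addrC in w2 *.
Qed.

Lemma cabs_pos_expi (a b : R) : 0 < a -> a%:C * expi b = 1 -> a = 1.
Proof.
move=> a0 /(congr1 (@cabs R)); rewrite cabsM cabs_expi mulr1 cabs_real gtr0_norm//.
by rewrite -[1 in RHS]/(1%:C) cabs_real normr1.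
Qed.

Lemma polar (z : R[i]) : z != 0 -> exists2 r : R, 0 < r & exists a, z = r%:C * expi a.
Proof.
move=> z0; have half (w : R[i]) : 0 < complex.Re w -> exists2 r : R, 0 < r & exists a, w = r%:C * expi a.
  move=> w0; exists (complex.Re w * Num.sqrt (1 + (complex.Im w / complex.Re w) ^+ 2)).
    by rewrite mulr_gt0// sqrtr_gt0 ltr_wpDr ?sqr_ge0.
  by exists (atan (complex.Im w / complex.Re w)); exact: polar_Re_gt0.
have rot a : 0 < complex.Re (expi a * z) -> exists2 r : R, 0 < r & exists a, z = r%:C * expi a.
  move=> /half[r r0 [b bE]]; exists r => //; exists (b - a).
  by rewrite expiD mulrA -bE expiN mulrC mulrA mulVf ?mul1r// expi_neq0.
case: z z0 half rot => x y z0 half rot.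
have [x0|x0|x0] := ltgtP x 0.
- apply: (rot pi); rewrite mulcE /expi cospi sinpi /=; lra.
- exact: half.
have [y0|y0|y0] := ltgtP y 0.
- apply: (rot (pi / 2)); rewrite mulcE /expi cos_pihalf sin_pihalf /=; lra.
- apply: (rot (- (pi / 2))); rewrite mulcE /expi cosN sinN cos_pihalf sin_pihalf /=; lra.
- by move: z0; rewrite x0 y0 eqxx.
Qed.

(** As a path on [0, 1], c is contracted to its initial point by c(a t), so it has a continuous
    logarithm there ([Null] for the retraction [kap]). Its argument grows by 2 pi n over the
    interval, and subtracting 2 pi n t makes it periodic. *)
Lemma Null_winding (c : R -> R[i]) : continuous (c : R -> C) -> periodic1 c ->
  (forall t, c t != 0) -> exists k : int, Null fracp (fun t => c t * expi (- (2 * pi * k%:~R * t))).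
Proof.
move=> cc cp c0; pose kap t : R := Num.min 1 (Num.max 0 t).
have kc : continuous kap.
  move=> t; apply: continuous_min; first exact: cvg_cst.
  by apply: continuous_max; [exact: cvg_cst|exact: cvg_id].
have k01 t : 0 <= kap t <= 1.
  by rewrite /kap le_min ge_min lexx ler01 le_max lexx.
have kid t : 0 <= t <= 1 -> kap t = t.
  by move=> /andP[t0 t1]; rewrite /kap max_r// min_r.
have kk t : kap (kap t) = kap t by exact: kid.
have lim (F : set_system R) (a t : R) : Filter F -> F --> a ->
    (fun p : R * R => c (p.1 * kap p.2) / c 0 : C) @ filter_prod F (nbhs t) --> (c (a * kap t) / c 0 : C).
  move=> FF Fa; apply: cvg_mulC; last exact: cvg_cst.
  have l1 : (fun p : R * R => p.1) @ filter_prod F (nbhs t) --> a by apply: cvg_trans Fa; exact: cvg_fst.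
  have l2 : (fun p : R * R => p.2) @ filter_prod F (nbhs t) --> t by exact: cvg_snd.
  have l3 := cvg_comp _ _ l2 (kc t).
  exact: (cvg_comp _ _ (cvgM l1 l3) (cc _)).
have [rho [phi [rc pc r0 k E]]] : Null kap (fun t => c (1 * kap t) / c 0).
  apply: (@Null_homotopy kap k01 (fun a t => c (a * kap t) / c 0)).
  - move=> a a01; split; last by move=> t; rewrite mulf_neq0 ?invr_eq0.
    split=> t; last by rewrite kk.
    apply: cvg_mulC; last exact: cvg_cst.
    have l : (fun s => a * kap s) @ t --> a * kap t by apply: cvgM; [exact: cvg_cst|exact: kc].
    exact: (cvg_comp _ _ l (cc _)).
  - by move=> a t a01; apply: lim; exact: cvg_within.
  - by apply: Null_eq (@Null1 kap) => t; rewrite mul0r divff.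
have E' t : 0 <= t <= 1 -> c t = c 0 * ((rho t)%:C * expi (phi t)).
  by move=> t01; rewrite -E kid// mul1r mulrCA divff ?mulr1.
have c01 : c 1 = c 0 by rewrite -[RHS]cp add0r.
have e0 : (rho 0)%:C * expi (phi 0) = 1.
  by apply: (mulfI (c0 0)); rewrite mulr1 -E'// lexx ler01.
have e1 : (rho 1)%:C * expi (phi 1) = 1.
  by apply: (mulfI (c0 0)); rewrite mulr1 -E' ?c01// lexx ler01.
have r01 : rho 0 = rho 1 by rewrite (cabs_pos_expi (r0 0) e0) (cabs_pos_expi (r0 1) e1).
have [n nE] : exists n : int, phi 1 - phi 0 = 2 * pi * n%:~R.
  apply: expi_eq1; rewrite expiD expiN.
  have x0 : expi (phi 0) = 1 by move: (e0); rewrite (cabs_pos_expi (r0 0) e0) mul1r.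
  have x1 : expi (phi 1) = 1 by move: (e1); rewrite (cabs_pos_expi (r0 1) e1) mul1r.
  by rewrite x0 x1 divr1.
exists n; have [r rp [b bE]] := polar (c0 0).
pose psi t := phi t - 2 * pi * n%:~R * t.
have psic : continuous psi.
  move=> t; apply: cvgB; first exact: pc.
  by apply: cvgM; [exact: cvg_cst|exact: cvg_id].
have psi01 : psi 0 = psi 1 by rewrite /psi mulr0 mulr1 -nE; ring.
exists (fun t => r * rho (fracp t)), (fun t => b + psi (fracp t)); split.
- by move=> t; apply: cvgM; [exact: cvg_cst|exact: continuous_fracp].
- by move=> t; apply: cvgD; [exact: cvg_cst|exact: continuous_fracp].
- by move=> t; rewrite mulr_gt0.
- by move=> t; rewrite (periodic_fracp _ fracpD1).
move=> t; have pe : periodic1 (fun t => c t * expi (- (2 * pi * n%:~R * t))).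
  by move=> s; rewrite cp mulrDr opprD expiD mulr1 (expiN (2 * pi * n%:~R)) expi_2pi_int invr1 mulr1.
rewrite -(periodic_fracp _ pe) E' ?fracp01// bE expiD /psi expiD rmorphM /=; ring.
Qed.

(** A periodic argument phi would make g = phi - 2 pi n t continuous with e^{ig} = 1 throughout and
    g 1 = g 0 - 2 pi n. For n != 0 the intermediate value theorem provides a value of g at distance
    pi from g 0, where e^{ig} = -1. *)
Lemma Null_expi (n : int) : Null fracp (fun t => expi (2 * pi * n%:~R * t)) -> n = 0.
Proof.
move=> [rho [phi [rc pc r0 k E]]].
pose g t := phi t - 2 * pi * n%:~R * t.
have gE t : expi (g t) = 1.
  have e : (rho t)%:C * expi (g t) = 1 by rewrite /g expiD mulrA -E -expiD subrr expi0.
  by move: (e); rewrite (cabs_pos_expi (r0 t) e) mul1r.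
have gc : continuous g.
  move=> t; apply: cvgB; first exact: pc.
  by apply: cvgM; [exact: cvg_cst|exact: cvg_id].
have ph01 : phi 1 = phi 0.
  have [_ <-] := k 1; have [_ <-] := k 0; congr phi.
  by rewrite -(fracpD1 0) add0r.
have g01 : g 1 = g 0 - 2 * pi * n%:~R by rewrite /g ph01; ring.
apply: contrapT => /eqP n0; have p0 := pi_gt0 R.
have ivt v : Num.min (g 0) (g 1) <= v <= Num.max (g 0) (g 1) -> expi v = 1.
  move=> /(@IVT R g 0 1 v ler01 (continuous_subspaceT gc))[t _ <-]; exact: gE.
have neg (v : R) : expi (v + pi) = 1 -> expi v = 1 -> False.
  rewrite expiD => h1 h2; move: h1; rewrite h2 mul1r /expi cospi sinpi => /(congr1 (@complex.Re R)) /=; lra.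
have [n1|n1] : 1 <= n%:~R :> R \/ n%:~R <= -1 :> R.
- have : (0 < n) || (n < 0) by rewrite -neq_lt eq_sym.
  move=> /orP[h|h]; [left|right].
    by rewrite -[1]/(1%:~R) ler_int.
  by rewrite -[-1]/((-1)%:~R) ler_int; lia.
- apply: (neg (g 0 - pi)) (ivt _ _); first by rewrite subrK.
  by rewrite ge_min le_max g01; apply/andP; split; apply/orP; [right|left]; nra.
- apply: (neg (g 0)) (gE 0); apply: ivt.
  by rewrite ge_min le_max g01; apply/andP; split; apply/orP; [left|right]; nra.
Qed.

(* the eigenvalue of the loop P_t belonging to the eigenvalue l of P *)
Definition aps_eig (l t : R) : R[i] :=
  cos (2 * pi * t) +i* (Num.max (sin (2 * pi * t)) 0 * l + Num.min (sin (2 * pi * t)) 0).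

Lemma periodic_cos : periodic1 (fun t : R => cos (2 * pi * t)).
Proof.
by move=> t; rewrite mulrDr mulr1 cosD (_ : 2 * pi = pi *+ 2) ?cos2pi ?sin2pi ?mulr1 ?mulr0 ?subr0// mulr_natl.
Qed.

Lemma periodic_sin : periodic1 (fun t : R => sin (2 * pi * t)).
Proof.
by move=> t; rewrite mulrDr mulr1 sinD (_ : 2 * pi = pi *+ 2) ?cos2pi ?sin2pi ?mulr1 ?mulr0 ?addr0// mulr_natl.
Qed.

Lemma periodic_aps_eig l : periodic1 (aps_eig l).
Proof. by move=> t; rewrite /aps_eig periodic_cos periodic_sin. Qed.

Lemma cvg_linear (T : Type) (F : set_system T) {FF : Filter F} (f : T -> R) (a t : R) :
  f @ F --> t -> (fun s => a * f s) @ F --> a * t.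
Proof. by move=> ft; apply: cvgM; [exact: cvg_cst|]. Qed.

Lemma cvg_cos2pi (t : R) : (fun s => cos (2 * pi * s)) @ t --> cos (2 * pi * t).
Proof.
have l : (fun s : R => 2 * pi * s) @ t --> 2 * pi * t by apply: cvg_linear; exact: cvg_id.
exact: (cvg_comp _ _ l (@continuous_cos R _)).
Qed.

Lemma cvg_sin2pi (t : R) : (fun s => sin (2 * pi * s)) @ t --> sin (2 * pi * t).
Proof.
have l : (fun s : R => 2 * pi * s) @ t --> 2 * pi * t by apply: cvg_linear; exact: cvg_id.
exact: (cvg_comp _ _ l (@continuous_sin R _)).
Qed.

Lemma cvg_sin_max (t : R) : (fun s => Num.max (sin (2 * pi * s)) 0) @ t --> Num.max (sin (2 * pi * t)) 0.
Proof. by apply: continuous_max; [exact: cvg_sin2pi|exact: cvg_cst]. Qed.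

Lemma cvg_sin_min (t : R) : (fun s => Num.min (sin (2 * pi * s)) 0) @ t --> Num.min (sin (2 * pi * t)) 0.
Proof. by apply: continuous_min; [exact: cvg_sin2pi|exact: cvg_cst]. Qed.

Lemma cvg_aps_eig l (t : R) : (aps_eig l : R -> C) @ t --> (aps_eig l t : C).
Proof.
apply: cvg_complex; first exact: cvg_cos2pi.
apply: cvgD; last exact: cvg_sin_min.
by apply: cvgM; [exact: cvg_sin_max|exact: cvg_cst].
Qed.

Lemma aps_eig_neq0 l (t : R) : l != 0 -> aps_eig l t != 0.
Proof.
move=> l0; apply/eqP => -[]; have := cos2Dsin2 (2 * pi * t).
move: (cos _) (sin _) => c x cx c0; rewrite c0 expr0n add0r in cx.
rewrite /Num.max /Num.min; case: (ltP x 0) => x0.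
  by rewrite mul0r add0r => x1; move: x0; rewrite x1 ltxx.
rewrite addr0 => /eqP; rewrite mulf_eq0 (negbTE l0) orbF => /eqP x1.
by move: cx; rewrite x1 expr0n => /eqP; rewrite eq_sym oner_eq0.
Qed.

(** With c = cos and s = sin, the real part after rotation is c^2 + l s^2 or c^2 + s^2, which is
    positive. *)
Lemma Null_aps_eig_pos l : 0 < l -> Null fracp (fun t => aps_eig l t * expi (- (2 * pi * t))).
Proof.
move=> l0; apply: Null_half_plane.
  split=> [t|t].
    apply: cvg_mulC; first exact: cvg_aps_eig.
    by apply: cvg_expi; apply: cvgN; apply: cvg_linear; exact: cvg_id.
  apply: (periodic_fracp (f := fun t => aps_eig l t * expi (- (2 * pi * t)))) => s.
  by rewrite periodic_aps_eig /expi !cosN !sinN periodic_cos periodic_sin.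
move=> t; rewrite mulcE /expi /aps_eig /= cosN sinN.
have := cos2Dsin2 (2 * pi * t); move: (cos _) (sin _) => c x cx.
rewrite /Num.max /Num.min; case: (ltP x 0) => x0; first by nra.
have [xe|xn] := eqVneq x 0; last by have xp : 0 < x by [rewrite lt_neqAle eq_sym xn]; nra.
by move: cx; rewrite xe expr0n /= addr0 mul0r addr0 oppr0 mulr0 subr0 -expr2 => ->; exact: ltr01.
Qed.

(** The loop stays in the closed lower half-plane, so it can be pushed down by i without meeting 0;
    the pushed loop, multiplied by i, lies in the right half-plane. *)
Lemma Null_aps_eig_neg l : l < 0 -> Null fracp (aps_eig l).
Proof.
move=> l0; pose d (a t : R) : R[i] := aps_eig l t - 'i * (1 - a)%:C.
have Im0 t : complex.Im (aps_eig l t) <= 0.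
  rewrite /aps_eig /=; move: (sin _) => x; rewrite /Num.max /Num.min.
  by case: (ltP x 0) => x0; [rewrite mul0r add0r ltW|nra].
have dE a t : d a t = cos (2 * pi * t) +i* (complex.Im (aps_eig l t) - (1 - a)).
  by rewrite /d /aps_eig; simpc.
have dp a : periodic1 (d a) by move=> t; rewrite /d periodic_aps_eig.
have dk a : kloop fracp (d a).
  split; last by move=> t; rewrite periodic_fracp.
  have h2 (t : R) : (fun=> 'i * (1 - a)%:C : C) @ t --> ('i * (1 - a)%:C : C) by exact: cvg_cst.
  by move=> t; exact: (@cvgB _ C _ _ _ _ _ _ _ (@cvg_aps_eig l t) (h2 t)).
have d0 : Null fracp (d 0).
  apply: (@Null_eq _ (fun t => (d 0 t * 'i) * expi (- (pi / 2)))).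
    move=> t; rewrite -mulrA -[RHS]mulr1; congr (_ * _).
    by rewrite /expi cosN sinN cos_pihalf sin_pihalf; simpc.
  apply: NullM; last exact: Null_cst_expi.
  have [dc0 dk0] := dk 0; apply: Null_half_plane; first split.
  - by move=> t; apply: cvg_mulC; [exact: dc0|exact: cvg_cst].
  - by move=> t; rewrite dk0.
  - move=> t; rewrite dE; have := Im0 t; move: (complex.Im (aps_eig l t)) (cos _) => x y x0.
    by rewrite mulcE /=; lra.
have d0n a t : a <= 1 -> d a t != 0.
  rewrite le_eqVlt => /orP[/eqP ->|a1]; first by rewrite /d subrr mulr0 subr0 aps_eig_neq0// lt_eqF.
  rewrite dE; apply/eqP => /(congr1 (@complex.Im R)); have := Im0 t.
  by move: (complex.Im (aps_eig l t)) => x x0 /=; lra.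
have {d0} : Null fracp (d 1); last by apply: Null_eq => t; rewrite /d subrr mulr0 subr0.
apply: (Null_homotopy fracp01 _ _ d0) => [a /andP[a0 a1]|a t a01].
  by split=> // t; exact: d0n.
have l1 : (fun p : R * R => p.1) @ filter_prod (within `[0, 1]%classic (nbhs a)) (nbhs t) --> a.
  by move=> W nW; apply: cvg_fst; exact: cvg_within.
have l2 : (fun p : R * R => p.2) @ filter_prod (within `[0, 1]%classic (nbhs a)) (nbhs t) --> t by exact: cvg_snd.
have h1 := cvg_comp _ _ l2 (@cvg_aps_eig l t).
have h2 : (fun p : R * R => 'i * (1 - p.1)%:C : C) @ filter_prod (within `[0, 1]%classic (nbhs a)) (nbhs t) --> ('i * (1 - a)%:C : C).
  apply: cvg_mulC; first exact: cvg_cst.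
  by apply: cvg_real_complex; apply: cvgB => //; exact: cvg_cst.
exact: (@cvgB _ C _ _ _ _ _ _ _ h1 h2).
Qed.

End Winding.

(** * The transgression of a line bundle *)

Lemma cvg_fstp (X Y : topologicalType) (p : X * Y) : (fun q => q.1) @ p --> p.1.
Proof. by case: p => a b; exact: cvg_fst. Qed.

Lemma cvg_sndp (X Y : topologicalType) (p : X * Y) : (fun q => q.2) @ p --> p.2.
Proof. by case: p => a b; exact: cvg_snd. Qed.

Lemma cvg_cutoff (R : realType) (k1 k2 t : R) :
  (fun s => Num.min 1 (Num.max 0 ((sin (2 * pi * s) - k1) / (k2 - k1)))) @ t -->
  Num.min 1 (Num.max 0 ((sin (2 * pi * t) - k1) / (k2 - k1))).
Proof.
apply: (@continuous_min R R (fun=> 1) (fun s => Num.max 0 ((sin (2 * pi * s) - k1) / (k2 - k1))) t).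
  exact: cvg_cst.
apply: (@continuous_max R R (fun=> 0) (fun s => (sin (2 * pi * s) - k1) / (k2 - k1)) t).
  exact: cvg_cst.
by apply: cvgM; [apply: cvgB; [exact: cvg_sin2pi|exact: cvg_cst]|exact: cvg_cst].
Qed.

Section Evaluation.
Variables (R : realType) (X : topologicalType).

Definition loop_at (g : loop_space R X) : R -> X := set_val g.

Lemma loop_at_continuous (g : loop_space R X) : continuous (loop_at g).
Proof. by have [] := set_valP g. Qed.

Lemma loop_at_periodic (g : loop_space R X) : periodic1 (loop_at g).
Proof. by have [] := set_valP g. Qed.

Lemma loop_nbhs (g0 : loop_space R X) (K : set R) (B : set X) : compact K -> open B ->
  (forall t, K t -> B (loop_at g0 t)) -> \forall g \near g0, forall t, K t -> B (loop_at g t).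
Proof.
move=> cK oB KB.
have c : (set_val : loop_space R X -> {compact-open, R -> X}) @ g0 --> (set_val g0 : {compact-open, R -> X}).
  exact: initial_continuous.
have /compact_open_cvgP/(_ K B cK oB) h := c; have {h} : nbhs g0 [set g | (set_val g : R -> X) @` K `<=` B].
  by apply: h => [|_ [t Kt <-]]; [exact: (@fmap_filter _ _ _ _ (nbhs_filter g0))|exact: KB].
by apply: filterS => g gK t Kt; apply: gK; exists t.
Qed.

Lemma cvg_eval (t0 : R) (g0 : loop_space R X) :
  (fun p : R * loop_space R X => loop_at p.2 p.1) @ (t0, g0) --> loop_at g0 t0.
Proof.
move=> W /nbhs_openP[B [oB Bg BW]].
have : nbhs t0 (loop_at g0 @^-1` B) by apply: loop_at_continuous; exact: open_nbhs_nbhs.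
move=> /nbhs_ballP[e /= e0 eB].
pose K := `[t0 - e / 2, t0 + e / 2]%classic : set R.
have KB t : K t -> B (loop_at g0 t).
  rewrite /K /= in_itv /= => /andP[h1 h2]; apply: eB; rewrite /ball /= ltr_norml.
  by apply/andP; split; lra.
have := loop_nbhs (@segment_compact _ _ _) oB KB; rewrite -/K => h.
exists ([set t | t0 - e / 2 < t < t0 + e / 2], [set g | forall t, K t -> B (loop_at g t)]) => /=.
  by split => //; apply: near_itv; apply/andP; split; lra.
move=> [t g] [/= /andP[h1 h2] gK]; apply: BW; apply: gK.
by rewrite /K /= in_itv /= !ltW.
Qed.

(** With [cvg_eval] this is the exponential law for the compact-open topology: joint convergence in
    (t, y) is made uniform on compact sets of t by compactness. *)
Lemma cvg_loop (Y : Type) (F : set_system Y) (f : Y -> loop_space R X) (g0 : loop_space R X) : Filter F ->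
  (forall t, (fun p : R * Y => loop_at (f p.2) p.1) @ filter_prod (nbhs t) F --> loop_at g0 t) -> f @ F --> g0.
Proof.
move=> FF h W [_ [[A oA <-] /= Ag0 AW]].
have c : (fun y => set_val (f y) : {compact-open, R -> X}) @ F --> (set_val g0 : {compact-open, R -> X}).
  apply/compact_open_cvgP => K B cK oB KB.
  have /compact_near_coveringP nc := cK.
  have : \forall y \near F, K `<=` (fun t => B (loop_at (f y) t)).
    apply: nc => t Kt; apply: (h t); apply: open_nbhs_nbhs; split=> //.
    by apply: KB; exists t.
  by apply: filterS => y hy _ [t Kt <-]; exact: hy.
have : nbhs (set_val g0 : {compact-open, R -> X}) A by apply: open_nbhs_nbhs.
move=> /c h1; have h2 : \forall y \near F, A (set_val (f y)) by exact: h1.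
by apply: filterS h2 => y Ay; exact: AW.
Qed.

End Evaluation.

Section TotalScale.
Variables (R : realType) (X : topologicalType) (L : line_bundle_data R X).
Local Notation C := (R[i]^o).
Local Notation Tot := (total_space L).
Variable atlas : set X -> (forall x, fiber L x) -> Prop.
Hypothesis atlasP : is_atlas atlas.
Implicit Types (p q : Tot) (g : loop_space R X) (s : R -> Tot).

Definition tscale (k : R[i]) p : Tot := tot (k *: tvec p).

Lemma tscaleA k l p : tscale k (tscale l p) = tscale (k * l) p.
Proof. by rewrite /tscale -scalerA. Qed.

Lemma tscale1 p : tscale 1 p = p.
Proof. by rewrite /tscale scale1r; case: p. Qed.

Lemma tvec_tscale k p : k != 0 -> tvec p != 0 -> tvec (tscale k p) != 0.
Proof. by move=> k0 p0; rewrite [X in X != 0](_ : _ = k *: tvec p) // scaler_eq0 negb_or k0. Qed.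

Lemma tratio_tscale k p : tvec p != 0 -> tratio (tscale k p) p = k.
Proof. by case: p => x v v0; exact: tratioE. Qed.

Lemma tratio_self p : tvec p != 0 -> tratio p p = 1.
Proof. by move=> p0; have := tratio_tscale 1 p0; rewrite tscale1. Qed.

Lemma tcoord_tscale tau k p : frame_at atlas tau (tbase p) -> tcoord tau (tscale k p) = k * tcoord tau p.
Proof.
move=> fp; have e := totP atlasP fp.
have -> : tscale k p = tot ((k * tcoord tau p) *: tau (tbase p)).
  by rewrite {1}e -scalerA.
by rewrite (tcoordE atlasP).
Qed.

Lemma cvg_tscale (T : Type) (F : set_system T) {FF : Filter F} (k : T -> C) (c : R[i]) (s : T -> Tot) p :
  (exists tau, frame_at atlas tau (tbase p)) ->
  k @ F --> (c : C) -> s @ F --> p -> (fun t => tscale (k t) (s t)) @ F --> tscale c p.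
Proof.
move=> [tau fp] kc sp; have b : (fun t => tbase (s t)) @ F --> tbase p by exact: (cvg_comp _ _ sp (@cvg_tbase _ _ _ _ atlasP p)).
apply: (@cvg_tot R X L atlas atlasP tau T F FF (fun t => tscale (k t) (s t)) (tscale c p) fp b).
rewrite (tcoord_tscale _ fp).
have h : (fun t => k t * tcoord tau (s t) : C) @ F --> (c * tcoord tau p : C).
  by apply: cvg_mulC; [exact: kc|exact: (cvg_comp _ _ sp (cvg_tcoord atlasP fp))].
apply: (cvg_near_eq h).
have : \forall t \near F, frame_at atlas tau (tbase (s t)) by apply: b; exact: frame_at_near.
by apply: filterS => t ft; rewrite tcoord_tscale.
Qed.

Lemma tscale_tratio p q : tbase q = tbase p -> (exists tau, frame_at atlas tau (tbase p)) -> tvec q != 0 ->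
  p = tscale (tratio p q) q.
Proof.
move=> e [tau fp] q0; have fq : frame_at atlas tau (tbase q) by rewrite e.
have cq := tcoord_neq0 atlasP fq q0.
rewrite (tratio_coord atlasP fp e cq).
have h : tscale (tcoord tau p / tcoord tau q) q = tot (tcoord tau p *: tau (tbase q)).
  rewrite {2}(totP atlasP fq) /tscale [X in tot X](_ : _ = (tcoord tau p / tcoord tau q) *: (tcoord tau q *: tau (tbase q)))//.
  by rewrite scalerA divfK.
by rewrite h e; exact: (totP atlasP).
Qed.

Lemma tratio_neq0 p q : tbase q = tbase p -> (exists tau, frame_at atlas tau (tbase p)) -> tvec p != 0 -> tvec q != 0 ->
  tratio p q != 0.
Proof.
move=> e [tau fp] p0 q0; have fq : frame_at atlas tau (tbase q) by rewrite e.
rewrite (tratio_coord atlasP fp e) ?(tcoord_neq0 atlasP fq q0)//.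
by rewrite mulf_neq0 ?invr_eq0 ?(tcoord_neq0 atlasP fq q0) ?(tcoord_neq0 atlasP fp p0).
Qed.

Definition framed g := forall t, exists tau, frame_at atlas tau (loop_at g t).

Lemma nv_sectionP g s : nv_section g s <->
  [/\ continuous s, periodic1 s, forall t, tbase (s t) = loop_at g t & forall t, tvec (s t) != 0].
Proof.
split=> [[sc sp h]|[sc sp sb s0]]; split=> // t.
- by have [v _ ->] := h t.
- by have [v v0 ->] := h t; apply/eqP.
- have := sb t; have := s0 t; case: (s t) => x v /= v0 e; subst x; exists v => //.
  exact/eqP.
Qed.

Lemma nv_scale g s (c : R -> R[i]) : framed g -> nv_section g s -> continuous (c : R -> C) ->
  periodic1 c -> (forall t, c t != 0) -> nv_section g (fun t => tscale (c t) (s t)).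
Proof.
move=> fg /nv_sectionP[sc sp sb s0] cc cp c0; apply/nv_sectionP; split.
- by move=> t; apply: cvg_tscale; [rewrite sb; exact: fg|exact: cc|exact: sc].
- by move=> t; rewrite cp sp.
- by move=> t; exact: sb.
- by move=> t; exact: tvec_tscale.
Qed.

Lemma nv_ratio g s s' : framed g -> nv_section g s -> nv_section g s' ->
  [/\ continuous ((fun t => tratio (s t) (s' t)) : R -> C), periodic1 (fun t => tratio (s t) (s' t)),
      forall t, tratio (s t) (s' t) != 0 & forall t, s t = tscale (tratio (s t) (s' t)) (s' t)].
Proof.
move=> fg /nv_sectionP[sc sp sb s0] /nv_sectionP[sc' sp' sb' s0'].
have fr t : exists tau, frame_at atlas tau (tbase (s t)) by rewrite sb; exact: fg.
have e t : tbase (s' t) = tbase (s t) by rewrite sb sb'.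
split=> t.
- apply: (cvg_tratio atlasP (fr t) (e t) (s0' t) (sc t) (sc' t)).
  by near=> u; exact: e.
- by rewrite sp sp'.
- exact: tratio_neq0.
- exact: tscale_tratio.
Unshelve. all: by end_near.
Qed.

Lemma periodic_expi (n : int) : periodic1 (fun t : R => expi (2 * pi * n%:~R * t)).
Proof. by move=> t; rewrite mulrDr mulr1 expiD expi_2pi_int mulr1. Qed.

Lemma cvg_expi_linear (a t : R) : (fun s : R => expi (a * s) : C) @ t --> (expi (a * t) : C).
Proof. by apply: cvg_expi; apply: cvg_linear; exact: cvg_id. Qed.

Lemma nv_rotate g s n : framed g -> nv_section g s -> nv_section g (rotate n s).
Proof.
move=> fg nv; apply: (nv_scale fg nv); [|exact: periodic_expi|by move=> t; exact: expi_neq0].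
by move=> t; exact: cvg_expi_linear.
Qed.

(** If c = rho e^{i phi} with periodic rho and phi, then (1 - a + a rho) e^{i a phi} deforms 1 to c
    through nowhere vanishing loops. *)
Lemma null_homotopic g s (c : R -> R[i]) : framed g -> nv_section g s -> Null (@fracp R) c ->
  nv_homotopic g s (fun t => tscale (c t) (s t)).
Proof.
move=> fg nv [rho [phi [rc pc r0 k E]]]; have /nv_sectionP[sc sp sb s0] := nv.
have rp : periodic1 rho by move=> t; have [<- _] := k (t + 1); have [<- _] := k t; rewrite fracpD1.
have pp : periodic1 phi by move=> t; have [_ <-] := k (t + 1); have [_ <-] := k t; rewrite fracpD1.
pose m (p : R * R) : R[i] := (1 - p.1 + p.1 * rho p.2)%:C * expi (p.1 * phi p.2).
have mc (p : R * R) : (m : R * R -> C) @ p --> (m p : C).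
  have l1 : (fun q : R * R => q.1) @ p --> p.1 by exact: cvg_fstp.
  have l2 : (fun q : R * R => q.2) @ p --> p.2 by exact: cvg_sndp.
  have l3 := cvg_comp _ _ l2 (rc p.2); have l4 := cvg_comp _ _ l2 (pc p.2).
  apply: cvg_mulC.
    apply: cvg_real_complex; apply: cvgD; last exact: cvgM.
    by apply: cvgB => //; exact: cvg_cst.
  by apply: cvg_expi; exact: cvgM.
exists (fun p : R * R => tscale (m p) (s p.2)); split.
- apply: continuous_subspaceT => p; apply: cvg_tscale; first by rewrite sb; exact: fg.
    exact: mc.
  have l2 : (fun q : R * R => q.2) @ p --> p.2 by exact: cvg_sndp.
  exact: (cvg_comp _ _ l2 (sc p.2)).
- move=> a /andP[a0 a1]; apply: nv_scale => //.
  + move=> t; have l1 : (fun u : R => a) @ t --> a by exact: cvg_cst.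
    have l2 : (fun u : R => u) @ t --> t by exact: cvg_id.
    have l : (fun u : R => (a, u)) @ t --> (a, t) by exact: cvg_pair l1 l2.
    exact: (cvg_comp _ _ l (mc (a, t))).
  + by move=> t; rewrite /m /= rp pp.
  + move=> t; rewrite /m mulf_neq0 ?expi_neq0// eq_complex /= negb_and gt_eqF//.
    have := r0 t; move: (rho t) => r rp0.
    have [->|an] := eqVneq a 0; first by rewrite subr0 mul0r addr0 ltr01.
    have ap : 0 < a by rewrite lt_neqAle eq_sym an.
    by rewrite ltr_wpDl ?subr_ge0 ?mulr_gt0.
- by move=> t; rewrite /m /= subr0 !mul0r addr0 expi0 mulr1 tscale1.
- by move=> t; rewrite /m /= subrr add0r !mul1r -E.
Qed.

Lemma homotopic_null g s s' : framed g -> nv_section g s ->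
  nv_homotopic g s s' -> Null (@fracp R) (fun t => tratio (s' t) (s t)).
Proof.
move=> fg nv [h [hc hn h0 h1]].
have bs (a t : R) : 0 <= a <= 1 -> tbase (h (a, t)) = loop_at g t.
  by move=> a01; have /nv_sectionP[] := hn a a01.
have nz (a t : R) : 0 <= a <= 1 -> tvec (h (a, t)) != 0.
  by move=> a01; have /nv_sectionP[] := hn a a01.
have hc' (a t : R) : 0 <= a <= 1 -> h @ filter_prod (within `[0, 1]%classic (nbhs a)) (nbhs t) --> h (a, t).
  move=> a01 W nW; have /subspace_continuousP := hc.
  have aI : (`[0, 1]%classic `*` setT) (a, t) by split; rewrite /= ?in_itv.
  move=> /(_ (a, t) aI W nW) [[A B] /= [nA nB] AB].
  exists ([set x | `[0, 1]%classic x /\ A x], B).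
    by split => //=; rewrite /within /=; apply: filterS nA => x Ax xI.
  by move=> [x y] [/= [xI Ax] By]; apply: AB.
have := @Null_homotopy R (@fracp R) (@fracp01 R) (fun a t => tratio (h (a, t)) (h (0, t))).
have e1 : (fun t => tratio (h (1, t)) (h (0, t))) =1 (fun t => tratio (s' t) (s t)).
  by move=> t; rewrite h0 h1.
move=> nh; apply: (Null_eq e1); apply: nh.
- move=> a a01; have nva := hn a a01; have nv0 := hn 0 (introT andP (conj (lexx _) ler01)).
  have [qc qp q0 _] := nv_ratio fg nva nv0; split => //; split=> // t.
  exact: (periodic_fracp (f := fun t => tratio (h (a, t)) (h (0, t)))).
- move=> a t a01.
  have i01 : 0 <= (0 : R) <= 1 by rewrite lexx ler01.
  have l2 : (fun p : R * R => p.2) @ filter_prod (within `[0, 1]%classic (nbhs a)) (nbhs t) --> t by exact: cvg_snd.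
  have c0 : (fun p : R * R => h (0, p.2)) @ filter_prod (within `[0, 1]%classic (nbhs a)) (nbhs t) --> h (0, t).
    have /nv_sectionP[c0 _ _ _] := hn 0 i01; exact: (cvg_comp _ _ l2 (c0 t)).
  have ca : (fun p : R * R => h (p.1, p.2)) @ filter_prod (within `[0, 1]%classic (nbhs a)) (nbhs t) --> h (a, t).
    by have := hc' a t a01; under [X in _ -> X @ _ --> _]eq_fun do rewrite -surjective_pairing.
  apply: (cvg_tratio atlasP _ _ _ ca c0).
  + by rewrite bs//; exact: fg.
  + by rewrite !bs.
  + exact: nz.
  + exists (`[0, 1]%classic, setT); first by split; [exact: withinT|exact: filterT].
    by move=> [x y] [/= xI _]; rewrite !bs//; move: xI; rewrite in_itv.
- apply: (@Null_eq _ _ (fun=> 1)); last exact: Null1.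
  by move=> t; rewrite h0 tratio_self//; have /nv_sectionP[] := nv.
Qed.

(** Reduces homotopy of sections to winding numbers; all torsor properties of the transgression
    follow from the multiplicativity of [tratio] and [Null]. *)
Lemma nv_homotopicP g s s' : framed g -> nv_section g s -> nv_section g s' ->
  nv_homotopic g s s' <-> Null (@fracp R) (fun t => tratio (s' t) (s t)).
Proof.
move=> fg nv nv'; split; first exact: homotopic_null.
move=> /(null_homotopic fg nv); have [_ _ _ e] := nv_ratio fg nv' nv.
by have -> : (fun t => tscale (tratio (s' t) (s t)) (s t)) = s' by apply/funext => t; rewrite -e.
Qed.

Lemma tratio_trans p q r : tbase q = tbase p -> tbase r = tbase q -> (exists tau, frame_at atlas tau (tbase p)) ->
  tvec q != 0 -> tvec r != 0 -> tratio p r = tratio p q * tratio q r.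
Proof.
move=> e1 e2 fp q0 r0; have fq : exists tau, frame_at atlas tau (tbase q) by rewrite e1.
have e : p = tscale (tratio p q * tratio q r) r.
  by rewrite -tscaleA -(tscale_tratio e2 fq r0) -(tscale_tratio e1 fp q0).
by rewrite {1}e tratio_tscale.
Qed.

Lemma nv_homotopic_refl g s : framed g -> nv_section g s -> nv_homotopic g s s.
Proof.
move=> fg nv; apply/nv_homotopicP => //; apply: (@Null_eq _ _ (fun=> 1)); last exact: Null1.
by move=> t; rewrite tratio_self//; have /nv_sectionP[] := nv.
Qed.

Lemma nv_homotopic_trans g s1 s2 s3 : framed g -> nv_section g s1 -> nv_section g s2 -> nv_section g s3 ->
  nv_homotopic g s1 s2 -> nv_homotopic g s2 s3 -> nv_homotopic g s1 s3.
Proof.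
move=> fg n1 n2 n3 /(nv_homotopicP fg n1 n2) h12 /(nv_homotopicP fg n2 n3) h23.
apply/nv_homotopicP => //; apply: Null_eq (NullM h23 h12) => t.
have /nv_sectionP[_ _ b1 z1] := n1; have /nv_sectionP[_ _ b2 z2] := n2; have /nv_sectionP[_ _ b3 z3] := n3.
by rewrite -tratio_trans ?b1 ?b2 ?b3.
Qed.

Lemma nv_homotopic_sym g s1 s2 : framed g -> nv_section g s1 -> nv_section g s2 ->
  nv_homotopic g s1 s2 -> nv_homotopic g s2 s1.
Proof.
move=> fg n1 n2 /(nv_homotopicP fg n1 n2) h; apply/nv_homotopicP => //.
apply: Null_eq (NullV h) => t.
have /nv_sectionP[_ _ b1 z1] := n1; have /nv_sectionP[_ _ b2 z2] := n2.
have e : tratio (s1 t) (s2 t) * tratio (s2 t) (s1 t) = 1.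
  by rewrite -tratio_trans ?b1 ?b2// tratio_self.
have z : tratio (s2 t) (s1 t) != 0 by apply: tratio_neq0; rewrite ?b1 ?b2//; exact: fg.
by rewrite -[LHS]mul1r -e mulfK.
Qed.

Lemma nv_class_eq g s1 s2 : framed g -> nv_section g s1 -> nv_section g s2 ->
  nv_homotopic g s1 s2 <-> nv_class g s1 = nv_class g s2.
Proof.
move=> fg n1 n2; split=> [h|e]; last first.
  have : nv_class g s2 s2 by split => //; exact: nv_homotopic_refl.
  by rewrite -e => -[].
apply/seteqP; split=> s [n hs]; split => //.
  by apply: (nv_homotopic_trans fg n2 n1) hs => //; exact: nv_homotopic_sym.
exact: (nv_homotopic_trans fg n1 n2).
Qed.

(** The ratio of the two sections at y, divided by the one at y0, tends to 1 jointly in t, so it is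
    null for y near y0 by [near_Null]. *)
Lemma near_homotopic (Y : topologicalType) (y0 : Y) (gam : Y -> loop_space R X) (s s' : R * Y -> Tot) :
  (forall t, s @ (t, y0) --> s (t, y0)) -> (forall t, s' @ (t, y0) --> s' (t, y0)) ->
  (\forall y \near y0, framed (gam y)) ->
  (\forall y \near y0, nv_section (gam y) (fun t => s (t, y))) ->
  (\forall y \near y0, nv_section (gam y) (fun t => s' (t, y))) ->
  nv_homotopic (gam y0) (fun t => s (t, y0)) (fun t => s' (t, y0)) ->
  \forall y \near y0, nv_homotopic (gam y) (fun t => s (t, y)) (fun t => s' (t, y)).
Proof.
move=> sc sc' nf ns ns' h0.
have f0 := nbhs_singleton nf; have n0 := nbhs_singleton ns; have n0' := nbhs_singleton ns'.
have /nv_sectionP[_ _ b0 z0] := n0; have /nv_sectionP[_ _ b0' z0'] := n0'.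
have nul0 := proj1 (nv_homotopicP f0 n0 n0') h0.
pose q y t := tratio (s' (t, y)) (s (t, y)).
have nall : \forall y \near y0, [/\ framed (gam y), nv_section (gam y) (fun t => s (t, y)) &
    nv_section (gam y) (fun t => s' (t, y))].
  by apply: filterS (filterI (filterI nf ns) ns') => y [[]].
have [q0c q0p q00 _] := nv_ratio f0 n0' n0.
have : \forall y \near y0, Null (@fracp R) (fun t => q y t / q y0 t).
  apply: (near_Null (@fracp01 R)).
    apply: filterS nall => y [fy ny ny']; have [qc qp qn _] := nv_ratio fy ny' ny.
    split=> t.
      by apply: cvg_mulC; [exact: qc|apply: cvg_invC; [exact: q00|exact: q0c]].
    by apply: (periodic_fracp (f := fun t => q y t / q y0 t)) => u; rewrite /q qp q0p.
  move=> t _; rewrite -(divff (q00 t)).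
  have l1 : (fun p : Y * R => p.1) @ filter_prod (nbhs y0) (nbhs t) --> y0 by exact: cvg_fst.
  have l2 : (fun p : Y * R => p.2) @ filter_prod (nbhs y0) (nbhs t) --> t by exact: cvg_snd.
  have l : (fun p : Y * R => (p.2, p.1)) @ filter_prod (nbhs y0) (nbhs t) --> (t, y0) by exact: cvg_pair l2 l1.
  apply: cvg_mulC; last first.
    by apply: cvg_invC; [exact: q00|exact: (cvg_comp _ _ l2 (q0c t))].
  have c1 := cvg_comp _ _ l (sc t); have c2 := cvg_comp _ _ l (sc' t).
  apply: (cvg_tratio atlasP _ _ _ c2 c1).
  - by rewrite b0'; exact: f0.
  - by rewrite b0' b0.
  - exact: z0.
  - have : \forall p \near filter_prod (nbhs y0) (nbhs t), [/\ framed (gam p.1), nv_section (gam p.1) (fun t => s (t, p.1)) &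
      nv_section (gam p.1) (fun t => s' (t, p.1))] by exact: (l1 _ nall).
    by apply: filterS => p [_ /nv_sectionP[_ _ e _] /nv_sectionP[_ _ e' _]]; rewrite /= e e'.
move=> nq; apply: filterS (filterI nq nall) => y [nqy [fy ny ny']].
apply/nv_homotopicP => //; apply: Null_eq (NullM nqy nul0) => t.
by rewrite divfK//; exact: q00.
Qed.

Lemma transgression_topE (W : set (transgression L)) : open W = opens (transgression_topology L) W.
Proof. by []. Qed.

(* A section along one loop, trivialised by tau0 on the arc sin <= k2 and by tau1 on the
   arc sin >= k1, extends to the nearby loops with the help of a cutoff function. *)
Section Extension.
Variables (g0 : loop_space R X) (s0 : R -> Tot) (tau0 tau1 : forall x, fiber L x) (k1 k2 : R).
Hypotheses (n0 : nv_section g0 s0) (k12 : k1 < k2).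
Hypothesis f0 : forall t, sin (2 * pi * t) <= k2 -> frame_at atlas tau0 (loop_at g0 t).
Hypothesis f1 : forall t, k1 <= sin (2 * pi * t) -> frame_at atlas tau1 (loop_at g0 t).

Let th (t : R) : R := Num.min 1 (Num.max 0 ((sin (2 * pi * t) - k1) / (k2 - k1))).
Let c0 t := tcoord tau0 (s0 t).
Let c1 t := tcoord tau1 (s0 t).
Let tr x := tcoord tau1 (tot (tau0 x)).

Definition extend_section (p : R * loop_space R X) : Tot :=
  tot ((1 - th p.1)%:C *: (c0 p.1 *: tau0 (loop_at p.2 p.1)) + (th p.1)%:C *: (c1 p.1 *: tau1 (loop_at p.2 p.1))).

(** The third condition keeps [extend_section] away from zero on the overlap of the arcs: relative
    to c1 tau1 it is (1 - th) z + th with Re z > 0. On g0 itself z = 1. *)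
Let good g := [/\ forall t, sin (2 * pi * t) <= k2 -> frame_at atlas tau0 (loop_at g t),
  forall t, k1 <= sin (2 * pi * t) -> frame_at atlas tau1 (loop_at g t) &
  forall t, k1 <= sin (2 * pi * t) <= k2 -> 0 < complex.Re (c0 t * tr (loop_at g t) / c1 t)].

Definition extend_dom : set (loop_space R X) := [set g | good g]°.

Let thc (t : R) : th @ t --> th t.
Proof.
exact: cvg_cutoff.
Qed.

Let th0 t : sin (2 * pi * t) <= k1 -> th t = 0.
Proof.
move=> h; rewrite /th max_l; first by rewrite min_r// ler01.
by rewrite pmulr_lle0 ?invr_gt0 ?subr_gt0// subr_le0.
Qed.

Let th1 t : k2 <= sin (2 * pi * t) -> th t = 1.
Proof.
move=> h; rewrite /th min_l//; rewrite le_max; apply/orP; right.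
by rewrite ler_pdivlMr ?subr_gt0// mul1r lerB.
Qed.

Let th01 t : 0 <= th t <= 1.
Proof. by rewrite /th le_min ge_min lexx ler01 le_max lexx. Qed.

Let s0c : continuous s0. Proof. by have /nv_sectionP[] := n0. Qed.
Let s0p : periodic1 s0. Proof. by have /nv_sectionP[] := n0. Qed.
Let s0b t : tbase (s0 t) = loop_at g0 t. Proof. by have /nv_sectionP[] := n0. Qed.
Let s0n t : tvec (s0 t) != 0. Proof. by have /nv_sectionP[] := n0. Qed.

Let c0c (t : R) : sin (2 * pi * t) <= k2 -> (c0 : R -> C) @ t --> (c0 t : C).
Proof.
move=> h; have fr : frame_at atlas tau0 (tbase (s0 t)) by rewrite s0b; exact: f0.
exact: (cvg_comp _ _ (@s0c t) (cvg_tcoord atlasP fr)).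
Qed.

Let c1c (t : R) : k1 <= sin (2 * pi * t) -> (c1 : R -> C) @ t --> (c1 t : C).
Proof.
move=> h; have fr : frame_at atlas tau1 (tbase (s0 t)) by rewrite s0b; exact: f1.
exact: (cvg_comp _ _ (@s0c t) (cvg_tcoord atlasP fr)).
Qed.

Let c0n t : sin (2 * pi * t) <= k2 -> c0 t != 0.
Proof. by move=> h; apply: (tcoord_neq0 atlasP) => //; rewrite s0b; exact: f0. Qed.

Let c1n t : k1 <= sin (2 * pi * t) -> c1 t != 0.
Proof. by move=> h; apply: (tcoord_neq0 atlasP) => //; rewrite s0b; exact: f1. Qed.

Let s0E0 t : sin (2 * pi * t) <= k2 -> s0 t = tot (c0 t *: tau0 (loop_at g0 t)).
Proof. by move=> h; rewrite [LHS](totP atlasP (tau := tau0)) s0b//; exact: f0. Qed.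

Let s0E1 t : k1 <= sin (2 * pi * t) -> s0 t = tot (c1 t *: tau1 (loop_at g0 t)).
Proof. by move=> h; rewrite [LHS](totP atlasP (tau := tau1)) s0b//; exact: f1. Qed.

Let trE x : frame_at atlas tau1 x -> tau0 x = tr x *: tau1 x.
Proof.
move=> fx; have [gen t0] := frame_at_gen atlasP fx; have [k kE] := gen (tau0 x).
by rewrite /tr {2}kE (tcoordE atlasP).
Qed.

Lemma extend_section0 t : extend_section (t, g0) = s0 t.
Proof.
rewrite /extend_section /=; have [h|h] := leP (sin (2 * pi * t)) k1.
  rewrite th0// subr0 !scale0r addr0 scale1r s0E0//; exact: le_trans h (ltW k12).
have [h'|h'] := leP k2 (sin (2 * pi * t)).
  by rewrite th1// subrr !scale0r add0r scale1r s0E1// ltW.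
have e : c0 t *: tau0 (loop_at g0 t) = c1 t *: tau1 (loop_at g0 t).
  have := s0E0 (ltW h'); rewrite s0E1 ?(ltW h)//.
  have ft := f1 (ltW h); rewrite (trE ft) scalerA => /(congr1 (tcoord tau1)).
  by rewrite !(tcoordE atlasP)// => ->.
by rewrite e -scalerDl -rmorphD subrK scale1r s0E1// ltW.
Qed.

(** Each of the three conditions holds on a neighbourhood of (t, g0) for every t; compactness of
    [0, 1] makes the neighbourhood of g0 uniform, and periodicity carries it to all t. *)
Lemma extend_dom0 : extend_dom g0.
Proof.
have cov (P : loop_space R X -> R -> Prop) :
    (forall t : R, \forall p \near ((t, g0) : R * loop_space R X), P p.2 p.1) ->
    \forall g \near g0, `[0, 1]%classic `<=` P g.
  have /compact_near_coveringP nc : compact `[0 : R, 1]%classic by exact: segment_compact.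
  by move=> h; apply: (nc (loop_space R X) (nbhs g0) P) => t _; exact: h.
have sl (t : R) : (fun p : R * loop_space R X => sin (2 * pi * p.1)) @ (t, g0) --> sin (2 * pi * t).
  exact: (cvg_comp _ _ (@cvg_fstp _ _ (t, g0)) (@cvg_sin2pi R t)).
have slt (t k : R) : sin (2 * pi * t) < k -> \forall p \near ((t, g0) : R * loop_space R X), sin (2 * pi * p.1) < k.
  by move=> h; apply: (cvgr_lt _ (sl t)).
have sgt (t k : R) : k < sin (2 * pi * t) -> \forall p \near ((t, g0) : R * loop_space R X), k < sin (2 * pi * p.1).
  by move=> h; apply: (cvgr_gt _ (sl t)).
have ev t := @cvg_eval R X t g0.
have h0 : \forall g \near g0, `[0, 1]%classic `<=` (fun t => sin (2 * pi * t) <= k2 -> frame_at atlas tau0 (loop_at g t)).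
  apply: cov => t; have [h|h] := leP (sin (2 * pi * t)) k2; last first.
    have := sgt t k2 h; apply: filterS => p hp hp'; by rewrite leNgt hp in hp'.
  have : \forall p \near ((t, g0) : R * loop_space R X), frame_at atlas tau0 (loop_at p.2 p.1).
    by apply: (ev t); apply: (frame_at_near atlasP); exact: f0.
  by apply: filterS.
have h1 : \forall g \near g0, `[0, 1]%classic `<=` (fun t => k1 <= sin (2 * pi * t) -> frame_at atlas tau1 (loop_at g t)).
  apply: cov => t; have [h|h] := leP k1 (sin (2 * pi * t)); last first.
    have := slt t k1 h; apply: filterS => p hp hp'; by rewrite leNgt hp in hp'.
  have : \forall p \near ((t, g0) : R * loop_space R X), frame_at atlas tau1 (loop_at p.2 p.1).
    by apply: (ev t); apply: (frame_at_near atlasP); exact: f1.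
  by apply: filterS.
have h2 : \forall g \near g0, `[0, 1]%classic `<=` (fun t => k1 <= sin (2 * pi * t) <= k2 ->
     0 < complex.Re (c0 t * tr (loop_at g t) / c1 t)).
  apply: cov => t; have [h|h] := leP k1 (sin (2 * pi * t)); last first.
    have := slt t k1 h; apply: filterS => p hp /andP[hp' _]; by rewrite leNgt hp in hp'.
  have [h'|h'] := leP (sin (2 * pi * t)) k2; last first.
    have := sgt t k2 h'; apply: filterS => p hp /andP[_ hp']; by rewrite leNgt hp in hp'.
  have q1 : c0 t * tr (loop_at g0 t) / c1 t = 1.
    have ft := f1 h; have := s0E0 h'; rewrite s0E1// (trE ft) scalerA => /(congr1 (tcoord tau1)).
    by rewrite !(tcoordE atlasP)// => <-; rewrite divff//; exact: c1n.
  have l1 := @cvg_fstp _ _ ((t, g0) : R * loop_space R X).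
  have qc : (fun p : R * loop_space R X => c0 p.1 * tr (loop_at p.2 p.1) / c1 p.1 : C) @ (t, g0) -->
      (c0 t * tr (loop_at g0 t) / c1 t : C).
    apply: cvg_mulC; last by apply: cvg_invC; [exact: c1n|exact: (cvg_comp _ _ l1 (c1c h))].
    apply: cvg_mulC; first exact: (cvg_comp _ _ l1 (c0c h')).
    exact: (cvg_comp _ _ (ev t) (cvg_frame_transition atlasP (f1 h) (f0 h'))).
  have q2 : \forall p \near ((t, g0) : R * loop_space R X), 0 < complex.Re (c0 p.1 * tr (loop_at p.2 p.1) / c1 p.1).
    by apply: (cvgr_gt _ (cvg_Re qc)); rewrite q1 ltr01.
  by apply: filterS q2.
apply: filterS (filterI (filterI h0 h1) h2) => g [[g1 g2] g3].
have red (t : R) : [/\ sin (2 * pi * t) = sin (2 * pi * fracp t), loop_at g t = loop_at g (fracp t),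
    c0 t = c0 (fracp t) & c1 t = c1 (fracp t)].
  split; first by rewrite -(periodic_fracp t (@periodic_sin R)).
  - by rewrite (periodic_fracp t (@loop_at_periodic R X g)).
  - by rewrite /c0 (periodic_fracp t s0p).
  - by rewrite /c1 (periodic_fracp t s0p).
have fI t : `[0, 1]%classic (fracp t) by rewrite /= in_itv /= fracp01.
split=> t; have [r1 r2 r3 r4] := red t; rewrite r1 r2 ?r3 ?r4; [exact: g1|exact: g2|exact: g3].
Qed.

Lemma extend_dom_open : open extend_dom. Proof. exact: open_interior. Qed.

Lemma extend_dom_framed g : extend_dom g -> framed g.
Proof.
move=> /nbhs_singleton[g1 g2 _] t; have [h|h] := leP (sin (2 * pi * t)) k2.
  by exists tau0; exact: g1.
by exists tau1; apply: g2; apply/ltW/(lt_trans k12).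
Qed.

Lemma extend_section_cvg t g : extend_dom g -> extend_section @ (t, g) --> extend_section (t, g).
Proof.
move=> dg; have [g1 g2 g3] := nbhs_singleton dg.
have l1 := @cvg_fstp _ _ ((t, g) : R * loop_space R X).
have l2 := @cvg_sndp _ _ ((t, g) : R * loop_space R X).
have ev := @cvg_eval R X t g.
have sl : (fun p : R * loop_space R X => sin (2 * pi * p.1)) @ (t, g) --> sin (2 * pi * t).
  exact: (cvg_comp _ _ l1 (@cvg_sin2pi R t)).
have thl := cvg_comp _ _ l1 (@thc t).
have [h|h] := ltP (sin (2 * pi * t)) k1.
  have hk2 : sin (2 * pi * t) <= k2 by apply/ltW/(lt_trans h).
  have e (p : R * loop_space R X) : sin (2 * pi * p.1) < k1 -> tot (c0 p.1 *: tau0 (loop_at p.2 p.1)) = extend_section p.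
    by move=> hp; rewrite /extend_section th0 ?ltW// subr0 !scale0r addr0 scale1r.
  rewrite -(e (t, g) h).
  have l : (fun p : R * loop_space R X => tot (c0 p.1 *: tau0 (loop_at p.2 p.1))) @ ((t, g) : R * loop_space R X) -->
      tot (c0 t *: tau0 (loop_at g t)).
    apply: (cvg_tot_scale atlasP (g1 t hk2) ev).
    exact: (cvg_comp _ _ l1 (c0c hk2)).
  have nf : \forall p \near ((t, g) : R * loop_space R X), sin (2 * pi * p.1) < k1 by apply: (cvgr_lt _ sl).
  by apply: (cvg_near_eq l); apply: filterS nf => p; exact: e.
have [h'|h'] := ltP k2 (sin (2 * pi * t)).
  have e (p : R * loop_space R X) : k2 < sin (2 * pi * p.1) -> tot (c1 p.1 *: tau1 (loop_at p.2 p.1)) = extend_section p.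
    by move=> hp; rewrite /extend_section th1 ?ltW// subrr !scale0r add0r scale1r.
  rewrite -(e (t, g) h').
  have l : (fun p : R * loop_space R X => tot (c1 p.1 *: tau1 (loop_at p.2 p.1))) @ ((t, g) : R * loop_space R X) -->
      tot (c1 t *: tau1 (loop_at g t)).
    apply: (cvg_tot_scale atlasP (g2 t h) ev).
    exact: (cvg_comp _ _ l1 (c1c h)).
  have nf : \forall p \near ((t, g) : R * loop_space R X), k2 < sin (2 * pi * p.1) by apply: (cvgr_gt _ sl).
  by apply: (cvg_near_eq l); apply: filterS nf => p; exact: e.
have e (p : R * loop_space R X) : frame_at atlas tau1 (loop_at p.2 p.1) ->
    tot (((1 - th p.1)%:C * (c0 p.1 * tr (loop_at p.2 p.1)) + (th p.1)%:C * c1 p.1) *: tau1 (loop_at p.2 p.1)) = extend_section p.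
  by move=> fp; rewrite /extend_section (trE fp) !scalerA -scalerDl -mulrA.
have ft := g2 t h; have ft0 := g1 t h'.
rewrite -(e (t, g) ft).
have l : (fun p : R * loop_space R X => tot (((1 - th p.1)%:C * (c0 p.1 * tr (loop_at p.2 p.1)) + (th p.1)%:C * c1 p.1) *: tau1 (loop_at p.2 p.1)))
    @ ((t, g) : R * loop_space R X) -->
    tot (((1 - th t)%:C * (c0 t * tr (loop_at g t)) + (th t)%:C * c1 t) *: tau1 (loop_at g t)).
  apply: (cvg_tot_scale atlasP ft ev).
  have a1 : (fun p : R * loop_space R X => (1 - th p.1)%:C : C) @ (t, g) --> ((1 - th t)%:C : C).
    by apply: cvg_real_complex; apply: cvgB => //; exact: cvg_cst.
  have a2 : (fun p : R * loop_space R X => c0 p.1 * tr (loop_at p.2 p.1) : C) @ (t, g) --> (c0 t * tr (loop_at g t) : C).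
    apply: cvg_mulC; first exact: (cvg_comp _ _ l1 (c0c h')).
    exact: (cvg_comp _ _ ev (cvg_frame_transition atlasP ft ft0)).
  have a3 : (fun p : R * loop_space R X => (th p.1)%:C * c1 p.1 : C) @ (t, g) --> ((th t)%:C * c1 t : C).
    by apply: cvg_mulC; [exact: cvg_real_complex|exact: (cvg_comp _ _ l1 (c1c h))].
  exact: (@cvgD _ C _ _ _ _ _ _ _ (cvg_mulC a1 a2) a3).
apply: (cvg_near_eq l).
have : \forall p \near ((t, g) : R * loop_space R X), frame_at atlas tau1 (loop_at p.2 p.1).
  by apply: ev; exact: (frame_at_near atlasP).
by apply: filterS => p; exact: e.
Qed.

Lemma extend_section_nv g : extend_dom g -> nv_section g (fun t => extend_section (t, g)).
Proof.
move=> dg; have [g1 g2 g3] := nbhs_singleton dg; apply/nv_sectionP; split.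
- move=> t; have l1 : (fun u : R => u) @ t --> t by exact: cvg_id.
  have l2 : (fun u : R => g) @ t --> g by exact: cvg_cst.
  have l : (fun u : R => (u, g)) @ t --> (t, g) by exact: cvg_pair l1 l2.
  exact: (cvg_comp _ _ l (@extend_section_cvg t g dg)).
- by move=> t; rewrite /extend_section /= /th /c0 /c1 periodic_sin s0p loop_at_periodic.
- by [].
move=> t; apply/eqP => e0; have e0' : (1 - th t)%:C *: (c0 t *: tau0 (loop_at g t)) + (th t)%:C *: (c1 t *: tau1 (loop_at g t)) = 0 by exact: e0.
move: e0'; have [h|h] := ltP (sin (2 * pi * t)) k1.
  have hk2 : sin (2 * pi * t) <= k2 by apply/ltW/(lt_trans h).
  have [_ nz] := frame_at_gen atlasP (g1 t hk2).
  rewrite th0 ?ltW// subr0 scale0r addr0 scale1r => /eqP.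
  by rewrite scaler_eq0 (negbTE nz) (negbTE (c0n hk2)).
have ft := g2 t h; have [_ nz] := frame_at_gen atlasP ft.
have [h'|h'] := leP (sin (2 * pi * t)) k2; last first.
  rewrite th1 ?ltW// subrr scale0r add0r scale1r => /eqP.
  by rewrite scaler_eq0 (negbTE nz) (negbTE (c1n h)).
rewrite (trE ft) !scalerA -scalerDl => /eqP; rewrite scaler_eq0 (negbTE nz) orbF => /eqP e.
have p := g3 t (introT andP (conj h h')).
have : (1 - th t)%:C * (c0 t * tr (loop_at g t) / c1 t) + (th t)%:C = 0.
  apply: (mulIf (c1n h)); rewrite mul0r -[RHS]e mulrDl -!mulrA mulVf ?mulr1//; exact: c1n.
move=> /(congr1 (@complex.Re R)); rewrite ReD ReZ /=; have /andP[t0 t1] := th01 t.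
move: p; move: (complex.Re _) => r r0; have [->|tn] := eqVneq (th t) 0; first by rewrite subr0 mul1r addr0 => r1; rewrite r1 ltxx in r0.
have tp : 0 < th t by rewrite lt_neqAle eq_sym tn.
by nra.
Qed.

End Extension.

Section LocalSection.
Variables (U : set (loop_space R X)) (Sig : R * loop_space R X -> Tot).
Hypotheses (oU : open U) (SigC : forall t g, U g -> Sig @ (t, g) --> Sig (t, g)).
Hypothesis Sign : forall g, U g -> nv_section g (fun t => Sig (t, g)).

Lemma local_section_within : {within setT `*` U, continuous Sig}.
Proof. by apply/subspace_continuousP => -[t g] [_ /= Ug]; apply: cvg_within_filter; exact: SigC. Qed.

(** Continuity of g -> [Sig(., g)], which the final topology grants, stated for every point p with
    that class so that no section has to be named off U. *)
Lemma local_section_cvg (p0 : transgression L) (W : set (transgression L)) g0 : U g0 ->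
  set_val (p0 : transgression_type L) = (g0, nv_class g0 (fun t => Sig (t, g0))) -> nbhs p0 W ->
  \forall g \near g0, forall p : transgression L,
    set_val (p : transgression_type L) = (g, nv_class g (fun t => Sig (t, g))) -> W p.
Proof.
move=> Ug0 p0E /nbhs_openP[W' [oW' W'p0 W'W]].
have mem g : U g -> (g, nv_class g (fun t => Sig (t, g))) \in transgression_set (L := L).
  by move=> Ug; apply/mem_set; exists (fun t => Sig (t, g)) => //; exact: Sign.
pose sg g : transgression_type L := if pselect (U g) is left h then SigSub (mem g h) else p0.
have sgE g : U g -> set_val (sg g) = (g, nv_class g (fun t => Sig (t, g))).
  by move=> Ug; rewrite /sg; case: pselect.
rewrite transgression_topE in oW'.
have := oW' U sg oU; rewrite openE => h.
have {h}: nbhs g0 (U `&` sg @^-1` W').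
  apply: h; first by exists Sig; [exact: local_section_within|move=> g Ug; split; [exact: Sign|exact: sgE]].
  split => //; rewrite /preimage /=.
  by have -> : sg g0 = p0 by apply/val_inj; rewrite -!set_valE sgE.
apply: filterS => g [Ug Wg] p pE; apply: W'W.
by have -> : p = sg g by apply/val_inj; rewrite -!set_valE sgE.
Qed.

(** The image of a local section is open, as in a covering. Any other continuous family that
    represents the same class at g is homotopic to [Sig] at all nearby loops, by
    [near_homotopic]. *)
Lemma local_section_open : (forall g, U g -> framed g) ->
  open [set p : transgression L | U (set_val (p : transgression_type L)).1 /\
    (set_val (p : transgression_type L)).2 =
      nv_class (set_val (p : transgression_type L)).1 (fun t => Sig (t, (set_val (p : transgression_type L)).1))].
Proof.
move=> fU; rewrite transgression_topE => U' sg oU' [s sc sP].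
rewrite openE => g [U'g []]; rewrite /preimage /=.
have [ng sgE] := sP g U'g; rewrite sgE /= => Ug e.
have scg t : s @ (t, g) --> s (t, g).
  have oUT : open (setT `*` U' : set (R * loop_space R X)) by apply: open_setX => //; exact: openT.
  have := sc; rewrite (continuous_open_subspace _ oUT) => /(_ (t, g)); apply.
  by rewrite inE.
have nU : \forall g' \near g, U g' by exact: open_nbhs_nbhs.
have nU' : \forall g' \near g, U' g' by exact: open_nbhs_nbhs.
have hom : nv_homotopic g (fun t => s (t, g)) (fun t => Sig (t, g)).
  by apply/nv_class_eq => //; [exact: fU|exact: Sign].
have nh : \forall g' \near g, nv_homotopic g' (fun t => s (t, g')) (fun t => Sig (t, g')).
  apply: (@near_homotopic (loop_space R X) g id s Sig scg) => //.
  - by move=> t; exact: SigC.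
  - by apply: filterS nU => g' Ug'; exact: fU.
  - by apply: filterS nU' => g' U'g'; exact: (sP _ U'g').1.
  - by apply: filterS nU => g' Ug'; exact: Sign.
apply: filterS (filterI (filterI nU nU') nh) => g' [[Ug' U'g'] hg'].
split => //; have [n' e'] := sP g' U'g'; rewrite /= e' /=; split => //.
by apply/nv_class_eq => //; [exact: fU|exact: Sign].
Qed.

End LocalSection.

End TotalScale.

Lemma ler_nrm_dist (R : realType) (V : normedModType R[i]) (x y z : V) :
  nrm (x - z) <= nrm (x - y) + nrm (y - z).
Proof. by have := ler_nrmD (x - y) (y - z); rewrite addrA subrK. Qed.

(** * Existence of frames for the determinant bundle *)

Section DetAtlas.
Variables (R : realType) (H : hilbertType R).
Local Notation C := (R[i]^o).
Implicit Types (Q : Fred H).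
Local Notation V Q lam := (eigen_sum (PdagP (set_val Q)) `[0, lam]%classic).
Local Notation V' Q lam := (eigen_sum (PPdag (set_val Q)) `[0, lam]%classic).

Lemma det_is_atlas : is_atlas (L := det_bundle H) (@det_atlas R H).
Proof.
split.
- by move=> U tau [lam [e [f [oU _]]]].
- move=> U tau Q [lam [e [f F]]] UQ; exact: (det_frame_gen F UQ).
- move=> U1 U2 tau1 tau2 Q [l1 [e1 [f1 F1]]] [l2 [e2 [f2 F2]]] U1Q U2Q; exact: (transition F1 F2 U1Q U2Q).
- move=> U tau W [lam [e [f F]]] oW; exact: (det_frame_open F oW).
- move=> W h; apply: open_det_total => U tau a; exact: h.
Qed.

(** The frame consists of the spectral projections of the fixed vectors of s0. The eigenlists [S Q]
    are chosen without any continuity, but the projections they define vary continuously by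
    [spectral_gap_proj_perturb]. *)
Lemma frame_family (B : Fred H -> bop H) Q0 (lam : R) s0 a0 m0 : continuous B ->
  (forall Q, selfadjoint (B Q)) -> (forall Q x, 0 <= rin (bop_app (B Q) x) x) -> 0 < lam ->
  spectral_gap (B Q0) lam s0 a0 m0 ->
  exists U e, [/\ open U, U Q0, continuous_frame U (fun Q => eigen_sum (B Q) `[0, lam]%classic) e,
    size e = size s0 & forall Q, U Q -> exists s a m, spectral_gap (B Q) lam s a m].
Proof.
move=> Bc Bsa B0 l0 g0; have [d d0 dP] := spectral_gap_perturb (Bsa Q0) l0 g0.
pose U := [set Q | nrm (B Q - B Q0) < d].
have /choice[S SP] : forall Q, exists s, U Q -> exists a m, [/\ spectral_gap (B Q) lam s a m, size s = size s0 &
      is_basis (eigen_sum (B Q) `[0, lam]%classic) [seq proj s y | y <- s0]].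
  move=> Q; have [UQ|] := pselect (U Q); last by exists [::].
  by have [s [a [m h]]] := dP _ (Bsa Q) (B0 Q) UQ; exists s => _; exists a, m.
exists U, [seq (fun Q => proj (S Q) y) | y <- s0]; split.
- rewrite openE => Q UQ; rewrite /interior.
  have e0 : 0 < d - nrm (B Q - B Q0) by rewrite subr_gt0.
  have := proj1 (@cvg_nrmP _ _ _ (nbhs Q) (nbhs_filter Q) B (B Q)) (Bc Q) _ e0.
  apply: filterS => Q' h; rewrite /U /=.
  by apply: le_lt_trans (ler_nrm_dist _ (B Q) _) _; rewrite -ltrBrDr.
- by rewrite /U /= subrr nrm0.
- split; last first.
    by move=> Q UQ; rewrite -map_comp /comp; have [a [m [_ _]]] := SP Q UQ.
  move=> _ /mapP[y ys ->]; apply: continuous_in_subspaceT => Q /set_mem UQ.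
  have [a [m [gQ sQ _]]] := SP Q UQ.
  apply: (proj2 (@cvg_nrmP _ _ _ (nbhs Q) (nbhs_filter Q) (fun Q => proj (S Q) y) _)) => e e0.
  pose K := (size (S Q))%:R * ((lam - a)^-1 + (m - lam)^-1) * nrm y + 1.
  have K0 : 0 < K.
    have [_ _ al lm _] := gQ.
    have h1 : 0 < lam - a by lra. have h2 : 0 < m - lam by lra.
    rewrite ltr_wpDl// !mulr_ge0 ?ler0n ?nrm_ge0 ?addr_ge0 ?invr_ge0 ?(ltW h1) ?(ltW h2)//.
  have nU : \forall Q' \near Q, U Q'.
    have e1 : 0 < d - nrm (B Q - B Q0) by rewrite subr_gt0.
    have := proj1 (@cvg_nrmP _ _ _ (nbhs Q) (nbhs_filter Q) B (B Q)) (Bc Q) _ e1.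
    apply: filterS => Q' h; rewrite /U /=.
    by apply: le_lt_trans (ler_nrm_dist _ (B Q) _) _; rewrite -ltrBrDr.
  have nd := proj1 (@cvg_nrmP _ _ _ (nbhs Q) (nbhs_filter Q) B (B Q)) (Bc Q) (e / K) (divr_gt0 e0 K0).
  apply: filterS (filterI nU nd) => Q' [UQ' h].
  have [a' [m' [gQ' sQ' _]]] := SP Q' UQ'.
  have := spectral_gap_proj_perturb y (Bsa Q') (Bsa Q) gQ' gQ (etrans sQ' (esym sQ)).
  have -> : (size (S Q))%:R * ((lam - a)^-1 + (m - lam)^-1) * nrm (B Q' - B Q) * nrm y =
     (K - 1) * nrm (B Q' - B Q) by rewrite /K; ring.
  move=> h'; apply: le_lt_trans h' _.
  have : K * nrm (B Q' - B Q) < e by rewrite mulrC -ltr_pdivlMr.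
  have := nrm_ge0 (B Q' - B Q); lra.
- by rewrite size_map.
- by move=> Q UQ; have [a [m [h _ _]]] := SP Q UQ; exists (S Q), a, m.
Qed.

Lemma PdagP_continuous : continuous (fun Q : Fred H => PdagP (set_val Q)).
Proof.
move=> Q; have c : (set_val : Fred H -> bop H) @ Q --> (set_val Q : bop H) by exact: initial_continuous.
apply: (@cvg_bop_comp _ _ _ _ (nbhs_filter Q)); last exact: c.
exact: (@cvg_adjoint _ _ _ _ (nbhs_filter Q) _ _ c).
Qed.

Lemma PPdag_continuous : continuous (fun Q : Fred H => PPdag (set_val Q)).
Proof.
move=> Q; have c : (set_val : Fred H -> bop H) @ Q --> (set_val Q : bop H) by exact: initial_continuous.
apply: (@cvg_bop_comp _ _ _ _ (nbhs_filter Q)); first exact: c.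
exact: (@cvg_adjoint _ _ _ _ (nbhs_filter Q) _ _ c).
Qed.

Lemma PdagP_ge0 (Q : bop H) x : 0 <= rin (bop_app (PdagP Q) x) x.
Proof. by rewrite rin_comp_adjoint sqr_ge0. Qed.

Lemma PPdag_ge0 (Q : bop H) x : 0 <= rin (bop_app (PPdag Q) x) x.
Proof. by rewrite -PdagP_adjoint PdagP_ge0. Qed.

Lemma det_frame_exists Q0 (lam : R) s a m s' a' m' : 0 < lam ->
  spectral_gap (PdagP (set_val Q0)) lam s a m -> spectral_gap (PPdag (set_val Q0)) lam s' a' m' ->
  exists U e f tau, [/\ det_frame U lam e f tau, U Q0, size e = size s & size f = size s'].
Proof.
move=> l0 g g'.
have [U1 [e [oU1 U1Q ce es g1]]] := frame_family PdagP_continuous (fun Q => @selfadjoint_PdagP _ _ _) (fun Q => @PdagP_ge0 _) l0 g.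
have [U2 [f [oU2 U2Q cf fs g2]]] := frame_family PPdag_continuous (fun Q => @selfadjoint_PPdag _ _ _) (fun Q => @PPdag_ge0 _) l0 g'.
pose U := U1 `&` U2.
have res W e0 U0 : U `<=` U0 -> continuous_frame U0 W e0 -> continuous_frame U W e0.
  move=> UU0 [c b]; split; last by move=> Q /UU0; exact: b.
  by move=> s0 /c; exact: continuous_subspaceW.
have ce' := res _ _ _ (@subIsetl _ _ _) ce; have cf' := res _ _ _ (@subIsetr _ _ _) cf.
pose ga (Q : Fred H) : dual_space (top_ext (V' Q lam)) :=
  xget 0 [set ga | dual_app ga (top_wedge (V' Q lam) [seq s Q | s <- f]) = 1].
exists U, e, f, (fun Q => @transport R H lam (set_val Q) (tens (top_wedge _ [seq s Q | s <- e]) (ga Q))).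
split => //; split => //; first exact: openI.
  split=> // Q [U1Q' U2Q']; have [sQ [aQ [mQ gQ]]] := g1 Q U1Q'; split.
    exact: spectral_gap_not_spec (@selfadjoint_PdagP _ _ _) gQ.
  by move=> l /andP[_ ll]; exact: spectral_gap_ess (@selfadjoint_PdagP _ _ _) gQ ll.
move=> Q UQ; exists (ga Q) => //; have [_ bf] := cf'; have bfQ := bf Q UQ.
have [g0 g0E] := dual_ex bfQ 1.
rewrite /ga; case: xgetP => [x _ //|/(_ g0)]; case.
rewrite /mkset g0E mul1r top_coord_wedge; last by move=> z; exact: basis_mem bfQ.
by rewrite coefxx//; exact: proj1 bfQ.
Qed.

(** The generator 1 of Det Q = C for invertible Q; the wedge and the functional are those of the
    zero space. *)
Definition det_one (Q : Fred H) : Det (set_val Q) := tens (top_wedge (ker_op (set_val Q)) [::])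
  (xget 0 [set a | dual_app a (top_wedge (ker_op (adjoint (set_val Q))) [::]) = 1]).

Lemma invertible_ker (Q : bop H) x : invertible Q -> bop_app Q x = 0 -> x = 0.
Proof. by move=> [Q' [h _]] Qx; rewrite -(bop_idE x) -h bop_compE Qx linear0. Qed.

Lemma invertible_adjoint (Q : bop H) : invertible Q -> invertible (adjoint Q).
Proof.
move=> [Q' [h1 h2]]; have adj_comp (A B : bop H) : adjoint (bop_comp A B) = bop_comp (adjoint B) (adjoint A).
  by apply: adjoint_uniq => x y; rewrite !bop_compE !adjointP.
have adj1 : adjoint (bop_id H) = bop_id H by apply: adjoint_uniq => x y; rewrite !bop_idE.
by exists (adjoint Q'); rewrite -!adj_comp h1 h2.
Qed.

Lemma dual_nil (W : set H) : is_basis W [::] ->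
  dual_app (xget 0 [set a : dual_space (top_ext W) | dual_app a (top_wedge W [::]) = 1]) (top_wedge W [::]) = 1.
Proof.
move=> b; have [g0 g0E] := dual_ex b 1; case: xgetP => [x _ //|/(_ g0)]; case.
by rewrite /mkset g0E mul1r top_coord_wedge// coefxx//; case: b.
Qed.

Lemma ker_nil (Q : bop H) : (forall x, bop_app Q x = 0 -> x = 0) -> is_basis (ker_op Q) [::].
Proof. by move=> h; apply: is_basis_nil => //; rewrite /ker_op /= linear0. Qed.

Lemma det_oneE Q (x : Det (set_val Q)) : invertible (set_val Q) -> is_det_one x <-> x = det_one Q.
Proof.
move=> iQ; have b := ker_nil (fun x => invertible_ker (invertible_adjoint iQ)).
split=> [[a a1 ->]|->]; last by eexists; [exact: dual_nil b|].
by rewrite /det_one; congr tens; apply: (dual_ext b); rewrite a1 dual_nil.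
Qed.

(** For lam below the spectrum of Q^dag Q, here d^2 / 2 with d a lower bound of Q and Q^dag, the
    spaces V_[0,lam] are zero near Q. The frames e and f are then empty lists, whose transport is
    [det_one]. *)
Lemma frame_at_one Q : invertible (set_val Q) -> frame_at (L := det_bundle H) (@det_atlas R H) (@det_one) Q.
Proof.
move=> iQ; have [c c0 cP] := invertible_bounded_below iQ.
have [c' c'0 cP'] := invertible_bounded_below (invertible_adjoint iQ).
pose d := Num.min c c'; have d0 : 0 < d by rewrite lt_min c0.
have gap0 (B : bop H) (k : R) : d <= k -> (forall x, k * nrm x <= nrm (bop_app B x)) ->
    spectral_gap (PdagP B) (d ^+ 2 / 2) [::] 0 (d ^+ 2).
  move=> dk kP; have d2 : 0 < d ^+ 2 by rewrite exprn_gt0.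
  split => //; [by rewrite divr_gt0|by lra|].
  move=> x _; rewrite rin_comp_adjoint -exprMn lerXn2r ?nnegrE ?nrm_ge0 ?mulr_ge0 ?nrm_ge0 ?(ltW d0)//.
  by apply: le_trans (kP x); rewrite ler_wpM2r ?nrm_ge0.
have g1 : spectral_gap (PdagP (set_val Q)) (d ^+ 2 / 2) [::] 0 (d ^+ 2) by apply: gap0 cP; rewrite ge_min lexx.
have g2 : spectral_gap (PPdag (set_val Q)) (d ^+ 2 / 2) [::] 0 (d ^+ 2).
  by rewrite -PdagP_adjoint; apply: gap0 cP'; rewrite ge_min lexx orbT.
have l0 : 0 < d ^+ 2 / 2 by rewrite divr_gt0 ?exprn_gt0.
have [U [e [f [tau [F UQ /size0nil e0 /size0nil f0]]]]] := det_frame_exists l0 g1 g2; subst e f.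
exists U => //; exists (d ^+ 2 / 2), [::], [::].
have [oU ad ce cf tE] := F; split => // Q' UQ'.
have [g gg tQ] := tE Q' UQ'; exists g => //.
have be := proj2 ce Q' UQ'; have bf := proj2 cf Q' UQ'; rewrite /= in be bf gg.
have [v [w [v' [bv bw bv']]]] := det_frames l0 be bf.
have bV := basisV l0 bv bw; have bV' := basisV' l0 bw bv'.
have v0 : v = [::].
  by have := is_basis_size bV be; rewrite size_cat /= => /eqP; rewrite addn_eq0 => /andP[/eqP/size0nil].
have v'0 : v' = [::].
  by have := is_basis_size bV' bf; rewrite size_cat /= => /eqP; rewrite addn_eq0 => /andP[/eqP/size0nil].
subst v v'.
have k0 x : bop_app (set_val Q') x = 0 -> x = 0.
  move=> h; have : ker_op (set_val Q') x by []; rewrite bv.2 => /lin_spanP[cc ->].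
  by rewrite big_ord0.
have k0' x : bop_app (adjoint (set_val Q')) x = 0 -> x = 0.
  move=> h; have : ker_op (adjoint (set_val Q')) x by []; rewrite bv'.2 => /lin_spanP[cc ->].
  by rewrite big_ord0.
apply: esym; apply: etrans (transport_inv l0 k0 k0' be bf gg (dual_nil bv')) _.
have c1 : coef [seq bop_app (set_val Q') x | x <- [::]] [::] = 1 by exact: coefxx (@lin_indep_nil _ H).
by rewrite c1 scale1r.
Qed.

End DetAtlas.

(** * The Atiyah-Patodi-Singer loops *)

Section ApsLoop.
Variables (R : realType) (H : hilbertType R).
Local Notation C := (R[i]^o).
Local Notation "1b" := (bop_id H).
Implicit Types (P Q : bop H) (t : R).

(** The positive and negative parts of sin let a single formula describe both halves of the loop,
    periodically in t. Their product is zero, which removes the cross terms in all norm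
    computations. *)
Definition spos t := Num.max (sin (2 * pi * t)) 0.
Definition sneg t := Num.min (sin (2 * pi * t)) 0.

(* P_(2 pi t), extended periodically *)
Definition aps_op P t : bop H :=
  (cos (2 * pi * t))%:C *: 1b + ('i * (spos t)%:C) *: P + ('i * (sneg t)%:C) *: 1b.

Lemma aps_opE P t x : bop_app (aps_op P t) x =
  (cos (2 * pi * t))%:C *: x + 'i *: ((spos t)%:C *: bop_app P x + (sneg t)%:C *: x).
Proof. by rewrite !bopDE !bopZE !bop_idE scalerDr !scalerA addrA. Qed.

Lemma aps_op_periodic P : periodic1 (aps_op P).
Proof. by move=> t; rewrite /aps_op /spos /sneg periodic_cos periodic_sin. Qed.

Lemma aps_op_path P t : 0 <= t <= 2 * pi -> aps_op P (t / (2 * pi)) = aps_path P t.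
Proof.
move=> /andP[t0 t2]; have p0 : 2 * pi != 0 :> R by rewrite mulf_neq0 ?pnatr_eq0// gt_eqF// pi_gt0.
have tE : 2 * pi * (t / (2 * pi)) = t by rewrite mulrCA divff ?mulr1.
apply: bop_ext => x; rewrite aps_opE /spos /sneg tE /aps_path; case: (leP t pi) => tp.
  have s0 : 0 <= sin t by rewrite sin_ge0_pi// t0.
  rewrite max_l// min_r// scale0r addr0 !bopDE !bopZE bop_idE scalerA; congr (_ + _ *: _).
  by simpc.
have s0 : sin t <= 0.
  rewrite -(subrK pi t) sinDpi oppr_le0 sin_ge0_pi// subr_ge0 (ltW tp) /=; lra.
rewrite max_r// min_l// scale0r add0r bopZE bop_idE scalerA -scalerDl; congr (_ *: _).
by simpc.
Qed.

Lemma aps_op0 P : aps_op P 0 = 1b.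
Proof.
apply: bop_ext => x; rewrite aps_opE /spos /sneg mulr0 sin0 cos0 max_l// min_r//.
by rewrite !scale0r addr0 scaler0 addr0 scale1r bop_idE.
Qed.

Lemma spos_sneg t : spos t * sneg t = 0.
Proof. by rewrite /spos /sneg /Num.max /Num.min; case: ltP; rewrite ?mul0r ?mulr0. Qed.

Lemma spos_sneg_cos t : cos (2 * pi * t) ^+ 2 + spos t ^+ 2 + sneg t ^+ 2 = 1.
Proof.
apply: etrans (cos2Dsin2 (2 * pi * t)); rewrite /spos /sneg /Num.max /Num.min; case: ltP => _.
  by rewrite [0 ^+ 2]expr0n addr0.
by rewrite [0 ^+ 2]expr0n addr0.
Qed.

Lemma nrm_cis (c : R) (x y : H) : complex.Im (inner x y) = 0 ->
  nrm (c%:C *: x + 'i *: y) ^+ 2 = c ^+ 2 * nrm x ^+ 2 + nrm y ^+ 2.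
Proof.
move=> xy; have i0 : rin (c%:C *: x) ('i *: y) = 0.
  rewrite rinZl /rin innerZr; move: xy; case: (inner x y) => a b /= ->.
  by rewrite !(mulr0, mul0r, oppr0, addr0, subr0).
rewrite nrmD_sqr i0 mulr0 addr0 !nrmZ cabs_real exprMn real_normK ?num_real//.
have -> : cabs 'i = 1 :> R.
  by apply/eqP; rewrite -(eqrXn2 (n := 2))// ?nrm_ge0// cabs_sqr /= expr0n add0r.
by rewrite mul1r.
Qed.

Lemma Im_sa P x : selfadjoint P -> complex.Im (inner x (bop_app P x)) = 0.
Proof.
move=> saP; have := saP x x; rewrite inner_conj; case: (inner x _) => a b /= [] h.
by lra.
Qed.

Lemma Im_inner_comb P (u v : R) x : selfadjoint P ->
  complex.Im (inner x (u%:C *: bop_app P x + v%:C *: x)) = 0.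
Proof.
move=> saP; rewrite innerDr !innerZrR innerxx ImD.
have := Im_sa x saP; case: (inner x (bop_app P x)) => a b /= ->.
by rewrite !(mulr0, mul0r, addr0).
Qed.

Lemma nrm_comb P (u v : R) x : u * v = 0 ->
  nrm (u%:C *: bop_app P x + v%:C *: x) ^+ 2 = u ^+ 2 * nrm (bop_app P x) ^+ 2 + v ^+ 2 * nrm x ^+ 2.
Proof.
move=> uv; rewrite nrmD_sqr rinZl rinZr [u * _]mulrA uv mul0r mulr0 addr0 !nrmZ !cabs_real !exprMn.
by rewrite !real_normK ?num_real.
Qed.

Lemma nrm_aps_op P t x : selfadjoint P ->
  nrm (bop_app (aps_op P t) x) ^+ 2 =
  cos (2 * pi * t) ^+ 2 * nrm x ^+ 2 + (spos t ^+ 2 * nrm (bop_app P x) ^+ 2 + sneg t ^+ 2 * nrm x ^+ 2).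
Proof. by move=> saP; rewrite aps_opE nrm_cis ?Im_inner_comb// nrm_comb// spos_sneg. Qed.

Lemma adjointD P Q : adjoint (P + Q) = adjoint P + adjoint Q.
Proof. by apply: adjoint_uniq => x y; rewrite !bopDE innerDl innerDr !adjointP. Qed.

Lemma adjointZ (a : R[i]) P : adjoint (a *: P) = (conjc a) *: adjoint P.
Proof. apply: adjoint_uniq => x y; rewrite !bopZE innerZl innerZr adjointP; congr (_ * _).
exact/esym/conjcK. Qed.

Lemma adjoint_id : adjoint 1b = 1b.
Proof. by apply: adjoint_uniq => x y; rewrite !bop_idE. Qed.

Lemma adjoint_aps_op P t x : selfadjoint P -> bop_app (adjoint (aps_op P t)) x =
  (cos (2 * pi * t))%:C *: x - 'i *: ((spos t)%:C *: bop_app P x + (sneg t)%:C *: x).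
Proof.
move=> saP; rewrite /aps_op !adjointD !adjointZ adjoint_id (selfadjoint_adjoint saP) !bopDE !bopZE bop_idE.
rewrite scalerDr !scalerA opprD -!scaleNr addrA.
by congr (_ *: _ + _ *: _ + _ *: _); simpc.
Qed.

Lemma nrm_adjoint_aps_op P t x : selfadjoint P ->
  nrm (bop_app (adjoint (aps_op P t)) x) ^+ 2 =
  cos (2 * pi * t) ^+ 2 * nrm x ^+ 2 + (spos t ^+ 2 * nrm (bop_app P x) ^+ 2 + sneg t ^+ 2 * nrm x ^+ 2).
Proof.
move=> saP; rewrite adjoint_aps_op// -scalerN nrm_cis; first by rewrite nrmN nrm_comb// spos_sneg.
have := Im_inner_comb (spos t) (sneg t) x saP; rewrite innerNr.
by case: (inner _ _) => a b /= ->; rewrite oppr0.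
Qed.

Lemma sin_neq1 t : sin (2 * pi * t) != 1 -> 0 < cos (2 * pi * t) ^+ 2 + sneg t ^+ 2.
Proof.
move=> s1; have := spos_sneg_cos t; have := cos2Dsin2 (2 * pi * t).
rewrite /spos /sneg /Num.max /Num.min; move: s1; move: (cos _) (sin _) => c s s1 h.
case: (ltP s 0) => s0; first by move=> _; have := sqr_ge0 c; nra.
move=> _; rewrite expr0n addr0 lt_neqAle sqr_ge0 andbT eq_sym; apply: contra s1 => /eqP c0.
have : (s - 1) * (s + 1) = 0 by move: h; rewrite c0; lra.
by move=> /eqP; rewrite mulf_eq0 subr_eq0 => /orP[//|/eqP]; lra.
Qed.

(** By [nrm_aps_op], |P_t x|^2 is at least (cos^2 + sneg^2) |x|^2, and likewise for the adjoint. The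
    factor vanishes only where sin = 1. *)
Lemma aps_op_invertible P t : selfadjoint P -> sin (2 * pi * t) != 1 -> invertible (aps_op P t).
Proof.
move=> saP s1; have c0 := sin_neq1 s1.
have low (y x : H) : nrm y ^+ 2 = cos (2 * pi * t) ^+ 2 * nrm x ^+ 2 + (spos t ^+ 2 * nrm (bop_app P x) ^+ 2 + sneg t ^+ 2 * nrm x ^+ 2) ->
    Num.sqrt (cos (2 * pi * t) ^+ 2 + sneg t ^+ 2) * nrm x <= nrm y.
  move=> e; rewrite -(@ler_pXn2r _ 2%N)// ?nnegrE ?nrm_ge0 ?mulr_ge0 ?sqrtr_ge0 ?nrm_ge0//.
  rewrite exprMn sqr_sqrtr ?(ltW c0)// e.
  have := mulr_ge0 (sqr_ge0 (spos t)) (sqr_ge0 (nrm (bop_app P x))); lra.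
apply: (@bounded_below_invertible _ _ _ (Num.sqrt (cos (2 * pi * t) ^+ 2 + sneg t ^+ 2))).
- by rewrite sqrtr_gt0.
- by move=> x; apply: low; exact: nrm_aps_op.
- by move=> x; apply: low; exact: nrm_adjoint_aps_op.
Qed.

Lemma invertible_fredholm P : invertible P -> fredholm P.
Proof.
move=> iP; split; first by exists [::]; apply: ker_nil => x; exact: invertible_ker.
have [Q [_ h]] := iP; exists [::] => y; exists (bop_app Q y).
by rewrite -bop_compE h bop_idE subrr; exact: lin_span_set0.
Qed.

Lemma sin1 t : sin (2 * pi * t) = 1 -> cos (2 * pi * t) = 0 /\ spos t = 1 /\ sneg t = 0.
Proof.
move=> s1; rewrite /spos /sneg s1 max_l ?ler01// min_r ?ler01//; split => //.
have := cos2Dsin2 (2 * pi * t); rewrite s1 expr1n => h.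
by apply/eqP; rewrite -sqrf_eq0; apply/eqP; lra.
Qed.

Lemma aps_op_sin1 P t x : sin (2 * pi * t) = 1 -> bop_app (aps_op P t) x = 'i *: bop_app P x.
Proof. by move=> /sin1[c0 [u1 v0]]; rewrite aps_opE c0 u1 v0 !scale0r addr0 add0r scale1r. Qed.

Lemma aps_op_fredholm P t : selfadjoint P -> fredholm P -> fredholm (aps_op P t).
Proof.
move=> saP [kP [s sP]]; have [s1|s1] := eqVneq (sin (2 * pi * t)) 1; last first.
  exact/invertible_fredholm/aps_op_invertible.
split.
  have -> // : ker_op (aps_op P t) = ker_op P.
  apply/seteqP; split=> x; rewrite /ker_op /= aps_op_sin1//; last by move=> ->; rewrite scaler0.
  by move=> /eqP; rewrite scaler_eq0 eq_complex /= oner_eq0 andbF /= => /eqP.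
exists s => y; have [x xP] := sP y; exists (- 'i *: x); rewrite aps_op_sin1// -[- 'i *: x]addr0 bop_linear (linear0 (bop_app P)) addr0 scalerA.
by rewrite (_ : 'i * - 'i = 1) ?scale1r// mulrN -expr2 complex.sqr_i opprK.
Qed.

Lemma cvg_aps_op (T : Type) (F : set_system T) {FF : Filter F} (p : T -> bop H) (f : T -> R) P t :
  p @ F --> P -> f @ F --> t -> (fun x => aps_op (p x) (f x)) @ F --> aps_op P t.
Proof.
move=> pP ft; have c1 : (sneg : R -> R) @ t --> sneg t by exact: cvg_sin_min.
have c2 : (spos : R -> R) @ t --> spos t by exact: cvg_sin_max.
have c0 : (fun s : R => cos (2 * pi * s)) @ t --> cos (2 * pi * t) by exact: cvg_cos2pi.
apply: cvgD; last first.
  apply: cvg_scale; last exact: cvg_cst.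
  apply: cvg_mulC; first exact: cvg_cst.
  by apply: cvg_real_complex; exact: (cvg_comp _ _ ft c1).
apply: cvgD; last first.
  apply: cvg_scale => //; apply: cvg_mulC; first exact: cvg_cst.
  by apply: cvg_real_complex; exact: (cvg_comp _ _ ft c2).
apply: cvg_scale; last exact: cvg_cst.
by apply: cvg_real_complex; exact: (cvg_comp _ _ ft c0).
Qed.

Lemma sa_val (P : Fred_sa H) : selfadjoint (set_val P).
Proof. by have [] := set_valP P. Qed.

Lemma sa_fredholm (P : Fred_sa H) : fredholm (set_val P).
Proof. by have [] := set_valP P. Qed.

Definition aps_fred (P : Fred_sa H) t : Fred H :=
  SigSub (mem_set (aps_op_fredholm t (sa_val P) (sa_fredholm P))).

Lemma aps_fredE (P : Fred_sa H) t : set_val (aps_fred P t) = aps_op (set_val P) t. Proof. by []. Qed.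

Lemma cvg_set_val (X : topologicalType) (A : set X) (T : Type) (F : set_system T) {FF : Filter F}
    (f : T -> set_type A) (a : set_type A) :
  (fun x => set_val (f x)) @ F --> set_val a -> f @ F --> a.
Proof.
move=> h W [_ [[B oB <-] /= Ba BW]].
have : nbhs (set_val a) B by exact: open_nbhs_nbhs.
move=> /h h1; have h2 : \forall x \near F, B (set_val (f x)) by exact: h1.
by apply: filterS h2 => x Bx; exact: BW.
Qed.

Lemma cvg_aps_fred (T : Type) (F : set_system T) {FF : Filter F} (p : T -> Fred_sa H) (f : T -> R) (P : Fred_sa H) t :
  p @ F --> P -> f @ F --> t -> (fun x => aps_fred (p x) (f x)) @ F --> aps_fred P t.
Proof.
move=> pP ft; apply: cvg_set_val; rewrite aps_fredE; under eq_fun do rewrite aps_fredE.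
apply: cvg_aps_op => //.
have c : (set_val : Fred_sa H -> bop H) @ P --> (set_val P : bop H) by exact: initial_continuous.
exact: (cvg_comp _ _ pP c).
Qed.

Lemma aps_op_is_loop (P : Fred_sa H) : (aps_fred P : {compact-open, R -> Fred H}) \in (@loops R (Fred H) : set _).
Proof.
apply/mem_set; split.
  by move=> t; apply: cvg_aps_fred; [exact: cvg_cst|exact: cvg_id].
by move=> t; apply/val_inj; rewrite -!set_valE !aps_fredE aps_op_periodic.
Qed.

Definition aps_loop (P : Fred_sa H) : loop_space R (Fred H) := SigSub (aps_op_is_loop P).

Lemma loop_at_aps (P : Fred_sa H) t : loop_at (aps_loop P) t = aps_fred P t. Proof. by []. Qed.

Lemma aps_based (P : Fred_sa H) : set_val (aps_loop P) 0 = Fred_id H.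
Proof. by apply/val_inj; rewrite -!set_valE aps_fredE aps_op0. Qed.

Definition aps (P : Fred_sa H) : based_loops R (Fred_id H) := SigSub (mem_set (aps_based P)).

Lemma cvg_aps_loop (P : Fred_sa H) : aps_loop @ P --> aps_loop P.
Proof.
apply: (cvg_loop (nbhs_filter P)) => t; apply: cvg_aps_fred.
  exact: (@cvg_sndp _ _ ((t, P) : R * Fred_sa H)).
exact: (@cvg_fstp _ _ ((t, P) : R * Fred_sa H)).
Qed.

Lemma continuous_aps : continuous aps.
Proof. move=> P; apply: (@cvg_set_val _ _ _ (nbhs P) (nbhs_filter P) aps (aps P)).
have c : aps_loop @ P --> aps_loop P by exact: cvg_aps_loop.
exact: c. Qed.

Lemma aps_mapP : is_aps_map aps.
Proof. by move=> P t t2; exact: aps_op_path. Qed.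

End ApsLoop.

(** Turns sums and products over eigenvalues with multiplicity into sums and products over a list of
    eigenvectors, k being the Rayleigh quotient. *)
Lemma fsbig_iterop (T : Type) (idx : T) (op : Monoid.com_law idx) (J I : choiceType) (s : seq J)
    (k : J -> I) (A : set I) (F : I -> T) :
  \big[op/idx]_(l \in A) iterop (count (fun y => k y == l) s) op (F l) idx =
  \big[op/idx]_(y <- s | k y \in A) F (k y).
Proof.
have cE l : count (fun y => k y == l) s = count_mem l [seq k y | y <- s].
  by rewrite count_map.
rewrite (fsbigE [seq l <- undup [seq k y | y <- s] | l \in A]).
- rewrite big_filter_cond -[RHS](big_map k (fun l => l \in A) F) -[RHS]big_undup_iterop_count.
  by apply: eq_big => [l|l _]; [rewrite andbb|rewrite cE].
- by rewrite filter_uniq// undup_uniq.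
- by move=> l /=; rewrite mem_filter => /andP[/set_mem].
move=> l Al; rewrite mem_filter (mem_set Al)/= mem_undup => ls.
by rewrite cE (count_memPn ls).
Qed.

Lemma alt_scale (K : fieldType) (V : lmodType K) n (f : seq V -> K) (r s : seq V) (c : V -> K) :
  alt_form n f -> f (r ++ [seq c y *: y | y <- s]) = \prod_(y <- s) c y * f (r ++ s).
Proof.
move=> fA; elim: s r => [|y s IH] r; first by rewrite big_nil mul1r.
rewrite big_cons /= (altZ fA) -cat_rcons IH cat_rcons; ring.
Qed.

(** * Eigenvectors of P and the determinant of P_t *)

Section EigenLists.
Variables (R : realType) (H : hilbertType R).
Implicit Types (P Q : bop H) (t mu nu : R) (s : seq H) (x y : H).

(** An orthonormal eigenbasis of V_[-mu,mu](P). Both inequalities are strict, since mu and -mu are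
    not in the spectrum. *)
Definition low_eigenlist P mu s := [/\ orthonormal s, eigenlist P s, forall y, y \in s -> `|rayleigh P y| < mu &
  forall x, perp s x -> x != 0 -> mu ^+ 2 * nrm x ^+ 2 < nrm (bop_app P x) ^+ 2].

Lemma low_eigenlist_perp P mu s x (l : R) : low_eigenlist P mu s -> perp s x -> - mu <= l <= mu ->
  bop_app P x = l%:C *: x -> x = 0.
Proof.
move=> [_ _ _ lo] px lmu Px; apply/eqP/negPn/negP => x0.
have := lo _ px x0; rewrite Px nrmZ cabs_real exprMn real_normK ?num_real//.
have l2 : l ^+ 2 <= mu ^+ 2 by case/andP: lmu => *; nra.
have n2 : 0 <= nrm x ^+ 2 by exact: sqr_ge0.
nra.
Qed.

Lemma adm_low_eigenlist P mu : selfadjoint P -> adm P mu ->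
  exists s a m, low_eigenlist P mu s /\ spectral_gap (bop_comp P P) (mu ^+ 2) s a m.
Proof.
move=> saP am; have [s [a [m [es [os ss am1 ma lo]]]]] := adm_spectral_gap saP am.
have mu0 : 0 < mu by case: am.
exists s, a, m; split; last by split.
split=> // [y ys|x px x0].
  have [k k0a Pk] := ss _ ys; have Py := rayleighE os es ys.
  have : k%:C *: y = (rayleigh P y ^+ 2)%:C *: y.
    by rewrite -Pk bop_compE Py -[_ *: y]addr0 bop_linear (linear0 (bop_app P)) addr0 Py scalerA -rmorphM -expr2.
  move=> /scale_inj E.
  have y0 : y != 0 by rewrite -nrm_gt0 (orthonormal_nrm os ys).
  have [kE] : k%:C = (rayleigh P y ^+ 2)%:C by apply: E.
  have : rayleigh P y ^+ 2 < mu ^+ 2 by rewrite -kE; apply: le_lt_trans am1; case/andP: k0a.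
  rewrite -[rayleigh P y ^+ 2]real_normK ?num_real// ltr_pXn2r ?nnegrE// ?ltW//.
have := lo _ px; rewrite sa_sqr_ge0//; apply: lt_le_trans.
by rewrite ltr_pM2r// exprn_gt0// nrm_gt0.
Qed.

Lemma low_eigenlist_basis P mu s (I : set R) : selfadjoint P -> low_eigenlist P mu s ->
  (I `<=` `[- mu, mu])%classic -> is_basis (eigen_sum P I) [seq y <- s | rayleigh P y \in I].
Proof.
move=> saP el Imu; have [os es _ _] := el; apply: eigen_sum_basis => // x l px Il; apply: (low_eigenlist_perp el px).
by have := Imu _ Il; rewrite /= in_itv.
Qed.

Lemma low_eigenlist_count P mu s (I : set R) : selfadjoint P -> low_eigenlist P mu s ->
  (I `<=` `[- mu, mu])%classic -> eigen_count P I = count (fun y => rayleigh P y \in I) s.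
Proof.
move=> saP el Imu; have [os es _ _] := el; rewrite /eigen_count.
have iterop1 n : iterop n addn 1%N 0%N = n.
  by case: n => // n; rewrite /=; elim: n => //= n ->; rewrite add1n.
rewrite -sum1_count -(@fsbig_iterop _ _ addn _ _ s (rayleigh P) I (fun=> 1%N)).
apply: eq_fsbigr => l /set_mem Il; rewrite iterop1.
apply: eigen_mult_count => // x px; apply: (low_eigenlist_perp el px).
by have := Imu _ Il; rewrite /= in_itv.
Qed.

Lemma low_eigenlist_prod P mu s (I : set R) (F : R -> R[i]) : selfadjoint P -> low_eigenlist P mu s ->
  (I `<=` `[- mu, mu])%classic ->
  \big[*%R/1]_(l \in I) F l ^+ eigen_mult P l = \prod_(y <- s | rayleigh P y \in I) F (rayleigh P y).
Proof.
move=> saP el Imu; have [os es _ _] := el.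
rewrite -(@fsbig_iterop _ _ *%R _ _ s (rayleigh P) I F).
apply: eq_fsbigr => l /set_mem Il.
rewrite (@eigen_mult_count _ _ P s l)// => x px; apply: (low_eigenlist_perp el px).
by have := Imu _ Il; rewrite /= in_itv.
Qed.

Lemma aps_op_eigenvector P t y (l : R) : bop_app P y = l%:C *: y -> bop_app (aps_op P t) y = aps_eig l t *: y.
Proof.
move=> Py; rewrite aps_opE Py scalerA -scalerDl scalerA -scalerDl; congr (_ *: y).
by rewrite -rmorphM -rmorphD /aps_eig [RHS]complex_ReIm /=; simpc.
Qed.

Lemma coef_aps_op P mu s t (p : pred H) : selfadjoint P -> low_eigenlist P mu s ->
  coef [seq bop_app (aps_op P t) y | y <- s & p y] [seq y <- s | p y] =
  \prod_(y <- s | p y) aps_eig (rayleigh P y) t.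
Proof.
move=> saP [os es _ _]; have op : orthonormal [seq y <- s | p y] by exact: orthonormal_filter.
have -> : [seq bop_app (aps_op P t) y | y <- s & p y] = [seq aps_eig (rayleigh P y) t *: y | y <- s & p y].
  apply/eq_in_map => y; rewrite mem_filter => /andP[_ ys].
  by apply: aps_op_eigenvector; exact: (rayleighE os es ys).
have := @alt_scale _ _ _ (fun u => coef u [seq y <- s | p y]) [::] [seq y <- s | p y] (fun y => aps_eig (rayleigh P y) t) (coef_alt _).
by rewrite !cat0s => ->; rewrite coefxx ?mulr1 ?big_filter//; exact: orthonormal_lin_indep.
Qed.

(** The winding number of a product of eigenvalue loops is the number of its positive
    eigenvalues. *)
Lemma Null_prod_aps_eig (I : Type) (r : seq I) (k : I -> R) (p : pred I) : (forall y : I, p y -> k y != 0) ->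
  Null (@fracp R) (fun t => \prod_(y <- r | p y) aps_eig (k y) t *
    expi (- (2 * pi * (count (fun y : I => p y && (0 < k y)) r)%:R * t))).
Proof.
move=> k0; elim: r => [|y r IH].
  apply: (Null_eq _ (Null1 _)) => t.
  by rewrite big_nil /= mulr0 mul0r oppr0 expi0 mulr1.
have [py|py] := boolP (p y); last first.
  by apply: (Null_eq _ IH) => t; rewrite big_cons (negbTE py) /= (negbTE py).
have [k1|k1] := ltP 0 (k y).
  apply: (Null_eq _ (NullM (Null_aps_eig_pos k1) IH)) => t.
  rewrite big_cons py /= py k1 /= natrD; set N := (count _ r)%:R.
  by rewrite (_ : - (2 * pi * (1%:R + N) * t) = - (2 * pi * t) + - (2 * pi * N * t)) ?expiD; ring.
have kn : k y < 0 by rewrite lt_neqAle k0.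
apply: (Null_eq _ (NullM (Null_aps_eig_neg kn) IH)) => t.
rewrite big_cons py /= py /= [0 < k y]ltNge k1 /= add0n; ring.
Qed.

End EigenLists.

Section ApsSpaces.
Variables (R : realType) (H : hilbertType R).
Local Notation "1b" := (bop_id H).
Implicit Types (P Q : bop H) (t mu nu : R) (s e f : seq H) (x y : H).

(** (c - iK)(c + iK) = c^2 + K^2. With K = spos P + sneg this computes P_t^dag P_t, and with -K the
    product in the other order. *)
Lemma rotation_sqr (c : R) (K : H -> H) x : linear K ->
  c%:C *: (c%:C *: x + 'i *: K x) - 'i *: K (c%:C *: x + 'i *: K x) = (c ^+ 2)%:C *: x + K (K x).
Proof.
move=> Kl; have KZ (a : R[i]) y : K (a *: y) = a *: K y.
  by have := Kl a y 0; rewrite addr0 (_ : K 0 = 0) ?addr0//; have := Kl (-1) 0 0; rewrite scaler0 addr0 scaleN1r addNr.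
rewrite Kl KZ !scalerDr !scalerA -!expr2 complex.sqr_i scaleN1r opprD opprK (mulrC _ c%:C).
by rewrite addrA addrK -rmorphXn.
Qed.

Lemma comb_sqr P (u v : R) x : u * v = 0 ->
  u%:C *: bop_app P (u%:C *: bop_app P x + v%:C *: x) + v%:C *: (u%:C *: bop_app P x + v%:C *: x) =
  (u ^+ 2)%:C *: bop_app (bop_comp P P) x + (v ^+ 2)%:C *: x.
Proof.
have PZ (a : R[i]) y : bop_app P (a *: y) = a *: bop_app P y.
  by rewrite -[a *: y]addr0 bop_linear (linear0 (bop_app P)) addr0.
move=> /eqP; rewrite mulf_eq0 => /orP[] /eqP ->.
  by rewrite expr0n /= !scale0r !add0r scalerA -rmorphM -expr2.
by rewrite expr0n /= !scale0r !addr0 PZ scalerA -rmorphM -expr2.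
Qed.

Lemma cos_sneg t : cos (2 * pi * t) ^+ 2 + sneg t ^+ 2 = 1 - spos t ^+ 2.
Proof. by have := spos_sneg_cos t; lra. Qed.

Lemma PdagP_aps_op P t x : selfadjoint P -> bop_app (PdagP (aps_op P t)) x =
  (1 - spos t ^+ 2)%:C *: x + (spos t ^+ 2)%:C *: bop_app (bop_comp P P) x.
Proof.
move=> saP; rewrite /PdagP (bop_compE (adjoint _)) adjoint_aps_op// !aps_opE.
pose K (y : H) : H := (spos t)%:C *: bop_app P y + (sneg t)%:C *: y.
have Kl : linear K.
  move=> a y z; rewrite /K bop_linear !scalerDr !scalerA !(mulrC _ a) -!scalerA addrACA.
  by [].
rewrite -[_ *: bop_app P x + _]/(K x) -[(spos t)%:C *: bop_app P _ + _]/(K _) rotation_sqr//.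
rewrite /K comb_sqr ?spos_sneg// addrCA addrC -scalerDl -rmorphD /=.
by rewrite cos_sneg addrC.
Qed.

Lemma PPdag_aps_op P t : selfadjoint P -> PPdag (aps_op P t) = PdagP (aps_op P t).
Proof.
move=> saP; apply: bop_ext => x; rewrite PdagP_aps_op// /PPdag (bop_compE (aps_op P t)) adjoint_aps_op// !aps_opE.
pose K (y : H) : H := - ((spos t)%:C *: bop_app P y + (sneg t)%:C *: y).
have KE y : (spos t)%:C *: bop_app P y + (sneg t)%:C *: y = - K y by rewrite /K opprK.
have Kl : linear K.
  move=> a y z; rewrite /K bop_linear !scalerDr !scalerA !(mulrC _ a) -!scalerA addrACA.
  by rewrite scalerN scalerDr opprD.
have E : (cos (2 * pi * t))%:C *: x - 'i *: ((spos t)%:C *: bop_app P x + (sneg t)%:C *: x) =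
    (cos (2 * pi * t))%:C *: x + 'i *: K x by rewrite /K scalerN.
have rot := rotation_sqr (cos (2 * pi * t)) x Kl.
rewrite E (KE (_ + 'i *: K x)) (scalerN _ (K (_ + _))) rot /K.
have -> : (spos t)%:C *: bop_app P (- ((spos t)%:C *: bop_app P x + (sneg t)%:C *: x)) +
  (sneg t)%:C *: - ((spos t)%:C *: bop_app P x + (sneg t)%:C *: x) =
  - ((spos t ^+ 2)%:C *: bop_app (bop_comp P P) x + (sneg t ^+ 2)%:C *: x).
  by rewrite -comb_sqr ?spos_sneg// (raddfN (bop_app P)) !scalerN -opprD.
rewrite opprK addrCA addrC -scalerDl -rmorphD /=.
by rewrite cos_sneg addrC.
Qed.

(* The two subspaces have the same dimension and are nested; which one is the   *)
(* smaller depends on whether mu <= 1.                                         *)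
Lemma aps_space P mu t s e : selfadjoint P -> 0 < mu -> low_eigenlist P mu s ->
  is_basis (eigen_sum (PdagP (aps_op P t)) `[0, mu ^+ 2]%classic) e ->
  size e = size s -> is_basis (eigen_sum P `[- mu, mu]%classic) e.
Proof.
move=> saP mu0 el be se; have [os es ls lo] := el.
have u01 : 0 <= spos t ^+ 2 <= 1.
  by rewrite sqr_ge0 /=; have := spos_sneg_cos t; have := sqr_ge0 (cos (2 * pi * t)); have := sqr_ge0 (sneg t); lra.
have bs : is_basis (eigen_sum P `[- mu, mu]%classic) s.
  have b1 : is_basis (eigen_sum P `[- mu, mu]%classic) [seq y <- s | rayleigh P y \in `[- mu, mu]%classic].
    exact: (low_eigenlist_basis saP el).
  move: b1; rewrite (_ : [seq y <- s | _] = s)//.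
  apply/all_filterP/allP => y ys; apply/mem_set; rewrite /= in_itv /= -ler_norml; exact: (ltW (ls _ ys)).
have saB := selfadjoint_PdagP (aps_op P t).
have [mu1|mu1] := leP 1 mu.
  have sB y : y \in s -> eigen_sum (PdagP (aps_op P t)) `[0, mu ^+ 2]%classic y.
    move=> ys; apply: lin_span_mem.
    exists ((1 - spos t ^+ 2) + spos t ^+ 2 * rayleigh P y ^+ 2).
      rewrite /= in_itv /=; have := ls _ ys.
      have : `|rayleigh P y| ^+ 2 = rayleigh P y ^+ 2 by rewrite real_normK ?num_real.
      have := normr_ge0 (rayleigh P y); move: (`|_|) => a a0 <- am.
      case/andP: u01 => u0 u1; have a2 : a ^+ 2 <= mu ^+ 2 by nra.
      have mu2 : 1 <= mu ^+ 2 by nra.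
      have a20 : 0 <= a ^+ 2 by exact: sqr_ge0.
      nra.
    rewrite /eigenspace_op /= PdagP_aps_op//.
    have Py := rayleighE os es ys.
    have -> : bop_app (bop_comp P P) y = (rayleigh P y ^+ 2)%:C *: y.
      by rewrite bop_compE Py -[_ *: y]addr0 bop_linear (linear0 (bop_app P)) addr0 Py scalerA -rmorphM -expr2.
    by rewrite scalerA -scalerDl -rmorphM -rmorphD.
  have bs' : is_basis (eigen_sum (PdagP (aps_op P t)) `[0, mu ^+ 2]%classic) s.
    by apply: (is_basis_sub be _ sB) => //; case: bs.
  split; first by case: be.
  by rewrite bs.2 -bs'.2 be.2.
have sub : eigen_sum (PdagP (aps_op P t)) `[0, mu ^+ 2]%classic `<=` lin_span [set` s].
  apply: lin_span_sub => x [k /=]; rewrite in_itv /= => /andP[k0 km] Bx.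
  have px := @perp_proj _ _ _ x os; set z := x - proj s x in px.
  suff z0 : z = 0.
    by have -> : x = proj s x; [apply/eqP; rewrite -subr_eq0; apply/eqP|exact: proj_span].
  apply/eqP/negPn/negP => zn; have lz := lo _ px zn.
  have eB : eigenlist (PdagP (aps_op P t)) s.
    move=> y ys; exists ((1 - spos t ^+ 2) + spos t ^+ 2 * rayleigh P y ^+ 2).
    rewrite PdagP_aps_op//.
    have Py := rayleighE os es ys.
    have -> : bop_app (bop_comp P P) y = (rayleigh P y ^+ 2)%:C *: y.
      by rewrite bop_compE Py -[_ *: y]addr0 bop_linear (linear0 (bop_app P)) addr0 Py scalerA -rmorphM -expr2.
    by rewrite scalerA -scalerDl -rmorphM -rmorphD.
  have Bz : bop_app (PdagP (aps_op P t)) z = k%:C *: z.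
    have dB u v : bop_app (PdagP (aps_op P t)) (u - v) = bop_app (PdagP (aps_op P t)) u - bop_app (PdagP (aps_op P t)) v.
      exact: (raddfB (bop_app (PdagP (aps_op P t)))).
    rewrite /z dB proj_eigenlist// Bx scalerBr; congr (_ - _).
    by have := proj_linear s k%:C x 0; rewrite !addr0 (_ : proj s 0 = 0) ?addr0// /proj big1// => i _; rewrite inner0l scale0r.
  have : rin (bop_app (PdagP (aps_op P t)) z) z = k * nrm z ^+ 2 by rewrite Bz rinZl rinxx.
  rewrite PdagP_aps_op// rinDl !rinZl rinxx sa_sqr_ge0//.
  have nz : 0 < nrm z ^+ 2 by rewrite exprn_gt0// nrm_gt0.
  have mu2 : mu ^+ 2 < 1 by nra.
  case/andP: u01 => u0 u1; move: (nrm (bop_app P z) ^+ 2) (nrm z ^+ 2) (spos t ^+ 2) lz nz u0 u1 => A Z u lz nz u0 u1 E.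
  have kZ : k * Z <= mu ^+ 2 * Z by rewrite ler_wpM2r// ltW.
  have a1 : 0 <= (1 - u) * ((1 - mu ^+ 2) * Z) by rewrite mulr_ge0 ?subr_ge0// mulr_ge0 ?subr_ge0 ?(ltW nz)// (ltW mu2).
  have [u00|u00] := eqVneq u 0.
    have a2 : 0 < (1 - mu ^+ 2) * Z by rewrite mulr_gt0// subr_gt0.
    move: E a2; rewrite u00; lra.
  have up : 0 < u by rewrite lt_neqAle eq_sym u00.
  have a2 : 0 < u * (A - mu ^+ 2 * Z) by rewrite mulr_gt0// subr_gt0.
  lra.
apply: (is_basis_sub bs) => //; first by case: be.
by move=> y ye; rewrite bs.2; apply: sub; exact: (basis_mem be).
Qed.

End ApsSpaces.

Section CanonicalSections.
Variables (R : realType) (H : hilbertType R).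
Local Notation C := (R[i]^o).
Local Notation L := (det_bundle H).
Local Notation atlas := (@det_atlas R H).
Local Notation quarter := (4^-1 : R).
Implicit Types (P : Fred_sa H) (t mu nu : R) (s : R -> total_space L) (b : seq H) (n m : int).
Local Notation V P mu := (eigen_sum (set_val P) `[- mu, mu]%classic).

Lemma lin_span_map (K : fieldType) (U W : lmodType K) (A : set U) (q : U -> W) (B : submod W) x :
  linear q -> (forall y, A y -> submod_set B (q y)) -> lin_span_set A x -> submod_set B (q x).
Proof.
move=> lq qA [r rA ->]; pose q' := GRing.isLinear.Build K U W _ q lq.
have q0 : q 0 = 0 by have := lq (-1) 0 0; rewrite scaler0 addr0 scaleN1r addNr.
have qZD (a : K) u v : q (a *: u + v) = a *: q u + q v by exact: lq.
elim: r rA => [|[a y] r IH] rA; first by rewrite big_nil q0; exact: submod0.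
rewrite big_cons qZD; apply: submodP; last by apply: IH => p pr; apply: rA; rewrite inE pr orbT.
by apply: qA; apply: (rA (a, y)); rewrite inE eqxx.
Qed.

Lemma lin_indep_map (K : fieldType) (U W : lmodType K) (q : U -> W) (r : seq U) :
  linear q -> (forall x, q x = 0 -> x = 0) -> lin_indep r -> lin_indep [seq q y | y <- r].
Proof.
move=> lq q0 ir c; rewrite size_map => e; apply: ir; apply: q0.
have q00 : q 0 = 0 by have := lq (-1) 0 0; rewrite scaler0 addr0 scaleN1r addNr.
have qD u v : q (u + v) = q u + q v by have := lq 1 u v; rewrite !scale1r.
have qZ (a : K) u : q (a *: u) = a *: q u by have := lq a u 0; rewrite addr0 q00 addr0.
rewrite (big_morph q qD q00) -[RHS]e; apply: eq_bigr => i _.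
by rewrite qZ (nth_map 0).
Qed.

Lemma aps_invariant P mu t x : V P mu x -> V P mu (bop_app (aps_op (set_val P) t) x).
Proof.
apply: (@lin_span_map _ _ _ _ (bop_app (aps_op (set_val P) t)) (eigen_sum (set_val P) `[- mu, mu]%classic)).
  exact: bop_linear.
move=> y [l lm Py]; rewrite (aps_op_eigenvector t Py) -[_ *: y]addr0.
by apply: submodP; [apply: lin_span_mem; exists l|exact: submod0].
Qed.

Lemma aps_image P mu t b : sin (2 * pi * t) != 1 -> is_basis (V P mu) b ->
  is_basis (V P mu) [seq bop_app (aps_op (set_val P) t) y | y <- b].
Proof.
move=> s1 bb; apply: (is_basis_sub bb); last by rewrite size_map.
  apply: lin_indep_map; [exact: bop_linear| |by case: bb].
  by move=> x; exact: (invertible_ker (aps_op_invertible (sa_val P) s1)).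
by move=> _ /mapP[y yb ->]; apply: aps_invariant; exact: (basis_mem bb).
Qed.

Lemma is_basis_mem_span (W : set H) b x : is_basis W b -> W x -> lin_span_set [set` b] x.
Proof. by move=> [_ ->]. Qed.

(** With different bases e and f in source and target, the determinant of P_t on V changes by the
    base change from e to f. *)
Lemma aps_coef P mu t b e f : sin (2 * pi * t) != 1 -> is_basis (V P mu) b ->
  is_basis (V P mu) e -> is_basis (V P mu) f ->
  coef [seq bop_app (aps_op (set_val P) t) y | y <- e] f =
  coef e f * coef [seq bop_app (aps_op (set_val P) t) y | y <- b] b.
Proof.
move=> s1 bb be bf; set Q := bop_app _.
have bQb : is_basis (V P mu) [seq Q y | y <- b] by exact: aps_image.
have bQe : is_basis (V P mu) [seq Q y | y <- e] by exact: aps_image.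
have sz1 := is_basis_size be bb; have sz2 := is_basis_size bf bb.
rewrite (coef_trans (t := [seq Q y | y <- b])) ?size_map//; [|by case: bQb|]; last first.
  by move=> x /(basis_mem bQe); exact: is_basis_mem_span.
rewrite (coef_trans (s := [seq Q y | y <- b]) (t := b)) ?size_map//; [|by case: bb|]; last first.
  by move=> x /(basis_mem bQb); exact: is_basis_mem_span.
rewrite coef_map//; [|exact: bop_linear|by case: bb|by case: bQb|]; last first.
  by move=> x /(basis_mem be); exact: is_basis_mem_span.
rewrite (coef_trans (s := e) (t := b) (u := f))//; [ring|by case: bb|].
by move=> x /(basis_mem be); exact: is_basis_mem_span.
Qed.

Lemma sin_quarter : sin (2 * pi * quarter) = 1.
Proof. by rewrite (_ : 2 * pi * quarter = pi / 2) ?sin_pihalf//; field. Qed.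

Lemma aps_fred_sin1 P t : sin (2 * pi * t) = 1 -> aps_fred P t = aps_fred P quarter.
Proof.
move=> s1; apply/val_inj/bop_ext => x.
by rewrite -!set_valE !aps_fredE !aps_op_sin1// sin_quarter.
Qed.

Lemma PdagP_quarter P : PdagP (aps_op (set_val P) quarter) = bop_comp (set_val P) (set_val P).
Proof.
apply: bop_ext => x; rewrite PdagP_aps_op; last exact: sa_val.
by have [_ [-> _]] := sin1 sin_quarter; rewrite expr1n subrr scale0r add0r scale1r.
Qed.

(** The parameter 1/4 is the time pi/2, where P_t = iP and hence P_t^dag P_t = P_t P_t^dag = P^2 has
    a gap at mu^2. *)
Lemma quarter_frame P mu : adm (set_val P) mu -> exists U e f tau,
  [/\ det_frame U (mu ^+ 2) e f tau, U (aps_fred P quarter) & size e = size f].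
Proof.
move=> am; have [s [a [m [el sg]]]] := adm_low_eigenlist (sa_val P) am.
have mu0 : 0 < mu ^+ 2 by rewrite exprn_gt0//; case: am.
have [||U [e [f [tau [df UQ se sf]]]]] := @det_frame_exists R H (aps_fred P quarter) (mu ^+ 2) s a m s a m mu0.
- by rewrite aps_fredE PdagP_quarter.
- by rewrite aps_fredE PPdag_aps_op ?PdagP_quarter//; exact: sa_val.
by exists U, e, f, tau; rewrite se sf.
Qed.

Lemma aps_framed P : framed (L := det_bundle H) atlas (aps_loop P).
Proof.
move=> t; rewrite loop_at_aps; have [s1|s1] := eqVneq (sin (2 * pi * t)) 1.
  have [mu am] := fredholm_adm (sa_val P) (sa_fredholm P).
  have [U [e [f [tau [df UQ _]]]]] := quarter_frame am.
  by exists tau, U; [exists (mu ^+ 2), e, f|rewrite (aps_fred_sin1 _ s1)].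
exists (@det_one R H); apply: frame_at_one; rewrite aps_fredE.
by apply: aps_op_invertible => //; exact: sa_val.
Qed.

Lemma low_eigenlist_full P mu (r : seq H) : low_eigenlist (set_val P) mu r -> is_basis (V P mu) r.
Proof.
move=> el; have [_ _ lr _] := el.
have := low_eigenlist_basis (sa_val P) el (@subset_refl _ _).
rewrite (_ : [seq y <- r | _] = r)//.
apply/all_filterP/allP => y ys; apply/mem_set; rewrite /= in_itv /= -ler_norml; exact: (ltW (lr _ ys)).
Qed.

Section Frame.
Variables (U : set (Fred H)) (mu : R) (e f : seq (Fred H -> H)).
Variable tau : forall Q : Fred H, Det (set_val Q).
Hypotheses (df : det_frame U (mu ^+ 2) e f tau) (ef : size e = size f).
Local Notation ev e Q := [seq g Q | g <- e].

(** The rank of the frames is read off at 1/4, where it is the dimension of V. [aps_space] then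
    identifies the spectral spaces of P_t with V at every other t in the chart. *)
Lemma frame_bases P t : adm (set_val P) mu -> U (aps_fred P quarter) -> U (aps_fred P t) ->
  is_basis (V P mu) (ev e (aps_fred P t)) /\ is_basis (V P mu) (ev f (aps_fred P t)).
Proof.
move=> am U4 Ut; have [s [a [m [el sg]]]] := adm_low_eigenlist (sa_val P) am.
have mu0 : 0 < mu by case: am.
have [_ _ [_ be] [_ bf] _] := df.
have saB : selfadjoint (bop_comp (set_val P) (set_val P)) by apply: selfadjoint_comp; exact: sa_val.
have bs : is_basis (eigen_sum (bop_comp (set_val P) (set_val P)) `[0, mu ^+ 2]%classic) s.
  have b1 := spectral_gap_basis saB sg (I := `[0, mu ^+ 2]%classic).
  move: b1; rewrite (_ : [seq y <- s | _] = s); first apply.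
    by move=> l /=; rewrite in_itv => /andP[].
  apply/all_filterP/allP => y ys; apply/mem_set; rewrite /= in_itv /=.
  have [os ss am1 _ _] := sg; have [l /andP[l0 la] Py] := ss _ ys.
  by rewrite /rayleigh Py rinZl rinxx (orthonormal_nrm os ys) expr1n mulr1 l0 (le_trans la)// ltW.
have se : size e = size s.
  have := be _ U4; rewrite aps_fredE PdagP_quarter => b4.
  by rewrite -(is_basis_size b4 bs) size_map.
split.
  apply: (aps_space (t := t) (sa_val P) mu0 el); last by rewrite size_map.
  by have := be _ Ut; rewrite aps_fredE.
apply: (aps_space (t := t) (sa_val P) mu0 el); last by rewrite size_map -ef.
by have := bf _ Ut; rewrite aps_fredE PPdag_aps_op//; exact: sa_val.
Qed.

(** The key identity for extending the section. By [transport_inv] the frame tau is det(P_t : e ->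
    f) times [det_one], and the factor coef(f, e) turns this into det(P_t on V). The left-hand side
    remains meaningful and nonzero at sin = 1. *)
Lemma frame_one P t b : adm (set_val P) mu -> U (aps_fred P quarter) -> U (aps_fred P t) ->
  sin (2 * pi * t) != 1 -> is_basis (V P mu) b ->
  coef (ev f (aps_fred P t)) (ev e (aps_fred P t)) *: tau (aps_fred P t) =
  coef [seq bop_app (aps_op (set_val P) t) y | y <- b] b *: det_one (aps_fred P t).
Proof.
move=> am U4 Ut s1 bb; have [be bf] := frame_bases am U4 Ut.
have iQ : invertible (set_val (aps_fred P t)).
  by rewrite aps_fredE; apply: aps_op_invertible => //; exact: sa_val.
have [_ [mu0 _] [_ be'] [_ bf'] tauE] := df.
have [g g1 ->] := tauE _ Ut.
have k0 : forall x, bop_app (set_val (aps_fred P t)) x = 0 -> x = 0 by move=> x; exact: invertible_ker.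
have k0' : forall x, bop_app (adjoint (set_val (aps_fred P t))) x = 0 -> x = 0.
  by move=> x; apply: invertible_ker; exact: invertible_adjoint.
rewrite (transport_inv mu0 k0 k0' (be' _ Ut) (bf' _ Ut) g1 (dual_nil (ker_nil k0'))).
rewrite scalerA [X in _ * coef [seq bop_app X _ | _ <- _] _]aps_fredE (aps_coef s1 bb be bf) mulrA.
rewrite coef_inv ?mul1r//; first by rewrite (is_basis_size bf be).
- by case: bf.
- by case: be.
by move=> x /(basis_mem bf); exact: is_basis_mem_span.
Qed.

End Frame.

End CanonicalSections.

Lemma cvg_pairl (X Y : topologicalType) (x : X) (y : Y) : (fun z : X => (z, y)) @ x --> (x, y).
Proof.
move=> W [[A B] [/= Ax By] AB]; apply: (filterS _ Ax) => z Az.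
by apply: AB; split=> //=; exact: nbhs_singleton.
Qed.

(** * The sections attached to points of the spectral cover *)

Section LocalCanonical.
Variables (R : realType) (H : hilbertType R).
Local Notation C := (R[i]^o).
Local Notation L := (det_bundle H).
Local Notation atlas := (@det_atlas R H).
Local Notation quarter := (4^-1 : R).
Implicit Types (P : Fred_sa H) (t mu nu : R) (s : R -> total_space L) (b : seq H) (n m : int).
Local Notation V P mu := (eigen_sum (set_val P) `[- mu, mu]%classic).
Local Notation ev e Q := [seq g Q | g <- e].

Definition aps_det P t b : R[i] := coef [seq bop_app (aps_op (set_val P) t) y | y <- b] b.

Lemma aps_det_indep P mu t b b' : sin (2 * pi * t) != 1 ->
  is_basis (V P mu) b -> is_basis (V P mu) b' -> aps_det P t b = aps_det P t b'.
Proof.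
by move=> s1 bb bb'; rewrite /aps_det (aps_coef s1 bb' bb bb) coefxx ?mul1r//; case: bb.
Qed.

Lemma aps_det_neq0 P mu t b : sin (2 * pi * t) != 1 -> is_basis (V P mu) b -> aps_det P t b != 0.
Proof. by move=> s1 bb; apply: (basis_coef_neq0 (aps_image s1 bb) bb). Qed.

(** No formula is imposed where sin = 1; the continuity contained in [nv_section] fixes the value
    there. *)
Definition spectral_section P mu n s := nv_section (aps_loop P) s /\ forall b t, is_basis (V P mu) b ->
  sin (2 * pi * t) != 1 ->
  s t = tot (L := L) ((expi (- (2 * pi * n%:~R * t)) * aps_det P t b) *: det_one (aps_fred P t)).

Lemma cvgl_comp (X Y : Type) (F : set_system X) (G : set_system Y) {FF : Filter F} {FG : Filter G}
    (g : X -> Y) (r : Y -> seq H) (r0 : seq H) : g @ F --> G -> cvgl G r r0 -> cvgl F (r \o g) r0.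
Proof.
by move=> gG [rs rc]; split=> [x|i]; [exact: rs|exact: (cvg_comp _ _ gG (rc i))].
Qed.

Lemma adm_open mu : open [set P : Fred_sa H | adm (set_val P) mu].
Proof.
rewrite openE => P /= am; have [s [a [m [_ sg]]]] := adm_spectral_gap (sa_val P) am.
have mu0 : 0 < mu by case: am.
have saB (Q : Fred_sa H) : selfadjoint (bop_comp (set_val Q) (set_val Q)) by apply: selfadjoint_comp; exact: sa_val.
have [|d d0 h] := spectral_gap_perturb (saB P) _ sg; first by rewrite exprn_gt0.
have c : (fun Q : Fred_sa H => bop_comp (set_val Q) (set_val Q)) @ P --> bop_comp (set_val P) (set_val P).
  have v : (fun Q : Fred_sa H => set_val Q) @ P --> set_val P by exact: initial_continuous.
  exact: (cvg_bop_comp v v).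
have := (@cvg_nrmP _ _ _ (nbhs P) (nbhs_filter P) _ _).1 c d d0.
apply: filterS => Q Qd.
have [|s' [a' [m' [sg' _ _]]]] := h _ (saB Q) _ Qd.
  by move=> x; rewrite sa_sqr_ge0 ?sqr_ge0//; exact: sa_val.
exact: (spectral_gap_adm (sa_val Q) mu0 sg').
Qed.

(** A single chart around the operator at 1/4 serves all P near P0, which makes the section jointly
    continuous in t and P. *)
Lemma local_spectral_section P0 mu n : adm (set_val P0) mu ->
  exists (N : set (Fred_sa H)) (S : R * Fred_sa H -> total_space L),
  [/\ open N, N P0, forall P, N P -> adm (set_val P) mu,
      forall P, N P -> spectral_section P mu n (fun t => S (t, P)) &
      forall t P, N P -> S @ (t, P) --> S (t, P)].
Proof.
move=> am0; have [U [e [f [tau [df U4 ef]]]]] := quarter_frame am0.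
have [oU [mu0 _] [ec be] [fc bf] _] := df.
have ce (Q : Fred H) : U Q -> cvgl (nbhs Q) (fun Q' => ev e Q') (ev e Q) by move=> UQ; exact: (cvg_frame oU (conj ec be) UQ).
have cf (Q : Fred H) : U Q -> cvgl (nbhs Q) (fun Q' => ev f Q') (ev f Q) by move=> UQ; exact: (cvg_frame oU (conj fc bf) UQ).
have ft Q : U Q -> frame_at (L := L) atlas tau Q by move=> UQ; exists U => //; exists (mu ^+ 2), e, f.
pose N : set (Fred_sa H) := [set P : Fred_sa H | adm (set_val P) mu] `&` (fun P => aps_fred P quarter) @^-1` U.
pose E t := expi (- (2 * pi * n%:~R * t)).
(* The frame formula is used only where sin = 1, but by [frame_one] it holds on the whole chart
   ([SE]). So each point has a neighbourhood on which one continuous formula describes S. *)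
pose S (p : R * Fred_sa H) := if sin (2 * pi * p.1) == 1
  then tot (L := L) ((E p.1 * coef (ev f (aps_fred p.2 p.1)) (ev e (aps_fred p.2 p.1))) *: tau (aps_fred p.2 p.1))
  else tot (L := L) ((E p.1 * aps_det p.2 p.1 (ev e (aps_fred p.2 quarter))) *: det_one (aps_fred p.2 p.1)).
have E0 t : E t != 0 by exact: expi_neq0.
have cE t : (E : R -> C) @ t --> (E t : C).
  have c := @cvg_expi_linear R (- (2 * pi * n%:~R)) t.
  have EE (z : R) : expi (- (2 * pi * n%:~R) * z) = E z by rewrite /E mulNr.
  by apply: cvg_near_eq; [move: c; rewrite EE; apply|near=> z; exact: EE].
have b4 P : N P -> is_basis (V P mu) (ev e (aps_fred P quarter)).
  by move=> [am UP]; have [] := frame_bases df ef am UP UP.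
have SE P t : N P -> U (aps_fred P t) ->
    S (t, P) = tot (L := L) ((E t * coef (ev f (aps_fred P t)) (ev e (aps_fred P t))) *: tau (aps_fred P t)).
  move=> NP Ut; have [am UP] := NP; rewrite /S; have [s1|s1] := eqVneq (sin (2 * pi * (t, P).1)) 1.
    by [].
  congr (tot _); rewrite -(scalerA (E t)) -(scalerA (E t) (coef _ _)); congr (E t *: _).
  exact: (esym (frame_one df ef am UP Ut s1 (b4 _ NP))).
have S1 P t : sin (2 * pi * t) != 1 ->
    S (t, P) = tot (L := L) ((E t * aps_det P t (ev e (aps_fred P quarter))) *: det_one (aps_fred P t)).
  by move=> s1; rewrite /S ifN.
have oN : open N.
  apply: openI; first exact: adm_open.
  apply: open_comp => // P _; have c : (fun P : Fred_sa H => P) @ P --> P by exact: cvg_id.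
  by apply: (cvg_aps_fred c); exact: cvg_cst.
have SC t P : N P -> S @ (t, P) --> S (t, P).
  move=> NP; have [am UP] := NP.
  have c1 : (fun p : R * Fred_sa H => p.1) @ (t, P) --> t by exact: (@cvg_fstp _ _ (t, P)).
  have c2 : (fun p : R * Fred_sa H => p.2) @ (t, P) --> P by exact: (@cvg_sndp _ _ (t, P)).
  have ca : (fun p : R * Fred_sa H => aps_fred p.2 p.1) @ (t, P) --> aps_fred P t by exact: (cvg_aps_fred c2 c1).
  have cEp : (fun p : R * Fred_sa H => E p.1 : C) @ (t, P) --> (E t : C) by exact: (cvg_comp _ _ c1 (cE t)).
  have [s1|s1] := eqVneq (sin (2 * pi * t)) 1.
    have Ut : U (aps_fred P t) by rewrite aps_fred_sin1.
    have nU : \forall p \near (t, P), U (aps_fred p.2 p.1) by apply: ca; exact: open_nbhs_nbhs.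
    have nN : \forall p \near (t, P), N p.2 by apply: c2; exact: open_nbhs_nbhs.
    have ck : (fun p : R * Fred_sa H => E p.1 * coef (ev f (aps_fred p.2 p.1)) (ev e (aps_fred p.2 p.1)) : C)
        @ (t, P) --> (E t * coef (ev f (aps_fred P t)) (ev e (aps_fred P t)) : C).
      apply: cvg_mulC; first exact: cEp.
      apply: (cvg_coef (be _ Ut).1); first exact: (cvgl_comp ca (cf _ Ut)).
      exact: (cvgl_comp ca (ce _ Ut)).
    have c := @cvg_tot_scale _ _ L _ (@det_is_atlas R H) tau _ (nbhs (t, P)) (nbhs_filter (t, P))
      (fun p => aps_fred p.2 p.1) _ _ _ (ft _ Ut) ca ck.
    rewrite (SE P t NP Ut); apply: (cvg_near_eq c).
    by near=> p; rewrite [p in RHS]surjective_pairing SE; [reflexivity|near: p|near: p].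
  have nS : \forall p \near (t, P), sin (2 * pi * p.1) != 1.
    have cs := cvg_comp _ _ c1 (@cvg_sin2pi R t).
    have nb : nbhs (sin (2 * pi * t)) [set y : R | y != 1].
      by apply: open_nbhs_nbhs; split; [exact: open_neq|exact: s1].
    exact: (cs _ nb).
  have fo : frame_at (L := L) atlas (@det_one R H) (aps_fred P t).
    by apply: frame_at_one; rewrite aps_fredE; apply: aps_op_invertible => //; exact: sa_val.
  have c4 : (fun p : R * Fred_sa H => aps_fred p.2 quarter) @ (t, P) --> aps_fred P quarter.
    by apply: (cvg_aps_fred c2); exact: cvg_cst.
  have cb : (fun p : R * Fred_sa H => aps_op (set_val p.2) p.1) @ (t, P) --> aps_op (set_val P) t.
    apply: cvg_aps_op => //; have v : (fun Q : Fred_sa H => set_val Q) @ P --> set_val P by exact: initial_continuous.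
    exact: (cvg_comp _ _ c2 v).
  have ce4 : cvgl (nbhs (t, P)) (fun p : R * Fred_sa H => ev e (aps_fred p.2 quarter)) (ev e (aps_fred P quarter)) by exact: (cvgl_comp c4 (ce _ UP)).
  have ck : (fun p : R * Fred_sa H => E p.1 * aps_det p.2 p.1 (ev e (aps_fred p.2 quarter)) : C)
      @ (t, P) --> (E t * aps_det P t (ev e (aps_fred P quarter)) : C).
    apply: cvg_mulC; first exact: cEp.
    rewrite /aps_det; apply: (cvg_coef (be _ UP).1); first exact: (cvgl_bop cb ce4).
    exact: ce4.
  have c := @cvg_tot_scale _ _ L _ (@det_is_atlas R H) (@det_one R H) _ (nbhs (t, P)) (nbhs_filter (t, P))
    (fun p => aps_fred p.2 p.1) _ _ _ fo ca ck.
  rewrite (S1 P t s1); apply: (cvg_near_eq c).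
  by near=> p; rewrite [p in RHS]surjective_pairing S1; [reflexivity|near: p].
exists N, S; split; [exact: oN|by split|by move=> P []| |exact: SC].
move=> P NP; have [am UP] := NP; split; last first.
  by move=> b t bb s1; rewrite S1// (aps_det_indep s1 (b4 _ NP) bb).
apply/nv_sectionP; split.
- move=> t; have cp := @cvg_pairl R (Fred_sa H) t P.
  exact: (cvg_comp _ _ cp (SC t P NP)).
- move=> t; have pA : aps_fred P (t + 1) = aps_fred P t by rewrite -!loop_at_aps; exact: loop_at_periodic.
  have pS : sin (2 * pi * (t + 1)) = sin (2 * pi * t) by exact: periodic_sin.
  have pE : E (t + 1) = E t.
    by rewrite /E mulrDr mulr1 opprD expiD [expi (- (2 * _ * _))](_ : _ = 1) ?mulr1// -mulrN -mulrNz expi_2pi_int.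
  have pD : aps_det P (t + 1) = aps_det P t by apply/funext => b; rewrite /aps_det aps_op_periodic.
  have SP u : S (u, P) = if sin (2 * pi * u) == 1
    then tot (L := L) ((E u * coef (ev f (aps_fred P u)) (ev e (aps_fred P u))) *: tau (aps_fred P u))
    else tot (L := L) ((E u * aps_det P u (ev e (aps_fred P quarter))) *: det_one (aps_fred P u)) by reflexivity.
  by rewrite (SP (t + 1)) pS pE pA pD; exact/esym/SP.
- by move=> t; rewrite loop_at_aps /S; case: ifP => _; reflexivity.
move=> t; have [s1|s1] := eqVneq (sin (2 * pi * t)) 1.
  have Ut : U (aps_fred P t) by rewrite aps_fred_sin1.
  rewrite (SE P t NP Ut); have [be' bf'] := frame_bases df ef am UP Ut.
  have [_ tn] := frame_at_gen (@det_is_atlas R H) (ft _ Ut).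
  by rewrite [tvec _]/(_ *: _) scaler_eq0 negb_or tn andbT mulf_neq0//; exact: (basis_coef_neq0 bf' be').
rewrite (S1 P t s1); have fo : frame_at (L := L) atlas (@det_one R H) (aps_fred P t).
  by apply: frame_at_one; rewrite aps_fredE; apply: aps_op_invertible => //; exact: sa_val.
have [_ tn] := frame_at_gen (@det_is_atlas R H) fo.
by rewrite [tvec _]/(_ *: _) scaler_eq0 negb_or tn andbT mulf_neq0//; exact: (aps_det_neq0 s1 (b4 _ NP)).
Unshelve. all: by end_near.
Qed.

End LocalCanonical.

Lemma sin1_eq (R : realType) (t u : R) : sin (2 * pi * t) = 1 -> sin (2 * pi * u) = 1 ->
  exists n : int, t = u + n%:~R.
Proof.
move=> st su; have [ct _] := sin1 st; have [cu _] := sin1 su.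
have e : expi (2 * pi * t - 2 * pi * u) = 1.
  by rewrite expiD /expi cosN sinN st su ct cu; simpc.
have [n en] := expi_eq1 e; exists n; have p0 := pi_gt0 R.
have : 2 * pi * (t - u - n%:~R) = 0 by rewrite !mulrBr en; ring.
by move=> /eqP; rewrite !mulf_eq0 (gt_eqF p0) pnatr_eq0 /= subr_eq0 => /eqP <-; ring.
Qed.

(** Times with sin = 1 differ by integers ([sin1_eq]), so they are isolated and limits decide the
    value there. *)
Lemma eq_off_sin1 (R : realType) (f g : R -> R[i]^o) : continuous f -> continuous g ->
  (forall t, sin (2 * pi * t) != 1 -> f t = g t) -> f =1 g.
Proof.
move=> fc gc fg t; have [st|st] := eqVneq (sin (2 * pi * t)) 1; last exact: fg.
have c1 : f @ t^' --> f t by apply: cvg_within_filter; exact: fc.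
have c2 : g @ t^' --> g t by apply: cvg_within_filter; exact: gc.
have c3 : g @ t^' --> f t.
  apply: (cvg_near_eq c1); have nt : \forall u \near t, `|u - t| < 1.
    by have := @nbhsx_ballx _ _ t (1 : R) ltr01; apply: filterS => u; rewrite /ball /= distrC.
  apply: filterS nt => u ut ne; apply: fg; apply/eqP => su.
  have [n E] := sin1_eq su st; move: ne ut; rewrite E [t + _]addrC addrK => ne.
  rewrite -intr_norm (_ : 1 = 1%:~R)// ltr_int => n1.
  have n0 : n = 0 by lia.
  by move: ne; rewrite n0 add0r eqxx.
exact: (cvg_unique (@norm_hausdorff _ _) c3 c2).
Qed.

(** * Sections attached to different representatives (mu, n) *)

Section Comparison.
Variables (R : realType) (H : hilbertType R).
Local Notation C := (R[i]^o).
Local Notation L := (det_bundle H).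
Local Notation atlas := (@det_atlas R H).
Implicit Types (P : Fred_sa H) (t mu nu : R) (s : R -> total_space L) (b : seq H) (n m : int).
Local Notation V P mu := (eigen_sum (set_val P) `[- mu, mu]%classic).

Definition outer P mu nu (y : H) :=
  (rayleigh (set_val P) y \in `[- nu, nu]%classic) && (rayleigh (set_val P) y \notin `[- mu, mu]%classic).

Lemma det_one_neq0 P t : sin (2 * pi * t) != 1 -> det_one (aps_fred P t) != 0.
Proof.
move=> s1; have fo : frame_at (L := L) atlas (@det_one R H) (aps_fred P t).
  by apply: frame_at_one; rewrite aps_fredE; apply: aps_op_invertible => //; exact: sa_val.
by have [_] := frame_at_gen (@det_is_atlas R H) fo.
Qed.

(** In the eigenbasis r for the larger bound nu both determinants are products of the numbers
    [aps_eig]; the factors with eigenvalue in [-mu, mu] cancel. Where sin = 1 the formula follows by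
    continuity. *)
Lemma spectral_section_ratio P mu nu n m s s' r : 0 < mu -> mu <= nu -> low_eigenlist (set_val P) nu r ->
  spectral_section P mu n s -> spectral_section P nu m s' -> forall t, tratio (s' t) (s t) =
  expi (- (2 * pi * (m - n)%:~R * t)) * \prod_(y <- r | outer P mu nu y) aps_eig (rayleigh (set_val P) y) t.
Proof.
move=> mu0 munu el [ns sE] [ns' s'E]; have fr := @aps_framed R H P.
have [cr _ _ _] := nv_ratio (@det_is_atlas R H) fr ns' ns.
apply: eq_off_sin1; [exact: cr|move=> t|move=> t s1].
  apply: cvg_mulC.
    have := @cvg_expi_linear R (- (2 * pi * (m - n)%:~R)) t; rewrite mulNr => c.
    by apply: (cvg_near_eq c); near=> z; rewrite mulNr.
  rewrite -big_filter (_ : (fun t0 => _) = (fun t0 => \prod_(y <- [seq y <- r | outer P mu nu y]) aps_eig (rayleigh (set_val P) y) t0)).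
    by apply: cvg_bigprod => y; exact: cvg_aps_eig.
  by apply/funext => z; rewrite big_filter.
have b1 := low_eigenlist_basis (sa_val P) el (@subset_refl _ _).
have sub : (`[- mu, mu]%classic `<=` `[- nu, nu]%classic)%classic.
  by move=> z /=; rewrite !in_itv /= => /andP[z1 z2]; lra.
have b2 := low_eigenlist_basis (sa_val P) el sub.
rewrite (s'E _ t b1 s1) (sE _ t b2 s1) /aps_det !(coef_aps_op _ _ (sa_val P) el).
have p0 y : rayleigh (set_val P) y \in `[- mu, mu]%classic -> rayleigh (set_val P) y \in `[- nu, nu]%classic.
  by move=> /set_mem ?; apply/mem_set/sub.
set D1 := \prod_(y <- r | rayleigh (set_val P) y \in `[- mu, mu]%classic) _.
set D2 := \prod_(y <- r | rayleigh (set_val P) y \in `[- nu, nu]%classic) _.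
have D12 : D2 = D1 * \prod_(y <- r | outer P mu nu y) aps_eig (rayleigh (set_val P) y) t.
  rewrite /D2 (bigID (fun y => rayleigh (set_val P) y \in `[- mu, mu]%classic)) /=; congr (_ * _).
  by apply: eq_bigl => y; apply/andb_idl/p0.
have D0 : D1 != 0.
  by rewrite /D1 -(coef_aps_op _ _ (sa_val P) el); exact: (aps_det_neq0 s1 b2).
apply: tratioE; first by rewrite scaler_eq0 negb_or det_one_neq0// andbT mulf_neq0// expi_neq0.
rewrite scalerA; congr (_ *: _); rewrite D12.
rewrite (_ : - (2 * pi * m%:~R * t) = - (2 * pi * (m - n)%:~R * t) + - (2 * pi * n%:~R * t)) ?expiD; first by ring.
by rewrite rmorphB /=; ring.
Unshelve. all: by end_near.
Qed.

(** The ratio has winding number N - (m - n), where N counts the eigenvalues in ]mu,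
    nu[; those in ]-nu, -mu[ contribute nothing. *)
Lemma spectral_section_homotopic P mu nu n m s s' : adm (set_val P) mu -> adm (set_val P) nu -> mu <= nu ->
  spectral_section P mu n s -> spectral_section P nu m s' ->
  nv_homotopic (aps_loop P) s s' <-> m - n = eigen_count (set_val P) `]mu, nu[%classic.
Proof.
move=> am an munu cs cs'; have [r [_ [_ [el _]]]] := adm_low_eigenlist (sa_val P) an.
have mu0 : 0 < mu by case: am.
have [[ns _] [ns' _]] := (cs, cs').
rewrite (nv_homotopicP (@det_is_atlas R H) (@aps_framed R H P) ns ns').
have ratio := spectral_section_ratio mu0 munu el cs cs'.
have [_ _ lr _] := el.
have cnt : eigen_count (set_val P) `]mu, nu[%classic =
    count (fun y => outer P mu nu y && (0 < rayleigh (set_val P) y)) r.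
  rewrite (low_eigenlist_count (sa_val P) el); last first.
    by move=> z /=; rewrite !in_itv /= => /andP[z1 z2]; lra.
  apply: eq_in_count => y yr; have := lr _ yr; rewrite ltr_norml => /andP[l1 l2].
  rewrite /outer !mem_setE !in_itv /=; move: (rayleigh _ y) l1 l2 => l l1 l2.
  by apply/idP/idP; lra.
set N := eigen_count _ _ in cnt *.
have nP : Null (@fracp R) (fun t => \prod_(y <- r | outer P mu nu y) aps_eig (rayleigh (set_val P) y) t *
    expi (- (2 * pi * N%:R * t))).
  rewrite cnt; apply: Null_prod_aps_eig => y; rewrite /outer => /andP[_]; apply: contraNneq => ->.
  by rewrite mem_setE in_itv /=; lra.
split=> [h|E].
  have nE : Null (@fracp R) (fun t => expi (2 * pi * (N%:Z - (m - n))%:~R * t)).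
    apply: (Null_eq _ (NullM h (NullV nP))) => t; rewrite ratio.
    have := Null_neq0 t nP; rewrite mulf_eq0 negb_or => /andP[p0 _].
    rewrite invfM -expiN opprK (_ : 2 * pi * (N%:Z - (m - n))%:~R * t =
      - (2 * pi * (m - n)%:~R * t) + 2 * pi * N%:R * t) ?expiD; first by field.
    by rewrite rmorphB /=; ring.
  by have := Null_expi nE; lia.
by apply: (Null_eq _ nP) => t; rewrite ratio E mulrC.
Qed.

Lemma sp_class_homotopic P mu nu n m s s' : admissible P mu -> admissible P nu ->
  spectral_section P mu n s -> spectral_section P nu m s' ->
  nv_homotopic (aps_loop P) s s' <-> sp_class P mu n (nu, m).
Proof.
move=> am an cs cs'; have [ns _] := cs; have [ns' _] := cs'.
have fr := @aps_framed R H P.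
have [munu|numu] := leP mu nu.
  rewrite (spectral_section_homotopic am an munu cs cs'); split=> [E|[_ /= [][]//]].
    split=> //=; have [e|ne] := eqVneq mu nu.
      apply: Or32; split=> //; move: E; rewrite -e; set A := eigen_count _ _.
      have -> : A = 0%N.
        by rewrite /A /eigen_count (_ : `]mu, mu[%classic = set0) ?fsbig_set0// set_itvoo0.
      lia.
    by apply: Or31; rewrite lt_neqAle ne munu.
  - by move=> <- ->; rewrite subrr /eigen_count set_itvoo0 fsbig_set0.
  - by move=> h; rewrite ltNge munu in h.
have -> : nv_homotopic (aps_loop P) s s' <-> nv_homotopic (aps_loop P) s' s.
  by split; apply: (nv_homotopic_sym (@det_is_atlas R H)).
rewrite (spectral_section_homotopic an am (ltW numu) cs' cs); split=> [E|[_ /= [][]//]].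
- by split=> //=; apply: Or33.
- by move=> h; rewrite ltNge (ltW numu) in h.
by move=> h; rewrite h ltxx in numu.
Qed.

End Comparison.

Lemma cvg_pair2 (T : Type) (F : set_system T) {FF : Filter F} (X Y : topologicalType)
    (f : T -> X) (g : T -> Y) (x : X) (y : Y) :
  f @ F --> x -> g @ F --> y -> (fun t => (f t, g t)) @ F --> (x, y).
Proof.
move=> fx gy W [[A B] [/= Ax By] AB]; have h1 := fx _ Ax; have h2 := gy _ By.
have h3 : F [set t | A (f t) /\ B (g t)] by exact: filterI.
suff h4 : F (fun t => W (f t, g t)) by exact: h4.
by apply: filterS h3 => t [At Bt]; apply: AB.
Qed.

Lemma twopi_neq0 (R : realType) : 2 * pi != 0 :> R.
Proof. by rewrite mulf_neq0 ?pnatr_eq0// gt_eqF// pi_gt0. Qed.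

Section Transport.
Variables (R : realType) (H : hilbertType R).
Local Notation C := (R[i]^o).
Local Notation L := (det_bundle H).
Local Notation atlas := (@det_atlas R H).
Local Notation quarter := (4^-1 : R).
Implicit Types (P : Fred_sa H) (t mu nu : R) (s : R -> total_space L) (b : seq H) (n m : int).
Local Notation V P mu := (eigen_sum (set_val P) `[- mu, mu]%classic).

Lemma expi_prod t (I : Type) (r : seq I) : \prod_(y <- r) expi t = expi ((size r)%:R * t).
Proof.
elim: r => [|y r IH]; first by rewrite big_nil mul0r expi0.
by rewrite big_cons IH /= -[(size r).+1]addn1 natrD mulrDl mul1r addrC expiD.
Qed.

Lemma det_pathE P mu t r : low_eigenlist (set_val P) mu r -> 0 <= t <= 2 * pi ->
  det_path (set_val P) mu t = aps_det P (t / (2 * pi)) r.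
Proof.
move=> el /andP[t0 t2]; have p0 := pi_gt0 R.
have tt : 2 * pi * (t / (2 * pi)) = t by rewrite mulrC divfK// twopi_neq0.
have [_ _ lr _] := el.
have full : [seq y <- r | rayleigh (set_val P) y \in `[- mu, mu]%classic] = r.
  apply/all_filterP/allP => y ys; apply/mem_set; rewrite /= in_itv /= -ler_norml; exact: (ltW (lr _ ys)).
rewrite /aps_det -full (coef_aps_op _ _ (sa_val P) el) /det_path; case: leP => tp.
  rewrite (low_eigenlist_prod _ (sa_val P) el)//; apply: eq_bigr => y _.
  have st : 0 <= sin t by apply: sin_ge0_pi; rewrite t0.
  by rewrite /aps_eig tt (max_idPl st) (min_idPr st) addr0.
have st : sin t <= 0.
  have := @sin_ge0_pi R (t - pi); rewrite sinB cospi sinpi mulr0 subr0 mulrN1 oppr_ge0.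
  by apply; lra.
rewrite (low_eigenlist_count (sa_val P) el)// -big_filter full -size_filter full -expi_prod.
by apply: eq_bigr => y _; rewrite /aps_eig tt (max_idPr st) (min_idPl st) mul0r add0r.
Qed.

Lemma spectral_section_canonical P mu n s : adm (set_val P) mu -> spectral_section P mu n s ->
  canonical_section P mu n (set_val (aps P)) s.
Proof.
move=> am [ns sE]; split=> // t t2 tne; have p0 := pi_gt0 R.
have [r [_ [_ [el _]]]] := adm_low_eigenlist (sa_val P) am.
have s1 : sin (2 * pi * (t / (2 * pi))) != 1.
  apply/eqP => st; have [k kE] := sin1_eq st (@sin_quarter R).
  have tE : t = 2 * pi * (quarter + k%:~R) by rewrite -kE mulrC divfK// twopi_neq0.
  have : 0 <= quarter + k%:~R <= (1 : R).
    have tp : 0 < 2 * pi :> R by rewrite mulr_gt0.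
    by rewrite -kE divr_ge0 ?ler_pdivrMr ?mul1r ?(ltW tp)//; case/andP: t2.
  move=> /andP[k0 k1]; have k00 : k = 0.
    have a1 : (-1 : R) < k%:~R by lra.
    have a2 : (k%:~R : R) < 1 by lra.
    by move: a1 a2; rewrite -[-1](rmorphN1 (intmul 1)) -[1]/(1%:~R) !ltr_int; lia.
  by apply: tne; rewrite tE k00 addr0; field.
exists (det_one (aps_fred P (t / (2 * pi)))).
  by apply/det_oneE => //; rewrite aps_fredE; apply: aps_op_invertible => //; exact: sa_val.
have := sE r _ (low_eigenlist_full el) s1; rewrite (det_pathE el t2).
by rewrite (_ : - (2 * pi * n%:~R * (t / (2 * pi))) = - n%:~R * t)// !mulNr -{2}[t](divfK (twopi_neq0 R)); congr (- _); ring.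
Qed.

Lemma spectral_section_exists P mu n : adm (set_val P) mu -> exists s, spectral_section P mu n s.
Proof. by move=> am; have [N [S [_ NP _ cs _]]] := local_spectral_section n am; exists (fun t => S (t, P)); exact: cs. Qed.

(** Where sin >= 0 the operator P_t is a continuous function [h] of (cos, sin), and closeness of
    (cos, sin) to (0, 1) follows from sin alone. This treats all t at once, without choosing a
    period. *)
Lemma quarter_arc P (U : set (Fred H)) : open U -> U (aps_fred P quarter) ->
  exists2 k : R, k < 1 & forall t, k <= sin (2 * pi * t) -> U (aps_fred P t).
Proof.
move=> [B oB <-] /= BP.
pose h (p : R * R) : bop H := (p.1)%:C *: bop_id H + ('i * (p.2)%:C) *: set_val P.
have hE t : 0 <= sin (2 * pi * t) -> aps_op (set_val P) t = h (cos (2 * pi * t), sin (2 * pi * t)).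
  by move=> s0; rewrite /aps_op /h /spos /sneg (max_idPl s0) (min_idPr s0) mulr0 scale0r addr0.
have [c0 _] := sin1 (@sin_quarter R).
pose z : R * R := (0, 1).
have B0 : B (h z).
  by move: BP; rewrite aps_fredE hE ?sin_quarter// c0.
have hc : h @ z --> h z.
  have c1 : (fun p : R * R => p.1) @ z --> (0 : R) by exact: (@cvg_fstp R R z).
  have c2 : (fun p : R * R => p.2) @ z --> (1 : R) by exact: (@cvg_sndp R R z).
  apply: cvgD.
    by apply: cvg_scale; [exact: cvg_real_complex|exact: cvg_cst].
  apply: cvg_scale; last exact: cvg_cst.
  by apply: cvg_mulC; [exact: cvg_cst|exact: cvg_real_complex].
have : nbhs z (h @^-1` B) by apply: hc; exact: open_nbhs_nbhs.
move=> [[A1 A2] /= [nA1 nA2] AB].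
have /nbhs_ballP[e1 /= e10 b1] : nbhs (0 : R) A1 by exact: nA1.
have /nbhs_ballP[e2 /= e20 b2] : nbhs (1 : R) A2 by exact: nA2.
(* sin >= 1 - e/2 implies cos^2 <= e < e1^2 and 1 - sin < e2. *)
pose e := Num.min (Num.min e2 (e1 ^+ 2 / 2)) 1.
have e0 : 0 < e by rewrite !lt_min e20 ltr01 divr_gt0// exprn_gt0.
have [ee2 ee1 ee] : [/\ e <= e2, e <= e1 ^+ 2 / 2 & e <= 1].
  by rewrite /e !ge_min !lexx /= !orbT.
exists (1 - e / 2); first by lra.
move=> t kt; rewrite aps_fredE hE; last by lra.
have s1 := sin_le1 (2 * pi * t).
apply: AB; split; rewrite /=.
  apply: b1; rewrite /ball /= sub0r normrN -(@ltr_pXn2r _ 2%N)// ?nnegrE ?(ltW e10)//.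
  rewrite real_normK ?num_real// cos2sin2; move: kt s1 => kt s1; nra.
by apply: b2; rewrite /ball /= ger0_norm ?subr_ge0//; lra.
Qed.

(** The topology of the transgression is defined by families over open sets of arbitrary loops. The
    section along P0 is therefore extended to nearby loops, with [det_one] as frame away from sin =
    1 and tau near it. [near_homotopic] compares the extension, along the loops of nearby P, with
    the family of spectral sections. *)
Lemma local_transgression P0 mu n : adm (set_val P0) mu ->
  exists (W : set (loop_space R (Fred H))) (Sig : R * loop_space R (Fred H) -> total_space L),
  [/\ open W /\ W (aps_loop P0), forall t g, W g -> Sig @ (t, g) --> Sig (t, g),
      forall g, W g -> framed (L := L) atlas g,
      forall g, W g -> nv_section g (fun t => Sig (t, g)) &
      \forall P \near P0, forall s, spectral_section P mu n s ->
        nv_class (aps_loop P) s = nv_class (aps_loop P) (fun t => Sig (t, aps_loop P))].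
Proof.
move=> am; have [N [S [oN NP Nam Ncs NS]]] := local_spectral_section n am.
have [U [e [f [tau [df U4 ef]]]]] := quarter_frame am.
have oU : open U by case: df.
have [k1 k11 kU] := quarter_arc oU U4.
have atP := @det_is_atlas R H.
pose k2 := (k1 + 1) / 2; have k12 : k1 < k2 by rewrite /k2; lra.
have ns := (Ncs _ NP).1.
have f0 t : sin (2 * pi * t) <= k2 -> frame_at (L := L) atlas (@det_one R H) (loop_at (aps_loop P0) t).
  move=> st; apply: frame_at_one; rewrite loop_at_aps aps_fredE; apply: aps_op_invertible; first exact: sa_val.
  by apply/eqP => E; move: st; rewrite E /k2; lra.
have f1 t : k1 <= sin (2 * pi * t) -> frame_at (L := L) atlas tau (loop_at (aps_loop P0) t).
  by move=> st; exists U; [exists (mu ^+ 2), e, f|rewrite loop_at_aps; exact: kU].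
pose Sig := @extend_section R _ L (fun t => S (t, P0)) (@det_one R H) tau k1 k2.
pose W := @extend_dom R _ L atlas (fun t => S (t, P0)) (@det_one R H) tau k1 k2.
have oW : open W by exact: extend_dom_open.
have W0 : W (aps_loop P0) by exact: (extend_dom0 atP ns f0 f1).
have SigC t g : W g -> Sig @ (t, g) --> Sig (t, g) by exact: (extend_section_cvg atP ns k12 f0 f1).
have Sign g : W g -> nv_section g (fun t => Sig (t, g)) by exact: (extend_section_nv atP ns k12 f0 f1).
exists W, Sig; split=> //; first by move=> g; exact: (extend_dom_framed k12).
have nN : \forall P \near P0, N P by exact: open_nbhs_nbhs.
have nW : \forall P \near P0, W (aps_loop P).
  by have c := @cvg_aps_loop R H P0; have h := c W (open_nbhs_nbhs (conj oW W0)); exact: h.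
have nh : \forall P \near P0, nv_homotopic (aps_loop P) (fun t => S (t, P)) (fun t => Sig (t, aps_loop P)).
  apply: (near_homotopic atP (gam := @aps_loop R H) (s := S) (s' := fun p => Sig (p.1, aps_loop p.2))).
  - by move=> t; exact: NS.
  - move=> t; have c1 : (fun p : R * Fred_sa H => p.1) @ (t, P0) --> t by exact: (@cvg_fstp _ _ (t, P0)).
    have c2 : (fun p : R * Fred_sa H => p.2) @ (t, P0) --> P0 by exact: (@cvg_sndp _ _ (t, P0)).
    have c3 : (fun p : R * Fred_sa H => aps_loop p.2) @ (t, P0) --> aps_loop P0 by exact: (cvg_comp _ _ c2 (@cvg_aps_loop R H P0)).
    exact: (cvg_comp _ _ (cvg_pair2 c1 c3) (SigC t _ W0)).
  - by apply: filterE => P; exact: aps_framed.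
  - by apply: filterS nN => P NP'; case: (Ncs _ NP').
  - by apply: filterS nW => P; exact: Sign.
  - rewrite (_ : (fun t => Sig (t, aps_loop P0)) = (fun t => S (t, P0))); last first.
      by apply/funext => t; exact: (extend_section0 atP ns k12 f0 f1).
    by apply: (nv_homotopic_refl atP); [exact: aps_framed|].
near=> P => s cs; have NP' : N P by near: P.
have WP : W (aps_loop P) by near: P.
have hP : nv_homotopic (aps_loop P) (fun t => S (t, P)) (fun t => Sig (t, aps_loop P)) by near: P.
have fr := @aps_framed R H P; have [ns' _] := cs; have [nS _] := Ncs _ NP'.
have hs : nv_homotopic (aps_loop P) s (fun t => S (t, P)).
  apply/(spectral_section_homotopic (Nam _ NP') (Nam _ NP') (lexx mu) cs (Ncs _ NP')).
  by rewrite subrr /eigen_count set_itvoo0 fsbig_set0.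
rewrite ((nv_class_eq atP fr ns' nS).1 hs).
exact: ((nv_class_eq atP fr nS (Sign _ WP)).1 hP).
Unshelve. all: by end_near.
Qed.

End Transport.

(** * The isomorphism *)

Section PullbackTheory.
Variables (X Y : topologicalType) (f : Y -> X) (C : zcover X).
Local Notation PB := (pullback f C).
Local Notation tot_type := (set_type (pb_total f (C := C))).
Implicit Types x y : PB.

Lemma pb_base x : zc_proj (pb_point x) = f (zc_proj x).
Proof. exact/esym/(set_valP (x : tot_type)). Qed.

Lemma pb_val x : set_val (x : tot_type) = (zc_proj x, pb_point x).
Proof. exact: surjective_pairing. Qed.

Lemma pb_ext x y : zc_proj x = zc_proj y -> pb_point x = pb_point y -> x = y.
Proof. by move=> e1 e2; apply/val_inj; rewrite -!set_valE !pb_val e1 e2. Qed.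

Lemma pb_exists (b : Y) (c : C) : f b = zc_proj c -> exists x, zc_proj x = b /\ pb_point x = c.
Proof.
move=> e; have h : pb_total f (C := C) (b, c) by exact: e.
by exists (SigSub (mem_set h) : tot_type).
Qed.

Lemma cvg_pb (T : Type) (F : set_system T) {FF : Filter F} (g : T -> PB) x :
  (fun t => zc_proj (g t)) @ F --> zc_proj x -> (fun t => pb_point (g t)) @ F --> pb_point x ->
  g @ F --> x.
Proof.
move=> c1 c2; apply: (@cvg_set_val _ _ T F FF (g : T -> tot_type) (x : tot_type)).
have c : (fun t => (zc_proj (g t), pb_point (g t))) @ F --> (zc_proj x, pb_point x) by exact: cvg_pair2.
rewrite pb_val (_ : (fun t => _) = (fun t => (zc_proj (g t), pb_point (g t)))) //.
by apply: boolp.funext => t; exact: pb_val.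
Qed.

Lemma cvg_pb_val x : (fun y => (zc_proj y, pb_point y)) @ x --> (zc_proj x, pb_point x).
Proof.
have c : (set_val : tot_type -> _) @ (x : tot_type) --> set_val (x : tot_type) by exact: initial_continuous.
rewrite pb_val in c; rewrite (_ : (fun y => _) = (set_val : tot_type -> _)) //.
by apply: boolp.funext => t; exact/esym/pb_val.
Qed.

Lemma cvg_pb_proj x : (@zc_proj _ PB) @ x --> zc_proj x.
Proof.
have c1 := @cvg_pb_val x; have c2 := @cvg_fstp Y C (zc_proj x, pb_point x).
exact: (cvg_comp _ _ c1 c2).
Qed.

Lemma cvg_pb_point x : (fun y => pb_point y) @ x --> pb_point x.
Proof.
have c1 := @cvg_pb_val x; have c2 := @cvg_sndp Y C (zc_proj x, pb_point x).
exact: (cvg_comp _ _ c1 c2).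
Qed.

End PullbackTheory.

Section TransgressionTheory.
Variables (R : realType) (X : topologicalType) (L : line_bundle_data R X).
Variable atlas : set X -> (forall x, fiber L x) -> Prop.
Hypothesis atP : is_atlas atlas.
Implicit Types (q : transgression L) (g : loop_space R X) (s : R -> total_space L) (k : int).

Lemma tr_val q : set_val (q : transgression_type L) = (zc_proj q, transgression_class q).
Proof. exact: surjective_pairing. Qed.

Lemma tr_ext q q' : zc_proj q = zc_proj q' -> transgression_class q = transgression_class q' -> q = q'.
Proof. by move=> e1 e2; apply/val_inj; rewrite -!set_valE !tr_val e1 e2. Qed.

Lemma tr_class q : exists2 s, nv_section (zc_proj q) s & transgression_class q = nv_class (zc_proj q) s.
Proof. exact: (set_valP (q : transgression_type L)). Qed.

Lemma tr_exists g s : nv_section g s -> exists q, zc_proj q = g /\ transgression_class q = nv_class g s.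
Proof.
move=> ns; have h : transgression_set (g, nv_class g s) by exists s.
by exists (SigSub (mem_set h) : transgression_type L).
Qed.

Lemma tscale_tot (a : R[i]) x (v : fiber L x) : tscale a (tot v) = tot (a *: v).
Proof. by []. Qed.

Lemma rotateE k s t : rotate k s t = tscale (expi (2 * pi * k%:~R * t)) (s t).
Proof. by []. Qed.

Lemma tratio_tscale2 (p q : total_space L) (a : R[i]) : a != 0 -> tbase q = tbase p ->
  (exists tau, frame_at atlas tau (tbase p)) -> tvec q != 0 ->
  tratio (tscale a p) (tscale a q) = tratio p q.
Proof.
move=> a0 qp fr q0; rewrite {1}(tscale_tratio atP qp fr q0) tscaleA mulrC -tscaleA.
by rewrite tratio_tscale//; exact: tvec_tscale.
Qed.

Lemma rotate_homotopic g k s s' : framed atlas g -> nv_section g s -> nv_section g s' ->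
  nv_homotopic g s s' -> nv_homotopic g (rotate k s) (rotate k s').
Proof.
move=> fr ns ns'; have nr := nv_rotate atP k fr ns; have nr' := nv_rotate atP k fr ns'.
rewrite (nv_homotopicP atP fr ns ns') (nv_homotopicP atP fr nr nr').
have [_ _ b1 v1] := (nv_sectionP _ _).1 ns; have [_ _ b2 v2] := (nv_sectionP _ _).1 ns'.
apply: Null_eq => t; apply/esym; apply: tratio_tscale2; [exact: expi_neq0|by rewrite b1 b2| |exact: v1].
by rewrite b2; exact: fr.
Qed.

Lemma transgression_act_class q k s : framed atlas (zc_proj q) -> nv_section (zc_proj q) s ->
  transgression_class q = nv_class (zc_proj q) s ->
  transgression_class (zc_act k q) = nv_class (zc_proj q) (rotate k s).
Proof.
move=> fr ns qc; have nr := nv_rotate atP k fr ns.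
have E : [set s' | nv_section (zc_proj q) s' /\ exists2 s0, nv_class (zc_proj q) s s0 &
    nv_homotopic (zc_proj q) (rotate k s0) s'] = nv_class (zc_proj q) (rotate k s).
  apply/seteqP; split=> s' [ns' h].
    have [s0 [ns0 h0] h1] := h; have nr0 := nv_rotate atP k fr ns0.
    have h2 := rotate_homotopic k fr ns ns0 h0.
    by split; [exact: ns'|exact: (nv_homotopic_trans atP fr nr nr0 ns' h2 h1)].
  split; first exact: ns'.
  by exists s; [split; [exact: ns|exact: (nv_homotopic_refl atP fr ns)]|exact: h].
rewrite /transgression_class /= /transgression_act tr_val /= qc E set_valE val_insubd.
by rewrite mem_set//; exists (rotate k s).
Qed.

Lemma open_local_classes (U : set (loop_space R X)) (Sig : R * loop_space R X -> total_space L) :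
  open U -> (forall t g, U g -> Sig @ (t, g) --> Sig (t, g)) ->
  (forall g, U g -> nv_section g (fun t => Sig (t, g))) -> (forall g, U g -> framed atlas g) ->
  open [set q | U (zc_proj q) /\ transgression_class q = nv_class (zc_proj q) (fun t => Sig (t, zc_proj q))].
Proof. exact: (local_section_open atP). Qed.

End TransgressionTheory.

Section Isomorphism.
Variables (R : realType) (H : hilbertType R).
Local Notation C := (R[i]^o).
Local Notation L := (det_bundle H).
Local Notation atlas := (@det_atlas R H).
Local Notation X := (pullback (@aps R H) (based_transgression (det_bundle H) (Fred_id H))).
Local Notation SC := (spectral_cover H).
Implicit Types (P : Fred_sa H) (mu nu : R) (s : R -> total_space L) (n m k : int) (p : SC) (x : X).

Let atP := @det_is_atlas R H.

Definition target_point x : transgression L := pb_point (pb_point x).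
Definition target_class x : set (R -> total_space L) := transgression_class (target_point x).

Lemma target_point_base x : zc_proj (target_point x) = aps_loop (zc_proj x).
Proof. by rewrite /target_point pb_base pb_base. Qed.

Lemma target_pointE x : set_val (target_point x : transgression_type L) = (aps_loop (zc_proj x), target_class x).
Proof. by rewrite tr_val target_point_base. Qed.

Lemma target_ext x y : zc_proj x = zc_proj y -> target_class x = target_class y -> x = y.
Proof.
move=> e1 e2; apply: pb_ext => //; apply: pb_ext; first by rewrite !pb_base e1.
by apply: tr_ext => //; rewrite -!/(target_point _) !target_point_base e1.
Qed.

Lemma target_exists P s : nv_section (aps_loop P) s ->
  exists x, zc_proj x = P /\ target_class x = nv_class (aps_loop P) s.
Proof.
move=> /tr_exists[q [qb qc]].
have [|y [yb yp]] := @pb_exists _ _ (set_val : based_loops R (Fred_id H) -> _) (transgression L) (aps P) q.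
  by rewrite qb.
have [|x [xb xp]] := @pb_exists _ _ (@aps R H) (based_transgression L (Fred_id H)) P y.
  by rewrite yb.
by exists x; rewrite xb /target_class /target_point xp yp.
Qed.

Lemma target_classP x : exists2 s, nv_section (aps_loop (zc_proj x)) s & target_class x = nv_class (aps_loop (zc_proj x)) s.
Proof. by rewrite -target_point_base; exact: tr_class. Qed.

Lemma cvg_target (T : Type) (F : set_system T) {FF : Filter F} (f : T -> X) x :
  (fun t => zc_proj (f t)) @ F --> zc_proj x -> (fun t => target_point (f t)) @ F --> target_point x -> f @ F --> x.
Proof.
move=> c1 c2; apply: cvg_pb => //; apply: cvg_pb => //.
rewrite pb_base (_ : (fun t => _) = (fun t => aps (zc_proj (f t)))); last first.
  by apply: boolp.funext => t; exact: pb_base.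
exact: (cvg_comp _ _ c1 (@continuous_aps R H _)).
Qed.

Lemma cvg_target_point x : target_point @ x --> target_point x.
Proof.
have c1 := @cvg_pb_point _ _ _ _ x; have c2 := @cvg_pb_point _ _ _ _ (pb_point x).
exact: (cvg_comp _ _ c1 c2).
Qed.

Lemma sp_class_refl P mu n : admissible P mu -> sp_class P mu n (mu, n).
Proof. by move=> am; split=> //=; apply: Or32. Qed.

Lemma sp_class_eq P mu nu n m s s' : admissible P mu -> admissible P nu ->
  spectral_section P mu n s -> spectral_section P nu m s' ->
  sp_class P mu n = sp_class P nu m <-> nv_class (aps_loop P) s = nv_class (aps_loop P) s'.
Proof.
move=> am an cs cs'; have fr := @aps_framed R H P; have [ns _] := cs; have [ns' _] := cs'.
rewrite -(nv_class_eq atP fr ns ns'); split=> [E|h].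
  by apply/(sp_class_homotopic am an cs cs'); rewrite E; exact: sp_class_refl.
apply/seteqP; split=> -[l j] /= [al hl].
  have [s2 cs2] := spectral_section_exists j al; have [ns2 _] := cs2.
  have h2 : nv_homotopic (aps_loop P) s s2 by apply/(sp_class_homotopic am al cs cs2); split.
  apply/(sp_class_homotopic an al cs' cs2); apply: (nv_homotopic_trans atP fr ns' ns ns2) h2.
  exact: (nv_homotopic_sym atP fr ns ns' h).
have [s2 cs2] := spectral_section_exists j al; have [ns2 _] := cs2.
have h2 : nv_homotopic (aps_loop P) s' s2 by apply/(sp_class_homotopic an al cs' cs2); split.
by apply/(sp_class_homotopic am al cs cs2); exact: (nv_homotopic_trans atP fr ns ns' ns2 h h2).
Qed.

Definition spectral_class p : set (R * int) := (set_val (p : spectral_type H)).2.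

Lemma spectral_classP p : exists mu n, admissible (zc_proj p) mu /\ spectral_class p = sp_class (zc_proj p) mu n.
Proof. exact: (set_valP (p : spectral_type H)). Qed.

Lemma spectral_ext p q : zc_proj p = zc_proj q -> spectral_class p = spectral_class q -> p = q.
Proof.
move=> e1 e2; apply/val_inj; rewrite -!set_valE.
rewrite (surjective_pairing (set_val (p : spectral_type H))) (surjective_pairing (set_val (q : spectral_type H))).
by congr (_, _); [exact: e1|exact: e2].
Qed.

Lemma spectral_exists P mu n : admissible P mu -> exists p, zc_proj p = P /\ spectral_class p = sp_class P mu n.
Proof.
move=> am; have h : spectral_set (P, sp_class P mu n) by exists mu, n.
by exists (SigSub (mem_set h) : spectral_type H).
Qed.

(** The graph of the isomorphism. Quantifying over all representatives and all spectral sections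
    makes it free of choices; by [corresponds1] a single representative suffices to establish it. *)
Definition corresponds p x := zc_proj x = zc_proj p /\ forall mu n s,
  admissible (zc_proj p) mu -> spectral_class p = sp_class (zc_proj p) mu n -> spectral_section (zc_proj p) mu n s ->
  target_class x = nv_class (aps_loop (zc_proj p)) s.

Lemma corresponds1 p x P mu n s : zc_proj p = P -> zc_proj x = P -> admissible P mu ->
  spectral_class p = sp_class P mu n -> spectral_section P mu n s -> target_class x = nv_class (aps_loop P) s -> corresponds p x.
Proof.
move=> pP xP am pc cs xc; split; first by rewrite pP.
rewrite pP xc => nu m s' an pc' cs'; apply/(sp_class_eq am an cs cs').
by rewrite -pc.
Qed.

Lemma corresponds_ex p : exists x, corresponds p x.
Proof.
have [mu [n [am pc]]] := spectral_classP p; have [s cs] := spectral_section_exists n am.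
have [x [xP xc]] := target_exists cs.1; exists x.
by apply: (corresponds1 (erefl _) xP am pc cs xc).
Qed.

Lemma corresponds_inj p q x : corresponds p x -> corresponds q x -> p = q.
Proof.
move=> [xp xpc] [xq xqc]; have pq : zc_proj p = zc_proj q by rewrite -xp.
have [mu [n [am pc]]] := spectral_classP p; have [s cs] := spectral_section_exists n am.
have [nu [m [an qc]]] := spectral_classP q; have [s' cs'] := spectral_section_exists m an.
have e1 := xpc _ _ _ am pc cs; have e2 := xqc _ _ _ an qc cs'.
apply: spectral_ext => //; rewrite pc qc; rewrite pq in am cs e1 *.
by apply/(sp_class_eq am an cs cs'); rewrite -e1.
Qed.

Lemma corresponds_fun p x y : corresponds p x -> corresponds p y -> x = y.
Proof.
move=> [xp xpc] [yp ypc]; have [mu [n [am pc]]] := spectral_classP p; have [s cs] := spectral_section_exists n am.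
by apply: target_ext; [rewrite xp|rewrite (xpc _ _ _ am pc cs) (ypc _ _ _ am pc cs)].
Qed.

(** This matches the action [mu, n] -> [mu, n - k] on the spectral cover and is the source of
    equivariance. *)
Lemma spectral_section_rotate P mu n k s : spectral_section P mu n s -> spectral_section P mu (n - k) (rotate k s).
Proof.
move=> [ns sE]; split; first by apply: (nv_rotate atP) => //; exact: aps_framed.
move=> b t bb s1; rewrite rotateE (sE b t bb s1) tscale_tot scalerA mulrA -expiD.
have -> // : 2 * pi * k%:~R * t + - (2 * pi * n%:~R * t) = - (2 * pi * (n - k)%:~R * t).
by rewrite rmorphB /=; ring.
Qed.

Lemma corresponds_act k p x : corresponds p x -> corresponds (zc_act k p) (zc_act k x).
Proof.
move=> [xp xpc]; have [mu [n [am pc]]] := spectral_classP p; have [s cs] := spectral_section_exists n am.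
have xc := xpc _ _ _ am pc cs; have [ns _] := cs.
have c1 : spectral_class (zc_act k p) = sp_class (zc_proj p) mu (n - k).
  by rewrite -sp_shift_class -pc.
apply: (corresponds1 (P := zc_proj p) _ _ am c1 (spectral_section_rotate k cs)); [by rewrite zc_proj_act|by rewrite zc_proj_act|].
rewrite -xp -target_point_base; apply: (transgression_act_class atP k); rewrite ?target_point_base.
- exact: aps_framed.
- by rewrite xp.
- by rewrite xp.
Qed.

(** If a representing section has winding number k relative to the spectral section of (mu, 0), it
    is homotopic to the latter rotated by k, which belongs to (mu, -k). *)
Lemma corresponds_surj x : exists p, corresponds p x.
Proof.
have [s ns xc] := target_classP x; set P := zc_proj x in ns xc.
have [mu am] := fredholm_adm (sa_val P) (sa_fredholm P).
have [s0 cs0] := spectral_section_exists 0 am; have [ns0 _] := cs0; have fr := @aps_framed R H P.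
have [c1 c2 c3 c4] := nv_ratio atP fr ns ns0.
have [k Nk] := Null_winding c1 c2 c3.
have cs1 := spectral_section_rotate k cs0; have [ns1 _] := cs1.
have [p [pP pc]] := spectral_exists (0 - k) am; exists p.
apply: (corresponds1 pP (erefl _) am pc cs1); rewrite xc.
apply/esym/(nv_class_eq atP fr ns1 ns)/(nv_homotopicP atP fr ns1 ns).
apply: (Null_eq _ Nk) => t; have [_ _ _ v1] := (nv_sectionP _ _).1 ns1.
move: (tratio (s t) (s0 t)) (c4 t) => a ->.
have -> : tscale a (s0 t) = tscale (a * expi (- (2 * pi * k%:~R * t))) (rotate k s0 t).
  by rewrite rotateE tscaleA -mulrA expiNr mulr1.
by rewrite tratio_tscale//; exact: v1.
Qed.

(** By the final topology only the composites of phi with the local sections P -> [mu, n] matter.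
    Near P0 they are the classes of the family [Sig] pulled back along P -> P_t. *)
Lemma continuous_from_spectral (phi : SC -> X) : (forall p, corresponds p (phi p)) -> continuous phi.
Proof.
move=> phiP; apply/continuousP => W oW.
rewrite with_topology_openE => U g oU [mu [n gE]].
have gP P : U P -> zc_proj (g P : SC) = P /\ spectral_class (g P) = sp_class P mu n.
  by move=> UP; have [_ e] := gE _ UP; split; [rewrite /= e|rewrite /spectral_class e].
have gC P : U P -> forall s, spectral_section P mu n s -> target_class (phi (g P)) = nv_class (aps_loop P) s.
  move=> UP s cs; have [e1 e2] := gP _ UP; have [am _] := gE _ UP.
  by have [_ h] := phiP (g P); rewrite e1 in h; exact: (h mu n s am e2 cs).
have gX P : U P -> zc_proj (phi (g P)) = P.
  by move=> UP; have [e1 _] := gP _ UP; have [h _] := phiP (g P); rewrite h.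
rewrite openE => P0 [UP0 WP0].
have [am _] := gE _ UP0.
have [V [Sig [[oV V0] SigC Vfr Sign nSig]]] := local_transgression n am.
have nU : \forall P \near P0, U P by exact: open_nbhs_nbhs.
have c1 : (fun P => zc_proj (phi (g P))) @ P0 --> zc_proj (phi (g P0)).
  have c : (fun P : Fred_sa H => P) @ P0 --> P0 by exact: cvg_id.
  rewrite gX//; apply: (cvg_near_eq c).
  by apply: filterS nU => P UP; rewrite gX.
have trS P : U P -> (forall s, spectral_section P mu n s -> nv_class (aps_loop P) s = nv_class (aps_loop P) (fun t => Sig (t, aps_loop P))) ->
    set_val (target_point (phi (g P)) : transgression_type L) = (aps_loop P, nv_class (aps_loop P) (fun t => Sig (t, aps_loop P))).
  move=> UP h; rewrite target_pointE gX//; have [amP _] := gE _ UP; have [s cs] := spectral_section_exists n amP.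
  by rewrite (gC _ UP _ cs) (h _ cs).
have c2 : (fun P => target_point (phi (g P))) @ P0 --> target_point (phi (g P0)).
  move=> W' nW'; have E0 := trS _ UP0 (nbhs_singleton nSig).
  have h1 := local_section_cvg oV SigC Sign V0 E0 nW'.
  have h2 : \forall P \near P0, forall p : transgression L,
      set_val (p : transgression_type L) = (aps_loop P, nv_class (aps_loop P) (fun t => Sig (t, aps_loop P))) -> W' p.
    exact: (@cvg_aps_loop R H P0 _ h1).
  suff : \forall P \near P0, W' (target_point (phi (g P))) by [].
  near=> P; have UP : U P by near: P.
  have h3 : forall p : transgression L,
      set_val (p : transgression_type L) = (aps_loop P, nv_class (aps_loop P) (fun t => Sig (t, aps_loop P))) -> W' p by near: P.
  by apply: h3; apply: trS => //; near: P.
have c3 : (fun P => phi (g P)) @ P0 --> phi (g P0) by exact: (@cvg_target _ (nbhs P0) (nbhs_filter P0) _ _ c1 c2).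
have nW : \forall P \near P0, W (phi (g P)) by apply: c3; exact: open_nbhs_nbhs.
by apply: filterI.
Unshelve. all: by end_near.
Qed.

(** Near x0 the class of x is that of the family [Sig], since such classes form an open set.
    Injectivity of [corresponds] then identifies psi x with the local section [mu, n] at the base
    point of x, which is continuous. *)
Lemma continuous_to_spectral (psi : X -> SC) : (forall x, corresponds (psi x) x) -> continuous psi.
Proof.
move=> psiP x0 W /nbhs_openP[B [oB B0 BW]].
have [P0E _] := psiP x0; set P0 := zc_proj x0 in P0E.
have [mu [n [am pc]]] := spectral_classP (psi x0); rewrite -P0E in am pc.
have [V [Sig [[oV V0] SigC Vfr Sign nSig]]] := local_transgression n am.
have [sigma sigmaP] : exists sigma : Fred_sa H -> SC, forall P, adm (set_val P) mu ->
    zc_proj (sigma P) = P /\ spectral_class (sigma P) = sp_class P mu n.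
  have h P : exists p : SC, adm (set_val P) mu -> zc_proj p = P /\ spectral_class p = sp_class P mu n.
    have [amP|namP] := pselect (adm (set_val P) mu); last by exists (psi x0).
    by have [p h] := spectral_exists n amP; exists p.
  by have [sigma sigmaP] := boolp.choice h; exists sigma.
have s0 : sigma P0 = psi x0.
  by have [e1 e2] := sigmaP _ am; apply: spectral_ext; [rewrite e1 -P0E|rewrite e2 pc].
have oA := @adm_open R H mu.
have oS : open ([set P : Fred_sa H | adm (set_val P) mu] `&` sigma @^-1` B).
  move: oB; rewrite with_topology_openE; apply; first exact: oA.
  exists mu, n => P amP; have [e1 e2] := sigmaP _ amP; split; first exact: amP.
  by rewrite [LHS]surjective_pairing; congr (_, _); [exact: e1|exact: e2].
have n1 : \forall x \near x0, ([set P : Fred_sa H | adm (set_val P) mu] `&` sigma @^-1` B) (zc_proj x).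
  apply: (@cvg_pb_proj _ _ _ _ x0); apply: open_nbhs_nbhs; split; first exact: oS.
  by split; [exact: am|rewrite /preimage /= s0].
have oT := open_local_classes atP oV SigC Sign Vfr.
have [s cs] := spectral_section_exists n am.
have c0 : target_class x0 = nv_class (aps_loop P0) (fun t => Sig (t, aps_loop P0)).
  rewrite -(nbhs_singleton nSig _ cs); have [_ h] := psiP x0; rewrite -P0E in h.
  exact: (h mu n s am pc cs).
have T0 : [set q : transgression L | V (zc_proj q) /\
    transgression_class q = nv_class (zc_proj q) (fun t => Sig (t, zc_proj q))] (target_point x0).
  by rewrite /mkset target_point_base; split; [exact: V0|exact: c0].
have n3 : \forall x \near x0, V (zc_proj (target_point x)) /\
    transgression_class (target_point x) = nv_class (zc_proj (target_point x)) (fun t => Sig (t, zc_proj (target_point x))).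
  exact: (@cvg_target_point x0 _ (open_nbhs_nbhs (conj oT T0))).
have n4 : \forall x \near x0, forall s, spectral_section (zc_proj x) mu n s ->
    nv_class (aps_loop (zc_proj x)) s = nv_class (aps_loop (zc_proj x)) (fun t => Sig (t, aps_loop (zc_proj x))).
  exact: (@cvg_pb_proj _ _ _ _ x0 _ nSig).
suff : \forall x \near x0, W (psi x) by [].
near=> x; have [amx sx] : ([set P : Fred_sa H | adm (set_val P) mu] `&` sigma @^-1` B) (zc_proj x) by near: x.
have [_ cx] : V (zc_proj (target_point x)) /\
    transgression_class (target_point x) = nv_class (zc_proj (target_point x)) (fun t => Sig (t, zc_proj (target_point x))) by near: x.
have h4 : forall s, spectral_section (zc_proj x) mu n s ->
    nv_class (aps_loop (zc_proj x)) s = nv_class (aps_loop (zc_proj x)) (fun t => Sig (t, aps_loop (zc_proj x))) by near: x.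
have [s2 cs2] := spectral_section_exists n amx; have [e1 e2] := sigmaP _ amx.
suff -> : psi x = sigma (zc_proj x) by exact: BW.
apply: (corresponds_inj (psiP x)); apply: (corresponds1 e1 (erefl _) amx e2 cs2).
by rewrite /target_class cx target_point_base (h4 _ cs2).
Unshelve. all: by end_near.
Qed.

End Isomorphism.

Theorem theorem3p21 (R : realType) (H : hilbertType R)
    (separableH : exists2 A : set H, countable A & dense A)
    (infiniteH : ~ finite_dim [set: H]) :
  exists aps : Fred_sa H -> based_loops R (Fred_id H),
    [/\ continuous aps,
        is_aps_map aps &
        exists phi : spectral_cover H ->
            pullback aps (based_transgression (det_bundle H) (Fred_id H)),
          zcover_iso phi /\ is_canonical phi].
Proof.
exists (@aps R H); split; [exact: continuous_aps|exact: aps_mapP|].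
have [phi phiP] := boolp.choice (@corresponds_ex R H).
have [psi psiP] := boolp.choice (@corresponds_surj R H).
exists phi; split.
  split.
  - exists psi; split.
    + by move=> p; exact: (corresponds_inj (psiP _) (phiP _)).
    + by move=> x; exact: (corresponds_fun (phiP _) (psiP _)).
    + exact: continuous_from_spectral.
    + exact: continuous_to_spectral.
  - by move=> p; case: (phiP p).
  - by move=> k p; exact: (corresponds_fun (phiP _) (corresponds_act k (phiP p))).
move=> P mu n p am pE; have [s cs] := spectral_section_exists n am.
exists s; first exact: spectral_section_canonical.
have [_ h] := phiP p; have pP : zc_proj (p : spectral_cover H) = P by rewrite /= pE.
have pc : spectral_class (p : spectral_cover H) = sp_class P mu n by rewrite /spectral_class pE.
rewrite pP in h; have E := h mu n s am pc cs; rewrite -[transgression_class _]/(target_class (phi p)) E.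
have [ns _] := cs; split; first exact: ns.
exact: (nv_homotopic_refl (@det_is_atlas R H) (@aps_framed R H P) ns).
Qed.
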